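(* Let $k\ge 3$, $1\le s\le k$, $n_1=\cdots=n_k=n\ge 2$ and $r\le n$ be positive integers. For a generic tensor $\mathcal A\in(\mathbb R^{n})^{\otimes k}$, every sequence $\{U_{[p]}\}$ generated by the iAPD-ALS algorithm (described in the context) with input $\mathcal A$, $r$ and any $\epsilon>0$ converges $R$-linearly to a KKT point of problem $\mathrm{mLRPOTA}(t)$, $t$ being the eventual number of columns; i.e. there are $U^*$, $C>0$, $q\in(0,1)$ with $\|U_{[p]}-U^*\|_F\le Cq^p$ for all sufficiently large $p$.
   Context: ''Generic'' means: for all $\mathcal A$ outside a subset of Lebesgue measure zero. Notation. $\mathrm V(m,n)=\{U\in\mathbb R^{n\times m}:U^{\mathsf T}U=I_m\}$; $\mathrm B(m,n)$ is the set of $n\times m$ real matrices with all columns of Euclidean norm $1$. For $\mathbf u_i\in\mathbb R^{n}$, $\mathcal A\tau(\mathbf u_1,\dots,\mathbf u_k)=\langle\mathcal A,\mathbf u_1\otimes\cdots\otimes\mathbf u_k\rangle$ and $\mathcal A\tau_i(\mathbf u_1,\dots,\mathbf u_k)$ is the contraction of $\mathcal A$ with all $\mathbf u_l$, $l\ne i$. For $U=(U^{(1)},\dots,U^{(k)})$ with columns $\mathbf u^{(i)}_j$, $j=1,\dots,t$: $\lambda_j(U)=\mathcal A\tau(\mathbf u^{(1)}_j,\dots,\mathbf u^{(k)}_j)$, $f(U)=\sum_j\lambda_j(U)^2$, $\|U\|_F^2=\sum_i\|U^{(i)}\|_F^2$. $\operatorname{Polar}(X)$ is the set of $Q\in\mathrm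 V(m,n)$ maximizing $\langle Q,X\rangle$. Problem $\mathrm{mLRPOTA}(t)$: maximize $f(U)$ over $\mathrm V(t,n)^{s}\times\mathrm B(t,n)^{k-s}$; feasible $U$ is a KKT point iff there are symmetric $P_i\in\mathbb R^{t\times t}$ ($i\le s$) and $\mathbf p\in\mathbb R^t$ with $V^{(i)}\Lambda=U^{(i)}P_i$ ($i\le s$), $V^{(i)}\Lambda=U^{(i)}\operatorname{diag}(\mathbf p)$ ($i>s$), where $V^{(i)}$ has columns $\mathcal A\tau_i(\mathbf u^{(1)}_j,\dots,\mathbf u^{(k)}_j)$ and $\Lambda=\operatorname{diag}(\lambda_j(U))$. iAPD-ALS algorithm. Choose $U_{[0]}\in\mathrm V(r,n)^s\times\mathrm B(r,n)^{k-s}$ with $f(U_{[0]})>0$ and $\kappa\in(0,\sqrt{f(U_{[0]})/r})$. For $p=1,2,\dots$ ($t$ = current number of columns, $\mathbf u^{(i)}_{j,[q]}$ = $j$-th column of $U^{(i)}_{[q]}$), let $\mathbf x^i_{j,[p]}=(\mathbf u^{(1)}_{j,[p]},\dots,\mathbf u^{(i-1)}_{j,[p]},\mathbf u^{(i)}_{j,[p-1]},\dots,\mathbf u^{(k)}_{j,[p-1]})$, $\lambda^{i-1}_{j,[p]}=\mathcal A\tau(\mathbf x^i_{j,[p]})$, $\Lambda^{(i)}_{[p]}=\operatorname{diag}(\lambda^{i-1}_{j,[p]})_j$, $V^{(i)}_{[p]}=[\mathcal A\tau_i(\mathbf x^i_{j,[p]})]_j$. (1) For $i=1,\dots,s$ in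 turn pick $U^{(i)}_{[p]}\in\operatorname{Polar}(V^{(i)}_{[p]}\Lambda^{(i)}_{[p]})$, and if the smallest eigenvalue of $(U^{(i)}_{[p]})^{\mathsf T}V^{(i)}_{[p]}\Lambda^{(i)}_{[p]}$ is $<\epsilon$, instead pick $U^{(i)}_{[p]}\in\operatorname{Polar}(V^{(i)}_{[p]}\Lambda^{(i)}_{[p]}+\epsilon U^{(i)}_{[p-1]})$. (2) Truncation: with $J=\{j:|((U^{(s)}_{[p]})^{\mathsf T}V^{(s)}_{[p]})_{jj}|<\kappa\}$, delete columns in $J$ from $U^{(1)}_{[p]},\dots,U^{(s)}_{[p]}$ and $U^{(s+1)}_{[p-1]},\dots,U^{(k)}_{[p-1]}$ and set $t:=t-|J|$. (3) For $i=s+1,\dots,k$ in turn, $\mathbf u^{(i)}_{j,[p]}=\operatorname{sgn}(\lambda^{i-1}_{j,[p]})\mathcal A\tau_i(\mathbf x^i_{j,[p]})/\|\mathcal A\tau_i(\mathbf x^i_{j,[p]})\|$. Set $U_{[p]}=(U^{(1)}_{[p]},\dots,U^{(k)}_{[p]})$ and iterate indefinitely. *)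

(* Defs.v *)
From HB Require Import structures.
From mathcomp Require Import all_boot all_order all_algebra.
From mathcomp Require Import reals.
Set Implicit Arguments. Unset Strict Implicit. Unset Printing Implicit Defensive.
Import Order.TTheory GRing.Theory Num.Theory.
Local Open Scope ring_scope.

Section Defs.
Variable R : realType.
Variables (k n : nat).

(* multi-indices (i_1,...,i_k) of (R^n)^{\otimes k}; factor indices are 0-based *)
Definition idx := {ffun 'I_k -> 'I_n}.
Definition tensor := idx -> R.

Definition tau (A : tensor) (u : 'I_k -> 'cV[R]_n) : R :=
  \sum_(I : idx) A I * \prod_(l < k) u l (I l) 0.

Definition taui (A : tensor) (u : 'I_k -> 'cV[R]_n) (i : 'I_k) : 'cV[R]_n :=
  \col_a \sum_(I : idx | I i == a) A I * \prod_(l < k | l != i) u l (I l) 0.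

Section Config.
Variable t : nat.
Implicit Types U : 'I_k -> 'M[R]_(n, t).

Definition cols U (j : 'I_t) : 'I_k -> 'cV[R]_n := fun l => col j (U l).
Definition lam (A : tensor) U (j : 'I_t) : R := tau A (cols U j).
Definition fobj (A : tensor) U : R := \sum_(j < t) lam A U j ^+ 2.
Definition Vmat (A : tensor) U (i : 'I_k) : 'M[R]_(n, t) :=
  \matrix_(a < n, j < t) taui A (cols U j) i a 0.
Definition Lam (A : tensor) U : 'M[R]_t := diag_mx (\row_j lam A U j).

Definition stiefel (Q : 'M[R]_(n, t)) : Prop := Q^T *m Q = 1%:M.
Definition oblique (Q : 'M[R]_(n, t)) : Prop :=
  forall j : 'I_t, \sum_(a < n) Q a j ^+ 2 = 1.
Definition feasible (s : nat) U : Prop :=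
  forall i : 'I_k, if (i < s)%N then stiefel (U i) else oblique (U i).

Definition is_polar (X Q : 'M[R]_(n, t)) : Prop :=
  stiefel Q /\ forall Q', stiefel Q' -> \tr (Q'^T *m X) <= \tr (Q^T *m X).

Definition is_KKT (s : nat) (A : tensor) U : Prop :=
  feasible s U /\
  exists (P : 'I_k -> 'M[R]_t) (p : 'rV[R]_t),
    forall i : 'I_k,
      if (i < s)%N then (P i)^T = P i /\ Vmat A U i *m Lam A U = U i *m P i
      else Vmat A U i *m Lam A U = U i *m diag_mx p.

Definition frob_dist U (W : 'I_k -> 'M[R]_(n, t)) : R :=
  Num.sqrt (\sum_(l < k) \sum_(a < n) \sum_(j < t) (U l a j - W l a j) ^+ 2).

Definition mix (i : 'I_k) (W U : 'I_k -> 'M[R]_(n, t)) : 'I_k -> 'M[R]_(n, t) :=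
  fun l => if (l < i)%N then W l else U l.
End Config.

(* "the smallest eigenvalue of the (symmetric) matrix M is < eps" *)
Definition mineig_lt (t : nat) (M : 'M[R]_t) (eps : R) : Prop :=
  exists a : R, eigenvalue M a /\ a < eps.

Definition vnorm (v : 'cV[R]_n) : R := Num.sqrt (\sum_(a < n) v a 0 ^+ 2).

(* One iteration p of iAPD-ALS: U = U_[p-1] (t columns) to U' = U_[p] (t' columns).
   W i (i < s) are the factors chosen in step (1) before truncation; g enumerates
   increasingly the columns kept by the truncation step (2). *)
Definition step_raw (A : tensor) (s : nat) (eps kappa : R) (t t' : nat)
  (U : 'I_k -> 'M[R]_(n, t)) (U' : 'I_k -> 'M[R]_(n, t')) : Prop :=
  exists (W : 'I_k -> 'M[R]_(n, t)) (g : 'I_t' -> 'I_t),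
  (forall i : 'I_k, (i < s)%N ->
     let M := mix i W U in
     let X := Vmat A M i *m Lam A M in
     (is_polar X (W i) /\ ~ mineig_lt ((W i)^T *m X) eps) \/
     (exists P, is_polar X P /\ mineig_lt (P^T *m X) eps /\
                is_polar (X + eps *: U i) (W i))) /\
  (* step (2): truncation, J defined through factor s *)
  (forall a b : 'I_t', (a < b)%N -> (g a < g b)%N) /\
  (forall j : 'I_t,
     (exists a, g a = j) <->
     (forall i0 : 'I_k, i0 = s.-1 :> nat ->
        let M := mix i0 W U in
        ~ (`|((W i0)^T *m Vmat A M i0) j j| < kappa))) /\
  (forall i : 'I_k, (i < s)%N -> U' i = colsub g (W i)) /\
  (forall i : 'I_k, (s <= i)%N ->
     let M := mix i U' (fun l => colsub g (U l)) in
     forall j : 'I_t',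
       let v := taui A (cols M j) i in
       v != 0 /\ col j (U' i) = (Num.sg (lam A M j) / vnorm v) *: v).

Definition state := {t : nat & 'I_k -> 'M[R]_(n, t)}.

Definition step (A : tensor) (s : nat) (eps kappa : R) (x y : state) : Prop :=
  match x, y with
  | existT t U, existT t' U' => step_raw A s eps kappa U U'
  end.

Definition null_set (N : tensor -> Prop) : Prop :=
  forall e : R, 0 < e ->
  exists a b : nat -> idx -> R,
    (forall m I, a m I <= b m I) /\
    (forall A, N A -> exists m, forall I, a m I <= A I <= b m I) /\
    (forall M : nat, \sum_(m < M) \prod_(I : idx) (b m I - a m I) <= e).

End Defs.

(* Main.v *)
Require Import Defs.
From HB Require Import structures.
From mathcomp Require Import all_boot all_order all_algebra.
From mathcomp Require Import boolp reals.
From mathcomp Require Import ring lra zify.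

(* A critical point (U, lambda) with all lambda_j nonzero is a zero of a polynomial system F_A which
   is affine in A: orthonormality constraints together with <A, y_h(x)> = kappa_h(x).  A quantitative
   covering argument (a Sard lemma for such systems) shows that, for A outside a null set, the
   differential of F_A is injective at every such zero.  Where the coefficient vectors y_h(x) stay
   independent on the tangent space this is a direct dimension count.  The remaining points have a
   tangent direction killed by the differential of the parametrization sum_j lambda_j u_j^1 x ... x u_j^k;
   with three orthonormal modes there is none, with two it forces two columns to agree up to sign
   in all other modes, and with one it forces linear relations between the reduced rank-one tensors
   and their tangent cones.  Each pattern of relations costs more dimensions than it gains, so these
   points too occur only for A in a null set.

   An injective differential gives an error bound: near a critical point, the distance is controlled
   by the residual of F_A.  The truncation eventually stops, and from then on |lambda_j| >= kappa, the
   objective grows by at least c |U_[p+1] - U_[p]|^2, and the residual is at most C |U_[p+1] - U_[p]|.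
   A cluster point is therefore critical, the iterates are trapped near it, and since the objective
   is flat to second order there, its gap to the limit value decreases geometrically. *)

Set Implicit Arguments. Unset Strict Implicit. Unset Printing Implicit Defensive.
Import Order.TTheory GRing.Theory Num.Theory.
Local Open Scope ring_scope.

(** * Linear algebra over finite function spaces *)

Section FiniteDimension.
Variables (R : realType).

(** The coefficient tensors [yP] combine, with weights linear in a tangent direction [xi], to the
    derivative [dPhi x xi] of the parametrization. Pairing the linearized equations with these
    weights gives a bilinear form, and comparing its two radicals shows that singular zeros are
    non-generic unless some nonzero [xi] satisfies both [dPhi x xi = 0] and [bform A x tau xi = 0]
    for all tangent [tau]. Only such points have to be stratified. The delicate case is one
    orthonormal mode with [t = n]: for the last column the dimensions lost and gained can tie, and
    the tie is broken by the vanishing of [bform], which is one more family of conditions on the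
    tensor. The exceptional set must be fixed before [eps], [kappa], the starting point and the run;
    it therefore refers only to critical points with nonzero values, for every possible number of
    columns. *)

Lemma dim_ffun (X : finType) : \dim (fullv : {vspace {ffun X -> R^o}}) = #|X|.
Proof. by rewrite dimvf /dim /= muln1. Qed.

(** A subspace of maximal dimension among those contained in [P] already contains every vector of
    [P], since adjoining one more would enlarge it. Most solution spaces below start as linear
    predicates and become vector spaces in this way. *)
Lemma vspace_of (V : vectType R) (P : V -> Prop) :
  P 0 -> (forall a u v, P u -> P v -> P (a *: u + v)) ->
  {U : {vspace V} | forall v, v \in U <-> P v}.
Proof.
move=> P0 Pl; apply: cid.
pose Q d := `[< exists U : {vspace V}, (forall v, v \in U -> P v) /\ \dim U = d >].
have [|n /asboolP Qn|d /asboolP[U [UP dU]] dmax] := @ex_maxnP Q (\dim {:V}).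
- exists 0%N; apply/asboolP; exists 0%VS; rewrite dimv0; split=> // v.
  by rewrite memv0 => /eqP->.
- by case: Qn => U [_ <-]; apply: dimvS; rewrite subvf.
exists U => v; split; first exact: UP.
move=> Pv.
have : (\dim (U + <[v]>) <= d)%N.
  apply: dmax; apply/asboolP; exists (U + <[v]>)%VS; split=> // w.
  case/memv_addP => u uU [_ /vlineP[a ->] ->]; rewrite addrC; apply: Pl => //.
  exact: UP.
rewrite -dU => le; have := dimv_leqif_sup (addvSl U <[v]>).
rewrite /leqif => -[_]; rewrite eqn_leq le dimvS ?addvSl //= => /esym /subvP; apply.
by apply: (subvP (addvSr U _)); exact: memv_line.
Qed.

Lemma lin_hom (V W : vectType R) (f : V -> W) :
  linear f -> {F : 'Hom(V, W) | forall v, F v = f v}.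
Proof.
move=> fl; pose g : {linear V -> W} := HB.pack f (GRing.isLinear.Build _ _ _ _ f fl).
by exists (linfun g) => v; rewrite lfunE.
Qed.

(** [J] is a minimal set of coordinates that determines the vectors of [U]. If [q] cannot be
    dropped, some vector of [U] vanishes on the rest of [J] but not at [q]; rescaled, it is the dual
    vector, and dual vectors are independent. *)
Lemma coord_set (X : finType) (U : {vspace {ffun X -> R^o}}) :
  exists J : {set X}, [/\ (#|J| <= \dim U)%N,
    forall v, v \in U -> (forall j, j \in J -> v j = 0) -> v = 0 &
    forall q, q \in J -> exists2 v, v \in U & forall j, j \in J -> v j = (j == q)%:R].
Proof.
pose P (J : {set X}) := `[< forall v, v \in U -> (forall j, j \in J -> v j = 0) -> v = 0 >].
have [J /minsetP[/asboolP JP Jmin] _] : {J | minset P J & J \subset setT}.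
  apply: minset_exists; apply/asboolP => v _ v0; apply/ffunP => j.
  by rewrite v0 ?in_setT // ffunE.
have dual q : q \in J -> exists2 v, v \in U & forall j, j \in J -> v j = (j == q)%:R.
  move=> qJ; apply: contrapT => nex.
  have : J :\ q = J.
    apply: Jmin; last exact: subD1set.
    apply/asboolP => v vU vJ; apply: contrapT => v0; apply: nex.
    have vq : v q != 0.
      apply/eqP => vq; apply: v0; apply: JP => // j jJ.
      by have [->//|jq] := eqVneq j q; apply: vJ; rewrite in_setD1 jq.
    exists ((v q)^-1 *: v); first by rewrite memvZ.
    move=> j jJ; rewrite ffunE; have [->|jq] := eqVneq j q.
      by rewrite /GRing.scale /= mulVf.
    by rewrite (vJ j) ?in_setD1 ?jq ?jJ // scaler0.
  by move/setP/(_ q); rewrite !inE eqxx qJ.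
exists J; split=> //.
have /choice[g gP] : forall q, exists v, q \in J -> v \in U /\ forall j, j \in J -> v j = (j == q)%:R.
  move=> q; case: (boolP (q \in J)) => [/dual[v ? ?]|_]; last by exists 0.
  by exists v.
pose I := (\sum_(q in J) <[g q]>)%VS.
have dir : directv I.
  apply/directv_sum_independent => us usP us0 q qJ.
  have /choice[c cP] : forall i, exists c, i \in J -> us i = c *: g i.
    move=> i; case: (boolP (i \in J)) => [/usP/vlineP[c ->]|_]; last by exists 0.
    by exists c.
  have : (\sum_(i in J) us i) q = 0 by rewrite us0 ffunE.
  rewrite sum_ffunE (bigD1 q) //= big1 => [|i /andP[iJ iq]]; last first.
    by rewrite cP // ffunE (gP i iJ).2 // eq_sym (negPf iq) scaler0.
  rewrite addr0 cP // ffunE (gP q qJ).2 // eqxx => cq.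
  suff -> : c q = 0 by rewrite scale0r.
  by move: cq; rewrite /GRing.scale /= mulr1.
have -> : #|J| = \dim I.
  rewrite (directvP dir) /= -sum1_card; apply: eq_bigr => q qJ.
  rewrite dim_vline; suff -> : g q != 0 by [].
  apply/eqP => gq; have := (gP q qJ).2 q qJ; rewrite gq ffunE eqxx.
  by move/eqP; rewrite eq_sym oner_eq0.
apply: dimvS; apply/subv_sumP => q qJ; rewrite -memvE; exact: (gP q qJ).1.
Qed.

(** Outside a determining set [J] there is a coordinate [x]; on [U] its value is a combination of
    the values on [J], with coefficients read off from the dual vectors, and this relation is the
    annihilator. *)
Lemma proper_annihilator (X : finType) (U : {vspace {ffun X -> R^o}}) :
  (\dim U < #|X|)%N ->
  exists2 w : X -> R, (exists x, w x != 0) & forall v, v \in U -> \sum_x w x * v x = 0.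
Proof.
move=> ltU; have [J [cJ J0 Jd]] := coord_set U.
have [x xJ] : exists x, x \notin J.
  apply: contrapT => nx; suff: J = setT by move=> JT; move: cJ ltU; rewrite JT cardsT; lia.
  by apply/setP => x; rewrite inE; apply/negPn/negP => ?; apply: nx; exists x.
have /choice[g gP] : forall q, exists v, q \in J -> v \in U /\ forall j, j \in J -> v j = (j == q)%:R.
  move=> q; case: (boolP (q \in J)) => [/Jd[v ? ?]|_]; last by exists 0.
  by exists v.
exists (fun y => if y == x then 1 else if y \in J then - g y x else 0).
  by exists x; rewrite eqxx oner_eq0.
move=> v vU.
have v0 : v - \sum_(q in J) v q *: g q = 0.
  apply: J0 => [|j jJ].
    by rewrite memvB // memv_suml // => q qJ; rewrite memvZ // (gP q qJ).1.
  rewrite !ffunE sum_ffunE (bigD1 j) //= big1 => [|i /andP[iJ ij]].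
    by rewrite ffunE (gP j jJ).2 // eqxx /GRing.scale /= mulr1 addr0 subrr.
  by rewrite ffunE (gP i iJ).2 // eq_sym (negPf ij) scaler0.
move/(congr1 (fun f : {ffun X -> R^o} => f x)): v0; rewrite !ffunE sum_ffunE => v0.
rewrite (bigD1 x) //= eqxx mul1r -[RHS]v0; congr (_ + _).
rewrite -sumrN big_mkcond [RHS]big_mkcond; apply: eq_bigr => y _ /=.
have [->|yx] := eqVneq y x; first by rewrite (negPf xJ).
case: (y \in J); last by rewrite mul0r.
by rewrite ffunE /GRing.scale /= mulNr mulrC.
Qed.

(** The values of the [phi q] form a space of coordinate vectors, in which a determining set of
    coordinates has dual vectors; [psi] evaluated at lifts of these gives the coefficients. *)
Lemma functional_span (V : vectType R) (Q : finType) (phi : Q -> 'Hom(V, R^o)) (psi : 'Hom(V, R^o)) :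
  (forall v, (forall q, phi q v = 0) -> psi v = 0) ->
  exists c : Q -> R, forall v, psi v = \sum_q c q * phi q v.
Proof.
move=> H.
have [F FE] : {F : 'Hom(V, {ffun Q -> R^o}) | forall v, F v = [ffun q => phi q v]}.
  by apply: lin_hom => a u v; apply/ffunP => q; rewrite !ffunE linearP.
have [J [_ J0 Jd]] := coord_set (limg F).
have /choice[g gP] : forall q, exists v, q \in J -> forall j, j \in J -> phi j v = (j == q)%:R.
  move=> q; case: (boolP (q \in J)) => [/Jd[_ /memv_imgP[v _ ->] vJ]|_]; last by exists 0.
  by exists v => _ j /vJ; rewrite FE ffunE.
exists (fun q => if q \in J then psi (g q) else 0) => v.
have K0 : F (v - \sum_(q in J) phi q v *: g q) = 0.
  apply: J0 => [|j jJ]; first by rewrite memv_img ?memvf.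
  rewrite FE ffunE linearB linear_sum /= (bigD1 j) //= big1 => [|i /andP[iJ ij]].
    by rewrite linearZ /= (gP j jJ) // eqxx /GRing.scale /= mulr1 addr0 subrr.
  by rewrite linearZ /= (gP i iJ) // eq_sym (negPf ij) scaler0.
have : psi (v - \sum_(q in J) phi q v *: g q) = 0.
  apply: H => q; move/(congr1 (fun f : {ffun Q -> R^o} => f q)): K0.
  by rewrite FE !ffunE.
rewrite linearB linear_sum /= => /eqP; rewrite subr_eq0 => /eqP->.
rewrite big_mkcond; apply: eq_bigr => q _ /=.
by case: (q \in J); rewrite ?mul0r // linearZ /= mulrC.
Qed.

(** Equality of the left and right rank of a bilinear form, as an inequality: [L] lies in the left
    radical and [K] contains the right one. In coordinates with respect to a basis of [U1], [L] is
    orthogonal to the functionals induced by [U2]; a common vector has square norm zero, so the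
    dimensions add up. *)
Lemma rank_duality (V W : vectType R) (b : V -> W -> R) (U1 L : {vspace V}) (U2 K : {vspace W}) :
  (forall a u v w, b (a *: u + v) w = a * b u w + b v w) ->
  (forall a u v w, b w (a *: u + v) = a * b w u + b w v) ->
  (forall u, u \in L -> u \in U1 /\ forall w, w \in U2 -> b u w = 0) ->
  (forall w, w \in U2 -> (forall u, u \in U1 -> b u w = 0) -> w \in K) ->
  (\dim L + \dim U2 <= \dim U1 + \dim K)%N.
Proof.
move=> bl br LP KP.
pose e := vbasis U1; pose m := \dim U1.
have [F FE] : {F : 'Hom(W, {ffun 'I_m -> R^o}) | forall v, F v = [ffun i => b (tnth e i) v]}.
  by apply: lin_hom => a u v; apply/ffunP => q; rewrite !ffunE br.
have [G GE] : {G : 'Hom(V, {ffun 'I_m -> R^o}) | forall v, G v = [ffun i => coord e i v : R^o]}.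
  by apply: lin_hom => a u v; apply/ffunP => q; rewrite !ffunE linearP.
have b0 w : b 0 w = 0.
  by have := bl (-1) 0 0 w; rewrite scaler0 addr0 mulN1r addNr.
have bsum (I : finType) (c : I -> R) (g : I -> V) w :
    b (\sum_i c i *: g i) w = \sum_i c i * b (g i) w.
  elim/big_rec2: _ => [|i x y _ <-]; [exact: b0|exact: bl].
have eU i : tnth e i \in U1 by rewrite vbasis_mem // mem_tnth.
have d1 : (\dim U2 <= \dim K + \dim (F @: U2))%N.
  rewrite -(limg_ker_dim F U2) leq_add2r; apply: dimvS; apply/subvP => w.
  rewrite memv_cap memv_ker => /andP[wU /eqP Fw]; apply: KP => // u uU.
  rewrite (coord_vbasis uU) bsum big1 // => i _.
  move/(congr1 (fun f : {ffun 'I_m -> R^o} => f i)): Fw; rewrite FE !ffunE.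
  by rewrite (tnth_nth 0) => ->; rewrite mulr0.
have d2 : \dim (G @: L) = \dim L.
  apply: limg_dim_eq; apply/eqP; rewrite -subv0; apply/subvP => u.
  rewrite memv_cap memv_ker => /andP[/LP[uU _] /eqP Gu].
  rewrite (coord_vbasis uU) big1 ?mem0v // => i _.
  move/(congr1 (fun f : {ffun 'I_m -> R^o} => f i)): Gu; rewrite GE !ffunE => ->.
  by rewrite scale0r.
have d3 : (\dim (G @: L) + \dim (F @: U2) <= m)%N.
  rewrite -dimv_disjoint_sum.
    by have := dimvS (subvf (G @: L + F @: U2)); rewrite dim_ffun card_ord.
  apply/eqP; rewrite -subv0; apply/subvP => x; rewrite memv_cap memv0.
  case/andP => /memv_imgP[u /LP[uU ub] xu] /memv_imgP[w wU xw].
  have : b u w = 0 by exact: ub.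
  rewrite {1}(coord_vbasis uU) bsum => s0.
  have : \sum_i (x i : R) ^+ 2 = 0.
    rewrite -[RHS]s0; apply: eq_bigr => i _; rewrite expr2 {1}xu xw GE FE !ffunE.
    by rewrite (tnth_nth 0).
  move/eqP; rewrite psumr_eq0 => [/allP x0|i _]; last exact: sqr_ge0.
  apply/eqP/ffunP => i; rewrite ffunE; apply/eqP.
  by have := x0 i (mem_index_enum _); rewrite sqrf_eq0.
by move: d1 d2 d3; rewrite /m; lia.
Qed.

(** Each successive cut by a kernel loses the dimension of the image of what is left. The bound
    [d l] is only required after the earlier cuts, which is what the triangular estimates below
    provide. *)
Lemma dim_filtration (V W : vectType R) (T : eqType) (f : T -> 'Hom(V, W)) (d : T -> nat)
    (U : {vspace V}) (s : seq T) :
  (forall s1 l s2, s = s1 ++ l :: s2 ->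
     \dim (f l @: (U :&: \bigcap_(j <- s1) lker (f j))) <= d l)%N ->
  (\dim U <= \sum_(l <- s) d l + \dim (U :&: \bigcap_(j <- s) lker (f j)))%N.
Proof.
elim/last_ind: s => [|s l IH] H; first by rewrite !big_nil capvf.
have le : (\dim U <= \sum_(l <- s) d l + \dim (U :&: \bigcap_(j <- s) lker (f j)))%N.
  by apply: IH => s1 l' s2 E; apply: (H _ _ (rcons s2 l)); rewrite E rcons_cat.
apply: (leq_trans le); rewrite -!cats1 !big_cat !big_seq1 /= -addnA leq_add2l.
rewrite -(limg_ker_dim (f l)) addnC leq_add //.
  by apply: (H s l [::]); rewrite cats1.
by rewrite capvA.
Qed.

Lemma dim_ker1 (V : vectType R) (U : {vspace V}) (phi : 'Hom(V, R^o)) :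
  (\dim U <= (\dim (U :&: lker phi)).+1)%N.
Proof.
rewrite -(limg_ker_dim phi U) -addn1 leq_add2l.
by apply: leq_trans (dimvS (subvf _)) _; rewrite dimvf.
Qed.

End FiniteDimension.

(** * Null sets *)

Section NullSets.
Variables (R : realType) (k n : nat).
Hypothesis n_gt0 : (0 < n)%N.
Let D : finType := {ffun 'I_k -> 'I_n}.

Let D0 : D := [ffun=> Ordinal n_gt0].

Lemma null_sub (N N' : tensor R k n -> Prop) : (forall A, N A -> N' A) -> null_set N' -> null_set N.
Proof.
move=> sub H e e0; have [a [b [ab [cov vol]]]] := H e e0; exists a, b; split=> //.
by split=> // A /sub/cov.
Qed.

Lemma vol_ge0 (a b : D -> R) : (forall I, a I <= b I) -> 0 <= \prod_I (b I - a I).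
Proof. by move=> H; apply: prodr_ge0 => I _; rewrite subr_ge0. Qed.

Lemma null_fin (N : tensor R k n -> Prop) :
  (forall e : R, 0 < e -> exists (T : finType) (a b : T -> D -> R),
    [/\ forall x I, a x I <= b x I,
        forall A, N A -> exists x, forall I, a x I <= A I <= b x I &
        \sum_x \prod_I (b x I - a x I) <= e]) -> null_set N.
Proof.
move=> H e e0; have [T [a [b [ab cov vol]]]] := H e e0.
(* Indices beyond the finite family receive a degenerate box, of volume zero because the index set
   of the entries is not empty. *)
pose tr (f : T -> D -> R) (m : nat) : D -> R :=
  if insub m is Some i then f (enum_val (i : 'I_#|T|)) else fun=> 0.
exists (tr a), (tr b); split; last split.
- by move=> m I; rewrite /tr; case: insubP => // *.
- move=> A /cov[x xP]; exists (enum_rank x) => I.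
  by rewrite /tr valK enum_rankK.
- move=> M; apply: le_trans vol.
  have F0 m : 0 <= \prod_(I : D) (tr b m I - tr a m I).
    by apply: vol_ge0 => I; rewrite /tr; case: insubP => // *.
  have -> : \sum_x \prod_I (b x I - a x I) =
      \sum_(m < #|T| + M) \prod_I (tr b m I - tr a m I).
    rewrite big_split_ord /= [X in _ + X]big1 ?addr0 => [|i _]; last first.
      by rewrite /tr insubF ?ltnNge ?leq_addr // (bigD1 D0) //= subrr mul0r.
    rewrite (reindex (@enum_val T T)) /=; last first.
      by apply: onW_bij; exact: enum_val_bij.
    by apply: eq_bigr => i _; apply: eq_bigr => I _; rewrite /tr valK.
  rewrite addnC big_split_ord /= lerDl; exact: sumr_ge0.
Qed.

Lemma sum_sub_uniq (T : eqType) (s1 s2 : seq T) (F : T -> R) :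
  uniq s1 -> {subset s1 <= s2} -> (forall x, 0 <= F x) -> \sum_(x <- s1) F x <= \sum_(x <- s2) F x.
Proof.
elim: s1 s2 => [|x s1 IH] s2 /=; first by move=> _ _ F0; rewrite big_nil sumr_ge0.
move=> /andP[xs1 us1] sub F0; have xs2 : x \in s2 by apply: sub; rewrite mem_head.
rewrite big_cons (perm_big _ (perm_to_rem xs2)) /= big_cons lerD2l.
apply: IH => // y ys1; have := sub y; rewrite inE ys1 orbT => /(_ isT).
rewrite (perm_mem (perm_to_rem xs2)) inE => /orP[/eqP yx|//].
by rewrite yx (negPf xs1) in ys1.
Qed.

Lemma geo_half (e : R) M : 0 < e -> \sum_(i < M) (e / 2 ^+ i.+1) <= e.
Proof.
move=> e0; have -> : \sum_(i < M) (e / 2 ^+ i.+1) = e - e / 2 ^+ M.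
  elim: M => [|M IH]; first by rewrite big_ord0 expr0 divr1 subrr.
  rewrite big_ord_recr /= IH exprS invfM.
  have : (2 : R) ^+ M != 0 by rewrite expf_neq0 // pnatr_eq0.
  by move: (2 ^+ M) => x x0; field.
by rewrite gerBl divr_ge0 ?exprn_ge0 // ltW.
Qed.

(** The set number [m] is covered with total volume [e / 2 ^+ m.+1], and the double family is
    enumerated through the coding of pairs; integers that are not codes receive a degenerate box. *)
Lemma null_cup (N : nat -> tensor R k n -> Prop) :
  (forall m, null_set (N m)) -> null_set (fun A => exists m, N m A).
Proof.
move=> H e e0.
have /choice[ab abP] : forall m, exists ab : (nat -> D -> R) * (nat -> D -> R),
  [/\ forall j I, ab.1 j I <= ab.2 j I,
   forall A, N m A -> exists j, forall I, ab.1 j I <= A I <= ab.2 j I &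
   forall M : nat, \sum_(j < M) \prod_(I : D) (ab.2 j I - ab.1 j I) <= e / 2 ^+ m.+1].
  move=> m; have [|a [b [h1 [h2 h3]]]] := H m (e / 2 ^+ m.+1).
    by rewrite divr_gt0 // exprn_gt0.
  by exists (a, b).
pose tr (f : nat -> nat -> D -> R) (m : nat) : D -> R :=
  if pickle_inv m is Some p then f (p : nat * nat).1 p.2 else fun=> 0.
exists (tr (fun m => (ab m).1)), (tr (fun m => (ab m).2)); split; last split.
- move=> m I; rewrite /tr; case: pickle_inv => // -[i j] /=.
  by have [h _ _] := abP i.
- move=> A [m NA]; have [_ h _] := abP m; have [j jP] := h A NA.
  by exists (pickle (m, j)) => I; rewrite /tr pickleK_inv.
- move=> M; pose vol p := \prod_(I : D) ((ab p.1).2 p.2 I - (ab p.1).1 p.2 I).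
  have vol0 p : 0 <= vol p by apply: vol_ge0 => I; have [h _ _] := abP p.1.
  pose s := pmap (@pickle_inv (nat * nat)%type) (iota 0 M).
  have -> : \sum_(m < M) \prod_(I : D) (tr (fun m => (ab m).2) m I - tr (fun m => (ab m).1) m I)
      = \sum_(p <- s) vol p.
    rewrite -(big_mkord predT (fun m => \prod_(I : D) (tr (fun m => (ab m).2) m I - tr (fun m => (ab m).1) m I))) /index_iota subn0 /s.
    elim: (iota 0 M) => [|m t IH]; first by rewrite !big_nil.
    rewrite big_cons IH /= /tr; case: (pickle_inv m) => [p|] /=; first by rewrite big_cons.
    by rewrite (bigD1 D0) //= subrr mul0r add0r.
  have us : uniq s.
    by apply: (pmap_uniq (@pickle_invK _)); exact: iota_uniq.
  (* The finitely many pairs met so far fit in a square, over which the volumes sum to at most the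
     geometric series. *)
  pose B := (\max_(p <- s) (maxn p.1 p.2)).+1.
  have sub : {subset s <= [seq (i, j) | i <- iota 0 B, j <- iota 0 B]}.
    move=> p ps; apply/allpairsP; exists p; rewrite !mem_iota /= !add0n !ltnS.
    have := @leq_bigmax_seq _ s predT (fun p => maxn p.1 p.2) p ps isT.
    by rewrite geq_max => /andP[-> ->]; case: (p).
  apply: le_trans (sum_sub_uniq us sub vol0) _.
  rewrite big_allpairs_dep.
  apply: le_trans (geo_half B e0).
  rewrite -(big_mkord predT (fun i => e / 2 ^+ i.+1)) /index_iota subn0.
  apply: ler_sum => i _; have [_ _ h] := abP i.
  have := h B; rewrite -(big_mkord predT (fun j => \prod_(I : D) ((ab i).2 j I - (ab i).1 j I))).
  by rewrite /index_iota subn0.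
Qed.

Lemma null_cup_count (T : countType) (N : T -> tensor R k n -> Prop) :
  (forall m, null_set (N m)) -> null_set (fun A => exists m, N m A).
Proof.
move=> H; apply: (@null_sub _ (fun A => exists m, exists2 x, unpickle m = Some x & N x A)).
  by move=> A [x Nx]; exists (pickle x), x; rewrite ?pickleK.
apply: null_cup => m; case E: (unpickle m) => [x|].
  by apply: null_sub (H x) => A [y [<-]].
apply: null_fin => e e0; exists void, (fun=> fun=> 0), (fun=> fun=> 0).
by split=> [[]|A [y []]|] //; rewrite big1 ?(ltW e0) // => -[].
Qed.

End NullSets.

(** * Covering the image of a thin parametrized set by boxes *)

Section Covering.
Variables (R : realType) (k n : nat).
Hypothesis n_gt0 : (0 < n)%N.
Let D : finType := {ffun 'I_k -> 'I_n}.

Definition cell (x : R) m : 'I_m.+1 := inord (Num.truncn x).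

Lemma cell_itv (x : R) m : 0 <= x <= m%:R -> (cell x m)%:R <= x < (cell x m)%:R + 1.
Proof.
move=> /andP[x0 xm]; have := truncn_itv x0.
have lt : (Num.truncn x < m.+1)%N by rewrite ltnS -(ler_nat R); apply: le_trans xm; rewrite truncn_le.
by rewrite /cell inordK // -natr1.
Qed.

Lemma cell_close (x y : R) m : 0 <= x <= m%:R -> 0 <= y <= m%:R -> cell x m = cell y m ->
  `|x - y| <= 1.
Proof.
move=> /cell_itv hx /cell_itv hy E; move: hx hy; rewrite E => hx hy.
rewrite ler_norml; lra.
Qed.

(** Locally on [Z] all coordinates are controlled by those in [J], and increments of the tensor part
    are almost orthogonal to some [w]. With cells of side [h] in the [J]-coordinates, the tensors of
    one cell lie in a cube of side of order [h] and in a slab of thickness of order [h ^+ 2]. As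
    boxes must be parallel to the axes, the cube is cut at scale [h ^+ 2] in all directions but
    [i0]. With [N] entries this makes about [h ^- N] cells, [h ^- (N - 1)] pieces in each, of volume
    about [h ^+ (2 N)]: in total of order [h]. *)
Lemma slab_null (I : finType) (iota : D -> I) (Z : (I -> R) -> Prop) (K : nat) (J : {set I}) (i0 : D) :
  (0 < K)%N -> (#|J| <= #|D|)%N ->
  (forall y, Z y -> forall i, `|y i| <= K%:R) ->
  (forall y y', Z y -> Z y' -> forall rho : R, 0 <= rho -> (forall i, `|y' i - y i| <= K%:R^-1) ->
     (forall j, j \in J -> `|y' j - y j| <= rho) -> forall i, `|y' i - y i| <= K%:R * rho) ->
  (forall y, Z y -> exists w : D -> R, [/\ w i0 = 1, forall d, `|w d| <= 1 &
     forall y' (rho : R), Z y' -> (forall i, `|y' i - y i| <= rho) -> rho <= K%:R^-1 ->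
       `|\sum_d w d * (y' (iota d) - y (iota d))| <= K%:R * rho ^+ 2]) ->
  null_set (fun A : tensor R k n => exists2 y, Z y & forall d, A d = y (iota d)).
Proof.
move=> K0 cJ bd lip slab; apply: (null_fin n_gt0) => e e0.
pose N := #|D|.
have N0 : (0 < N)%N by apply/card_gt0P; exists i0.
(* [CC] collects the constants of the count, so that the total volume is at most [CC * h]; [q]
   exceeds [CC / e], and the extra [K * K] gives [K * h <= K^-1], the range in which the slab
   hypothesis applies. *)
pose CC := (((2 * K * K).+1 ^ #|I|) * ((3 * K) ^ (N + N.-1)) * (2 * (K ^ 3 + N)))%N.
pose q := ((Num.truncn (CC%:R / e)).+1 + K * K)%N.
have q0 : (0 < q)%N by rewrite /q.
have qR : 0 < q%:R :> R by rewrite ltr0n.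
have KR : 0 < K%:R :> R by rewrite ltr0n.
pose h : R := q%:R^-1.
have h0 : 0 < h by rewrite invr_gt0.
have hq : h * q%:R = 1 by rewrite mulVf // gt_eqF.
have Kh : K%:R * h <= K%:R^-1.
  rewrite /h ler_pdivrMr // ler_pdivlMl // -natrM ler_nat /q; lia.
(* [m2] serves twice: for cells of side [h] in an interval of length [2 K], and for pieces of side
   [h ^+ 2] in one of length [2 K h]. *)
pose m1 := (2 * K * K)%N; pose m2 := (2 * K * q)%N.
pose C1 := {ffun I -> 'I_m1.+1}.
pose C2 := {ffun {j : I | j \in J} -> 'I_m2.+1}.
pose C3 := {ffun {d : D | d \in predC1 i0} -> 'I_m2.+1}.
pose c1 (y : I -> R) : C1 := [ffun i => cell ((y i + K%:R) * K%:R) m1].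
pose c2 (y : I -> R) : C2 := [ffun j => cell ((y (val j) + K%:R) * q%:R) m2].
have c1P y y' : Z y -> Z y' -> c1 y = c1 y' -> forall i, `|y' i - y i| <= K%:R^-1.
  move=> Zy Zy' /ffunP E i; have := E i; rewrite !ffunE => /cell_close H.
  have r y1 : Z y1 -> 0 <= (y1 i + K%:R) * K%:R <= m1%:R.
    move=> /bd/(_ i); rewrite ler_norml /m1 !natrM => /andP[u v].
    by apply/andP; split; [apply: mulr_ge0; lra|rewrite ler_pM2r //; lra].
  have := H (r _ Zy) (r _ Zy'); rewrite -mulrBl normrM (gtr0_norm KR) -ler_pdivlMr // mul1r.
  by rewrite distrC; apply: le_trans; rewrite opprD addrACA subrr addr0.
have c2P y y' : Z y -> Z y' -> c2 y = c2 y' -> forall j, j \in J -> `|y' j - y j| <= h.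
  move=> Zy Zy' /ffunP E i iJ; have := E (exist _ i iJ); rewrite !ffunE /= => /cell_close H.
  have r y1 : Z y1 -> 0 <= (y1 i + K%:R) * q%:R <= m2%:R.
    move=> /bd/(_ i); rewrite ler_norml /m2 !natrM => /andP[u v].
    by apply/andP; split; [apply: mulr_ge0; lra|rewrite ler_pM2r //; lra].
  have := H (r _ Zy) (r _ Zy'); rewrite -mulrBl normrM (gtr0_norm qR) -ler_pdivlMr // mul1r.
  by rewrite distrC; apply: le_trans; rewrite opprD addrACA subrr addr0.
have /choice[yc ycP] : forall c : C1 * C2, exists y, (exists2 y, Z y & c = (c1 y, c2 y)) ->
    Z y /\ c = (c1 y, c2 y).
  move=> c; have [[y Zy cy]|nex] := pselect (exists2 y, Z y & c = (c1 y, c2 y)); first by exists y.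
  by exists (fun=> 0).
have /choice[w wP] : forall y, exists w : D -> R, Z y -> [/\ w i0 = 1, forall d, `|w d| <= 1 &
     forall y' (rho : R), Z y' -> (forall i, `|y' i - y i| <= rho) -> rho <= K%:R^-1 ->
       `|\sum_d w d * (y' (iota d) - y (iota d))| <= K%:R * rho ^+ 2].
  move=> y; have [/slab[w ?]|nz] := pselect (Z y); first by exists w.
  by exists (fun=> 0).
(* Half thickness: [K * (K * h) ^+ 2] from the slab, and [h ^+ 2] per coordinate for replacing an
   entry by the corner of its piece. *)
pose W : R := (K ^ 3 + N)%N%:R * h ^+ 2.
have W0 : 0 <= W by rewrite mulr_ge0 // exprn_ge0 // ltW.
pose lo (x : C1 * C2 * C3) (d : {d : D | d \in predC1 i0}) : R :=
  yc x.1 (iota (val d)) - K%:R * h + (x.2 d)%:R * h ^+ 2.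
(* The slab equation solved for the coordinate [i0], where [w] equals 1. *)
pose ctr (x : C1 * C2 * C3) : R := yc x.1 (iota i0) -
  \sum_(d : {d : D | d \in predC1 i0}) w (yc x.1) (val d) * (lo x d - yc x.1 (iota (val d))).
pose a (x : C1 * C2 * C3) (d : D) : R :=
  if insub d is Some d' then lo x d' else ctr x - W.
pose b (x : C1 * C2 * C3) (d : D) : R :=
  if insub d is Some d' then lo x d' + h ^+ 2 else ctr x + W.
exists (C1 * C2 * C3)%type, a, b; split.
- move=> x d; rewrite /a /b; case: insubP => [d' _ _|_]; last lra.
  by rewrite lerDl exprn_ge0 // ltW.
- move=> A [y Zy Ay].
  pose c := (c1 y, c2 y).
  have [Zc [E1 E2]] : Z (yc c) /\ c = (c1 (yc c), c2 (yc c)) by apply: ycP; exists y.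
  have dK := c1P _ _ Zc Zy (esym E1).
  have dh := c2P _ _ Zc Zy (esym E2).
  have dKh := lip _ _ Zc Zy _ (ltW h0) dK dh.
  pose x : C1 * C2 * C3 := (c, [ffun d => cell ((A (val d) - yc c (iota (val d)) + K%:R * h) / h ^+ 2) m2]).
  have loP d : lo x d <= A (val d) <= lo x d + h ^+ 2.
    have h2 : 0 < h ^+ 2 by rewrite exprn_gt0.
    have : 0 <= (A (val d) - yc c (iota (val d)) + K%:R * h) / h ^+ 2 <= m2%:R.
      have := dKh (iota (val d)); rewrite -Ay ler_norml => /andP[u v].
      apply/andP; split; first by apply: divr_ge0; [lra|exact: ltW].
      rewrite ler_pdivrMr //; have -> : m2%:R * h ^+ 2 = 2 * K%:R * h.
        by rewrite /m2 !natrM expr2 -(mulrA 2) -!mulrA (mulrCA q%:R) (mulrC q%:R) hq mulr1.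
      lra.
    move=> /cell_itv; rewrite /lo /x /= ffunE.
    move: (cell _ _)%:R => v; rewrite ler_pdivlMr // ltr_pdivrMr //.
    move=> /andP[u1 u2]; apply/andP; split; first lra.
    by move: u2; rewrite mulrDl mul1r; lra.
  exists x => d; rewrite /a /b; case: insubP => [d' _ <-|]; first exact: loP.
  rewrite inE negbK => /eqP ->{d}.
  have [w1 wle wsl] := wP _ Zc.
  have := wsl y _ Zy dKh Kh; rewrite (bigD1 i0) //= w1 mul1r -Ay.
  have -> : \sum_(d | d != i0) w (yc c) d * (y (iota d) - yc c (iota d)) =
     \sum_(d : {d : D | d \in predC1 i0}) w (yc c) (val d) * (A (val d) - yc c (iota (val d))).
    transitivity (\sum_(d in predC1 i0) w (yc c) d * (A d - yc c (iota d))).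
      by apply: eq_big => d; rewrite ?inE // Ay.
    by rewrite big_sub.
  have : `|\sum_(d : {d : D | d \in predC1 i0}) w (yc c) (val d) * (A (val d) - yc c (iota (val d))) -
    \sum_(d : {d : D | d \in predC1 i0}) w (yc c) (val d) * (lo x d - yc c (iota (val d)))| <= N%:R * h ^+ 2.
    rewrite -sumrB; apply: le_trans (ler_norm_sum _ _ _) _.
    have : \sum_(d : {d : D | d \in predC1 i0}) `|w (yc c) (val d) * (A (val d) - yc c (iota (val d))) -
      w (yc c) (val d) * (lo x d - yc c (iota (val d)))| <= \sum_(d : {d : D | d \in predC1 i0}) h ^+ 2.
      apply: ler_sum => d _; rewrite -mulrBr normrM.
      rewrite -[leRHS]mul1r ler_pM //.
      by have := loP d; rewrite ler_norml => /andP[u1 u2]; apply/andP; split; lra.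
    move=> /le_trans; apply; rewrite sumr_const -[h ^+ 2 *+ _]mulr_natl.
    apply: ler_wpM2r; first by rewrite exprn_ge0 // ltW.
    by rewrite ler_nat; apply: (leq_card _ val_inj).
  rewrite !ler_norml /ctr /W natrD natrX; move: (\sum_d _) (\sum_d _) => s1 s2.
  by rewrite exprMn /= => /andP[? ?] /andP[? ?]; apply/andP; split; nra.
- have vol x : \prod_(d : D) (b x d - a x d) = 2 * W * (h ^+ 2) ^+ N.-1.
    rewrite (bigD1 i0) //= {1}/b {1}/a insubF ?inE ?eqxx //.
    congr (_ * _); first by ring.
    rewrite -(cardC1 i0) -prodr_const; apply: eq_big => [d|d di]; first by rewrite inE.
    by rewrite /a /b insubT //= addrAC subrr add0r.
  under eq_bigr => x _ do rewrite vol.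
  rewrite sumr_const -[leLHS]mulr_natl.
  have cT : (#|{: C1 * C2 * C3}| <= (m1.+1 ^ #|I|) * (3 * K * q) ^ (N + N.-1))%N.
    rewrite !card_prod !card_ffun !card_ord !card_sig -mulnA leq_mul2l; apply/orP; right.
    rewrite (cardC1 i0) -/N.
    rewrite -expnD; have m2q : (m2.+1 <= 3 * K * q)%N by rewrite /m2; nia.
    apply: (leq_trans (n := (m2.+1 ^ (N + N.-1)))%N).
      by rewrite leq_exp2l ?leq_add2r // /m2; nia.
    by rewrite leq_exp2r // addn_gt0 N0.
  apply: (@le_trans _ _ (CC%:R * h)).
    have V0 : 0 <= 2 * W * (h ^+ 2) ^+ N.-1.
      by apply: mulr_ge0; [exact: mulr_ge0|do 2!apply: exprn_ge0; exact: ltW].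
    apply: (@le_trans _ _ (((m1.+1 ^ #|I|) * (3 * K * q) ^ (N + N.-1))%N%:R * (2 * W * (h ^+ 2) ^+ N.-1))).
      by apply: (ler_wpM2r V0); rewrite ler_nat.
    rewrite [((3 * K * q) ^ _)%N]expnMn /W /CC 4!natrM [(q ^ _)%:R]natrX [(2 * _)%:R]natrM.
    move: (_ ^ #|I|)%N%:R ((3 * K) ^ (N + N.-1))%N%:R (K ^ 3 + N)%N%:R => ca cb cc.
    have hE : h = q%:R ^+ (N + N.-1) * (h ^+ 2 * (h ^+ 2) ^+ N.-1).
      have E : (2 * N)%N = (N + N.-1).+1 by lia.
      by rewrite -exprS prednK // -exprM E exprSr mulrA -exprMn (mulrC q%:R) hq expr1n mul1r.
    rewrite [X in _ <= _ * X]hE; move: (h ^+ 2) ((h ^+ 2) ^+ _) (_ ^+ (N + N.-1)) => x y z.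
    by rewrite le_eqVlt; apply/orP; left; apply/eqP; ring.
  rewrite /h ler_pdivrMr // mulrC -ler_pdivrMr // /q natrD.
  have /andP[_] := truncn_itv (divr_ge0 (ler0n R CC) (ltW e0)).
  by move=> /ltW /le_trans; apply; rewrite lerDl.
Qed.

End Covering.

(** * Polynomial expressions and a Sard-type lemma *)

(** Polynomials are kept as expressions, so that the differential [dv] is a recursive function and
    the Taylor estimates are inductions. *)
Inductive pexpr (R X : Type) : Type :=
| PX of X
| PC of R
| PA of pexpr R X & pexpr R X
| PM of pexpr R X & pexpr R X.
Arguments PX {R X} _.
Arguments PC {R X} _.

Section Polynomials.
Variables (R : realType).

Fixpoint ev (X : Type) (e : pexpr R X) (y : X -> R) : R :=
  match e with
  | PX x => y x
  | PC c => c
  | PA e1 e2 => ev e1 y + ev e2 y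
  | PM e1 e2 => ev e1 y * ev e2 y
  end.

Fixpoint dv (X : Type) (e : pexpr R X) (y v : X -> R) : R :=
  match e with
  | PX x => v x
  | PC c => 0
  | PA e1 e2 => dv e1 y v + dv e2 y v
  | PM e1 e2 => dv e1 y v * ev e2 y + ev e1 y * dv e2 y v
  end.

Definition psum (X : Type) (I : finType) (P : pred I) (F : I -> pexpr R X) : pexpr R X :=
  \big[@PA R X/PC 0]_(i | P i) F i.
Definition pprod (X : Type) (I : finType) (P : pred I) (F : I -> pexpr R X) : pexpr R X :=
  \big[@PM R X/PC 1]_(i | P i) F i.

Lemma ev_psum X (I : finType) (P : pred I) (F : I -> pexpr R X) y : ev (psum P F) y = \sum_(i | P i) ev (F i) y.
Proof. exact: (big_morph (fun e => ev e y)). Qed.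

Lemma dv_psum X (I : finType) (P : pred I) (F : I -> pexpr R X) y v :
  dv (psum P F) y v = \sum_(i | P i) dv (F i) y v.
Proof. exact: (big_morph (fun e => dv e y v)). Qed.

Lemma ev_pprod X (I : finType) (P : pred I) (F : I -> pexpr R X) y : ev (pprod P F) y = \prod_(i | P i) ev (F i) y.
Proof. exact: (big_morph (fun e => ev e y)). Qed.

Lemma dv_pprod X (I : finType) (P : pred I) (F : I -> pexpr R X) y v :
  dv (pprod P F) y v = \sum_(i | P i) dv (F i) y v * \prod_(j | P j && (j != i)) ev (F j) y.
Proof.
rewrite /pprod -big_filter -[X in _ = X]big_filter; set s := filter _ _.
transitivity (\sum_(i <- s) dv (F i) y v * \prod_(j <- s | j != i) ev (F j) y); last first.
  by apply: eq_bigr => i _; rewrite big_filter_cond.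
have : uniq s by rewrite filter_uniq // index_enum_uniq.
elim: s => [|i s IH] /=; first by rewrite !big_nil.
move=> /andP[nis us]; rewrite !big_cons /= eqxx /= IH //; congr (_ * _ + _).
- rewrite (big_morph (fun e => ev e y) (id1 := 1) (op1 := *%R)) // big_seq_cond [RHS]big_seq_cond.
  apply: eq_bigl => j; rewrite andbT; case js: (j \in s) => //=.
  by apply/esym; apply: contraNneq nis => <-.
- rewrite big_distrr /= big_seq [RHS]big_seq; apply: eq_bigr => j js.
  rewrite big_cons; have -> : i != j by apply: contraNneq nis => ->.
  by rewrite mulrCA.
Qed.

Lemma ev_ext X (e : pexpr R X) y y' : y =1 y' -> ev e y = ev e y'.
Proof. by move=> /funext->. Qed.

Lemma dv_ext X (e : pexpr R X) y y' v v' : y =1 y' -> v =1 v' -> dv e y v = dv e y' v'.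
Proof. by move=> /funext-> /funext->. Qed.

Lemma dv_lin X (e : pexpr R X) y a u v :
  dv e y (fun i => a * u i + v i) = a * dv e y u + dv e y v.
Proof.
elim: e => [x|c|e1 IH1 e2 IH2|e1 IH1 e2 IH2] //=; first by rewrite mulr0 addr0.
- by rewrite IH1 IH2; ring.
- by rewrite IH1 IH2; ring.
Qed.

Lemma taylor (X : Type) (e : pexpr R X) (K : R) : exists2 B, 0 <= B &
  forall y y' rho, 0 <= rho -> (forall i, `|y i| <= K) -> (forall i, `|y' i| <= K) ->
    (forall i, `|y' i - y i| <= rho) ->
   [/\ `|ev e y| <= B, `|ev e y'| <= B, `|ev e y' - ev e y| <= B * rho,
    `|dv e y (fun i => y' i - y i)| <= B * rho &
     `|ev e y' - ev e y - dv e y (fun i => y' i - y i)| <= B * rho ^+ 2].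
Proof.
elim: e => [x|c|e1 [B1 B10 H1] e2 [B2 B20 H2]|e1 [B1 B10 H1] e2 [B2 B20 H2]].
- exists (`|K| + 1); first by rewrite addr_ge0.
  move=> y y' rho r0 hy hy' hd /=; have := hy x; have := hy' x; have := hd x => h1 h2 h3.
  have KK := ler_norm K; have K0 := normr_ge0 K.
  split; [lra|lra|nra|nra|rewrite subrr normr0; nra].
- exists `|c| => // y y' rho r0 hy hy' hd /=.
  by rewrite !subrr normr0; split=> //; rewrite ?mulr_ge0 ?sqr_ge0.
- exists (B1 + B2); first exact: addr_ge0.
  move=> y y' rho r0 hy hy' hd /=.
  have [a1 a2 a3 a4 a5] := H1 _ _ _ r0 hy hy' hd.
  have [b1 b2 b3 b4 b5] := H2 _ _ _ r0 hy hy' hd.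
  move: a1 a2 a3 a4 a5 b1 b2 b3 b4 b5; rewrite !ler_norml !mulrDl.
  move: (_ ^+ 2) (dv _ _ _) (dv _ _ _) (ev _ _) (ev _ _) (ev _ _) (ev _ _) => *.
  by split; lra.
- exists (3 * (B1 * B2)); first by rewrite !mulr_ge0.
  move=> y y' rho r0 hy hy' hd /=.
  have [a1 a2 a3 a4 a5] := H1 _ _ _ r0 hy hy' hd.
  have [b1 b2 b3 b4 b5] := H2 _ _ _ r0 hy hy' hd.
  move: a1 a2 a3 a4 a5 b1 b2 b3 b4 b5.
  move: (dv e1 _ _) (dv e2 _ _) (ev e1 y) (ev e1 y') (ev e2 y) (ev e2 y').
  move=> d1 d2 f f' g g' a1 a2 a3 a4 a5 b1 b2 b3 b4 b5.
  have M (x z p q : R) : `|x| <= p -> `|z| <= q -> `|x * z| <= p * q.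
    by move=> ? ?; rewrite normrM ler_pM.
  have B12 : 0 <= B1 * B2 by exact: mulr_ge0.
  have T (x z p q : R) : `|x| <= p -> `|z| <= q -> `|x + z| <= p + q.
    by move=> ? ?; apply: le_trans (ler_normD _ _) _; exact: lerD.
  split.
  + by apply: le_trans (M _ _ _ _ a1 b1) _; lra.
  + by apply: le_trans (M _ _ _ _ a2 b2) _; lra.
  + have -> : f' * g' - f * g = (f' - f) * g' + f * (g' - g) by ring.
    apply: le_trans (T _ _ _ _ (M _ _ _ _ a3 b2) (M _ _ _ _ a1 b3)) _.
    have : 0 <= B1 * B2 * rho by exact: mulr_ge0.
    by nra.
  + apply: le_trans (T _ _ _ _ (M _ _ _ _ a4 b1) (M _ _ _ _ a1 b4)) _.
    have : 0 <= B1 * B2 * rho by exact: mulr_ge0.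
    by nra.
  + have -> : f' * g' - f * g - (d1 * g + f * d2) =
       (f' - f - d1) * g + (f * (g' - g - d2) + (f' - f) * (g' - g)) by ring.
    apply: le_trans (T _ _ _ _ (M _ _ _ _ a5 b1) (T _ _ _ _ (M _ _ _ _ a1 b5) (M _ _ _ _ a3 b3))) _.
    by rewrite le_eqVlt; apply/orP; left; apply/eqP; ring.
Qed.

Lemma taylor_fam (X : Type) (Q : finType) (G : Q -> pexpr R X) (K : R) : exists2 B, 0 <= B &
  forall q y y' rho, 0 <= rho -> (forall i, `|y i| <= K) -> (forall i, `|y' i| <= K) ->
    (forall i, `|y' i - y i| <= rho) ->
   [/\ `|ev (G q) y| <= B, `|ev (G q) y' - ev (G q) y| <= B * rho &
     `|ev (G q) y' - ev (G q) y - dv (G q) y (fun i => y' i - y i)| <= B * rho ^+ 2].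
Proof.
have /choice[b bP] : forall q, exists b, 0 <= b /\ forall y y' rho, 0 <= rho ->
    (forall i, `|y i| <= K) -> (forall i, `|y' i| <= K) ->
    (forall i, `|y' i - y i| <= rho) ->
   [/\ `|ev (G q) y| <= b, `|ev (G q) y' - ev (G q) y| <= b * rho &
     `|ev (G q) y' - ev (G q) y - dv (G q) y (fun i => y' i - y i)| <= b * rho ^+ 2].
  move=> q; have [b b0 H] := taylor (G q) K; exists b; split=> // y y' rho r0 h1 h2 h3.
  by have [? ? ? ? ?] := H _ _ _ r0 h1 h2 h3.
exists (\sum_q b q); first by apply: sumr_ge0 => q _; have [] := bP q.
move=> q y y' rho r0 h1 h2 h3; have [bq H] := bP q; have [u1 u2 u3] := H _ _ _ r0 h1 h2 h3.
have le : b q <= \sum_q b q.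
  by rewrite (bigD1 q) //= lerDl sumr_ge0 // => i _; have [] := bP i.
split; first exact: le_trans u1 le.
  by apply: le_trans u2 _; rewrite ler_wpM2r.
by apply: le_trans u3 _; rewrite ler_wpM2r // sqr_ge0.
Qed.

Lemma dv_hom (X : finType) (e : pexpr R X) (y : X -> R) :
  {F : 'Hom({ffun X -> R^o}, R^o) | forall v, F v = dv e y v}.
Proof.
apply: lin_hom => a u v; rewrite -[RHS](dv_lin e y a u v).
by apply: dv_ext => // i; rewrite !ffunE.
Qed.

Lemma proj_hom (X : finType) (x : X) : {F : 'Hom({ffun X -> R^o}, R^o) | forall v, F v = v x}.
Proof. by apply: lin_hom => a u v; rewrite !ffunE. Qed.

Lemma max_norm (X : finType) (f : X -> R) : exists m, [/\ 0 <= m, forall x, `|f x| <= m &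
  m = 0 \/ exists x, m = `|f x|].
Proof.
have [[x0 _]|no] := pselect (exists x : X, True).
  exists `|f [arg max_(x > x0) `|f x|]%O|; case: Order.TotalTheory.arg_maxP => // i _ H; split=> //.
    by move=> x; exact: H.
  by right; exists i.
by exists 0; split=> // [x|]; [case: no; exists x|left].
Qed.

Variables (k n : nat).
Hypothesis n_gt0 : (0 < n)%N.
Let D : finType := {ffun 'I_k -> 'I_n}.

(** At such a zero the tangent space has at most the dimension of tensor space and projects to a
    proper subspace of it. The zeros are split into countably many pieces [P J d0 K], on which the
    coordinates [J] that determine the kernel are fixed and all constants are bounded by [K]. On one
    piece [slab_null] applies, with [w] an annihilator of the projection. *)
Lemma sard_null (I Q : finType) (iota : D -> I) (G : Q -> pexpr R I) :
  null_set (fun A : tensor R k n => exists y : I -> R,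
    [/\ forall q, ev (G q) y = 0, forall d, A d = y (iota d) &
     exists Ker : {vspace {ffun I -> R^o}},
     [/\ forall v, v \in Ker <-> forall q, dv (G q) y v = 0, (\dim Ker <= #|D|)%N &
      exists2 w : D -> R, exists d, w d != 0 &
        forall v, v \in Ker -> \sum_d w d * v (iota d) = 0]]).
Proof.
(* The last two clauses are quantitative forms of two facts: the coordinates in [J] determine a
   kernel vector, and [w] annihilates the projection of the kernel. In this form they apply to
   increments that lie in the kernel only approximately. *)
pose P (J : {set I}) (d0 : D) (K : nat) (y : I -> R) : Prop :=
  [/\ forall q, ev (G q) y = 0, forall i, `|y i| <= K%:R,
   forall (v : I -> R) r1 r2, 0 <= r1 -> 0 <= r2 -> (forall q, `|dv (G q) y v| <= r1) ->
      (forall j, j \in J -> `|v j| <= r2) -> forall i, `|v i| <= K%:R * (r1 + r2) &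
   exists w : D -> R, [/\ w d0 = 1, forall d, `|w d| <= 1 &
     forall (v : I -> R) r1, (forall q, `|dv (G q) y v| <= r1) -> 0 <= r1 ->
       `|\sum_d w d * v (iota d)| <= K%:R * r1]].
pose N' (x : {set I} * D * nat) (A : tensor R k n) := (#|x.1.1| <= #|D|)%N /\
  exists2 y, P x.1.1 x.1.2 x.2 y & forall d, A d = y (iota d).
apply: (@null_sub _ _ _ _ (fun A => exists x, N' x A)); last first.
  apply: null_cup_count => // -[[J d0] K]; rewrite /N' /=.
  have [cJ|cJ] := boolP (#|J| <= #|D|)%N; last first.
    apply: null_fin => // e e0; exists void, (fun=> fun=> 0), (fun=> fun=> 0).
    by split=> [[]|A []|] //; rewrite big1 ?(ltW e0) // => -[].
  have [B B0 HB] := taylor_fam G K%:R.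
  pose K' := (2 * K * (Num.truncn B).+1 + K + 1)%N.
  have BK : B <= (Num.truncn B).+1%:R by have /andP[_ /ltW] := truncn_itv B0.
  have K'R : K'%:R = 2 * K%:R * (Num.truncn B).+1%:R + K%:R + 1 :> R by rewrite /K' !natrD !natrM.
  have K0 : 0 <= K%:R :> R by [].
  have KB : K%:R * B <= K%:R * (Num.truncn B).+1%:R by rewrite ler_wpM2l.
  have KB0 : 0 <= K%:R * B by rewrite mulr_ge0.
  have KT0 : 0 <= K%:R * (Num.truncn B).+1%:R :> R by rewrite mulr_ge0.
  have K'0 : 0 < K'%:R :> R by rewrite ltr0n /K' addn1.
  have dG y y' rho : P J d0 K y -> P J d0 K y' -> 0 <= rho -> (forall i, `|y' i - y i| <= rho) ->
      forall q, `|dv (G q) y (fun i => y' i - y i)| <= B * rho ^+ 2.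
    move=> [z b _ _] [z' b' _ _] r0 h q; have [_ _] := HB q _ _ _ r0 b b' h.
    by rewrite z z' subrr sub0r normrN.
  apply: (@null_sub _ _ _ _ (fun A => exists2 y, P J d0 K y & forall d, A d = y (iota d))).
    by move=> A [].
  apply: (@slab_null _ _ _ n_gt0 _ _ _ K' J d0) => //.
  - by rewrite /K' addn1.
  - move=> y [_ b _ _] i; apply: le_trans (b i) _; rewrite K'R; lra.
  (* Two zeros differ by a vector that the differential kills up to the quadratic remainder, so the
     largest coordinate [m] of the increment obeys [m <= K (B m^2 + rho)]. Since [m <= 1 / K'], the
     quadratic term is at most [m / 2] and is absorbed. *)
  - move=> y y' Py Py' rho r0 le leJ i.
    have [m [m0 mx mE]] := max_norm (fun i => y' i - y i).
    have [_ _ /(_ (fun i => y' i - y i) (B * m ^+ 2) rho) L _] := Py.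
    have mm : m * K'%:R <= 1.
      have [->|[x ->]] := mE; first by rewrite mul0r.
      by rewrite -ler_pdivlMr // mul1r.
    have mL : m <= K%:R * (B * m ^+ 2 + rho).
      have [->|[x {1}->]] := mE; first by rewrite expr0n /= mulr0 add0r mulr_ge0.
      apply: L => //; first by rewrite mulr_ge0 // sqr_ge0.
      exact: dG.
    apply: le_trans (mx i) _.
    have h1 : K%:R * B * m ^+ 2 <= m / 2.
      have : K%:R * B * (m * m) <= (K%:R * (Num.truncn B).+1%:R) * (m * m).
        by apply: ler_wpM2r => //; exact: mulr_ge0.
      have : m * (m * K'%:R) <= m * 1 by exact: ler_wpM2l.
      rewrite K'R expr2; move: (K%:R * (Num.truncn B).+1%:R) KT0 => z z0 u v.
      have : 0 <= m * m * (K%:R + 1) by rewrite !mulr_ge0 // addr_ge0.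
      by nra.
    have h2 : m <= 2 * K%:R * rho by move: mL; rewrite mulrDr mulrA; lra.
    apply: le_trans h2 _; apply: ler_wpM2r => //; rewrite K'R.
    have : K%:R <= K%:R * (Num.truncn B).+1%:R :> R by rewrite ler_peMr // ler1n.
    lra.
  - move=> y Py; have [_ _ _ [w [w1 w2 w3]]] := Py; exists w; split=> // y' rho Py' le lrho.
    have [r0|r0] := leP 0 rho.
      apply: le_trans (w3 (fun i => y' i - y i) (B * rho ^+ 2) _ _) _ => //.
      + exact: dG.
      + by rewrite mulr_ge0 // sqr_ge0.
      + rewrite mulrA ler_wpM2r ?sqr_ge0 // K'R; lra.
    by have := le (iota d0); rewrite leNgt (lt_le_trans r0).
move=> A [y [z Ay [Ker [KerP dK [w wn0 wK]]]]].
have [J [cJ J0 _]] := coord_set Ker.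
have /choice[phi phiP] : forall x : Q + I, exists F : 'Hom({ffun I -> R^o}, R^o), forall v,
   F v = match x with inl q => dv (G q) y v | inr j => if j \in J then v j else 0 end.
  case=> [q|j]; first by have [F FE] := dv_hom (G q) y; exists F.
  have [jJ|jJ] := boolP (j \in J); first by have [F FE] := proj_hom j; exists F => v; rewrite FE.
  by exists 0 => v; rewrite lfunE.
have phi0 v : (forall x, phi x v = 0) -> v = 0.
  move=> v0; apply: J0 => [|j jJ]; last by have := v0 (inr j); rewrite phiP jJ.
  by apply/KerP => q; have := v0 (inl q); rewrite phiP.
have /choice[c cP] : forall i, exists c, forall v : {ffun I -> R^o}, v i = \sum_x c x * phi x v.
  move=> i; have [F FE] := proj_hom i.
  have [v /phi0 ->|c cP] := @functional_span _ _ _ phi F; first by rewrite linear0.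
  by exists c => v; rewrite -FE.
have [psi psiE] : {F : 'Hom({ffun I -> R^o}, R^o) | forall v, F v = \sum_d w d * v (iota d)}.
  apply: lin_hom => a u v; rewrite /GRing.scale /= mulr_sumr -big_split /=; apply: eq_bigr => d _.
  by rewrite !ffunE /GRing.scale /=; ring.
have /choice[g gE] : forall q, exists F : 'Hom({ffun I -> R^o}, R^o), forall v, F v = dv (G q) y v.
  by move=> q; have [F FE] := dv_hom (G q) y; exists F.
have [v v0|c' c'P] := @functional_span _ _ _ g psi.
  by rewrite psiE; apply: wK; apply/KerP => q; rewrite -gE.
have [d1 wd1] := wn0.
(* Dividing by the entry of largest modulus makes all entries of [w] at most 1 in modulus. *)
pose d0 := [arg max_(d > d1) `|w d|]%O.
have d0P d : `|w d| <= `|w d0|.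
  by rewrite /d0; case: Order.TotalTheory.arg_maxP => // i _; exact.
have wd0 : w d0 != 0.
  by rewrite -normr_gt0; apply: lt_le_trans (d0P d1); rewrite normr_gt0.
pose M := \sum_i `|y i| + (\sum_i \sum_x `|c i x| + `|w d0|^-1 * \sum_q `|c' q|).
have M1 : 0 <= \sum_i `|y i| by apply: sumr_ge0.
have M2 : 0 <= \sum_i \sum_x `|c i x| by do 2!apply: sumr_ge0 => ? _.
have M3 : 0 <= `|w d0|^-1 * \sum_q `|c' q| by rewrite mulr_ge0 ?invr_ge0 // sumr_ge0.
have M0 : 0 <= M by rewrite !addr_ge0.
pose K := (Num.truncn M).+1.
have MK : M <= K%:R by have /andP[_ /ltW] := truncn_itv M0.
exists (J, d0, K); split; first exact: leq_trans cJ dK.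
exists y => //; split=> //.
- move=> i; apply: le_trans MK; rewrite /M (bigD1 i) //= -!addrA lerDl.
  by rewrite !addr_ge0 // sumr_ge0.
- move=> v r1 r2 r10 r20 h1 h2 i; pose v' : {ffun I -> R^o} := [ffun i => v i].
  have -> : v i = v' i by rewrite ffunE.
  rewrite cP; apply: le_trans (ler_norm_sum _ _ _) _.
  apply: (@le_trans _ _ (\sum_x `|c i x| * (r1 + r2))).
    apply: ler_sum => x _; rewrite normrM ler_wpM2l // phiP.
    case: x => [q|j].
      rewrite (@dv_ext _ _ y y v' v) => // [|z']; last by rewrite ffunE.
      by apply: le_trans (h1 q) _; rewrite lerDl.
    case: ifP => [jJ|_]; last by rewrite normr0 addr_ge0.
    by rewrite ffunE; apply: le_trans (h2 j jJ) _; rewrite lerDr.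
  rewrite -mulr_suml; apply: ler_wpM2r; first exact: addr_ge0.
  apply: le_trans MK; rewrite /M [X in _ + (X + _)](bigD1 i) //=.
  have : 0 <= \sum_(i0 | i0 != i) \sum_x `|c i0 x| by do 2!apply: sumr_ge0 => ? _.
  lra.
exists (fun d => w d / w d0); split; first by rewrite divff.
  by move=> d; rewrite normrM normfV ler_pdivrMr ?normr_gt0 // mul1r.
move=> v r1 h r10; pose v' : {ffun I -> R^o} := [ffun i => v i].
have -> : \sum_d w d / w d0 * v (iota d) = (w d0)^-1 * psi v'.
  rewrite psiE mulr_sumr; apply: eq_bigr => d _; rewrite ffunE; ring.
rewrite normrM normfV c'P; apply: (@le_trans _ _ (`|w d0|^-1 * \sum_q `|c' q| * r1)).
  apply: ler_wpM2l; first by rewrite invr_ge0.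
  apply: le_trans (ler_norm_sum _ _ _) _; apply: ler_sum => q _.
  rewrite normrM ler_wpM2l // gE (@dv_ext _ _ y y v' v) // => z'; by rewrite ffunE.
rewrite -mulr_suml mulrA; apply: ler_wpM2r => //; apply: le_trans MK; rewrite /M; lra.
Qed.

End Polynomials.

(** * Polynomial systems that are affine in the tensor *)

Fixpoint prename (R X Y : Type) (f : X -> Y) (e : pexpr R X) : pexpr R Y :=
  match e with
  | PX x => PX (f x)
  | PC c => PC c
  | PA e1 e2 => PA (prename f e1) (prename f e2)
  | PM e1 e2 => PM (prename f e1) (prename f e2)
  end.

Section AffineSystems.
Variables (R : realType) (k n : nat).
Hypothesis n_gt0 : (0 < n)%N.
Let D : finType := {ffun 'I_k -> 'I_n}.

Lemma ev_prename (X Y : Type) (f : X -> Y) (e : pexpr R X) y : ev (prename f e) y = ev e (fun x => y (f x)).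
Proof. by elim: e => //= [e1 -> e2 ->|e1 -> e2 ->]. Qed.

Lemma dv_prename (X Y : Type) (f : X -> Y) (e : pexpr R X) y v :
  dv (prename f e) y v = dv e (fun x => y (f x)) (fun x => v (f x)).
Proof. by elim: e => //= [e1 -> e2 ->//|e1 -> e2 ->]; rewrite !ev_prename. Qed.

Variables (X Qc Qh : finType) (C : Qc -> pexpr R X) (yh : Qh -> D -> pexpr R X) (kap : Qh -> pexpr R X).

Definition zero_at (A : tensor R k n) (w : X -> R) : Prop :=
  (forall c, ev (C c) w = 0) /\ (forall h, \sum_d A d * ev (yh h d) w = ev (kap h) w).

(** Kernel of the differential of the system in tensor and variables together, tested on the
    direction [(e, v)]. *)
Definition lin_zero (A : tensor R k n) (w : X -> R) (e : D -> R) (v : X -> R) : Prop :=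
  (forall c, dv (C c) w v = 0) /\
  (forall h, \sum_d e d * ev (yh h d) w + \sum_d A d * dv (yh h d) w v = dv (kap h) w v).

Let G (q : Qc + Qh) : pexpr R (D + X) :=
  match q with
  | inl c => prename inr (C c)
  | inr h => PA (psum predT (fun d => PM (PX (inl d)) (prename inr (yh h d))))
      (PM (PC (-1)) (prename inr (kap h)))
  end.

Let join (A : D -> R) (w : X -> R) (i : D + X) : R :=
  match i with inl d => A d | inr x => w x end.

Let G0 A w : zero_at A w -> forall q, ev (G q) (join A w) = 0.
Proof.
move=> [c0 h0] [c|h] /=; first by rewrite ev_prename; apply: c0.
rewrite ev_psum ev_prename mulN1r; apply/eqP; rewrite subr_eq0; apply/eqP.
by rewrite -[RHS](h0 h); apply: eq_bigr => d _ /=; rewrite ev_prename.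
Qed.

Let dG A w v : (forall q, dv (G q) (join A w) v = 0) <->
  lin_zero A w (fun d => v (inl d)) (fun x => v (inr x)).
Proof.
have E h : dv (G (inr h)) (join A w) v =
    \sum_d v (inl d) * ev (yh h d) w + \sum_d A d * dv (yh h d) w (fun x => v (inr x))
    - dv (kap h) w (fun x => v (inr x)).
  rewrite /= dv_psum dv_prename /= mul0r add0r mulN1r; congr (_ - _).
  by rewrite -big_split /=; apply: eq_bigr => d _; rewrite ev_prename dv_prename.
split=> [H|[H1 H2] [c|h]].
- split=> [c|h]; first by have := H (inl c); rewrite /= dv_prename.
  by have := H (inr h); rewrite E => /eqP; rewrite subr_eq0 => /eqP.
- by rewrite /= dv_prename; apply: H1.
- by rewrite E H2 subrr.
Qed.

Lemma lin_zero_lin A w a e v e' v' : lin_zero A w e v -> lin_zero A w e' v' ->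
  lin_zero A w (fun d => a * e d + e' d) (fun x => a * v x + v' x).
Proof.
move=> [H1 H2] [H1' H2']; split=> [c|h]; first by rewrite dv_lin H1 H1' mulr0 addr0.
rewrite dv_lin -H2 -H2' mulrDr !mulr_sumr -!big_split /=.
by apply: eq_bigr => d _; rewrite dv_lin; ring.
Qed.

Lemma lin_zero0 A w : lin_zero A w (fun=> 0) (fun=> 0).
Proof.
have dv0 Y (e : pexpr R Y) y : dv e y (fun=> 0) = 0.
  by elim: e => //= [e1 -> e2 ->|e1 -> e2 ->]; rewrite ?mul0r ?mulr0 addr0.
split=> [c|h]; first exact: dv0.
by rewrite !big1 ?addr0 ?dv0 // => d _; rewrite ?mul0r ?dv0 ?mulr0.
Qed.

Let kerv A w : {Ker : {vspace {ffun D + X -> R^o}} |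
  forall v, v \in Ker <-> forall q, dv (G q) (join A w) v = 0}.
Proof.
have [|a u v|U UP] := @vspace_of R _ (fun v : {ffun D + X -> R^o} => lin_zero A w (fun d => v (inl d)) (fun x => v (inr x))).
- have := lin_zero0 A w; set a := (X in lin_zero _ _ X _); set b := (X in lin_zero _ _ _ X -> _).
  have -> : a = (fun d => (0 : {ffun D + X -> R^o}) (inl d)) by apply/funext => d; rewrite ffunE.
  by have -> : b = (fun d => (0 : {ffun D + X -> R^o}) (inr d)) by apply/funext => d; rewrite ffunE.
- move=> hu hv; have := lin_zero_lin a hu hv.
  set e := (X in lin_zero _ _ X _); set b := (X in lin_zero _ _ _ X -> _).
  have -> : e = (fun d => (a *: u + v) (inl d)) by apply/funext => d; rewrite !ffunE.
  by have -> : b = (fun d => (a *: u + v) (inr d)) by apply/funext => d; rewrite !ffunE.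
by exists U => v; rewrite UP dG.
Qed.

Let projD : {F : 'Hom({ffun D + X -> R^o}, {ffun D -> R^o}) | forall v, F v = [ffun d => v (inl d)]}.
Proof. by apply: lin_hom => a u v; apply/ffunP => d; rewrite !ffunE. Qed.

Let projX : {F : 'Hom({ffun D + X -> R^o}, {ffun X -> R^o}) | forall v, F v = [ffun d => v (inr d)]}.
Proof. by apply: lin_hom => a u v; apply/ffunP => d; rewrite !ffunE. Qed.

(** In both alternatives the projection of the kernel to tensor space is proper: its dimension is
    too small, or a vector is lost because it moves only the variables. *)
Lemma affine_null (T : tensor R k n -> (X -> R) -> Prop) :
  (forall A w, zero_at A w -> T A w -> forall Ker : {vspace {ffun D + X -> R^o}},
    (forall v, v \in Ker <-> lin_zero A w (fun d => v (inl d)) (fun x => v (inr x))) ->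
    (\dim Ker < #|D|)%N \/ ((\dim Ker <= #|D|)%N /\
      exists2 v, v \in Ker & v != 0 /\ forall d, v (inl d) = 0)) ->
  null_set (fun A : tensor R k n => exists w, zero_at A w /\ T A w).
Proof.
move=> H; apply: null_sub (@sard_null _ _ _ n_gt0 _ _ inl G) => A [w [zw Tw]].
exists (join A w); split=> //; first exact: G0.
have [Ker KerP] := kerv A w; have [F FE] := projD.
have KP v : v \in Ker <-> lin_zero A w (fun d => v (inl d)) (fun x => v (inr x)).
  by rewrite KerP dG.
have {H}Hd := H A w zw Tw Ker KP.
exists Ker; split=> //; first by case: Hd => [/ltnW|[]].
have lt : (\dim (F @: Ker) < #|D|)%N.
  have dF := limg_ker_dim F Ker.
  case: Hd => [|[le [v vK [v0 vD]]]]; first by apply: leq_ltn_trans; rewrite -dF leq_addl.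
  have : (0 < \dim (Ker :&: lker F))%N.
    rewrite lt0n dimv_eq0; apply: contra v0 => /eqP K0.
    rewrite -memv0 -K0 memv_cap vK memv_ker FE; apply/eqP/ffunP => d.
    by rewrite !ffunE.
  by move=> K0; apply: leq_trans le; rewrite -dF -addn1 addnC leq_add2r.
have [u un0 uP] := proper_annihilator lt; exists u => // v vK.
rewrite -[RHS](uP (F v) (memv_img _ vK)).
by apply: eq_bigr => d _; rewrite FE ffunE.
Qed.

(** Above a fixed direction of the variables the admissible tensor directions form at most a
    translate of a space orthogonal to [Y], so the kernel has dimension at most
    [dim S + |D| - dim Y]. *)
Lemma affine_null1 :
  null_set (fun A : tensor R k n => exists w, zero_at A w /\
    exists (S : {vspace {ffun X -> R^o}}) (Y : {vspace {ffun D -> R^o}}),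
    [/\ forall v : {ffun X -> R^o}, (forall c, dv (C c) w v = 0) -> v \in S,
        forall v, v \in Y -> exists c : Qh -> R, forall d, v d = \sum_h c h * ev (yh h d) w &
        (\dim S < \dim Y)%N]).
Proof.
apply: affine_null => A w zw [S [Y [SP YP lt]]] Ker KerP; left.
have [F FE] := projD; have [P PE] := projX.
have dP := limg_ker_dim P Ker.
have dS : (\dim (P @: Ker) <= \dim S)%N.
  apply: dimvS; apply/subvP => _ /memv_imgP[v vK ->]; apply: SP => c.
  rewrite PE; have /KerP[/(_ c) <- _] := vK; apply: dv_ext => // x.
  by rewrite ffunE.
have dFK : \dim (F @: (Ker :&: lker P)) = \dim (Ker :&: lker P).
  apply: limg_dim_eq; apply/eqP; rewrite -subv0; apply/subvP => v.
  rewrite !memv_cap !memv_ker => /andP[/andP[_ /eqP Pv] /eqP Fv].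
  rewrite memv0; apply/eqP/ffunP => -[d|x].
    by move/ffunP/(_ d): Fv; rewrite FE !ffunE.
  by move/ffunP/(_ x): Pv; rewrite PE !ffunE.
have dY : (\dim (F @: (Ker :&: lker P)) + \dim Y <= #|D|)%N.
  rewrite -dimv_disjoint_sum; first by rewrite -(dim_ffun R) dimvS ?subvf.
  apply/eqP; rewrite -subv0; apply/subvP => x; rewrite memv_cap memv0.
  case/andP => /memv_imgP[v vK xv] /YP[c cP].
  move: vK; rewrite memv_cap memv_ker => /andP[/KerP[_ vh] /eqP Pv].
  have s0 : \sum_d (x d : R) ^+ 2 = 0.
    transitivity (\sum_h c h * \sum_d x d * ev (yh h d) w).
      under [RHS]eq_bigr => h _ do rewrite mulr_sumr.
      rewrite exchange_big /=; apply: eq_bigr => d _.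
      rewrite expr2 {2}cP mulr_sumr; apply: eq_bigr => h _; rewrite mulrCA; congr (_ * (_ * _)).
    rewrite big1 // => h _; suff -> : \sum_d x d * ev (yh h d) w = 0 by rewrite mulr0.
    have := vh h; have -> : (fun x => v (inr x)) = (fun=> 0 : R).
      by apply/funext => z; move/ffunP/(_ z): Pv; rewrite PE !ffunE.
    have [_ /(_ h)] := lin_zero0 A w; rewrite [X in X + _]big1 => [|d _]; last by rewrite mul0r.
    rewrite add0r => -> /(canRL (addrK _)); rewrite subrr => {2}<-.
    by apply: eq_bigr => d _; rewrite xv FE ffunE.
  apply/eqP/ffunP => d; rewrite ffunE; apply/eqP.
  move/eqP: s0; rewrite psumr_eq0 => [/allP x0|i _]; last exact: sqr_ge0.
  by have := x0 d (mem_index_enum _); rewrite sqrf_eq0.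
rewrite -dP; apply: leq_trans dY; rewrite dFK -addnS leq_add2l.
exact: leq_ltn_trans dS lt.
Qed.

Lemma affine_null2 :
  null_set (fun A : tensor R k n => exists w, zero_at A w /\
    (exists2 L : {vspace ({ffun D -> R^o} * {ffun X -> R^o})%type},
      forall (e : {ffun D -> R^o}) (v : {ffun X -> R^o}), lin_zero A w e v -> (e, v) \in L & (\dim L <= #|D|)%N) /\
    exists2 v : X -> R, exists x, v x != 0 & lin_zero A w (fun=> 0) v).
Proof.
apply: affine_null => A w zw [[L LP dL] [v [x vx] v0]] Ker KerP; right; split.
  have [F FE] : {F : 'Hom({ffun D + X -> R^o}, ({ffun D -> R^o} * {ffun X -> R^o})%type) |
      forall v, F v = ([ffun d => v (inl d)], [ffun d => v (inr d)])}.
    apply: lin_hom => a u u'; rewrite /GRing.scale /= /GRing.add /=.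
    by congr pair; apply/ffunP => d; rewrite !ffunE.
  apply: leq_trans dL; have <- : \dim (F @: Ker) = \dim Ker.
    apply: limg_dim_eq; apply/eqP; rewrite -subv0; apply/subvP => u.
    rewrite !memv_cap !memv_ker FE => /andP[_ /eqP[/ffunP h1 /ffunP h2]].
    rewrite memv0; apply/eqP/ffunP => -[d|z].
      by have := h1 d; rewrite !ffunE.
    by have := h2 z; rewrite !ffunE.
  apply: dimvS; apply/subvP => _ /memv_imgP[u /KerP uK ->]; rewrite FE; apply: LP.
  have -> : ([ffun d => u (inl d)] : D -> R) = (fun d => u (inl d)) by apply/funext=> d; rewrite ffunE.
  by have -> : ([ffun d => u (inr d)] : X -> R) = (fun d => u (inr d)) by apply/funext=> d; rewrite ffunE.
exists [ffun i => if i is inr z then v z else 0]; last split=> [|d]; last by rewrite ffunE.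
  apply/KerP; have <- : (fun=> 0 : R) = (fun d : D => ([ffun i => if i is inr z then v z else 0] : {ffun D + X -> R^o}) (inl d)).
    by apply/funext => d; rewrite ffunE.
  suff <- : v = (fun d : X => ([ffun i => if i is inr z then v z else 0] : {ffun D + X -> R^o}) (inr d)) by [].
  by apply/funext => d; rewrite ffunE.
by apply: contra vx => /eqP/ffunP/(_ (inr x)); rewrite !ffunE => ->.
Qed.

End AffineSystems.

(** * Rank-one tensors and the critical point system *)

Section Ffun.
Variables (R : realType) (Y : finType).
Implicit Types u v : {ffun Y -> R^o}.
Lemma addfE u v y : (u + v) y = u y + v y.
Proof. by rewrite ffunE. Qed.
Lemma oppfE u y : (- u) y = - u y.
Proof. by rewrite ffunE. Qed.
Lemma scalefE a u y : (a *: u) y = a * u y.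
Proof. by rewrite ffunE. Qed.
End Ffun.

Section RankOne.
Variables (R : realType) (k n : nat).
Local Notation D := {ffun 'I_k -> 'I_n}.
Definition cfg := 'I_k -> 'I_n -> R.
Implicit Types (c : cfg) (v : 'I_n -> R).

Definition dot v v' : R := \sum_a v a * v' a.
Definition rk1 c (I : D) : R := \prod_l c l (I l).
Definition rk c : {ffun D -> R^o} := [ffun I => rk1 c I].
Lemma rkE c I : rk c I = rk1 c I.
Proof. by rewrite ffunE. Qed.
Definition upd (T : Type) (c : 'I_k -> T) (i : 'I_k) (v : T) : 'I_k -> T :=
  fun l => if l == i then v else c l.
Definition unitv (a : 'I_n) : 'I_n -> R := fun b => (b == a)%:R.
Definition ip (A B : D -> R) : R := \sum_I A I * B I.

Lemma dotC v v' : dot v v' = dot v' v.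
Proof. by apply: eq_bigr => a _; rewrite mulrC. Qed.

Lemma dot_linl x v v' z : dot (fun a => x * v a + v' a) z = x * dot v z + dot v' z.
Proof. by rewrite /dot mulr_sumr -big_split; apply: eq_bigr => a _ /=; ring. Qed.

Lemma dot_linr x v v' z : dot z (fun a => x * v a + v' a) = x * dot z v + dot z v'.
Proof. by rewrite dotC dot_linl !(dotC z). Qed.

Lemma dot0l v : dot (fun=> 0) v = 0.
Proof. by rewrite /dot big1 // => a _; rewrite mul0r. Qed.

Lemma dot0r v : dot v (fun=> 0) = 0.
Proof. by rewrite dotC dot0l. Qed.

Lemma dot_unitl a v : dot (unitv a) v = v a.
Proof.
rewrite /dot (bigD1 a) //= big1 => [|b ba]; first by rewrite /unitv eqxx mul1r addr0.
by rewrite /unitv (negPf ba) mul0r.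
Qed.

Lemma dot_ge0 v : 0 <= dot v v.
Proof. by apply: sumr_ge0 => a _; rewrite -expr2 sqr_ge0. Qed.

Lemma dot_eq0 v : dot v v = 0 -> v =1 fun=> 0.
Proof.
move/eqP; rewrite psumr_eq0 => [/allP v0 a|a _]; last by rewrite -expr2 sqr_ge0.
by have := v0 a (mem_index_enum _); rewrite mulf_eq0 orbb => /eqP.
Qed.

Lemma upd_same (T : Type) (c : 'I_k -> T) i (v : T) : upd c i v i = v.
Proof. by rewrite /upd eqxx. Qed.

Lemma upd_other (T : Type) (c : 'I_k -> T) i (v : T) l : l != i -> upd c i v l = c l.
Proof. by rewrite /upd => /negPf->. Qed.

Lemma upd_id (T : Type) (c : 'I_k -> T) i : upd c i (c i) = c.
Proof. by apply/funext => l; rewrite /upd; case: eqP => // ->. Qed.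

Lemma upd_upd (T : Type) (c : 'I_k -> T) i (v v' : T) : upd (upd c i v) i v' = upd c i v'.
Proof. by apply/funext => l; rewrite /upd; case: eqP. Qed.

Lemma updC (T : Type) (c : 'I_k -> T) i j (v v' : T) : i != j -> upd (upd c i v) j v' = upd (upd c j v') i v.
Proof.
move=> ij; apply/funext => l; rewrite /upd.
by case: (eqVneq l j) => // ->; rewrite eq_sym (negPf ij).
Qed.

Lemma rk1_upd c i v I : rk1 (upd c i v) I = v (I i) * \prod_(l | l != i) c l (I l).
Proof.
rewrite /rk1 (bigD1 i) //= upd_same; congr (_ * _).
by apply: eq_bigr => l li; rewrite upd_other.
Qed.

Lemma rk_lin c i x v v' :
  rk (upd c i (fun a => x * v a + v' a)) = x *: rk (upd c i v) + rk (upd c i v').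
Proof. by apply/ffunP => I; rewrite !ffunE /GRing.scale /= !rk1_upd; ring. Qed.

Lemma rk_Z c i x v : rk (upd c i (fun a => x * v a)) = x *: rk (upd c i v).
Proof. by apply/ffunP => I; rewrite !ffunE /GRing.scale /= !rk1_upd; ring. Qed.

Lemma rk_0 c i : rk (upd c i (fun=> 0)) = 0.
Proof. by apply/ffunP => I; rewrite !ffunE rk1_upd mul0r. Qed.

Lemma rk_sum (J : finType) (P : pred J) c i (F : J -> 'I_n -> R) :
  rk (upd c i (fun a => \sum_(j | P j) F j a)) = \sum_(j | P j) rk (upd c i (F j)).
Proof.
apply/ffunP => I; rewrite sum_ffunE ffunE rk1_upd mulr_suml.
by apply: eq_bigr => j _; rewrite ffunE rk1_upd.
Qed.

Lemma rk_expand c i v : rk (upd c i v) = \sum_a v a *: rk (upd c i (unitv a)).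
Proof.
apply/ffunP => I; rewrite sum_ffunE ffunE rk1_upd (bigD1 (I i)) //= [X in _ = _ + X]big1 => [|a aI].
  by rewrite !ffunE rk1_upd /unitv eqxx mul1r addr0.
by rewrite !ffunE rk1_upd /unitv eq_sym (negPf aI) mul0r scaler0.
Qed.

Lemma ip_rk c d : ip (rk c) (rk d) = \prod_l dot (c l) (d l).
Proof.
rewrite /ip /dot bigA_distr_bigA /=; apply: eq_bigr => I _.
by rewrite !ffunE /rk1 -big_split.
Qed.

Lemma ip_linl A B x (Z : {ffun D -> R^o}) : ip (x *: (A : {ffun D -> R^o}) + B) Z = x * ip A Z + ip B Z.
Proof.
by rewrite /ip mulr_sumr -big_split; apply: eq_bigr => I _; rewrite !ffunE /GRing.scale /=; ring.
Qed.

Lemma ip_Zl x (A Z : {ffun D -> R^o}) : ip (x *: A) Z = x * ip A Z.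
Proof. by rewrite /ip mulr_sumr; apply: eq_bigr => I _; rewrite !ffunE /GRing.scale /= mulrA. Qed.

Lemma ip_Zr x (A : D -> R) (Z : {ffun D -> R^o}) : ip A (x *: Z) = x * ip A Z.
Proof. by rewrite /ip mulr_sumr; apply: eq_bigr => I _; rewrite !ffunE /GRing.scale /= mulrCA. Qed.

Lemma ip_suml (J : finType) (P : pred J) (F : J -> {ffun D -> R^o}) Z :
  ip (\sum_(j | P j) F j) Z = \sum_(j | P j) ip (F j) Z.
Proof.
rewrite /ip exchange_big /=; apply: eq_bigr => I _.
by rewrite sum_ffunE mulr_suml.
Qed.

Lemma ip_sumr (J : finType) (P : pred J) (F : J -> {ffun D -> R^o}) (Z : D -> R) :
  ip Z (\sum_(j | P j) F j) = \sum_(j | P j) ip Z (F j).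
Proof.
rewrite /ip exchange_big /=; apply: eq_bigr => I _.
by rewrite sum_ffunE mulr_sumr.
Qed.

Lemma ip_0l (Z : {ffun D -> R^o}) : ip (0 : {ffun D -> R^o}) Z = 0.
Proof. by rewrite /ip big1 // => I _; rewrite ffunE mul0r. Qed.

Lemma ip_rk_upd c d i v : ip (rk (upd c i v)) (rk d) = dot v (d i) * \prod_(l | l != i) dot (c l) (d l).
Proof.
rewrite ip_rk (bigD1 i) //= upd_same; congr (_ * _).
by apply: eq_bigr => l li; rewrite upd_other.
Qed.

Lemma ip_rk_zero c d i : dot (c i) (d i) = 0 -> ip (rk c) (rk d) = 0.
Proof. by move=> h; rewrite ip_rk (bigD1 i) //= h mul0r. Qed.

Definition rkP (X : Type) (c : 'I_k -> 'I_n -> pexpr R X) (I : D) : pexpr R X :=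
  pprod predT (fun l => c l (I l)).

Lemma ev_rkP X (c : 'I_k -> 'I_n -> pexpr R X) I w :
  ev (rkP c I) w = rk1 (fun l a => ev (c l a) w) I.
Proof. by rewrite ev_pprod. Qed.

Lemma dv_rkP X (c : 'I_k -> 'I_n -> pexpr R X) I w (v : X -> R) :
  dv (rkP c I) w v = \sum_i rk1 (upd (fun l a => ev (c l a) w) i (fun a => dv (c i a) w v)) I.
Proof. by rewrite dv_pprod; apply: eq_bigr => i _; rewrite rk1_upd. Qed.

End RankOne.

Section KKTSystem.
Variables (R : realType) (k n t s : nat).
Local Notation D := {ffun 'I_k -> 'I_n}.

(* The variable [inl (i, a, j)] is entry (a, j) of the factor of mode i; [inr j] is lambda_j. *)
Definition vars : finType := ('I_k * 'I_n * 'I_t + 'I_t)%type.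
Local Notation X := vars.
Implicit Types (x tau xi : X -> R).

Definition ucol x (j : 'I_t) : cfg R k n := fun i a => x (inl (i, a, j)).
Definition ups x (j : 'I_t) : R := x (inr j).

Definition pU (i : 'I_k) (a : 'I_n) (j : 'I_t) : pexpr R X := PX (inl (i, a, j) : X).
Definition pv (j : 'I_t) : pexpr R X := PX (inr j : X).
Definition pcol (j : 'I_t) : 'I_k -> 'I_n -> pexpr R X := fun i a => pU i a j.
Definition pe (a : 'I_n) : 'I_n -> pexpr R X := fun b => PC (unitv R a b).

Definition con_ix : finType := ('I_k * 'I_t * 'I_t)%type.
Definition active (i : 'I_k) (j j' : 'I_t) := (i < s)%N || (j == j').
Definition conP (q : con_ix) : pexpr R X :=
  let: (i, j, j') := q in
  if active i j j' then
    PA (psum predT (fun a => PM (pU i a j) (pU i a j'))) (PC (- (j == j')%:R))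
  else PC 0.

(* Critical point equations, affine in the tensor: the value lambda_j of column j; the power equation
   taui = lambda_j u_j of a unit mode; symmetry of V Lambda U^T for an orthonormal mode. *)
Definition kkt_ix : finType := ('I_t + ('I_k * 'I_n * 'I_t) + ('I_k * 'I_n * 'I_n))%type.
Definition yP (h : kkt_ix) (I : D) : pexpr R X :=
  match h with
  | inl (inl j) => rkP (pcol j) I
  | inl (inr (i, a, j)) => if (i < s)%N then PC 0 else rkP (upd (pcol j) i (pe a)) I
  | inr (i, a, b) => if (i < s)%N then
      psum predT (fun j => PM (pv j) (PA (PM (pU i b j) (rkP (upd (pcol j) i (pe a)) I))
         (PM (PM (PC (-1)) (pU i a j)) (rkP (upd (pcol j) i (pe b)) I))))
      else PC 0
  end.
Definition kapP (h : kkt_ix) : pexpr R X :=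
  match h with
  | inl (inl j) => pv j
  | inl (inr (i, a, j)) => if (i < s)%N then PC 0 else PM (pv j) (pU i a j)
  | inr _ => PC 0
  end.

Definition tangent x tau : Prop := forall i j j', active i j j' ->
  dot (ucol tau j i) (ucol x j' i) + dot (ucol x j i) (ucol tau j' i) = 0.

Definition feas x : Prop := forall i j j', active i j j' ->
  dot (ucol x j i) (ucol x j' i) = (j == j')%:R.

Lemma feasP x : (forall q, ev (conP q) x = 0) <-> feas x.
Proof.
split=> [H i j j' ac|H [[i j] j']].
  have := H (i, j, j'); rewrite /= ac /= ev_psum /= => /eqP; rewrite subr_eq0 => /eqP <-.
  by [].
rewrite /=; case: ifP => //= /H; rewrite ev_psum /= => E.
by rewrite [X in X - _](_ : _ = (j == j')%:R) ?subrr // -E.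
Qed.

Lemma tangentP x tau : (forall q, dv (conP q) x tau = 0) <-> tangent x tau.
Proof.
have E i j j' : active i j j' -> dv (conP (i, j, j')) x tau =
    dot (ucol tau j i) (ucol x j' i) + dot (ucol x j i) (ucol tau j' i).
  by move=> /= ->; rewrite /= dv_psum addr0 /= big_split.
split=> [H i j j' ac|H [[i j] j']]; first by rewrite -E.
by have [ac|ac] := boolP (active i j j'); [rewrite E ?H|rewrite /= (negPf ac)].
Qed.

(** Derivative at [x], in the direction [tau], of the parametrization that sends [x] to the sum of
    the [ups x j *: rk (ucol x j)]. *)
Definition dPhi x tau : {ffun D -> R^o} :=
  \sum_j (ups tau j *: rk (ucol x j) + ups x j *: \sum_i rk (upd (ucol x j) i (ucol tau j i))).

Lemma ucol_lin a tau xi j i : ucol (fun z => a * tau z + xi z) j i = fun b => a * ucol tau j i b + ucol xi j i b.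
Proof. by []. Qed.

Lemma tangent_lin x a tau xi : tangent x tau -> tangent x xi -> tangent x (fun z => a * tau z + xi z).
Proof.
move=> h1 h2 i j j' ac; rewrite !ucol_lin dot_linl dot_linr addrACA -mulrDr.
by rewrite h1 // h2 // mulr0 addr0.
Qed.

Lemma tangent0 x : tangent x (fun=> 0).
Proof. by move=> i j j' _; rewrite dot0l dot0r addr0. Qed.

Lemma dPhi_lin x a tau xi : dPhi x (fun z => a * tau z + xi z) = a *: dPhi x tau + dPhi x xi.
Proof.
rewrite /dPhi scaler_sumr -big_split; apply: eq_bigr => j _ /=.
under eq_bigr => i _ do rewrite ucol_lin rk_lin.
rewrite big_split -scaler_sumr /= /ups scalerDl !scalerDr !scalerA addrACA.
by rewrite (mulrC a (x _)).
Qed.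

Lemma ffun_lin (Y : finType) a (u v : {ffun Y -> R^o}) : ((a *: u + v) : Y -> R) = fun z => a * u z + v z.
Proof. by apply/funext => z; rewrite !ffunE. Qed.

Lemma ffun_0 (Y : finType) : ((0 : {ffun Y -> R^o}) : Y -> R) = fun=> 0.
Proof. by apply/funext => z; rewrite !ffunE. Qed.

Lemma tangent_vspace x : {T : {vspace {ffun X -> R^o}} | forall v, v \in T <-> tangent x v}.
Proof.
apply: vspace_of => [|a u v hu hv]; first by rewrite ffun_0; exact: tangent0.
by rewrite ffun_lin; exact: tangent_lin.
Qed.

Definition Tan x := projT1 (tangent_vspace x).
Lemma TanP x v : v \in Tan x <-> tangent x v.
Proof. exact: (projT2 (tangent_vspace x)). Qed.

Lemma dPhi_hom x : {F : 'Hom({ffun X -> R^o}, {ffun D -> R^o}) | forall v, F v = dPhi x v}.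
Proof. by apply: lin_hom => a u v; rewrite ffun_lin dPhi_lin. Qed.
Definition dPhiH x := projT1 (dPhi_hom x).
Lemma dPhiHE x v : dPhiH x v = dPhi x v.
Proof. exact: (projT2 (dPhi_hom x)). Qed.

Definition Kern x := (Tan x :&: lker (dPhiH x))%VS.
Lemma KernP x v : v \in Kern x <-> tangent x v /\ dPhi x v = 0.
Proof.
rewrite memv_cap memv_ker dPhiHE; split=> [/andP[/TanP ? /eqP]|[/TanP-> ->]] //.
by rewrite eqxx.
Qed.

(* A skew matrix with [rot i *m U_i = xi_i] for a tangent direction [xi] of the Stiefel factor [i]. *)
Definition rot x xi (i : 'I_k) (a b : 'I_n) : R :=
  \sum_j (ucol xi j i a * ucol x j i b - ucol x j i a * ucol xi j i b)
  - \sum_j \sum_l ucol x j i a * dot (ucol x j i) (ucol xi l i) * ucol x l i b.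

(** Weights with which the coefficient tensors [yP] add up to [dPhi x xi]. The factor 1/2
    compensates that the symmetry equations of an orthonormal mode are indexed by ordered pairs. *)
Definition coefF x xi (h : kkt_ix) : R :=
  match h with
  | inl (inl j) => ups xi j
  | inl (inr (i, a, j)) => if (i < s)%N then 0 else ups x j * ucol xi j i a
  | inr (i, a, b) => if (i < s)%N then 2^-1 * rot x xi i a b else 0
  end.

Lemma rot_skew x xi (i : 'I_k) a b : tangent x xi -> (i < s)%N -> rot x xi i b a = - rot x xi i a b.
Proof.
move=> tx si; rewrite /rot opprB [LHS]addrC; congr (_ + _); last first.
  by rewrite -sumrN; apply: eq_bigr => j _; ring.
rewrite [X in _ = X]exchange_big -sumrN; apply: eq_bigr => j _.
rewrite -sumrN; apply: eq_bigr => l _.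
have /(_ l j) := tx i; rewrite /active si => /(_ isT).
by rewrite dotC => /eqP; rewrite addr_eq0 => /eqP ->; ring.
Qed.

Lemma rot_mul x xi (i : 'I_k) a m : feas x -> tangent x xi -> (i < s)%N ->
  \sum_b rot x xi i a b * ucol x m i b = ucol xi m i a.
Proof.
move=> fx tx si; rewrite /rot.
have ort j l : dot (ucol x j i) (ucol x l i) = (j == l)%:R by apply: fx; rewrite /active si.
under eq_bigr => b _ do rewrite mulrBl !mulr_suml.
rewrite sumrB.
have -> : \sum_b \sum_j (ucol xi j i a * ucol x j i b - ucol x j i a * ucol xi j i b) * ucol x m i b =
   ucol xi m i a - \sum_j ucol x j i a * dot (ucol x m i) (ucol xi j i).
  rewrite exchange_big /=.
  under eq_bigr => j _ do under eq_bigr => b _ do rewrite mulrBl -!mulrA.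
  under eq_bigr => j _ do rewrite sumrB -!mulr_sumr -/(dot _ _) -/(dot _ _) ort.
  rewrite sumrB; congr (_ - _); last by apply: eq_bigr => j _; rewrite dotC.
  rewrite (bigD1 m) //= big1 => [|j jm]; first by rewrite eqxx mulr1 addr0.
  by rewrite (negPf jm) mulr0.
have -> : \sum_b \sum_j (\sum_l ucol x j i a * dot (ucol x j i) (ucol xi l i) * ucol x l i b) * ucol x m i b =
   \sum_j ucol x j i a * dot (ucol x j i) (ucol xi m i).
  rewrite exchange_big /=; apply: eq_bigr => j _.
  under eq_bigr => b _ do rewrite mulr_suml.
  rewrite exchange_big /=.
  under eq_bigr => l _ do under eq_bigr => b _ do rewrite -!mulrA.
  under eq_bigr => l _ do rewrite -!mulr_sumr -/(dot _ _) ort.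
  rewrite (bigD1 m) //= big1 => [|l lm]; first by rewrite eqxx mulr1 addr0.
  by rewrite (negPf lm) !mulr0.
rewrite -addrA -opprD -big_split /= big1 ?subr0 // => j _.
rewrite -mulrDr; suff -> : dot (ucol x m i) (ucol xi j i) + dot (ucol x j i) (ucol xi m i) = 0 by rewrite mulr0.
by rewrite dotC; apply: tx; rewrite /active si.
Qed.

Lemma ev_yP x h I : ev (yP h I) x =
  match h with
  | inl (inl j) => rk1 (ucol x j) I
  | inl (inr (i, a, j)) => if (i < s)%N then 0 else rk1 (upd (ucol x j) i (unitv R a)) I
  | inr (i, a, b) => if (i < s)%N then
      \sum_j ups x j * (ucol x j i b * rk1 (upd (ucol x j) i (unitv R a)) I
         - ucol x j i a * rk1 (upd (ucol x j) i (unitv R b)) I)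
      else 0
  end.
Proof.
have E j i a : (fun l b => ev (upd (pcol j) i (pe a) l b) x) = upd (ucol x j) i (unitv R a).
  by apply/funext => l; rewrite /upd; case: eqP.
case: h => [[j|[[i a] j]]|[[i a] b]] /=; first exact: ev_rkP.
  by case: ifP => // _; rewrite ev_rkP E.
case: ifP => // _; rewrite ev_psum; apply: eq_bigr => j _ /=.
by rewrite !ev_rkP !E mulN1r mulNr.
Qed.

Lemma sum_kkt_ix (F : kkt_ix -> R) : \sum_h F h =
  \sum_j F (inl (inl j)) + \sum_i \sum_a \sum_j F (inl (inr (i, a, j))) +
  \sum_i \sum_a \sum_b F (inr (i, a, b)).
Proof.
by rewrite !big_sumType /=; congr (_ + _ + _); rewrite pair_bigA /= pair_bigA /=; apply: eq_bigr => -[[]].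
Qed.

(** In an orthonormal mode a tangent direction is [rot *m U], so its contribution pairs the entries
    of [rot] with tensors that the skewness of [rot] allows to antisymmetrize; the result is a
    combination of the coefficient tensors of the symmetry equations. *)
Lemma dPhi_span x xi I : feas x -> tangent x xi ->
  dPhi x xi I = \sum_h coefF x xi h * ev (yP h I) x.
Proof.
move=> fx tx; rewrite sum_kkt_ix.
under [X in X + _ + _]eq_bigr => j _ do rewrite ev_yP /=.
under [X in _ + X + _]eq_bigr => i _ do under eq_bigr => a _ do under eq_bigr => j _ do rewrite ev_yP /=.
under [X in _ + X]eq_bigr => i _ do under eq_bigr => a _ do under eq_bigr => j _ do rewrite ev_yP /=.
rewrite /dPhi sum_ffunE /=.
under [LHS]eq_bigr => j _ do rewrite addfE !scalefE sum_ffunE mulr_sumr rkE.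
rewrite big_split /= -addrA; congr (_ + _); rewrite exchange_big -big_split /=.
apply: eq_bigr => i _.
under eq_bigr => j _ do rewrite rk_expand sum_ffunE.
have [si|si] := boolP (i < s)%N; last first.
  rewrite [X in _ + X]big1 ?addr0 => [|a _]; last by rewrite big1 // => b _; rewrite mul0r.
  rewrite exchange_big /=; apply: eq_bigr => j _.
  by rewrite mulr_sumr; apply: eq_bigr => a _; rewrite !ffunE /GRing.scale /= mulrA.
rewrite [X in _ = X + _]big1 ?add0r => [|a _]; last by rewrite big1 // => b _; rewrite mul0r.
pose T a b := \sum_j ups x j * (ucol x j i b * rk1 (upd (ucol x j) i (unitv R a)) I).
transitivity (\sum_a \sum_b rot x xi i a b * T a b).
  under [RHS]eq_bigr => a _ do under eq_bigr => b _ do rewrite /T mulr_sumr.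
  under [RHS]eq_bigr => a _ do rewrite exchange_big /=.
  rewrite [RHS]exchange_big /=; apply: eq_bigr => j _.
  rewrite mulr_sumr; apply: eq_bigr => a _; rewrite !ffunE /GRing.scale /=.
  rewrite -(rot_mul a j fx tx si) mulr_suml mulr_sumr; apply: eq_bigr => b _; ring.
have E : \sum_a \sum_b rot x xi i a b * T b a = - \sum_a \sum_b rot x xi i a b * T a b.
  rewrite exchange_big /= -sumrN; apply: eq_bigr => a _; rewrite -sumrN.
  by apply: eq_bigr => b _; rewrite (rot_skew a b tx si) mulNr.
transitivity (2^-1 * (\sum_a \sum_b rot x xi i a b * T a b - \sum_a \sum_b rot x xi i a b * T b a)).
  by rewrite E; field.
rewrite -sumrB mulr_sumr; apply: eq_bigr => a _; rewrite -sumrB mulr_sumr.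
apply: eq_bigr => b _; rewrite /T -mulrBr -mulrA; congr (_ * (_ * _)).
by rewrite -sumrB; apply: eq_bigr => j _; rewrite mulrBr.
Qed.

Lemma coefF_lin x a tau xi h : coefF x (fun z => a * tau z + xi z) h = a * coefF x tau h + coefF x xi h.
Proof.
case: h => [[j|[[i c] j]]|[[i c] b]] //=.
  case: ifP => _; first by rewrite mulr0 addr0.
  by rewrite /ucol; ring.
case: ifP => _; last by rewrite mulr0 addr0.
rewrite /rot; under eq_bigr => j _ do rewrite !ucol_lin.
under [X in _ - X]eq_bigr => j _ do under eq_bigr => l _ do rewrite ucol_lin dot_linr.
rewrite mulrCA -mulrDr; congr (_ * _); rewrite mulrBr addrACA -opprD; congr (_ - _).
  by rewrite mulr_sumr -big_split; apply: eq_bigr => j _ /=; ring.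
rewrite mulr_sumr -big_split; apply: eq_bigr => j _ /=.
by rewrite mulr_sumr -big_split; apply: eq_bigr => l _ /=; ring.
Qed.

(** Derivative of the critical point equations in the variables, in the direction [tau], paired with
    the weights of [xi]. When [dPhi x xi = 0], its vanishing for all tangent [tau] is the
    obstruction that the dimension count meets. *)
Definition bform (A : tensor R k n) x tau xi : R :=
  \sum_h coefF x xi h * (\sum_I A I * dv (yP h I) x tau - dv (kapP h) x tau).

Definition kkt_at (A : tensor R k n) x : Prop := zero_at conP yP kapP A x.

Lemma kkt_feas A x : kkt_at A x -> feas x.
Proof. by move=> [/feasP]. Qed.

Hypothesis n_gt0 : (0 < n)%N.

(** The linearized equations, paired with the weights of [xi], form a bilinear form between pairs of
    a tensor direction and a tangent direction on one side, and tangent directions [xi] on the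
    other. By hypothesis its right radical is zero; by [rank_duality] the left one, which contains
    the kernel, has at most the dimension of tensor space. *)
Lemma null_regular : null_set (fun A : tensor R k n => exists x, kkt_at A x /\
  (exists2 v : X -> R, exists z, v z != 0 & lin_zero conP yP kapP A x (fun=> 0) v) /\
  (forall xi, tangent x xi -> dPhi x xi = 0 -> (forall tau, tangent x tau -> bform A x tau xi = 0) ->
    forall z, xi z = 0)).
Proof.
apply: null_sub (affine_null2 n_gt0 conP yP kapP) => A [x [kx [sing inj]]].
exists x; split=> //; split=> //.
have fx := kkt_feas kx.
pose b (u : {ffun D -> R^o} * {ffun X -> R^o}) (xi : {ffun X -> R^o}) : R :=
  \sum_h coefF x xi h * (\sum_I u.1 I * ev (yP h I) x + \sum_I A I * dv (yP h I) x u.2 - dv (kapP h) x u.2).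
have bl a u v w : b (a *: u + v) w = a * b u w + b v w.
  rewrite /b mulr_sumr -big_split; apply: eq_bigr => h _ /=.
  rewrite mulrCA -mulrDr; congr (_ * _).
  have -> : \sum_I (a *: u + v).1 I * ev (yP h I) x = a * \sum_I u.1 I * ev (yP h I) x + \sum_I v.1 I * ev (yP h I) x.
    by rewrite mulr_sumr -big_split; apply: eq_bigr => I _; rewrite /= addfE scalefE; ring.
  have -> : \sum_I A I * dv (yP h I) x (a *: u + v).2 =
      a * \sum_I A I * dv (yP h I) x u.2 + \sum_I A I * dv (yP h I) x v.2.
    by rewrite mulr_sumr -big_split; apply: eq_bigr => I _; rewrite /= ffun_lin dv_lin; ring.
  by rewrite /= ffun_lin dv_lin; ring.
have br a u v w : b w (a *: u + v) = a * b w u + b w v.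
  rewrite /b mulr_sumr -big_split; apply: eq_bigr => h _ /=.
  by rewrite ffun_lin coefF_lin; ring.
have [|a [u1 u2] [v1 v2]|U1 U1P] := @vspace_of R ({ffun D -> R^o} * {ffun X -> R^o})%type (fun p => tangent x p.2).
- by rewrite /= ffun_0; exact: tangent0.
- by rewrite /= ffun_lin => hu hv; exact: tangent_lin.
have [|a u v|L LP] := @vspace_of R ({ffun D -> R^o} * {ffun X -> R^o})%type
   (fun p => tangent x p.2 /\ forall xi : {ffun X -> R^o}, xi \in Tan x -> b p xi = 0).
- split=> [|xi _]; first by rewrite /= ffun_0; exact: tangent0.
  by have := bl (-1) 0 0 xi; rewrite scaler0 addr0 mulN1r addNr.
- move=> [hu bu] [hv bv]; split=> [|xi xiT]; last by rewrite bl bu // bv // mulr0 addr0.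
  by rewrite /= ffun_lin; exact: tangent_lin.
exists L.
  move=> e v [c0 h0]; apply/LP; split=> /=; first exact/tangentP.
  move=> xi _; rewrite /b big1 // => h _ /=; have := h0 h => /= ->.
  by rewrite subrr mulr0.
have := @rank_duality R _ _ b U1 L (Tan x) 0%VS bl br.
have dU : (\dim U1 <= #|D| + \dim (Tan x))%N.
  have [F FE] : {F : 'Hom(({ffun D -> R^o} * {ffun X -> R^o})%type, {ffun X -> R^o}) | forall v, F v = v.2}.
    exact: lin_hom.
  have [E EE] : {F : 'Hom(({ffun D -> R^o} * {ffun X -> R^o})%type, {ffun D -> R^o}) | forall v, F v = v.1}.
    exact: lin_hom.
  rewrite -(limg_ker_dim F U1); apply: leq_add.
    have <- : \dim (E @: (U1 :&: lker F)) = \dim (U1 :&: lker F).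
      apply: limg_dim_eq; apply/eqP; rewrite -subv0; apply/subvP => -[u1 u2].
      rewrite !memv_cap !memv_ker FE EE /= => /andP[/andP[_ /eqP->] /eqP->].
      by rewrite mem0v.
    by rewrite -(dim_ffun R) dimvS ?subvf.
  apply: dimvS; apply/subvP => _ /memv_imgP[u /U1P uU ->]; rewrite FE; exact/TanP.
rewrite dimv0 addn0 => H.
have {H} : (\dim L + \dim (Tan x) <= \dim U1)%N.
  apply: H => [u /LP[tu bu]|xi /TanP txi h]; first by split=> //; exact/U1P.
  rewrite memv0; apply/eqP/ffunP => z; rewrite ffunE; apply: (inj xi) => //.
    apply/ffunP => I; rewrite (dPhi_span I fx txi) ffunE.
    pose uI : {ffun D -> R^o} * {ffun X -> R^o} := ([ffun J => (J == I)%:R], 0).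
    rewrite -[RHS](h uI); last by apply/U1P; rewrite /= ffun_0; exact: tangent0.
    apply: eq_bigr => g _; congr (_ * _) => /=.
    have [/= _ /(_ g) E0] := lin_zero0 conP yP kapP A x.
    rewrite -addrA ffun_0; have -> : \sum_J A J * dv (yP g J) x (fun=> 0) - dv (kapP g) x (fun=> 0) = 0.
      move: E0; rewrite [X in X + _]big1 ?add0r => [->|J _]; last by rewrite mul0r.
      by rewrite subrr.
    rewrite addr0 (bigD1 I) //= big1 => [|J JI]; first by rewrite ffunE eqxx mul1r addr0.
    by rewrite ffunE (negPf JI) mul0r.
  move=> tau ttau; pose u : {ffun D -> R^o} * {ffun X -> R^o} := (0, [ffun z => tau z]).
  have ft : ([ffun z => tau z] : X -> R) = tau by apply/funext => y; rewrite ffunE.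
  rewrite -[RHS](h u); last by apply/U1P; rewrite /= ft.
  rewrite /bform /b; apply: eq_bigr => g _ /=; rewrite ft.
  rewrite [X in _ = _ * (X + _ - _)]big1 ?add0r // => I _.
  by rewrite ffunE mul0r.
by move=> /leq_trans/(_ dU); rewrite leq_add2r.
Qed.

End KKTSystem.

(** * Strata, and test tensors for the kernel of the parametrization *)

Section Stratum.
Variables (R : realType) (k n t s : nat).
Hypothesis n_gt0 : (0 < n)%N.
Local Notation D := {ffun 'I_k -> 'I_n}.
Local Notation X := (vars k n t).
Local Notation kkt_at := (@kkt_at R k n t s).
Local Notation Tan := (@Tan R k n t s).
Local Notation Kern := (@Kern R k n t s).
Local Notation tangent := (@tangent R k n t s).

Section Skeleton.
Variables (Aux Qa Qe : finType) (Ca : Qa -> pexpr R (X + Aux)%type)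
  (yE : Qe -> D -> pexpr R (X + Aux)%type) (kE : Qe -> pexpr R (X + Aux)%type).

Definition xpart (w : X + Aux -> R) : X -> R := fun z => w (inl z).

(* A stratum is cut out by auxiliary equations [Ca] (tensor-free) and [yE], [kE] (affine in the tensor).
   Along the tangent directions in [Z] the equations [Ca] have at most an [m]-dimensional kernel, and [Z']
   consists of new conditions on the tensor; the last inequality makes the stratum too thin to be generic. *)
Lemma null_stratum :
  null_set (fun A : tensor R k n => exists w : X + Aux -> R,
  [/\ kkt_at A (xpart w), forall q, ev (Ca q) w = 0,
    forall h, \sum_I A I * ev (yE h I) w = ev (kE h) w &
    exists (Z : {vspace {ffun X -> R^o}}) (Z' : {vspace {ffun D -> R^o}}) (m : nat),
    [/\ (Z <= Tan (xpart w))%VS, (Z' :&: dPhiH (xpart w) @: Tan (xpart w) = 0)%VS,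
      forall v, v \in Z' -> exists c : Qe -> R, forall I, v I = \sum_h c h * ev (yE h I) w,
      forall U : {vspace {ffun X + Aux -> R^o}},
        (forall v, v \in U -> (forall q, dv (Ca q) w v = 0) /\
            exists2 tau, tau \in Z & forall z, v (inl z) = tau z) -> (\dim U <= m)%N &
      (m + \dim (Kern (xpart w)) < \dim Z + \dim Z')%N]]).
Proof.
pose C (q : con_ix k t + Qa) : pexpr R (X + Aux) :=
  match q with inl q => prename inl (conP R n s q) | inr q => Ca q end.
pose y (h : kkt_ix k n t + Qe) I : pexpr R (X + Aux) :=
  match h with inl h => prename inl (yP R s h I) | inr h => yE h I end.
pose ka (h : kkt_ix k n t + Qe) : pexpr R (X + Aux) :=
  match h with inl h => prename inl (kapP R s h) | inr h => kE h end.
apply: null_sub (affine_null1 n_gt0 C y ka) => A [w [kx Cw yw [Z [Z' [m [ZT Z0 Z's Zm lt]]]]]].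
set x := xpart w in kx ZT Z0 lt *.
exists w; split.
  split=> [[q|q]|[h|h]] /=; rewrite ?ev_prename; [exact: kx.1|exact: Cw| |exact: yw].
  by rewrite -[RHS](kx.2 h); apply: eq_bigr => I _; rewrite ev_prename.
have fx := kkt_feas kx.
have [|a u v|S SP] := @vspace_of R _ (fun v : {ffun X + Aux -> R^o} => forall q, dv (C q) w v = 0).
- move=> q; rewrite ffun_0; have [h _] := lin_zero0 C y ka A w; exact: h.
- by move=> hu hv q; rewrite ffun_lin dv_lin hu hv mulr0 addr0.
have [p pE] : {F : 'Hom({ffun X + Aux -> R^o}, {ffun X -> R^o}) | forall v, F v = [ffun z => v (inl z)]}.
  by apply: lin_hom => a u v; apply/ffunP => z; rewrite !ffunE.
have pS v : v \in S -> p v \in Tan x.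
  move=> /SP h; apply/TanP/tangentP => q; have := h (inl q); rewrite /= dv_prename => <-.
  by apply: dv_ext => // z; rewrite pE ffunE.
exists S, (dPhiH x @: Tan x + Z')%VS; split.
- by move=> v h; apply/SP.
- move=> v /memv_addP[_ /memv_imgP[xi /TanP txi ->] [v2 /Z's[c cP] ->]].
  exists (fun h => match h with inl h => coefF s x xi h | inr h => c h end) => I.
  rewrite big_sumType /= addfE cP dPhiHE (dPhi_span I fx txi); congr (_ + _).
  by apply: eq_bigr => h _; rewrite ev_prename.
(* [U] is the part of the solution space [S] lying over [Z], of dimension at most [m]. Hence
   [dim S + dim Z <= dim (Tan x) + m], to be compared with [dim (Tan x) - dim (Kern x) + dim Z'],
   the dimension of the span of coefficient tensors found above. *)
have [|a u v|U UP] := @vspace_of R _ (fun v : {ffun X + Aux -> R^o} => v \in S /\ p v \in Z).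
- by rewrite linear0 !mem0v.
- by move=> [u1 u2] [v1 v2]; rewrite linearP; split; apply: memvD => //; apply: memvZ.
have dU : (\dim U <= m)%N.
  apply: Zm => v /UP[/SP vS pZ]; split=> [q|]; first exact: (vS (inr q)).
  by exists (p v) => // z; rewrite pE ffunE.
have dS := limg_ker_dim p S; have dUp := limg_ker_dim p U.
have Ek : (S :&: lker p = U :&: lker p)%VS.
  apply/vspaceP => v; rewrite !memv_cap memv_ker; apply/andP/andP => -[h1 h2]; split=> //.
    by apply/UP; rewrite (eqP h2) mem0v.
  by have /UP[] := h1.
have Ei : (p @: S :&: Z <= p @: U)%VS.
  apply/subvP => z; rewrite memv_cap => /andP[/memv_imgP[v vS ->] pZ].
  by apply: memv_img; apply/UP.
have dsum := dimv_sum_cap (p @: S) Z.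
have dT : (\dim (p @: S + Z) <= \dim (Tan x))%N.
  apply: dimvS; rewrite subv_add ZT andbT; apply/subvP => _ /memv_imgP[v vS ->]; exact: pS.
have dPi := limg_ker_dim (dPhiH x) (Tan x).
rewrite addvC dimv_disjoint_sum //.
have := dimvS Ei; move: dS dUp dsum dT dPi lt dU; rewrite Ek -/(Kern x).
have ar (kk a b c d e f g T0 K0 P0 Z1 : nat) : (kk + a = b -> kk + c = d -> e + f = a + g ->
  e <= T0 -> K0 + P0 = T0 -> m + K0 < g + Z1 -> d <= m -> f <= c -> b < Z1 + P0)%N by lia.
exact: ar.
Qed.

End Skeleton.

Section Kernel.
Variable x : X -> R.
Hypothesis fx : feas s x.
Hypothesis ups0 : forall j, ups x j != 0.
Local Notation u := (ucol x).

Lemma unit_col j i : dot (u j i) (u j i) = 1.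
Proof. by rewrite (fx (i := i) (j := j) (j' := j)) ?eqxx // /active eqxx orbT. Qed.

Lemma orth_col j l (i : 'I_k) : (i < s)%N -> dot (u j i) (u l i) = (j == l)%:R.
Proof. by move=> si; rewrite fx // /active si. Qed.

Lemma tangent_self xi j i : tangent x xi -> dot (ucol xi j i) (u j i) = 0.
Proof.
move=> /(_ i j j); rewrite /active eqxx orbT => /(_ isT).
rewrite [dot (ucol x j i) _]dotC -mulr2n -mulr_natl => /eqP.
by rewrite mulf_eq0 pnatr_eq0 => /eqP.
Qed.

Lemma tangent_skew xi j l (i : 'I_k) : (i < s)%N -> tangent x xi ->
  dot (u l i) (ucol xi j i) = - dot (u j i) (ucol xi l i).
Proof.
move=> si /(_ i j l); rewrite /active si => /(_ isT).
by rewrite dotC => /eqP; rewrite addr_eq0 => /eqP.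
Qed.

Lemma ip_dPhi xi (d : cfg R k n) : ip (dPhi x xi) (rk d) =
  \sum_j (ups xi j * \prod_l dot (u j l) (d l) +
    ups x j * \sum_i dot (ucol xi j i) (d i) * \prod_(l | l != i) dot (u j l) (d l)).
Proof.
rewrite /dPhi ip_suml; apply: eq_bigr => j _.
rewrite ip_linl ip_rk ip_Zl ip_suml; congr (_ + _ * _).
by apply: eq_bigr => i _; rewrite ip_rk_upd.
Qed.

Lemma prod_zero (d : cfg R k n) j (i : 'I_k) (P : pred 'I_k) : P i -> dot (u j i) (d i) = 0 ->
  \prod_(l | P l) dot (u j l) (d l) = 0.
Proof. by move=> Pi h; rewrite (bigD1 i) //= h mul0r. Qed.

Lemma kern_zero (z0 : 'I_k) xi : (z0 < s)%N -> tangent x xi -> dPhi x xi = 0 ->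
  (forall j a, ucol xi j z0 a = 0) -> forall z, xi z = 0.
Proof.
move=> z0s tx dx xi0.
have test l (d : cfg R k n) : d z0 = u l z0 ->
    ups xi l * \prod_i dot (u l i) (d i) +
    ups x l * \sum_i dot (ucol xi l i) (d i) * \prod_(i' | i' != i) dot (u l i') (d i') = 0.
  move=> dl; have := ip_dPhi xi d; rewrite dx ip_0l (bigD1 l) //= [X in _ = _ + X]big1 ?addr0 => [/esym//|j jl].
  have d0 : dot (u j z0) (d z0) = 0 by rewrite dl orth_col // (negPf jl).
  rewrite (prod_zero (i := z0)) // mulr0 add0r big1 ?mulr0 // => i _.
  have [->|iz] := eqVneq i z0.
    rewrite (_ : ucol xi j z0 = fun=> 0) ?dot0l ?mul0r //.
    by apply/funext => a; rewrite xi0.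
  by rewrite (prod_zero (i := z0)) ?mulr0 // eq_sym.
have v0 l : ups xi l = 0.
  have := test l (u l) erefl; rewrite big1 => [|i _]; last exact: unit_col.
  rewrite big1 ?mulr0 ?addr0 ?mulr1 // => i _.
  by rewrite tangent_self // mul0r.
case=> [[[i a] l]|l]; last exact: v0.
suff : dot (ucol xi l i) (ucol xi l i) = 0 by move/dot_eq0/(_ a).
have [->|iz] := eqVneq i z0.
  rewrite (_ : ucol xi l z0 = fun=> 0) ?dot0l //.
  by apply/funext => b; rewrite xi0.
have := test l (upd (u l) i (ucol xi l i)); rewrite upd_other ?[z0 == _]eq_sym // => /(_ erefl).
rewrite v0 mul0r add0r => /eqP; rewrite mulf_eq0 (negPf (ups0 l)) /= => /eqP.
rewrite (bigD1 i) //= upd_same big1 ?mulr1 => [|i' i'i]; last first.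
  by rewrite upd_other // unit_col.
rewrite big1 ?addr0 // => i' i'i.
by rewrite upd_other // tangent_self // mul0r.
Qed.

(** The test tensor is column [m] with its factor of mode [z0] replaced by that of [xi]. This factor
    is orthogonal to all columns of mode [z0], and the second orthonormal mode removes the columns
    other than [m]; what is left is its square norm. *)
Lemma kern_span2 (z0 z1 : 'I_k) xi m : (z0 < s)%N -> (z1 < s)%N -> z0 != z1 -> tangent x xi ->
  dPhi x xi = 0 -> (forall l, dot (u l z0) (ucol xi m z0) = 0) -> forall a, ucol xi m z0 a = 0.
Proof.
move=> s0 s1 z01 tx dx h; apply: dot_eq0.
have := ip_dPhi xi (upd (u m) z0 (ucol xi m z0)); rewrite dx ip_0l.
rewrite (bigD1 m) //= [X in _ + X]big1 => [|j jm].
  rewrite (prod_zero (i := z0)) ?upd_same // mulr0 add0r addr0 (bigD1 z0) //= upd_same.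
  rewrite [X in _ * (X + _)](_ : _ = dot (ucol xi m z0) (ucol xi m z0)); last first.
    rewrite big1 ?mulr1 // => l lz; rewrite upd_other // unit_col //.
  rewrite [X in _ + X]big1 ?addr0 => [/esym/eqP|i iz].
    by rewrite mulf_eq0 (negPf (ups0 m)) => /eqP.
  by rewrite [X in _ * X](prod_zero (i := z0)) ?mulr0 ?upd_same // eq_sym.
rewrite (prod_zero (i := z0)) ?upd_same // mulr0 add0r big1 ?mulr0 // => i _.
have [->|iz] := eqVneq i z0; last first.
  by rewrite (prod_zero (i := z0)) ?mulr0 ?upd_same // eq_sym.
rewrite [X in _ * X](prod_zero (i := z1)) ?mulr0 // 1?eq_sym //.
by rewrite upd_other 1?eq_sym // orth_col // (negPf jm).
Qed.

(** The test tensor has column [l] in mode [z0] and column [m] in mode [z1]. A term survives only if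
    its single moved factor repairs the missing orthogonality match, so only the columns [l] and [m]
    contribute. *)
Lemma kern_pair (z0 z1 : 'I_k) (xi : X -> R) l m (d : cfg R k n) : (z0 < s)%N -> (z1 < s)%N -> z0 != z1 ->
  l != m -> dPhi x xi = 0 -> d z0 = u l z0 -> d z1 = u m z1 ->
  ups x m * (dot (ucol xi m z0) (u l z0) * \prod_(i | (i != z0) && (i != z1)) dot (u m i) (d i)) +
  ups x l * (dot (ucol xi l z1) (u m z1) * \prod_(i | (i != z0) && (i != z1)) dot (u l i) (d i)) = 0.
Proof.
move=> s0 s1 z01 lm dx d0 d1; have := ip_dPhi xi d; rewrite dx ip_0l => E; rewrite {}[RHS]E.
have z10 : z1 != z0 by rewrite eq_sym.
have A0 j : j != l -> dot (u j z0) (d z0) = 0 by move=> jl; rewrite d0 orth_col // (negPf jl).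
have A1 j : j != m -> dot (u j z1) (d z1) = 0 by move=> jm; rewrite d1 orth_col // (negPf jm).
rewrite (bigD1 m) //= (bigD1 l) //= [X in _ + (_ + X)]big1 ?addr0 => [|j /andP[jm jl]]; last first.
  rewrite (prod_zero (i := z0)) ?A0 // mulr0 add0r big1 ?mulr0 // => i _.
  have [->|iz] := eqVneq i z0.
    by rewrite [X in _ * X](prod_zero (i := z1)) ?mulr0 ?A1.
  by rewrite [X in _ * X](prod_zero (i := z0)) ?mulr0 ?A0 // eq_sym.
have Am : dot (u m z0) (d z0) = 0 by apply: A0; rewrite eq_sym.
rewrite (prod_zero (P := xpredT) isT Am) mulr0 add0r.
rewrite (prod_zero (P := xpredT) isT (A1 l lm)) mulr0 add0r; congr (_ * _ + _ * _).
  rewrite [RHS](bigD1 z0) //= [X in _ = _ + X]big1 ?addr0 => [|i iz]; last first.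
    by rewrite [X in _ * X](prod_zero (i := z0)) ?mulr0 ?A0 // eq_sym.
  by rewrite d0 [X in _ = _ * X](bigD1 z1) //= d1 unit_col mul1r.
rewrite [RHS](bigD1 z1) //= [X in _ = _ + X]big1 ?addr0 => [|i iz]; last first.
  by rewrite [X in _ * X](prod_zero (i := z1)) ?mulr0 ?A1 // eq_sym.
rewrite d1 [X in _ = _ * X](bigD1 z0) //= d0 unit_col mul1r; congr (_ * _).
by apply: eq_bigl => i; rewrite andbC.
Qed.

End Kernel.

Definition perp (v : 'I_n -> R) : {vspace {ffun 'I_n -> R^o}} :=
  lker (projT1 (lin_hom (f := fun z : {ffun 'I_n -> R^o} => dot v z : R^o)
    (fun a z z' => etrans (congr1 (dot v) (ffun_lin a z z')) (dot_linr a z z' v)))).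

Lemma perpP v z : z \in perp v <-> dot v z = 0.
Proof.
rewrite /perp memv_ker; case: lin_hom => /= F FE.
by rewrite FE; split=> [/eqP|->].
Qed.

Lemma dim_perp_ge v : (n.-1 <= \dim (perp v))%N.
Proof.
have := dim_ker1 fullv (projT1 (lin_hom (f := fun z : {ffun 'I_n -> R^o} => dot v z : R^o)
    (fun a z z' => etrans (congr1 (dot v) (ffun_lin a z z')) (dot_linr a z z' v)))).
rewrite dim_ffun card_ord capfv -/(perp v).
by move=> h; rewrite -ltnS (prednK n_gt0).
Qed.

Lemma dim_perp v : dot v v != 0 -> \dim (perp v) = n.-1.
Proof.
move=> vv; apply/eqP; rewrite eqn_leq dim_perp_ge andbT -ltnS (prednK n_gt0).
have := dimvS (subvf (perp v)); rewrite dim_ffun card_ord leq_eqVlt => /orP[/eqP E|//].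
have : [ffun a => v a] \in perp v.
  have /eqP -> : perp v == fullv by rewrite eqEdim subvf dim_ffun card_ord E /=.
  exact: memvf.
move/perpP; rewrite (_ : ([ffun a => v a] : 'I_n -> R) = v) => [v0|].
  by rewrite v0 eqxx in vv.
by apply/funext => a; rewrite ffunE.
Qed.

End Stratum.

(** * Degeneracies with at least two orthonormal modes *)

Section Columns.
Variables (R : realType) (k n t s : nat).
Hypothesis n_gt0 : (0 < n)%N.
Local Notation D := {ffun 'I_k -> 'I_n}.
Local Notation X := (vars k n t).
Local Notation kkt_at := (@kkt_at R k n t s).
Local Notation Tan := (@Tan R k n t s).
Local Notation Kern := (@Kern R k n t s).
Local Notation tangent := (@tangent R k n t s).

Definition colof (z : X) : 'I_t := match z with inl (_, _, l) => l | inr l => l end.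

Lemma mem_col_sum (P : pred 'I_t) (Z : 'I_t -> {vspace {ffun X -> R^o}}) (tau : {ffun X -> R^o}) :
  (forall l v, v \in Z l -> forall z, colof z != l -> v z = 0) ->
  tau \in (\sum_(l | P l) Z l)%VS ->
  (forall l, P l -> exists2 v, v \in Z l & forall z, colof z = l -> tau z = v z) /\
  (forall z, ~~ P (colof z) -> tau z = 0).
Proof.
move=> supp /memv_sumP[v vZ ->]; split=> [l Pl|z Pz].
  exists (v l); first exact: vZ.
  move=> z zl; rewrite sum_ffunE (bigD1 l) //= big1 ?addr0 // => i /andP[Pi il].
  by apply: (supp _ _ (vZ i Pi)); rewrite zl eq_sym.
rewrite sum_ffunE big1 // => i Pi; apply: (supp _ _ (vZ i Pi)).
by apply: contraNneq Pz => ->.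
Qed.

Lemma dim_col_sum (P : pred 'I_t) (Z : 'I_t -> {vspace {ffun X -> R^o}}) :
  (forall l v, v \in Z l -> forall z, colof z != l -> v z = 0) ->
  \dim (\sum_(l | P l) Z l)%VS = (\sum_(l | P l) \dim (Z l))%N.
Proof.
move=> supp; have /directvP -> // : directv (\sum_(l | P l) Z l).
apply/directv_sum_independent => v vZ v0 l Pl; apply/ffunP => z; rewrite ffunE.
have [zl|zl] := eqVneq (colof z) l; last exact: (supp _ _ (vZ l Pl)).
move/ffunP/(_ z): v0; rewrite sum_ffunE (bigD1 l) //= big1 ?addr0 ?ffunE // => i /andP[Pi il].
by apply: (supp _ _ (vZ i Pi)); rewrite zl eq_sym.
Qed.

Definition emb_fun (i : 'I_k) (l : 'I_t) (v : {ffun 'I_n -> R^o}) : {ffun X -> R^o} :=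
  [ffun z => if z is inl (i', a, l') then if (i' == i) && (l' == l) then v a else 0 else 0].

Lemma emb_fun_lin i l : linear (emb_fun i l).
Proof.
move=> a u v; apply/ffunP => -[[[i' b] l']|l']; rewrite !ffunE.
  by case: ifP => _ //; rewrite ?ffunE // scaler0 addr0.
by rewrite scaler0 addr0.
Qed.

Definition emb i l := projT1 (lin_hom (emb_fun_lin i l)).
Lemma embE i l v : emb i l v = emb_fun i l v.
Proof. exact: (projT2 (lin_hom (emb_fun_lin i l))). Qed.

Lemma ucol_emb i l v : ucol (emb i l v) l i = v.
Proof. by apply/funext => a; rewrite /ucol embE ffunE !eqxx. Qed.

Lemma dim_emb i l U : \dim (emb i l @: U) = \dim U.
Proof.
apply: limg_dim_eq; apply/eqP; rewrite -subv0; apply/subvP => v.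
rewrite memv_cap memv_ker => /andP[_ /eqP v0]; rewrite memv0; apply/eqP/ffunP => a.
by rewrite -(ucol_emb i l v) v0 /ucol !ffunE.
Qed.

(** Directions that move only the factor of mode [i] in column [l], orthogonally to it; in a unit
    mode they are tangent. *)
Definition Theta (x : X -> R) i l := (emb i l @: perp (ucol x l i))%VS.

Lemma Theta_zero x i l v : v \in Theta x i l -> forall z,
  (forall a, z != inl (i, a, l)) -> v z = 0.
Proof.
move=> /memv_imgP[w _ ->] [[[i' a] l']|l'] h; rewrite embE ffunE //.
by case: ifP => // /andP[/eqP E1 /eqP E2]; have := h a; rewrite E1 E2 eqxx.
Qed.

Lemma Theta_dot x i l v : v \in Theta x i l -> dot (ucol x l i) (ucol v l i) = 0.
Proof. by move=> /memv_imgP[w /perpP h ->]; rewrite ucol_emb. Qed.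

Lemma Theta_col x i l v : v \in Theta x i l -> forall z, colof z != l -> v z = 0.
Proof.
move=> vT z zl; apply: (Theta_zero vT) => a; apply: contraNneq zl => ->.
by rewrite eqxx.
Qed.

Lemma Theta_tangent x (i : 'I_k) l v : (s <= i)%N -> v \in Theta x i l -> tangent x v.
Proof.
move=> si vT i' j j' ac.
have [Ei|ni] := eqVneq i' i; last first.
  have h m : ucol v m i' = fun=> 0.
    by apply/funext => a; apply: (Theta_zero vT) => b; apply: contra ni => /eqP[->].
  by rewrite !h dot0l dot0r addr0.
move: ac; rewrite /active Ei ltnNge si /= => /eqP <-.
have [->|nj] := eqVneq j l; first by rewrite dotC (Theta_dot vT) addr0.
have -> : ucol v j i = fun=> 0.
  by apply/funext => a; apply: (Theta_zero vT) => b; apply: contra nj => /eqP[_ ->].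
by rewrite dot0l dot0r addr0.
Qed.

Lemma dim_Theta_ge x i l : (n.-1 <= \dim (Theta x i l))%N.
Proof. by rewrite dim_emb dim_perp_ge. Qed.

Section KernelDimension.
Variable (x : X -> R).
Hypothesis fx : feas s x.

(** Tangency keeps each factor of mode [z0] orthogonal to its unit column, so forcing it to vanish
    costs at most [n - 1] dimensions per column. *)
Lemma kern_dim_columns (z0 : 'I_k) (B : {set 'I_t}) (U : {vspace {ffun X -> R^o}}) : (U <= Tan x)%VS ->
  exists U' : {vspace {ffun X -> R^o}},
    (\dim U <= #|B| * n.-1 + \dim U')%N /\
    (forall v, v \in U' -> v \in U /\ forall l, l \in B -> forall a, ucol v l z0 a = 0).
Proof.
move=> UT.
have /choice[f fE] : forall l, exists F : 'Hom({ffun X -> R^o}, {ffun 'I_n -> R^o}),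
    forall v, F v = [ffun a => ucol v l z0 a].
  move=> l; have [|F FE] := @lin_hom R _ _ (fun v : {ffun X -> R^o} => [ffun a => ucol v l z0 a] : {ffun 'I_n -> R^o}).
    by move=> a u v; apply/ffunP => b; rewrite !ffunE /ucol !ffunE.
  by exists F.
exists (U :&: \bigcap_(l <- enum B) lker (f l))%VS; split; last first.
  move=> v; rewrite memv_cap => /andP[vU vI]; split=> // l lB a.
  have : v \in lker (f l).
    by apply: (subvP _ _ vI); rewrite (big_rem l) ?mem_enum //= capvSl.
  by rewrite memv_ker fE => /eqP/ffunP/(_ a); rewrite !ffunE.
have := @dim_filtration R _ _ _ f (fun=> n.-1) U (enum B).
move=> H.
have -> : (#|B| * n.-1 = \sum_(l <- enum B) n.-1)%N.
  by rewrite big_const_seq count_predT -cardE iter_addn_0 mulnC.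
apply: H => s1 l s2 _.
rewrite -(@dim_perp _ _ n_gt0 (ucol x l z0)); last by rewrite (unit_col fx) oner_eq0.
apply: dimvS; apply/subvP => _ /memv_imgP[v vI ->].
move: vI; rewrite memv_cap => /andP[/(subvP UT)/TanP tv _].
apply/perpP; rewrite fE -[RHS](tangent_self l z0 tv) dotC; congr dot.
by apply/funext => a; rewrite ffunE.
Qed.

End KernelDimension.

(* With two orthonormal modes the differential of the parametrization degenerates only along pairs of
   columns with |ups| equal that agree up to signs in all modes >= s. *)
Section TwoOrthogonal.
Variables (z0 z1 z2 : 'I_k).
Hypotheses (z0s : (z0 < s)%N) (z1s : (z1 < s)%N) (z01 : z0 != z1) (z2s : (s <= z2)%N).

Definition twin (x : X -> R) (l m : 'I_t) : Prop :=
  (exists b : bool, ups x l = (-1) ^+ b * ups x m) /\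
  (forall i : 'I_k, (s <= i)%N -> exists b : bool, forall a, ucol x l i a = (-1) ^+ b * ucol x m i a).
  
Lemma twin_refl x l : twin x l l.
Proof. by split=> [|i _]; exists false; rewrite ?expr0 ?mul1r // => a; rewrite mul1r. Qed.

Lemma twin_sym x l m : twin x l m -> twin x m l.
Proof.
move=> [[b E] H]; split=> [|i si]; first by exists b; rewrite E mulrA -signr_addb addbb mul1r.
by have [c F] := H i si; exists c => a; rewrite F mulrA -signr_addb addbb mul1r.
Qed.

Lemma twin_trans x l m p : twin x l m -> twin x m p -> twin x l p.
Proof.
move=> [[b E] H] [[b' E'] H']; split=> [|i si].
  by exists (b (+) b'); rewrite E E' mulrA -signr_addb.
have [c F] := H i si; have [c' F'] := H' i si; exists (c (+) c') => a.
by rewrite F F' mulrA -signr_addb.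
Qed.

Lemma dot_le1 (v w : 'I_n -> R) : dot v v = 1 -> dot w w = 1 -> `|dot v w| <= 1.
Proof.
move=> v1 w1; have := dot_ge0 (fun a => 1 * v a + w a); have := dot_ge0 (fun a => -1 * v a + w a).
rewrite !dot_linl !dot_linr v1 w1 (dotC w v) ler_norml; lra.
Qed.

Lemma dot_sign (v w : 'I_n -> R) : dot v v = 1 -> dot w w = 1 -> `|dot v w| = 1 ->
  exists b : bool, forall a, v a = (-1) ^+ b * w a.
Proof.
move=> v1 w1 vw; have [b bE] : exists b : bool, dot v w = (-1) ^+ b.
  have [d0|d0] := lerP 0 (dot v w); [exists false|exists true].
    by rewrite expr0 -vw ger0_norm.
  by rewrite expr1 -vw ltr0_norm // opprK.
exists b => a; move: ((-1) ^+ b) (sqrr_sign R b) bE => c cc bE.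
have : dot (fun a => - c * w a + v a) (fun a => - c * w a + v a) = 0.
  by rewrite dot_linl !dot_linr v1 w1 (dotC w v) bE; nra.
by move/dot_eq0/(_ a) => /=; lra.
Qed.

Section AtPoint.
Variable x : X -> R.
Hypotheses (fx : feas s x) (u0 : forall j, ups x j != 0).
Local Notation u := (ucol x).

Lemma prod_abs1 (I : finType) (P : pred I) (F : I -> R) :
  (forall i, P i -> `|F i| <= 1) -> `|\prod_(i | P i) F i| = 1 -> forall i, P i -> `|F i| = 1.
Proof.
move=> F1; rewrite normr_prod => p1 i Pi; apply/eqP; rewrite eq_le F1 //=.
rewrite -[leLHS]p1 (bigD1 i) //= ler_piMr //.
by apply: prodr_ile1 => j /andP[Pj _]; rewrite normr_ge0 F1.
Qed.

(** Let [a], [b] be the entries of [xi] linking [l] and [m] in modes [z0] and [z1], [p], [q] the two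
    values, and [g] the product of the cosines between the two columns in the other modes. Three
    test tensors give [a q = - p b g], [a q g = - p b] and [a p = - q b g], whence [g ^+ 2 = 1] and
    [p ^+ 2 = q ^+ 2]. As [g] is a product of cosines, each of them is a sign. *)
Lemma kern_twin xi l m : l != m -> tangent x xi -> dPhi x xi = 0 ->
  dot (u l z0) (ucol xi m z0) != 0 -> twin x l m.
Proof.
move=> lm tx dx a0.
pose P := fun i : 'I_k => (i != z0) && (i != z1).
have z10 : z1 != z0 by rewrite eq_sym.
pose d1 := upd (u m) z0 (u l z0); pose d2 := upd (u l) z1 (u m z1).
have E1 := kern_pair fx z0s z1s z01 lm dx (d := d1) (upd_same _ _ _) (upd_other _ _ z10).
have E2 := kern_pair fx z0s z1s z01 lm dx (d := d2) (upd_other _ _ z01) (upd_same _ _ _).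
have ml : m != l by rewrite eq_sym.
pose d3 := upd (u l) z0 (u m z0).
have E3 := kern_pair fx z0s z1s z01 ml dx (d := d3) (upd_same _ _ _) (upd_other _ _ z10).
pose g := \prod_(i | P i) dot (u l i) (u m i).
have P1 j d : (forall i, P i -> d i = u j i) -> \prod_(i | (i != z0) && (i != z1)) dot (u j i) (d i) = 1.
  by move=> h; apply: big1 => i Pi; rewrite h // (unit_col fx).
have Pg1 d : (forall i, P i -> d i = u m i) -> \prod_(i | (i != z0) && (i != z1)) dot (u l i) (d i) = g.
  by move=> h; apply: eq_bigr => i Pi; rewrite h.
have Pg2 d : (forall i, P i -> d i = u l i) -> \prod_(i | (i != z0) && (i != z1)) dot (u m i) (d i) = g.
  by move=> h; apply: eq_bigr => i Pi; rewrite h // dotC.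
have h1 i : P i -> d1 i = u m i by move=> /andP[? _]; apply: upd_other.
have h2 i : P i -> d2 i = u l i by move=> /andP[_ ?]; apply: upd_other.
have h3 i : P i -> d3 i = u l i by move=> /andP[? _]; apply: upd_other.
rewrite (P1 m d1 h1) (Pg1 d1 h1) in E1.
rewrite (P1 l d2 h2) (Pg2 d2 h2) in E2.
rewrite (P1 l d3 h3) (Pg2 d3 h3) in E3.
move: E1 E2 E3; rewrite ![dot (ucol xi _ _) _]dotC.
rewrite (tangent_skew l m z0s tx) (tangent_skew m l z1s tx).
move: a0; set a := dot (u l z0) (ucol xi m z0); set b := dot (u m z1) (ucol xi l z1).
move: (u0 l) (u0 m); set p := ups x l; set q := ups x m => p0 q0 a0 E1 E2 E3.
have aq : a * q != 0 by rewrite mulf_neq0.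
have g2 : g ^+ 2 = 1.
  have : a * q * (1 - g ^+ 2) = 0.
    have -> : a * q * (1 - g ^+ 2) = q * (a * 1) + p * (b * g) - g * (q * (a * g) + p * (b * 1)) by ring.
    by rewrite E1 E2; ring.
  by move/eqP; rewrite mulf_eq0 (negPf aq) /= subr_eq0 eq_sym => /eqP.
have pq : p ^+ 2 = q ^+ 2.
  have e1 : a * q = - (p * b * g) by rewrite !mulr1 in E1; lra.
  have e2 : a * p = - (q * b * g) by rewrite !mulr1 in E3; lra.
  have : (a ^+ 2 + b ^+ 2) * (p ^+ 2 - q ^+ 2) = 0.
    have -> : (a ^+ 2 + b ^+ 2) * (p ^+ 2 - q ^+ 2) =
      (a * p) ^+ 2 - (a * q) ^+ 2 + b ^+ 2 * (p ^+ 2 - q ^+ 2) by ring.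
    rewrite e1 e2; have -> : (- (q * b * g)) ^+ 2 - (- (p * b * g)) ^+ 2 = (q ^+ 2 - p ^+ 2) * b ^+ 2 * g ^+ 2 by ring.
    by rewrite g2; ring.
  have ab : a ^+ 2 + b ^+ 2 != 0.
    rewrite gt_eqF // ltr_pwDl ?sqr_ge0 // lt_def sqr_ge0 sqrf_eq0 a0 //.
  by move/eqP; rewrite mulf_eq0 (negPf ab) /= subr_eq0 => /eqP.
split.
  move/eqP: pq; rewrite eqf_sqr => /orP[]/eqP E; [exists false|exists true]; rewrite -/p E.
    by rewrite mul1r.
  by rewrite expr1 mulN1r.
move=> i si; apply: dot_sign; [exact: (unit_col fx)|exact: (unit_col fx)|].
have := @prod_abs1 _ P (fun i => dot (u l i) (u m i)); apply.
- by move=> j _; apply: dot_le1; exact: (unit_col fx).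
- by move/eqP: g2; rewrite -[X in _ == X](expr1n _ 2) eqf_sqr => /orP[]/eqP; rewrite -/g => ->; rewrite ?normrN normr1.
- by rewrite /P; apply/andP; split; apply: contraTneq si => ->; rewrite -ltnNge.
Qed.

End AtPoint.
End TwoOrthogonal.
End Columns.

Section TwoOrthogonalNull.
Variables (R : realType) (k n t s : nat).
Hypothesis n_gt0 : (0 < n)%N.
Local Notation D := {ffun 'I_k -> 'I_n}.
Local Notation X := (vars k n t).
Local Notation kkt_at := (@kkt_at R k n t s).
Local Notation Tan := (@Tan R k n t s).
Local Notation Kern := (@Kern R k n t s).
Local Notation tangent := (@tangent R k n t s).
Variables (z0 z1 z2 : 'I_k).
Hypotheses (z0s : (z0 < s)%N) (z1s : (z1 < s)%N) (z01 : z0 != z1) (z2s : (s <= z2)%N).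

Definition noaux (x : X -> R) (z : X + void) : R :=
  match z with inl z => x z | inr v => match v with end end.

Section Pattern.
Variables (rep : {ffun 'I_t -> 'I_t}) (sv : {ffun 'I_t -> bool}) (su : {ffun 'I_t * 'I_k -> bool}).

Definition twin_eq (q : 'I_t + 'I_t * 'I_k * 'I_n) : pexpr R (X + void) :=
  match q with
  | inl l => PA (PX (inl (inr l))) (PM (PC (- (-1) ^+ sv l)) (PX (inl (inr (rep l)))))
  | inr (l, i, a) => if (i < s)%N then PC 0 else
      PA (PX (inl (inl (i, a, l)))) (PM (PC (- (-1) ^+ su (l, i))) (PX (inl (inl (i, a, rep l)))))
  end.

Definition twin_pattern (x : X -> R) : Prop :=
  [/\ forall l, rep (rep l) = rep l, exists l, rep l != l,
     forall l, ups x l = (-1) ^+ sv l * ups x (rep l),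
     forall l (i : 'I_k), (s <= i)%N -> forall a, ucol x l i a = (-1) ^+ su (l, i) * ucol x (rep l) i a &
     forall xi, tangent x xi -> dPhi x xi = 0 -> (forall l, rep l != l -> forall a, ucol xi l z0 a = 0) ->
       forall z, xi z = 0].

(** A column that is not its own representative has its value and its factor of mode [z2] tied to
    the representative. This freezes [n] tangent dimensions, while the column adds at most [n - 1]
    to the kernel of [dPhi]. *)
Lemma null_twin_pattern : null_set (fun A : tensor R k n => exists x, kkt_at A x /\ twin_pattern x).
Proof.
apply: null_sub (null_stratum s n_gt0 twin_eq (Qe := void)
  (fun v _ => match v with end) (fun v => match v with end)).
move=> A [x [kx [rr [b bb] Ev Eu Kc]]]; exists (noaux x).
have fx := kkt_feas kx.
have xE : xpart (noaux x) = x by apply/funext.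
rewrite !xE; split=> //.
- case=> [l|[[l i] a]] /=; first by rewrite mulNr; apply/eqP; rewrite subr_eq0; apply/eqP; exact: Ev.
  case: ifP => //= si; rewrite mulNr; apply/eqP; rewrite subr_eq0; apply/eqP.
  by apply: (Eu l i _ a); rewrite leqNgt si.
pose dl (l : 'I_t) : {ffun X -> R^o} := [ffun z => (z == inr l)%:R].
pose Zl l := (Theta x z2 l + <[dl l]>)%VS.
have ZlP l v : v \in Zl l -> tangent x v /\ forall z, colof z != l -> v z = 0.
  case/memv_addP => v1 v1T [_ /vlineP[c ->] ->]; split; last first.
    move=> z zl; rewrite addfE scalefE (Theta_col v1T) // add0r ffunE.
    by case: (eqVneq z (inr l)) zl => [->|]; rewrite ?eqxx // mulr0.
  rewrite addrC ffun_lin; apply: tangent_lin; last exact: (Theta_tangent z2s v1T).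
  move=> i j j' _; have h m : ucol (dl l) m i = fun=> 0 by apply/funext => a; rewrite /ucol ffunE.
  by rewrite !h dot0l dot0r addr0.
have dZl l : (n <= \dim (Zl l))%N.
  rewrite dimv_disjoint_sum.
    have d1 : dl l != 0.
      by apply/eqP => /ffunP/(_ (inr l)); rewrite !ffunE eqxx => /eqP; rewrite oner_eq0.
    rewrite dim_vline d1 addn1.
    by apply: leq_trans (leqSpred n) _; rewrite ltnS dim_Theta_ge.
  apply/eqP; rewrite -subv0; apply/subvP => v; rewrite memv_cap => /andP[vT /vlineP[c cE]].
  have : v (inr l) = 0 by apply: (Theta_zero vT).
  rewrite cE scalefE ffunE eqxx mulr1 => ->; by rewrite scale0r mem0v.
pose Z := (\sum_(l | rep l != l) Zl l)%VS.
have ZT : (Z <= Tan x)%VS.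
  by apply/subv_sumP => l _; apply/subvP => v /ZlP[tv _]; apply/TanP.
exists Z, 0%VS, 0%N; split=> //.
- by rewrite cap0v.
- by move=> v; rewrite memv0 => /eqP-> ; exists (fun=> 0) => I; rewrite ffunE big1 // => -[].
- move=> U UP; rewrite leqn0 dimv_eq0 -subv0; apply/subvP => v /UP[dC [tau tZ vt]].
  have [/= c1 c2] := mem_col_sum (P := fun l => rep l != l) (fun l v h => (ZlP l v h).2) tZ.
  rewrite memv0; apply/eqP/ffunP => -[z|[]]; rewrite vt ffunE.
  have [zb|] := boolP (rep (colof z) != colof z); last by apply: c2.
  have rep0 z' : colof z' = rep (colof z) -> tau z' = 0.
    by move=> E; apply: c2; rewrite E rr eqxx.
  case: z zb rep0 => [[[i a] l]|l] /= zb rep0.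
    have [si|si] := ltnP i s.
      have [w wZ ->] := c1 l zb; last by [].
      case/memv_addP: wZ => v1 v1T [_ /vlineP[c ->] ->].
      rewrite addfE scalefE ffunE /= mulr0 addr0; apply: (Theta_zero v1T) => b'.
      by apply: contraTneq si => -[-> _]; rewrite ltnNge z2s.
    have := dC (inr (l, i, a)); rewrite /= ltnNge si /= mul0r add0r !vt (rep0 (inl (i, a, rep l))) // mulr0 addr0.
    exact.
  by have := dC (inl l); rewrite /= mul0r add0r !vt (rep0 (inr (rep l))) // mulr0 addr0; exact.
- rewrite dimv0 addn0 add0n dim_col_sum => [|l v /ZlP[]//].
  have [U [dU UP]] := kern_dim_columns n_gt0 fx z0 [set l | rep l != l] (capvSl (Tan x) (lker (dPhiH x)) : (Kern x <= Tan x)%VS).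
  have U0 : \dim U = 0%N.
    apply/eqP; rewrite dimv_eq0 -subv0; apply/subvP => v /UP[/KernP[tv dv0] v0].
    rewrite memv0; apply/eqP/ffunP => z; rewrite ffunE; apply: Kc => // l lb.
    by apply: v0; rewrite inE.
  apply: (@leq_trans (\sum_(l | rep l != l) n)%N); last exact: leq_sum.
  apply: leq_ltn_trans dU _; rewrite U0 addn0 sum_nat_const.
  have -> : #|[set l | rep l != l]| = #|[pred l | rep l != l]| by rewrite cardsE.
  rewrite ltn_mul2l ltn_predL n_gt0 andbT; by apply/card_gt0P; exists b.
Qed.
End Pattern.

(** A kernel direction links only twin columns in mode [z0], so it vanishes once its factors of that
    mode vanish in all columns but one of each twin class. The finitely many choices of classes and
    signs are treated one by one. *)
Lemma null_two : null_set (fun A : tensor R k n => exists x, [/\ kkt_at A x, forall j, ups x j != 0 &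
  exists xi, [/\ tangent x xi, dPhi x xi = 0 & exists z, xi z != 0]]).
Proof.
pose T : countType := ({ffun 'I_t -> 'I_t} * {ffun 'I_t -> bool} * {ffun 'I_t * 'I_k -> bool})%type.
apply: null_sub (null_cup_count (T := T) n_gt0
   (N := fun p A => exists x, kkt_at A x /\ twin_pattern p.1.1 p.1.2 p.2 x) _); last first.
  by move=> p; apply: null_twin_pattern.
move=> A [x [kx u0 [xi [txi dxi [zz xi0]]]]].
have fx := kkt_feas kx.
pose tw l m := `[< twin s x l m >].
have twr l : tw l l by apply/asboolP; exact: twin_refl.
pose rep0 l := [arg min_(m < l | tw l m) (m : nat)]%N.
have repP l : tw l (rep0 l) /\ forall m, tw l m -> (rep0 l <= m)%N.
  by rewrite /rep0; case: arg_minnP.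
have repE l m : tw l m -> rep0 l = rep0 m.
  move=> /asboolP lm; have [/asboolP l1 l2] := repP l; have [/asboolP m1 m2] := repP m.
  apply/val_inj/eqP; rewrite eqn_leq; apply/andP; split.
    by apply: l2; apply/asboolP; apply: twin_trans lm m1.
  by apply: m2; apply/asboolP; apply: twin_trans (twin_sym lm) l1.
pose rep : {ffun 'I_t -> 'I_t} := [ffun l => rep0 l].
have twrep l : twin s x l (rep l) by rewrite ffunE; have [/asboolP] := repP l.
have /choice[sv svE] : forall l, exists b : bool, ups x l = (-1) ^+ b * ups x (rep l).
  by move=> l; have [] := twrep l.
have /choice[su suE] : forall p : 'I_t * 'I_k, exists b : bool, (s <= p.2)%N ->
    forall a, ucol x p.1 p.2 a = (-1) ^+ b * ucol x (rep p.1) p.2 a.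
  move=> [l i] /=; have [_ /(_ i)] := twrep l.
  by case: (leqP s i) => _ h; [have [b bE] := h isT; exists b|exists false].
have Kc : forall xi, tangent x xi -> dPhi x xi = 0 -> (forall l, rep l != l -> forall a, ucol xi l z0 a = 0) ->
       forall z, xi z = 0.
  move=> {zz xi0 dxi} {}xi {}txi dxi rep_xi.
  apply: (kern_zero fx u0 z0s txi dxi) => m; apply: (kern_span2 fx u0 z0s z1s z01 txi dxi) => l.
  have [->|lm] := eqVneq l m; first by rewrite dotC (tangent_self m z0 txi).
  have [ml|ml] := eqVneq (rep m) m; last first.
    by rewrite (_ : ucol xi m z0 = fun=> 0) ?dot0r //; apply/funext => a; apply: rep_xi.
  have [ll|ll] := eqVneq (rep l) l; last first.
    rewrite (tangent_skew _ _ z0s txi) (_ : ucol xi l z0 = fun=> 0) ?dot0r ?oppr0 //.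
    by apply/funext => a; apply: rep_xi.
  apply/eqP; apply: contraNT lm => /(kern_twin z0s z1s z01 fx u0 _ txi dxi).
  have [//|lm /(_ isT) tlm] := eqVneq l m.
  by move: lm; rewrite -ml -ll !ffunE (repE _ _ (introT (asboolP _) tlm)) eqxx.
exists (rep, [ffun l => sv l], [ffun p => su p]), x; split=> //; split=> //=.
- by move=> l; rewrite !ffunE; have [h _] := repP l; rewrite -(repE _ _ h).
- apply: contrapT => nb; move/eqP: xi0; apply; apply: Kc => // l lb.
  by case: nb; exists l.
- by move=> l; rewrite [in LHS]svE; congr (_ ^+ nat_of_bool _ * _); rewrite ffunE.
- by move=> l i si a; rewrite [in LHS](suE (l, i)) //; congr (_ ^+ nat_of_bool _ * _); rewrite ffunE.
Qed.

End TwoOrthogonalNull.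

(** * Degeneracies with one orthonormal mode *)

Section OneOrthogonal.
Variables (R : realType) (k n t s : nat).
Hypothesis n_gt0 : (0 < n)%N.
Local Notation D := {ffun 'I_k -> 'I_n}.
Local Notation X := (vars k n t).
Local Notation kkt_at := (@kkt_at R k n t s).
Local Notation Tan := (@Tan R k n t s).
Local Notation Kern := (@Kern R k n t s).
Local Notation tangent := (@tangent R k n t s).
Local Notation W := {ffun D -> R^o}.
Variable z0 : 'I_k.
Hypothesis only1 : forall i : 'I_k, (i < s)%N = (i == z0).

(* Factors of mode z0 are replaced by the all-ones vector, so that [Bt x l] is the product of the
   remaining factors of column l, seen as a full tensor constant in mode z0. *)
Definition one : 'I_n -> R := fun=> 1.
Definition bcol (x : X -> R) (l : 'I_t) : cfg R k n := upd (ucol x l) z0 one.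
Definition Bt x l : W := rk (bcol x l).

Lemma z0s : (z0 < s)%N. Proof. by rewrite only1. Qed.
Lemma unit_mode (i : 'I_k) : i != z0 -> (s <= i)%N.
Proof. by move=> iz; rewrite leqNgt only1. Qed.

Lemma one_pos : dot one one != 0.
Proof. by rewrite /dot /one sumr_const card_ord mulr1 pnatr_eq0 -lt0n. Qed.

Definition setc (I : D) a : D := [ffun l => if l == z0 then a else I l].
(** Contraction of mode [z0] with [v]. The result is kept as a tensor constant in that mode, so that
    all spaces live in the same vector space. *)
Definition ctr (v : 'I_n -> R) (T : W) : W := [ffun I => \sum_a v a * T (setc I a)].

Lemma ctr_rk v (c : cfg R k n) : ctr v (rk c) = dot v (c z0) *: rk (upd c z0 one).
Proof.
apply/ffunP => I; rewrite scalefE rkE ffunE rk1_upd mul1r /dot mulr_suml.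
apply: eq_bigr => a _; rewrite rkE -(upd_id c z0) rk1_upd ffunE eqxx mulrA upd_same.
congr (_ * _ * _); apply: eq_bigr => l lz; rewrite upd_other // ffunE (negPf lz) //.
Qed.

Lemma ctr_lin v a S T : ctr v (a *: S + T) = a *: ctr v S + ctr v T.
Proof.
apply/ffunP => I; rewrite addfE scalefE !ffunE mulr_sumr -big_split; apply: eq_bigr => b _ /=.
by rewrite addfE scalefE; ring.
Qed.

Lemma ctr0 v : ctr v 0 = 0.
Proof. by apply/ffunP => I; rewrite !ffunE big1 // => a _; rewrite ffunE mulr0. Qed.

Lemma ctrZ v a S : ctr v (a *: S) = a *: ctr v S.
Proof. by rewrite -[a *: S]addr0 ctr_lin ctr0 addr0. Qed.

Lemma ctr_sum v (J : finType) (P : pred J) (F : J -> W) : ctr v (\sum_(j | P j) F j) = \sum_(j | P j) ctr v (F j).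
Proof.
apply: (big_morph (ctr v)) => [S T|]; last exact: ctr0.
by rewrite -{1}[S]scale1r ctr_lin scale1r.
Qed.

Lemma ctr_dPhi x xi v : ctr v (dPhi x xi) =
  \sum_j ((ups xi j * dot v (ucol x j z0) + ups x j * dot v (ucol xi j z0)) *: Bt x j
    + (ups x j * dot v (ucol x j z0)) *: \sum_(i | i != z0) rk (upd (bcol x j) i (ucol xi j i))).
Proof.
rewrite ctr_sum; apply: eq_bigr => j _; rewrite ctr_lin ctrZ ctr_rk ctr_sum -/(Bt x j).
rewrite (bigD1 z0) //= ctr_rk upd_same upd_upd -/(Bt x j) scalerDl !scalerDr !scalerA -!addrA.
congr (_ + (_ + _)); rewrite scaler_sumr [RHS]scaler_sumr; apply: eq_bigr => i iz.
rewrite ctr_rk upd_other 1?eq_sym // scalerA; congr (_ *: rk _).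
by rewrite updC.
Qed.

(* Modulo the factor of mode z0, the tangent cone of the rank-one tensor [Bt x l]. *)
Lemma that_vspace x l : {T : {vspace W} | forall v, v \in T <->
  exists q : 'I_k -> 'I_n -> R, v = \sum_(i | i != z0) rk (upd (bcol x l) i (q i))}.
Proof.
apply: vspace_of => [|a u v [q ->] [q' ->]].
  by exists (fun _ _ => 0); rewrite big1 // => i _; rewrite rk_0.
exists (fun i b => a * q i b + q' i b); rewrite scaler_sumr -big_split; apply: eq_bigr => i _ /=.
by rewrite rk_lin.
Qed.
Definition That x l := projT1 (that_vspace x l).
Lemma ThatP x l v : v \in That x l <->
  exists q : 'I_k -> 'I_n -> R, v = \sum_(i | i != z0) rk (upd (bcol x l) i (q i)).
Proof. exact: (projT2 (that_vspace x l)). Qed.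

Definition Ecol x (J : {set 'I_t}) : {vspace W} := (\sum_(j in J) <[Bt x j]>)%VS.
Lemma EcolP x J v : v \in Ecol x J <-> exists al : 'I_t -> R, v = \sum_(j in J) al j *: Bt x j.
Proof.
split=> [/memv_sumP[w wP ->]|[al ->]]; last first.
  by apply: memv_suml => j jJ; apply: (subvP (sumv_sup j jJ (subvv _))); rewrite memvZ ?memv_line.
have /choice[al alP] : forall j, exists a, j \in J -> w j = a *: Bt x j.
  move=> j; case: (boolP (j \in J)) => [/wP/vlineP[a ->]|_]; last by exists 0.
  by exists a.
by exists al; apply: eq_bigr => j /alP.
Qed.

Lemma dim_Ecol x J : (\dim (Ecol x J) <= #|J|)%N.
Proof.
apply: leq_trans (dimv_leq_sum _ _ _) _; rewrite -sum1_card; apply: leq_sum => j _.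
by rewrite dim_vline; case: (_ != _).
Qed.

Definition indep x (J : {set 'I_t}) := forall al : 'I_t -> R, \sum_(j in J) al j *: Bt x j = 0 ->
  forall j, j \in J -> al j = 0.

Lemma indep_sub x (J J' : {set 'I_t}) : J' \subset J -> indep x J -> indep x J'.
Proof.
move=> sub ind al h j jJ'.
have := ind (fun j => if j \in J' then al j else 0).
rewrite (bigID (mem J')) /= [X in _ + X]big1 ?addr0 => [|i /andP[_ /negPf->]]; last by rewrite scale0r.
have -> : \sum_(i in J | i \in J') (if i \in J' then al i else 0) *: Bt x i = 0.
  rewrite -[RHS]h; apply: eq_big => i; last by move=> /andP[_ ->].
  by case iJ': (i \in J'); rewrite ?andbF // (subsetP sub).
by move=> /(_ erefl j (subsetP sub _ jJ')); rewrite jJ'.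
Qed.

Section AtPoint.
Variable x : X -> R.
Hypotheses (fx : feas s x) (u0 : forall j, ups x j != 0).
Local Notation u := (ucol x).

(** Contraction with column [l] of the orthonormal mode: moves of mode [z0] survive from every
    column, all other moves only from column [l]. A kernel direction thus becomes a relation between
    the [Bt] and the tangent cone of column [l]. *)
Lemma slot_dPhi xi l : ctr (u l z0) (dPhi x xi) =
  \sum_j (ups x j * dot (u l z0) (ucol xi j z0)) *: Bt x j + ups xi l *: Bt x l
   + ups x l *: \sum_(i | i != z0) rk (upd (bcol x l) i (ucol xi l i)).
Proof.
rewrite ctr_dPhi; apply/esym.
have o j : dot (u l z0) (u j z0) = (l == j)%:R by rewrite (orth_col fx _ _ z0s).
rewrite [RHS](eq_bigr (fun j => (ups x j * dot (u l z0) (ucol xi j z0)) *: Bt x j + (if j == l then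
  ups xi l *: Bt x l + ups x l *: \sum_(i | i != z0) rk (upd (bcol x l) i (ucol xi l i)) else 0))).
  rewrite big_split /= -addrA; congr (_ + _).
  by rewrite [RHS](bigD1 l) //= eqxx [X in _ = _ + X]big1 ?addr0 // => j /negPf->.
move=> j _; rewrite o (eq_sym l); case: eqP => [->|_]; last by rewrite !mulr0 add0r scale0r.
by rewrite !mulr1 scalerDl addrAC addrC addrA.
Qed.

Lemma slot_eq xi l : dPhi x xi = 0 ->
  \sum_j (ups x j * dot (u l z0) (ucol xi j z0)) *: Bt x j + ups xi l *: Bt x l
   + ups x l *: \sum_(i | i != z0) rk (upd (bcol x l) i (ucol xi l i)) = 0.
Proof. by move=> dx; rewrite -slot_dPhi dx ctr0. Qed.

Lemma Bt_That l (i : 'I_k) c : i != z0 -> c *: Bt x l = rk (upd (bcol x l) i (fun a => c * u l i a)).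
Proof.
move=> iz; rewrite rk_Z /Bt; congr (_ *: rk _); apply/funext => j.
by rewrite /upd; case: eqP => // ->; rewrite /bcol upd_other.
Qed.

Lemma bcol_z0 l : bcol x l z0 = one. Proof. exact: upd_same. Qed.
Lemma bcol_i l (i : 'I_k) : i != z0 -> bcol x l i = u l i. Proof. exact: upd_other. Qed.

Lemma bcol_self l (i : 'I_k) : dot (bcol x l i) (bcol x l i) != 0.
Proof.
have [->|iz] := eqVneq i z0; first by rewrite bcol_z0 one_pos.
by rewrite bcol_i // (unit_col fx) oner_neq0.
Qed.

Lemma prod_bcol_neq0 (P : pred 'I_k) l : \prod_(i | P i) dot (bcol x l i) (bcol x l i) != 0.
Proof. by apply/prodf_neq0 => i _; exact: bcol_self. Qed.

(* Pairing with the rank-one tensor having [v] in mode [i] isolates the mode-[i] term. *)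
Lemma That_test l (q : 'I_k -> 'I_n -> R) (i : 'I_k) v : i != z0 -> dot (u l i) v = 0 ->
  \sum_(j | j != z0) rk (upd (bcol x l) j (q j)) = 0 -> dot (q i) v = 0.
Proof.
move=> iz uv h; have := ip_suml (fun j => j != z0) (fun j => rk (upd (bcol x l) j (q j))) (rk (upd (bcol x l) i v)).
rewrite h ip_0l (bigD1 i) //= big1 ?addr0 => [/esym/eqP|j /andP[jz ji]]; last first.
  by apply: (@ip_rk_zero _ _ _ _ _ i); rewrite upd_same upd_other 1?eq_sym // bcol_i.
rewrite ip_rk_upd upd_same mulf_eq0 => /orP[/eqP//|/eqP].
under eq_bigr => l' l'i do rewrite upd_other //.
by move/eqP; rewrite (negPf (prod_bcol_neq0 _ _)).
Qed.

(** The only ambiguity of such a representation is the transfer of multiples of the column between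
    modes; orthogonality in all modes but [i1] removes it. *)
Lemma That_inj l (i1 : 'I_k) (q : 'I_k -> 'I_n -> R) : i1 != z0 ->
  (forall i, i != z0 -> i != i1 -> dot (q i) (u l i) = 0) ->
  \sum_(j | j != z0) rk (upd (bcol x l) j (q j)) = 0 -> forall i, i != z0 -> forall a, q i a = 0.
Proof.
move=> i1z h q0.
have h1 i : i != z0 -> i != i1 -> forall a, q i a = 0.
  by move=> iz ii1; apply: dot_eq0; apply: (That_test iz _ q0); rewrite dotC h.
move=> i iz; have [->|ii1] := eqVneq i i1; last exact: h1.
move: q0; rewrite (bigD1 i1) //= big1 ?addr0 => [q0|j /andP[jz ji]]; last first.
  by rewrite (_ : q j = fun=> 0) ?rk_0 //; apply/funext => a; exact: h1.
apply: dot_eq0; have := ip_rk_upd (bcol x l) (upd (bcol x l) i1 (q i1)) i1 (q i1).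
rewrite q0 ip_0l upd_same => /esym/eqP; rewrite mulf_eq0 => /orP[/eqP//|/eqP].
under eq_bigr => l' l'i do rewrite upd_other //.
by move/eqP; rewrite (negPf (prod_bcol_neq0 _ _)).
Qed.

Section Zeta.
Variables (l : 'I_t) (q : 'I_k -> 'I_n -> R) (i0 i' : 'I_k).
Hypotheses (i0z : i0 != z0) (i'z : i' != z0) (i0i' : i0 != i').
Hypothesis qn : exists a, q i0 a != dot (q i0) (u l i0) * u l i0 a.

(** Variation of the element of [That x l] with factors [q] when the factor of mode [i'] in column
    [l] moves by [tau]. *)
Definition zeta (tau : X -> R) : W :=
  \sum_(i | (i != z0) && (i != i')) rk (upd (upd (bcol x l) i (q i)) i' (ucol tau l i')).

Lemma zeta_hom : {F : 'Hom({ffun X -> R^o}, W) | forall v, F v = zeta v}.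
Proof.
apply: lin_hom => a v w; rewrite /zeta scaler_sumr -big_split; apply: eq_bigr => i _ /=.
by rewrite ffun_lin ucol_lin rk_lin.
Qed.

(** The part [w0] of [q i0] orthogonal to the column is nonzero. Pairing with [w0] in mode [i0] and
    the moved factor in mode [i'] kills the tangent cone, whose terms keep the column in at least
    one of these modes, and leaves a nonzero multiple of the square norm of the moved factor. *)
Lemma zeta_inj tau : tau \in Theta x i' l -> zeta tau \in That x l -> tau = 0.
Proof.
move=> tT /ThatP[p zp].
pose w0 := fun a => - dot (q i0) (u l i0) * u l i0 a + q i0 a.
have uw : dot (u l i0) w0 = 0.
  by rewrite /w0 dot_linr (unit_col fx) mulr1 dotC addNr.
have qw : dot (q i0) w0 = dot w0 w0.
  by rewrite {2}/w0 dot_linl uw mulr0 add0r.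
have ww : dot w0 w0 != 0.
  apply/eqP => /dot_eq0 w00; have [a] := qn; have := w00 a; rewrite /w0 => E /eqP; apply; lra.
pose th := ucol tau l i'.
have uth : dot (u l i') th = 0 by exact: Theta_dot tT.
suff th0 : forall a, th a = 0.
  apply/ffunP => z; rewrite ffunE; have [/existsP[a /eqP->]|/existsPn nz] := boolP [exists a, z == inl (i', a, l)].
    exact: th0.
  exact: (Theta_zero tT).
apply: dot_eq0.
pose d := upd (upd (bcol x l) i0 w0) i' th.
have d0 : d i0 = w0 by rewrite /d upd_other // upd_same.
have d' : d i' = th by rewrite /d upd_same.
have i'i0 : i' != i0 by rewrite eq_sym.
have R0 : ip (zeta tau) (rk d) = 0.
  rewrite zp ip_suml big1 // => i iz.
  have [Ei|ii'] := eqVneq i i'.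
    by apply: (@ip_rk_zero _ _ _ _ _ i0); rewrite d0 upd_other ?Ei // bcol_i.
  by apply: (@ip_rk_zero _ _ _ _ _ i'); rewrite d' upd_other 1?eq_sym // bcol_i.
move: R0; rewrite /zeta ip_suml (bigD1 i0) /=; last by rewrite i0z i0i'.
rewrite big1 ?addr0 => [|i /andP[/andP[iz ii'] ii0]]; last first.
  apply: (@ip_rk_zero _ _ _ _ _ i0); rewrite d0 upd_other // upd_other 1?eq_sym // bcol_i //.
rewrite ip_rk_upd d' => /eqP; rewrite mulf_eq0 => /orP[/eqP//|].
rewrite (bigD1 i0) //= upd_same d0 qw mulf_eq0 (negPf ww) /= => /eqP.
have -> : \prod_(i | (i != i') && (i != i0)) dot (upd (bcol x l) i0 (q i0) i) (d i) =
   \prod_(i | (i != i') && (i != i0)) dot (bcol x l i) (bcol x l i).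
  by apply: eq_bigr => i /andP[h1 h2]; rewrite /d !upd_other.
by move/eqP; rewrite (negPf (prod_bcol_neq0 _ _)).
Qed.

(** As [zeta] is injective modulo [That x l], the directions it sends into [Ecol x J + That x l]
    have dimension at most [|J|] minus that of the intersection; [Z] is a complement to them in
    [Theta]. *)
Lemma zeta_complement (J : {set 'I_t}) : exists Z : {vspace {ffun X -> R^o}},
  [/\ (Z <= Theta x i' l)%VS, (n.-1 + \dim (Ecol x J :&: That x l) <= \dim Z + #|J|)%N &
   forall tau, tau \in Z -> zeta tau \in (Ecol x J + That x l)%VS -> tau = 0].
Proof.
have [F FE] := zeta_hom.
pose Al := (Theta x i' l :&: F @^-1: (Ecol x J + That x l))%VS.
exists (Theta x i' l :\: Al)%VS; split; first exact: diffvSl.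
  have dA : (\dim (F @: Al) = \dim Al)%N.
    apply: limg_dim_eq; apply/eqP; rewrite -subv0; apply/subvP => v.
    rewrite !memv_cap memv_ker => /andP[/andP[vT _] /eqP Fv].
    by rewrite (zeta_inj vT) ?mem0v // -FE Fv mem0v.
  have d2 : (\dim (F @: Al) + \dim (That x l) <= \dim (Ecol x J + That x l))%N.
    rewrite -dimv_disjoint_sum.
      apply: dimvS; rewrite subv_add addvSr andbT; apply/subvP => _ /memv_imgP[v vA ->].
      by move: vA; rewrite memv_cap memv_preim => /andP[].
    apply/eqP; rewrite -subv0; apply/subvP => y; rewrite memv_cap => /andP[/memv_imgP[v vA ->] h].
    move: vA; rewrite memv_cap => /andP[vT _].
    by rewrite (zeta_inj vT) ?linear0 ?mem0v // -FE.
  have d3 := dimv_sum_cap (Ecol x J) (That x l).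
  have d4 := dimv_cap_compl (Theta x i' l) Al.
  have d5 := dim_Theta_ge n_gt0 x i' l.
  have d6 := dim_Ecol x J.
  have e1 : (Theta x i' l :&: Al = Al)%VS by rewrite /Al capvA capvv.
  move: d2 d3 d4 d5 d6; rewrite dA e1.
  have ar (a b c d e f g h i j : nat) : (a + b <= c -> c + d = e + b -> a + f = g -> h <= g ->
    e <= i -> h + d <= f + i)%N by lia.
  exact: ar.
move=> tau; rewrite -FE => tZ h; apply/eqP; rewrite -memv0 -(capv_diff (Theta x i' l) Al).
rewrite memv_cap tZ /= memv_cap (subvP (diffvSl _ _) _ tZ) /=.
by rewrite -memv_preim.
Qed.

End Zeta.
End AtPoint.
End OneOrthogonal.

(** * Bounding the kernel with one orthonormal mode *)

Section OneOrthogonalKernel.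
Variables (R : realType) (k n t s : nat).
Hypothesis n_gt0 : (0 < n)%N.
Local Notation D := {ffun 'I_k -> 'I_n}.
Local Notation X := (vars k n t).
Local Notation kkt_at := (@kkt_at R k n t s).
Local Notation Tan := (@Tan R k n t s).
Local Notation Kern := (@Kern R k n t s).
Local Notation tangent := (@tangent R k n t s).
Local Notation W := {ffun D -> R^o}.
Variable z0 : 'I_k.
Hypothesis only1 : forall i : 'I_k, (i < s)%N = (i == z0).
Local Notation bcol := (@bcol R k n t z0).
Local Notation Bt := (@Bt R k n t z0).
Local Notation That := (@That R k n t z0).
Local Notation Ecol := (@Ecol R k n t z0).
Local Notation indep := (@indep R k n t z0).

Variable i1 : 'I_k.
Hypothesis i1z : i1 != z0.

Lemma Bt_in_That (x : X -> R) l : Bt x l \in That x l.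
Proof.
apply/ThatP; exists (fun i => if i == i1 then ucol x l i1 else fun=> 0).
rewrite (bigD1 i1) //= big1 ?addr0 => [|i /andP[_ /negPf->]]; last by rewrite rk_0.
by rewrite eqxx -{1}[Bt x l]scale1r (Bt_That _ _ _ i1z); congr (rk (upd _ _ _)); apply/funext => a; rewrite mul1r.
Qed.

Section AtPoint.
Variable x : X -> R.
Hypotheses (fx : feas s x) (u0 : forall j, ups x j != 0).
Local Notation u := (ucol x).

Definition eta2 l (i1 i2 : 'I_k) (tau : X -> R) : W :=
  rk (upd (bcol x l) i1 (ucol tau l i1)) + rk (upd (bcol x l) i2 (ucol tau l i2)).

(** Moves in two unit modes together, [2 (n - 1)] dimensions, change [Bt x l] injectively and
    orthogonally to itself. The changes that stay in [Ecol x J], which contains [Bt x l], therefore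
    span at most [|J| - 1] dimensions. *)
Lemma eta_complement l (i2 : 'I_k) (J : {set 'I_t}) : i2 != z0 -> i1 != i2 ->
  Bt x l \in Ecol x J -> exists Z : {vspace {ffun X -> R^o}},
  [/\ (Z <= Theta x i1 l + Theta x i2 l)%VS, (n.-1 + n.-1 + 1 <= \dim Z + #|J|)%N &
   forall tau, tau \in Z -> eta2 l i1 i2 tau \in Ecol x J -> tau = 0].
Proof.
move=> i2z i12 BE.
pose Th := (Theta x i1 l + Theta x i2 l)%VS.
have ThP tau : tau \in Th -> [/\ dot (u l i1) (ucol tau l i1) = 0, dot (u l i2) (ucol tau l i2) = 0 &
   forall z, (forall a, z != inl (i1, a, l)) -> (forall a, z != inl (i2, a, l)) -> tau z = 0].
  case/memv_addP => v vT [w wT ->].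
  have E i : ucol (v + w) l i = fun a => 1 * ucol v l i a + ucol w l i a.
    by apply/funext => a; rewrite /ucol addfE mul1r.
  have vz : ucol v l i2 = fun=> 0.
    by apply/funext => a; apply: (Theta_zero vT) => b; apply: contra i12 => /eqP[->].
  have wz : ucol w l i1 = fun=> 0.
    by apply/funext => a; apply: (Theta_zero wT) => b; apply: contra i12 => /eqP[->].
  split; first by rewrite E dot_linr (Theta_dot vT) wz dot0r mulr0 addr0.
    by rewrite E dot_linr (Theta_dot wT) vz dot0r mulr0 addr0.
  by move=> z h1 h2; rewrite addfE (Theta_zero vT) // (Theta_zero wT) // addr0.
have [F FE] : {F : 'Hom({ffun X -> R^o}, W) | forall v, F v = eta2 l i1 i2 v}.
  apply: lin_hom => a v w; rewrite /eta2 ffun_lin !ucol_lin !rk_lin scalerDr.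
  by rewrite addrACA.
have eta2_inj tau : tau \in Th -> eta2 l i1 i2 tau = 0 -> tau = 0.
  move=> /ThP[h1 h2 h3] e0.
  pose q i := if i == i1 then ucol tau l i1 else if i == i2 then ucol tau l i2 else fun=> 0 : R.
  have i21 : i2 == i1 = false by rewrite eq_sym (negPf i12).
  have q0 : forall i, i != z0 -> forall a, q i a = 0.
    apply: (That_inj n_gt0 fx (l := l) (q := q) i1z) => [i iz ii1|].
      rewrite /q (negPf ii1); case: eqP => [->|_]; last by rewrite dot0l.
      by rewrite dotC.
    rewrite (bigD1 i1) //= (bigD1 i2) /=; last by rewrite i2z i21.
    rewrite big1 ?addr0 => [|i /andP[/andP[_ a] b]]; last by rewrite /q (negPf a) (negPf b) rk_0.
    by rewrite /q eqxx i21 eqxx.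
  apply/ffunP => z; rewrite ffunE.
  have [/existsP[a /eqP->]|/existsPn n1] := boolP [exists a, z == inl (i1, a, l)].
    by have := q0 i1 i1z a; rewrite /q eqxx.
  have [/existsP[a /eqP->]|/existsPn n2] := boolP [exists a, z == inl (i2, a, l)].
    by have := q0 i2 i2z a; rewrite /q i21 eqxx.
  exact: h3.
pose Al := (Th :&: F @^-1: Ecol x J)%VS.
exists (Th :\: Al)%VS; split; first exact: diffvSl.
  have dT : \dim Th = (\dim (Theta x i1 l) + \dim (Theta x i2 l))%N.
    rewrite dimv_disjoint_sum //; apply/eqP; rewrite -subv0; apply/subvP => v.
    rewrite memv_cap memv0 => /andP[v1 v2]; apply/eqP/ffunP => z; rewrite ffunE.
    have [/existsP[a /eqP->]|/existsPn h] := boolP [exists a, z == inl (i1, a, l)].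
      by apply: (Theta_zero v2) => b; apply: contra i12 => /eqP[->].
    exact: (Theta_zero v1).
  have dA : \dim (F @: Al) = \dim Al.
    apply: limg_dim_eq; apply/eqP; rewrite -subv0; apply/subvP => v.
    rewrite !memv_cap memv_ker => /andP[/andP[vT _] /eqP Fv].
    by rewrite (eta2_inj v vT) ?mem0v // -FE.
  have Bn0 : Bt x l != 0.
    have : ip (Bt x l) (Bt x l) != 0 by rewrite /Bt ip_rk; exact: (prod_bcol_neq0 n_gt0 z0 fx xpredT l).
    by apply: contraNneq => ->; rewrite ip_0l.
  have d2 : (\dim (F @: Al) + 1 <= #|J|)%N.
    have <- : \dim <[Bt x l]> = 1%N by rewrite dim_vline Bn0.
    rewrite -dimv_disjoint_sum.
      apply: leq_trans (dim_Ecol z0 x J); apply: dimvS; rewrite subv_add -memvE BE andbT.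
      by apply/subvP => _ /memv_imgP[v vA ->]; move: vA; rewrite memv_cap memv_preim => /andP[].
    apply/eqP; rewrite -subv0; apply/subvP => y; rewrite memv_cap => /andP[/memv_imgP[v vA ->] /vlineP[c cE]].
    move: vA; rewrite memv_cap => /andP[/ThP[h1 h2 _] _].
    have : ip (F v) (Bt x l) = 0.
      have z i : i != z0 -> dot (u l i) (ucol v l i) = 0 -> ip (rk (upd (bcol x l) i (ucol v l i))) (Bt x l) = 0.
        by move=> iz h; apply: (@ip_rk_zero _ _ _ _ _ i); rewrite upd_same bcol_i // dotC.
      rewrite FE /eta2 -[rk (upd _ i1 _)]scale1r ip_linl z // z // mulr0 addr0 //.
    rewrite cE ip_Zl ip_rk => /eqP; rewrite mulf_eq0 (negPf (prod_bcol_neq0 n_gt0 z0 fx xpredT l)) orbF => /eqP ->.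
    by rewrite scale0r mem0v.
  have d4 := dimv_cap_compl Th Al.
  have e1 : (Th :&: Al = Al)%VS by rewrite /Al capvA capvv.
  have d5 := dim_Theta_ge n_gt0 x i1 l; have d6 := dim_Theta_ge n_gt0 x i2 l.
  move: d2 d4 d5 d6; rewrite dA e1 dT.
  have ar (a b c d e f g : nat) : (a + 1 <= b -> a + c = d + e -> f <= d -> f <= e -> f + f + 1 <= c + b)%N by lia.
  exact: ar.
move=> tau; rewrite -FE => tZ h; apply/eqP; rewrite -memv0 -(capv_diff Th Al).
rewrite memv_cap tZ /= memv_cap (subvP (diffvSl _ _) _ tZ) /=.
by rewrite -memv_preim.
Qed.

Variable I : {set 'I_t}.
Hypothesis indI : indep x I.

(** The entries of [xi] between columns of [I] in mode [z0] form a skew matrix, so for [l] in [I]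
    only those of smaller index are free. This order makes the relations triangular. *)
Definition below (l : 'I_t) : {set 'I_t} := if l \in I then [set j in I | (j < l)%N] else I.

Lemma below_sub l : below l \subset I.
Proof. by rewrite /below; case: ifP => // _; apply/subsetP => j; rewrite inE => /andP[]. Qed.

Definition krow (xi : X -> R) l : W :=
  \sum_(j in below l) (ups x j * dot (u l z0) (ucol xi j z0)) *: Bt x j.

Lemma krow0 xi l : krow xi l = 0 -> forall j, j \in below l -> dot (u l z0) (ucol xi j z0) = 0.
Proof.
move=> r0 j jl; have := indep_sub (below_sub l) indI r0 jl.
by move/eqP; rewrite mulf_eq0 (negPf (u0 j)) => /eqP.
Qed.

(** Entries of larger index are, up to sign, entries of later rows, which vanish; the slot equation
    then expresses the row through the tangent cone. *)
Lemma krow_That xi l : l \in I -> tangent x xi -> dPhi x xi = 0 ->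
  (forall j a, j \notin I -> ucol xi j z0 a = 0) ->
  (forall l', l' \in I -> (l < l')%N -> krow xi l' = 0) -> krow xi l \in That x l.
Proof.
move=> lI tx dx xI r0; have := slot_eq only1 fx l dx.
have -> : \sum_j (ups x j * dot (u l z0) (ucol xi j z0)) *: Bt x j = krow xi l.
  rewrite /krow [RHS]big_mkcond; apply: eq_bigr => j _; case: ifP => // jl.
  suff -> : dot (u l z0) (ucol xi j z0) = 0 by rewrite mulr0 scale0r.
  have [jI|jI] := boolP (j \in I); last first.
    by rewrite (_ : ucol xi j z0 = fun=> 0) ?dot0r //; apply/funext => a; exact: xI.
  move: jl; rewrite /below lI inE jI /= => /negbT; rewrite -leqNgt leq_eqVlt => /orP[/eqP/val_inj->|lj].
    by rewrite dotC (tangent_self _ _ tx).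
  rewrite (tangent_skew _ _ (z0s only1) tx) (krow0 (r0 j jI lj)) ?oppr0 //.
  by rewrite /below jI inE lI lj.
move/eqP; rewrite -addrA addr_eq0 => /eqP ->.
rewrite memvN; apply: memvD; apply: memvZ; first exact: Bt_in_That.
by apply/ThatP; eexists.
Qed.

(** Once all rows vanish, the factors of [xi] in mode [z0] are orthogonal to all columns.
    Contracting [dPhi x xi = 0] with such a factor leaves a relation between independent [Bt], one
    coefficient of which is a nonzero multiple of its square norm. *)
Lemma krow_inj xi : tangent x xi -> dPhi x xi = 0 ->
  (forall j a, j \notin I -> ucol xi j z0 a = 0) ->
  (forall l, l \in I -> krow xi l = 0) -> forall z, xi z = 0.
Proof.
move=> tx dx xI r0; apply: (kern_zero fx u0 (z0s only1) tx dx) => m.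
have [mI|mI] := boolP (m \in I); last by move=> a; exact: xI.
have o l : dot (u l z0) (ucol xi m z0) = 0.
  have lt l1 l2 : l1 \in I -> l2 \in I -> (l2 < l1)%N -> dot (u l1 z0) (ucol xi l2 z0) = 0.
    by move=> h1 h2 h; apply: (krow0 (r0 l1 h1)); rewrite /below h1 inE h2 h.
  have [lI|lI] := boolP (l \in I); last first.
    rewrite (tangent_skew _ _ (z0s only1) tx) (_ : ucol xi l z0 = fun=> 0) ?dot0r ?oppr0 //.
    by apply/funext => a; exact: xI.
  have [lm|ml|/val_inj->] := ltngtP l m; last by rewrite dotC (tangent_self _ _ tx).
    by rewrite (tangent_skew _ _ (z0s only1) tx) lt // oppr0.
  exact: lt.
apply: dot_eq0; have := ctr_dPhi z0 x xi (ucol xi m z0); rewrite dx ctr0 => /esym E.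
have E' : \sum_(j in I) (ups x j * dot (ucol xi m z0) (ucol xi j z0)) *: Bt x j = 0.
  rewrite -[RHS]E big_mkcond; apply: eq_bigr => j _; rewrite [dot _ (u j z0)]dotC o !mulr0 add0r scale0r addr0.
  case: ifP => // /negbT jI; rewrite (_ : ucol xi j z0 = fun=> 0) ?dot0r ?mulr0 ?scale0r //.
  by apply/funext => a; exact: xI.
by have /eqP := indI E' mI; rewrite mulf_eq0 (negPf (u0 m)) => /eqP.
Qed.

(** Columns outside [I] cost [n - 1] each. On what is left the rows are read in decreasing order,
    each lying in the tangent cone of its column once the later rows vanish. *)
Lemma kern_dim_rows : (\dim (Kern x) <= #|~: I| * n.-1 + \sum_(l in I) \dim (Ecol x (below l) :&: That x l))%N.
Proof.
have [U [dU UP]] := kern_dim_columns n_gt0 fx z0 (~: I) (capvSl (Tan x) (lker (dPhiH x)) : (Kern x <= Tan x)%VS).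
apply: leq_trans dU _; rewrite leq_add2l.
have U' v : v \in U -> [/\ tangent x v, dPhi x v = 0 & forall j a, j \notin I -> ucol v j z0 a = 0].
  by move=> /UP[/KernP[tv dv] h]; split=> // j a jI; apply: h; rewrite inE.
have /choice[f fE] : forall l, exists F : 'Hom({ffun X -> R^o}, W), forall v, F v = krow v l.
  move=> l; have [|F FE] := @lin_hom R _ _ (fun v : {ffun X -> R^o} => krow v l); last by exists F.
  move=> a v w; rewrite /krow scaler_sumr -big_split; apply: eq_bigr => j _ /=.
  by rewrite ffun_lin ucol_lin dot_linr scalerA -scalerDl; congr (_ *: _); ring.
pose s0 := sort (fun a b : 'I_t => (b <= a)%N) (enum I).
have s0m l : (l \in s0) = (l \in I) by rewrite mem_sort mem_enum.
have := @dim_filtration R _ _ _ f (fun l => \dim (Ecol x (below l) :&: That x l)) U s0.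
have -> : (\sum_(l <- s0) \dim (Ecol x (below l) :&: That x l) =
  \sum_(l in I) \dim (Ecol x (below l) :&: That x l))%N.
  by rewrite (perm_big (enum I)) ?perm_sort // big_enum.
have kerI l (J : seq 'I_t) v : l \in J -> v \in (\bigcap_(j <- J) lker (f j))%VS -> krow v l = 0.
  move=> lJ vI; rewrite -fE; apply/eqP; rewrite -memv_ker; apply: (subvP _ _ vI).
  by rewrite (big_rem l) //= capvSl.
have -> : (U :&: \bigcap_(j <- s0) lker (f j))%VS = 0%VS.
  apply/eqP; rewrite -subv0; apply/subvP => v; rewrite memv_cap => /andP[/U'[tv dv h] vI].
  rewrite memv0; apply/eqP/ffunP => z; rewrite ffunE; apply: krow_inj => // l lI.
  by apply: kerI vI; rewrite s0m.
rewrite dimv0 addn0; apply => s1 l s2 E.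
have lI : l \in I by rewrite -s0m E mem_cat mem_head orbT.
apply: dimvS; apply/subvP => _ /memv_imgP[v vI ->].
move: vI; rewrite memv_cap => /andP[/U'[tv dv h] vI]; rewrite fE memv_cap; apply/andP; split.
  by apply/EcolP; eexists.
apply: krow_That => // l' l'I ll'; apply: kerI vI.
have : l' \in s0 by rewrite s0m.
rewrite E mem_cat inE => /or3P[//|/eqP E1|l's2]; first by rewrite E1 ltnn in ll'.
have : sorted (fun a b : 'I_t => (b <= a)%N) s0.
  by apply: sort_sorted => a b; exact: leq_total.
rewrite E => /cat_sorted2[_]; rewrite /= path_sortedE; last by move=> a b c h1 h2; exact: leq_trans h2 h1.
by move=> /andP[/allP/(_ _ l's2)]; rewrite leqNgt ll'.
Qed.

End AtPoint.
End OneOrthogonalKernel.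

(** * Counting relations between reduced rank-one tensors *)

Lemma ltn_sum_strict (I : finType) (a b : I -> nat) : (forall i, a i <= b i)%N ->
  (exists i, a i < b i)%N -> (\sum_i a i < \sum_i b i)%N.
Proof.
move=> h [i hi]; rewrite (bigD1 i) //= [X in (_ < X)%N](bigD1 i) //=.
by rewrite -addSn leq_add // leq_sum.
Qed.

Lemma leq_of_add (a c d e : nat) : (a + c <= d + e -> e <= a -> c <= d)%N.
Proof. by lia. Qed.

Lemma ltn_of_add (a c d e : nat) : (a + c <= d + e -> e < a -> c < d)%N.
Proof. by lia. Qed.

Lemma pred_double_lt (a c d : nat) : (a.-1 + a.-1 + 1 <= c + d -> 0 < a -> d < a -> a.-1 < c)%N.
Proof. by lia. Qed.

Section OneOrthogonalNull.
Variables (R : realType) (k n t s : nat).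
Hypotheses (n_gt0 : (0 < n)%N) (tn : (t <= n)%N).
Local Notation D := {ffun 'I_k -> 'I_n}.
Local Notation X := (vars k n t).
Local Notation kkt_at := (@kkt_at R k n t s).
Local Notation Tan := (@Tan R k n t s).
Local Notation Kern := (@Kern R k n t s).
Local Notation tangent := (@tangent R k n t s).
Local Notation W := {ffun D -> R^o}.
Variables z0 i1 i2 : 'I_k.
Hypothesis only1 : forall i : 'I_k, (i < s)%N = (i == z0).
Hypotheses (i1z : i1 != z0) (i2z : i2 != z0) (i12 : i1 != i2).
Local Notation bcol := (@bcol R k n t z0).
Local Notation Bt := (@Bt R k n t z0).
Local Notation That := (@That R k n t z0).
Local Notation Ecol := (@Ecol R k n t z0).
Local Notation indep := (@indep R k n t z0).

(** Multiples of the column are moved from every other mode into mode [i']; in whichever mode they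
    stand, they contribute multiples of the same tensor [Bt x l]. *)
Lemma That_normal (x : X -> R) l (i' : 'I_k) v : feas s x -> i' != z0 -> v \in That x l ->
  exists q : 'I_k -> 'I_n -> R, [/\ v = \sum_(i | i != z0) rk (upd (bcol x l) i (q i)),
    forall a, q z0 a = 0 & forall i, i != z0 -> i != i' -> dot (q i) (ucol x l i) = 0].
Proof.
move=> fx i'z /ThatP[p vp].
pose c i := dot (p i) (ucol x l i).
pose C := \sum_(i | (i != z0) && (i != i')) c i.
pose q i a := if i == z0 then 0 else if i == i' then p i a + C * ucol x l i a
  else - c i * ucol x l i a + p i a.
exists q; split=> [|a|i iz ii'].
- rewrite vp (bigD1 i') //= [RHS](bigD1 i') //=.
  have -> : rk (upd (bcol x l) i' (q i')) = rk (upd (bcol x l) i' (p i')) + C *: Bt x l.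
    rewrite (Bt_That _ _ _ i'z) -[rk (upd _ i' (p i'))]scale1r -rk_lin; congr (rk (upd _ _ _)).
    by apply/funext => a; rewrite /q (negPf i'z) eqxx mul1r.
  have -> : \sum_(i | (i != z0) && (i != i')) rk (upd (bcol x l) i (q i)) =
      \sum_(i | (i != z0) && (i != i')) (rk (upd (bcol x l) i (p i)) - c i *: Bt x l).
    apply: eq_bigr => i /andP[iz ii']; rewrite -scaleNr (Bt_That _ _ _ iz) addrC.
    rewrite -[X in _ = X + _]scale1r -rk_lin; congr (rk (upd _ _ _)); apply/funext => a.
    by rewrite /q (negPf iz) (negPf ii') mul1r.
  rewrite sumrB -scaler_suml -/C -!addrA; congr (_ + _).
  by rewrite addrCA subrr addr0.
- by rewrite /q eqxx.
- have -> : q i = fun a => - c i * ucol x l i a + p i a.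
    by apply/funext => a; rewrite /q (negPf iz) (negPf ii').
  by rewrite dot_linl (unit_col fx) mulr1 addNr.
Qed.

Section Relation.
Variables (Au : finType) (ca : 'I_t -> pexpr R (X + Au)%type) (qa : 'I_k -> 'I_n -> pexpr R (X + Au)%type).
Definition vu i a j : pexpr R (X + Au)%type := PX (inl (inl (i, a, j))).
Definition vb (j : 'I_t) : 'I_k -> 'I_n -> pexpr R (X + Au)%type :=
  upd (fun i a => vu i a j) z0 (fun=> PC 1).
(** Entry [J] of the relation that puts a combination of the [Bt] into the tangent cone of column
    [l]. Coefficients and factors are arbitrary expressions because two different parametrizations
    of them are used. *)
Definition relP l (J : D) : pexpr R (X + Au)%type :=
  PA (psum predT (fun j => PM (ca j) (rkP (vb j) J)))
     (PM (PC (-1)) (psum (fun i => i != z0) (fun i => rkP (upd (vb l) i (qa i)) J))).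

Variables (w v : X + Au -> R).
Local Notation x := (xpart w).
Local Notation tau := (xpart v).
Local Notation auxa w j := (ev (ca j) w).
Local Notation auxq w i := (fun a => ev (qa i a) w).
Local Notation dva j := (dv (ca j) w v).
Local Notation dvq i := (fun a => dv (qa i a) w v).

Lemma ev_vb j : (fun i a => ev (vb j i a) w) = bcol x j.
Proof. by apply/funext => i; apply/funext => a; rewrite /vb /bcol /upd; case: eqP. Qed.

Lemma ev_vb_upd l i : (fun i' a => ev (upd (vb l) i (qa i) i' a) w) = upd (bcol x l) i (auxq w i).
Proof.
by apply/funext => i'; rewrite /upd; case: (i' == i) => //; rewrite -ev_vb.
Qed.

Lemma dv_vb j i : (fun a => dv (vb j i a) w v) = if i == z0 then fun=> 0 else ucol tau j i.
Proof. by apply/funext => a; rewrite /vb /upd; case: eqP. Qed.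

Lemma ev_relP l J : ev (relP l J) w =
  (\sum_j auxa w j *: Bt x j - \sum_(i | i != z0) rk (upd (bcol x l) i (auxq w i))) J.
Proof.
rewrite /= !ev_psum /= addfE oppfE !sum_ffunE mulN1r; congr (_ - _).
  by apply: eq_bigr => j _; rewrite /= ev_rkP ev_vb scalefE rkE.
by apply: eq_bigr => i _; rewrite ev_rkP ev_vb_upd rkE.
Qed.

Lemma dv_relP l : (forall J, dv (relP l J) w v = 0) ->
  \sum_j dva j *: Bt x j + \sum_j auxa w j *: \sum_(i | i != z0) rk (upd (bcol x j) i (ucol tau j i)) =
  \sum_(i | i != z0) (rk (upd (bcol x l) i (dvq i)) +
     \sum_(i' | (i' != z0) && (i' != i)) rk (upd (upd (bcol x l) i (auxq w i)) i' (ucol tau l i'))).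
Proof.
move=> h; apply/ffunP => J; have := h J; rewrite /= !dv_psum /= mul0r add0r mulN1r.
have rk1_0 c (i : 'I_k) : rk1 (upd c i (fun=> 0)) J = 0 :> R by rewrite -rkE rk_0 ffunE.
move/eqP; rewrite subr_eq0 => /eqP E; rewrite addfE !sum_ffunE -big_split /=.
rewrite [LHS](_ : _ = \sum_j dv (PM (ca j) (rkP (vb j) J)) w v); last first.
  apply: eq_bigr => j _; rewrite /= ev_rkP ev_vb dv_rkP ev_vb !scalefE rkE; congr (_ + _ * _).
  rewrite sum_ffunE [RHS](bigD1 z0) //= dv_vb eqxx rk1_0 add0r; apply: eq_bigr => i iz.
  by rewrite dv_vb (negPf iz) rkE.
rewrite E; apply: eq_bigr => i iz; rewrite dv_rkP ev_vb_upd addfE sum_ffunE rkE.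
rewrite (bigD1 i) //=; congr (_ + _).
  by rewrite upd_upd; congr (rk1 (upd _ _ _) _); apply/funext => a; rewrite upd_same.
rewrite (bigD1 z0) 1?eq_sym //=.
have dvo i' : i' != i -> (fun a => dv (upd (vb l) i (qa i) i' a) w v) = if i' == z0 then fun=> 0 else ucol tau l i'.
  by move=> ii; rewrite -dv_vb; apply/funext => a; rewrite upd_other.
rewrite dvo 1?eq_sym // eqxx rk1_0 add0r; apply: eq_big => [i'|i' /andP[ii iz']].
  by rewrite andbC.
by rewrite dvo // (negPf iz') rkE.
Qed.

End Relation.

Definition Aux : finType := ('I_t * 'I_t + 'I_t * 'I_k * 'I_n)%type.
Definition va l j : pexpr R (X + Aux)%type := PX (inr (inl (l, j))).
Definition vq l i a : pexpr R (X + Aux)%type := PX (inr (inr (l, i, a))).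
Definition auxa (w : X + Aux -> R) l j : R := w (inr (inl (l, j))).
Definition auxq (w : X + Aux -> R) l i a : R := w (inr (inr (l, i, a))).

Section Pattern.
Variables (I Fl : {set 'I_t}) (Qs : {ffun 'I_t -> {set 'I_t}}) (qs : {ffun 'I_t -> 'I_t}).
Local Notation below := (@below t I).

Definition con_aux_ix : finType := ('I_t * 'I_t + 'I_t * 'I_k * 'I_n + 'I_t * 'I_k + 'I_t * D)%type.

(** These constraints make the auxiliary data of every column unique: no relation for columns of [I]
    outside [Fl], a normalized one for those in [Fl], and for a column outside [I] the expansion of
    [Bt] itself, encoded by prescribing the column in mode [i1] and zero in the other modes. *)
Definition con_aux (c : con_aux_ix) : pexpr R (X + Aux)%type :=
  match c with
  | inl (inl (inl (l, j))) =>
      if ((l \in I) && (l \notin Fl)) || (j \notin below l) then va l j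
      else if (l \in I) && (j \in Qs l) then PA (va l j) (PC (- (j == qs l)%:R)) else PC 0
  | inl (inl (inr (l, i, a))) =>
      if l \notin I then PA (vq l i a) (if i == i1 then PM (PC (-1)) (vu Aux i a l) else PC 0)
      else if (l \notin Fl) || (i == z0) then vq l i a else PC 0
  | inl (inr (l, i)) =>
      if [&& l \in I, i != z0 & i != i1] then psum predT (fun a => PM (vq l i a) (vu Aux i a l)) else PC 0
  | inr (l, J) => relP (va l) (vq l) l J
  end.

Definition null_vec (x : X -> R) l (al : 'I_t -> R) :=
  (forall j, j \notin below l -> al j = 0) /\ \sum_j al j *: Bt x j \in That x l.

(* [Fl] collects the columns whose tangent cone meets the span of the previous ones; there the relation
   is normalized to be [1] at [qs l] and [0] on the rest of the minimal coordinate set [Qs l]. *)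
Definition one_pattern (x : X -> R) : Prop :=
  [/\ indep x I, forall l, l \notin I -> Bt x l \in Ecol x I,
     forall l, l \in I -> l \notin Fl -> (Ecol x (below l) :&: That x l = 0)%VS,
     forall l, l \in I -> l \in Fl -> (forall al, null_vec x l al -> (forall j, j \in Qs l -> al j = 0) -> forall j, al j = 0) /\
        exists al, [/\ null_vec x l al, forall j, j \in Qs l -> al j = (j == qs l)%:R & qs l \in Qs l] &
     (exists l, l \notin I) \/ (exists l, [/\ l \in I, l \in Fl & (#|below l| < n.-1)%N])].

Lemma sum_below (x : X -> R) l (al : 'I_t -> R) : (forall j, j \notin below l -> al j = 0) ->
  \sum_j al j *: Bt x j = \sum_(j in below l) al j *: Bt x j.
Proof.
move=> h; rewrite (bigID (mem (below l))) /= [X in _ + X]big1 ?addr0 // => j jl.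
by rewrite h // scale0r.
Qed.

Lemma card_below l : (#|below l| <= n.-1)%N.
Proof.
have ll : l \notin below l by rewrite /below; case: ifP => [lI|->//]; rewrite inE ltnn andbF.
have : (#|below l| < t)%N.
  rewrite -[X in (_ < X)%N]card_ord -cardsT; apply: proper_card; rewrite properE subsetT /=.
  by apply/subsetPn; exists l.
by move=> h; have := leq_trans h tn; case: (n) n_gt0.
Qed.

(** Each column brings a space of moves excluded by its relation, of dimension at least the [cost]
    of the column in the bound for the kernel of [dPhi]. The variation of a relation involves only
    its own column and those in [below], so the moves vanish column by column, and then the
    auxiliary variations by uniqueness: [m = 0]. One strict inequality suffices. *)
Lemma null_one_pattern : null_set (fun A : tensor R k n => exists x,
  [/\ kkt_at A x, forall j, ups x j != 0 & one_pattern x]).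
Proof.
apply: null_sub (null_stratum s n_gt0 con_aux (Qe := void)
  (fun v _ => match v with end) (fun v => match v with end)).
move=> A [x [kx u0 [ind BE nFl Flp str]]].
have fx := kkt_feas kx.
pose cost l := if l \in I then \dim (Ecol x (below l) :&: That x l) else n.-1.
(* Only for these columns may dimension and cost agree: there is no relation, or [below l] is so
   large that [zeta_complement] leaves no surplus. *)
pose tight l := (l \in I) && ((l \notin Fl) || (n.-1 <= #|below l|)%N).
pose good l (p : ('I_t -> R) * ('I_k -> 'I_n -> R) * {vspace {ffun X -> R^o}}) := 
  let al := p.1.1 in let q := p.1.2 in let Z := p.2 in
  [/\ (forall j, j \notin below l -> al j = 0) /\
      \sum_j al j *: Bt x j = \sum_(i | i != z0) rk (upd (bcol x l) i (q i)),
    (l \in I -> l \notin Fl -> (forall j, al j = 0) /\ forall i a, q i a = 0) /\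
      (l \notin I -> forall i a, q i a = if i == i1 then ucol x l i a else 0),
    l \in I -> l \in Fl -> [/\ forall j, j \in Qs l -> al j = (j == qs l)%:R, forall a, q z0 a = 0 &
       forall i, i != z0 -> i != i1 -> dot (q i) (ucol x l i) = 0],
    [/\ (Z <= Tan x)%VS, forall v, v \in Z -> (forall z, colof z != l -> v z = 0) /\
        (ups v l = 0 /\ forall a, ucol v l z0 a = 0),
      (cost l <= \dim Z)%N & ~~ tight l -> (cost l < \dim Z)%N] &
    forall (tau : {ffun X -> R^o}) (da : 'I_t -> R) dq, tau \in Z -> (forall j, j \notin below l -> da j = 0) ->
      (l \notin I -> forall i a, dq i a = if i == i1 then ucol tau l i a else 0) ->
      \sum_j da j *: Bt x j = \sum_(i | i != z0) (rk (upd (bcol x l) i (dq i)) +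
        \sum_(i' | (i' != z0) && (i' != i)) rk (upd (upd (bcol x l) i (q i)) i' (ucol tau l i'))) ->
      tau = 0].
have ThT i' l v : i' != z0 -> v \in Theta x i' l -> [/\ v \in Tan x, forall z, colof z != l -> v z = 0,
    ups v l = 0 & forall i a, i != i' -> ucol v l i a = 0].
  move=> iz vT; split; first by apply/TanP; apply: Theta_tangent vT; exact: (unit_mode only1).
  - exact: Theta_col vT.
  - exact: (Theta_zero vT).
  - by move=> i a ii; apply: (Theta_zero vT) => b; apply: contra ii => /eqP[->].
have goodE l : exists p, good l p.
  have [lI|lI] := boolP (l \in I); last first.
    have bI : below l = I by rewrite /below (negPf lI).
    have /EcolP[be beE] := BE l lI.
    pose be' j := if j \in I then be j else 0.
    have be0 j : j \notin I -> be' j = 0 by rewrite /be' => /negPf->.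
    pose q i := if i == i1 then ucol x l i else fun=> 0 : R.
    have [Z [ZT dZ Zi]] := eta_complement n_gt0 i1z fx i2z i12 (BE l lI).
    have ZT' v : v \in Z -> exists2 v1, v1 \in Theta x i1 l & exists2 v2, v2 \in Theta x i2 l & v = v1 + v2.
      by move=> /(subvP ZT)/memv_addP[v1 ? [v2 ? ->]]; exists v1 => //; exists v2.
    exists (be', q, Z); split=> /=.
    - split; first by move=> j; rewrite bI; exact: be0.
      rewrite (@sum_below x l be') bI; last exact: be0.
      rewrite (bigD1 i1) //= [X in _ = _ + X]big1 ?addr0 => [|i /andP[_ ii]]; last by rewrite /q (negPf ii) rk_0.
      rewrite /q eqxx -[RHS](_ : Bt x l = _).
        by rewrite beE; apply: eq_bigr => j jI; rewrite /be' jI.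
      rewrite -[Bt x l]scale1r (Bt_That _ _ _ i1z); congr (rk (upd _ _ _)).
      by apply/funext => a; rewrite mul1r.
    - by split=> [lI'|_ i a]; [rewrite lI' in lI|rewrite /q; case: eqP].
    - by move=> lI'; rewrite lI' in lI.
    - have dd : (n.-1 < \dim Z)%N.
        have : (#|I| < t)%N.
          rewrite -[X in (_ < X)%N]card_ord -cardsT; apply: proper_card; rewrite properE subsetT /=.
          by apply/subsetPn; exists l.
        move=> It; have := leq_trans It tn; move: dZ n_gt0.
        exact: pred_double_lt.
      split.
      + apply/subvP => v /ZT'[v1 /(ThT _ _ _ i1z)[h1 _ _ _] [v2 /(ThT _ _ _ i2z)[h2 _ _ _] ->]].
        exact: memvD.
      + move=> v /ZT'[v1 /(ThT _ _ _ i1z)[_ h1 g1 e1] [v2 /(ThT _ _ _ i2z)[_ h2 g2 e2] ->]].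
        split; first by move=> z zl; rewrite addfE h1 // h2 // addr0.
        split; first by rewrite /ups addfE; move: g1 g2; rewrite /ups => -> ->; rewrite addr0.
        move=> a; have := e1 z0 a; have := e2 z0 a; rewrite /ucol addfE => -> //; last by rewrite eq_sym.
        by move=> -> //; rewrite ?addr0 // eq_sym.
      + by rewrite /cost (negPf lI) ltnW.
      + by rewrite /cost (negPf lI).
    - move=> tau da dq tZ da0 dqE; rewrite (@sum_below x l da da0) bI => E.
      apply: Zi => //.
      have [v1 /(ThT _ _ _ i1z)[_ _ _ e1] [v2 /(ThT _ _ _ i2z)[_ _ _ e2] tE]] := ZT' _ tZ.
      have t0 i : i != i1 -> i != i2 -> ucol tau l i = fun=> 0.
        move=> h1 h2; apply/funext => a; have := e1 i a h1; have := e2 i a h2.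
        by rewrite tE /ucol addfE => -> ->; rewrite addr0.
      suff -> : eta2 z0 x l i1 i2 tau = \sum_(j in I) da j *: Bt x j by apply/EcolP; exists da.
      rewrite E (bigD1 i1) //= [X in _ = _ + X]big1 ?addr0 => [|i /andP[iz ii]]; last first.
        have -> : dq i = fun=> 0 by apply/funext => a; rewrite dqE // (negPf ii).
        rewrite rk_0 add0r big1 // => i' /andP[i'z i'i].
        by rewrite updC 1?eq_sym // /q (negPf ii) rk_0.
      rewrite /eta2; congr (_ + _).
        by congr (rk (upd _ _ _)); apply/funext => a; rewrite dqE // eqxx.
      rewrite (bigD1 i2) /=; last by rewrite i2z eq_sym.
      rewrite big1 ?addr0 => [|i /andP[/andP[iz h1] h2]]; last by rewrite t0 // rk_0.
      congr (rk (upd _ _ _)); rewrite /q eqxx -[RHS](_ : bcol x l = _) //.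
      by apply/funext => i; rewrite /upd; case: eqP => // ->; rewrite /bcol upd_other.
  have [lF|lF] := boolP (l \in Fl); last first.
    exists (fun=> 0, fun _ _ => 0, 0%VS); split=> /=.
    - split=> //; rewrite big1 => [|j _]; last by rewrite scale0r.
      by apply/esym/big1 => i _; exact: rk_0.
    - by split=> [//|lI']; rewrite lI in lI'.
    - by move=> _ lF'; rewrite lF' in lF.
    - split; first exact: sub0v.
      + by move=> v; rewrite memv0 => /eqP ->; split=> [z _|]; [rewrite ffunE|split=> [|a]; rewrite /ups /ucol ffunE].
      + by rewrite /cost lI (nFl l lI lF) dimv0.
      + by rewrite /tight lI /= lF.
    - by move=> tau da dq; rewrite memv0 => /eqP.
  have [_ [al [[al0 alT] alQ qQ]]] := Flp l lI lF.
  have [q [qE qz qn]] := That_normal fx i1z alT.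
  have lb : l \notin below l by rewrite /below lI inE ltnn andbF.
  (* Otherwise the relation would involve only the [Bt] of [I], with coefficient 1 at [qs l],
     against their independence. *)
  have [i0 i0z [a0 qa]] : exists2 i0, i0 != z0 & exists a, q i0 a != dot (q i0) (ucol x l i0) * ucol x l i0 a.
    apply: contrapT => npar.
    have par i : i != z0 -> q i = fun a => dot (q i) (ucol x l i) * ucol x l i a.
      move=> iz; apply/funext => a; apply: contrapT => h; apply: npar; exists i => //.
      by exists a; apply/eqP.
    have E : \sum_j al j *: Bt x j = (\sum_(i | i != z0) dot (q i) (ucol x l i)) *: Bt x l.
      rewrite qE scaler_suml; apply: eq_bigr => i iz.
      by rewrite (Bt_That _ _ _ iz) -par.
    have qb : qs l \in below l.
      by apply: contraT => /al0; rewrite alQ // eqxx => /eqP; rewrite oner_eq0.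
    pose al' j := al j - (j == l)%:R * (\sum_(i | i != z0) dot (q i) (ucol x l i)).
    have s0 : \sum_(j in I) al' j *: Bt x j = 0.
      have bI : {subset below l <= I} by apply/subsetP; exact: below_sub.
      rewrite /al'; under eq_bigr => j _ do rewrite scalerBl.
      rewrite sumrB [X in _ - X](bigD1 l) //= eqxx mul1r [X in _ - (_ + X)]big1 ?addr0; last first.
        by move=> j /andP[_ /negPf->]; rewrite mul0r scale0r.
      rewrite -E; apply/eqP; rewrite subr_eq0; apply/eqP; rewrite [RHS](bigID (mem I)) /=.
      rewrite [X in _ = _ + X]big1 ?addr0 // => j jI; rewrite al0 ?scale0r //.
      by apply: contra jI; exact: bI.
    have := ind _ s0 (qs l) (subsetP (below_sub I l) _ qb).
    rewrite /al' alQ // eqxx; case: eqP => [E1|_]; first by move: qb; rewrite E1 (negPf lb).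
    by rewrite mul0r subr0 => /eqP; rewrite oner_eq0.
  (* The mode to be moved must differ from [i0]; two unit modes make this possible. *)
  pose i' := if i0 == i1 then i2 else i1.
  have i'z : i' != z0 by rewrite /i'; case: ifP.
  have i0i' : i0 != i' by rewrite /i'; case: (eqVneq i0 i1) => [->|].
  have [Z [ZT dZ Zi]] := zeta_complement n_gt0 fx i0z i'z i0i' (ex_intro _ a0 qa) (below l).
  have ZT' v : v \in Z -> v \in Theta x i' l by move/(subvP ZT).
  exists (al, q, Z); split=> /=.
  - by [].
  - by split=> [_ lF'|lI']; [rewrite lF in lF'|rewrite lI in lI'].
  - by move=> _ _; split.
  - have cb := card_below l.
    split.
    + by apply/subvP => v /ZT'/(ThT _ _ _ i'z)[].
    + by move=> v /ZT'/(ThT _ _ _ i'z)[_ h1 h2 h3]; split=> //; split=> // a; apply: h3; rewrite eq_sym.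
    + by rewrite /cost lI; exact: leq_of_add dZ cb.
    + by rewrite /cost /tight lI lF /= -ltnNge; exact: ltn_of_add dZ.
  - move=> tau da dq tZ da0 _; rewrite (@sum_below x l da da0) => E; apply: Zi => //.
    have [_ _ _ t0] := ThT _ _ _ i'z (ZT' _ tZ).
    have zE : zeta z0 x l q i' tau = \sum_(j in below l) da j *: Bt x j - \sum_(i | i != z0) rk (upd (bcol x l) i (dq i)).
      rewrite E big_split /= addrAC subrr add0r /zeta big_mkcondr /=; apply: eq_bigr => i iz.
      have t0' j : j != i' -> ucol tau l j = fun=> 0 by move=> h; apply/funext => a; exact: t0.
      have [->|ii'] := eqVneq i i'.
        by rewrite big1 // => j /andP[_ ji]; rewrite t0' // rk_0.
      rewrite (bigD1 i') /=; last by rewrite i'z eq_sym.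
      by rewrite big1 ?addr0 // => j /andP[_ ji]; rewrite t0' // rk_0.
    rewrite zE; apply: memv_add; first by apply/EcolP; exists da.
    by rewrite memvN; apply/ThatP; exists dq.
have /choice[p pP] := goodE.
pose w (z : X + Aux) : R := match z with
  | inl z => x z | inr (inl (l, j)) => (p l).1.1 j | inr (inr (l, i, a)) => (p l).1.2 i a end.
have xE : xpart w = x by apply/funext.
exists w; rewrite !xE; split=> //.
- case=> [[[[l j]|[[l i] a]]|[l i]]|[l J]].
  + have [[h1 _] [h2 _] h3 _ _] := pP l; rewrite /=.
    case: ifP => [/orP[/andP[lI lF]|jb]|/negbT].
    * by have [h _] := h2 lI lF; exact: h.
    * exact: h1.
    rewrite negb_or negb_and negbK => /andP[nF _]; case: ifP => // /andP[lI jQ].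
    have lF : l \in Fl by move: nF; rewrite lI.
    by have [h _ _] := h3 lI lF; rewrite /= h // subrr.
  + have [_ [h2 h2'] h3 _ _] := pP l; rewrite /=; case: ifP => [lI|/negbFE lI].
      rewrite /= h2' //; case: ifP => _ /=; first by rewrite mulN1r subrr.
      by rewrite addr0.
    case: ifP => // /orP[lF|/eqP ->]; first by have [_ h] := h2 lI lF; exact: h.
    have [lF|lF] := boolP (l \in Fl); first by have [_ h _] := h3 lI lF; exact: h.
    by have [_ h] := h2 lI lF; exact: h.
  + have [_ [h2 _] h3 _ _] := pP l; rewrite /=; case: ifP => // /and3P[lI iz ii]; rewrite ev_psum /=.
    have [lF|lF] := boolP (l \in Fl); first by have [_ _ h] := h3 lI lF; exact: h.
    by have [_ h] := h2 lI lF; rewrite big1 // => a _; rewrite h mul0r.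
  + have [[_ h] _ _ _ _] := pP l; rewrite [con_aux _]/= ev_relP xE.
    by rewrite [X in X - _](_ : _ = \sum_j (p l).1.1 j *: Bt x j) // h subrr ffunE.
pose Zs l := (p l).2.
have supp l v : v \in Zs l -> forall z, colof z != l -> v z = 0.
  by move=> vZ; have [_ _ _ [_ /(_ v vZ)[]]] := pP l.
exists (\sum_(l | true) Zs l)%VS, 0%VS, 0%N; split.
- by apply/subv_sumP => l _; have [_ _ _ []] := pP l.
- by rewrite cap0v.
- by move=> v; rewrite memv0 => /eqP ->; exists (fun v : void => match v with end) => J; rewrite ffunE big1 // => -[].
- move=> U UP; rewrite leqn0 dimv_eq0 -subv0; apply/subvP => v /UP[dC [tau tZ vt]].
  have vtau : xpart v = tau by apply/funext.
  have [/= c1 _] := mem_col_sum supp tZ.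
  have dR l : \sum_j auxa v l j *: Bt x j + \sum_j auxa w l j *: \sum_(i | i != z0) rk (upd (bcol x j) i (ucol tau j i)) =
      \sum_(i | i != z0) (rk (upd (bcol x l) i (auxq v l i)) +
        \sum_(i' | (i' != z0) && (i' != i)) rk (upd (upd (bcol x l) i (auxq w l i)) i' (ucol tau l i'))).
    by have := dv_relP (fun J => dC (inr (l, J))); rewrite xE vtau.
  have da0 l j : j \notin below l -> auxa v l j = 0.
    by move=> jb; have := dC (inl (inl (inl (l, j)))); rewrite /= jb orbT.
  have dq0 l i a : l \notin I -> auxq v l i a = if i == i1 then ucol tau l i a else 0.
    move=> lI; have := dC (inl (inl (inr (l, i, a)))); rewrite /= lI /=.
    case: eqP => _ /=; last by rewrite addr0.
    by rewrite mul0r add0r mulN1r -vtau => /eqP; rewrite subr_eq0 => /eqP.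
  have step l : (forall j, j \in below l -> forall z, colof z = j -> tau z = 0) ->
      forall z, colof z = l -> tau z = 0.
    move=> bl; have [tl tlZ tlE] := c1 l isT.
    have ut i : ucol tau l i = ucol tl l i by apply/funext => a; rewrite /ucol tlE.
    suff tl0 : tl = 0 by move=> z zl; rewrite tlE // tl0 ffunE.
    have [[h1 _] _ _ _ Zi] := pP l.
    apply: (Zi _ (auxa v l) (auxq v l) tlZ (da0 l)) => [lI i a|]; first by rewrite dq0 // -ut.
    have := dR l; rewrite [X in _ + X = _]big1 ?addr0 => [->|j _].
      apply: eq_bigr => i iz; congr (_ + _); apply: eq_bigr => i' _.
      by rewrite ut; congr (rk (upd (upd _ _ _) _ _)).
    have [jb|jb] := boolP (j \in below l); last by rewrite /auxa /= h1 // scale0r.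
    rewrite big1 ?scaler0 // => i _; rewrite (_ : ucol tau j i = fun=> 0) ?rk_0 //.
    by apply/funext => a; exact: bl jb _ _.
  have tI m : forall l, l \in I -> (l < m)%N -> forall z, colof z = l -> tau z = 0.
    elim: m => // m IH l lI lm; apply: step => j.
    by rewrite /below lI inE => /andP[jI jl]; apply: IH => //; apply: leq_trans jl _.
  have tau0 z : tau z = 0.
    by apply: (step (colof z)) => // j /(subsetP (below_sub I _)) jI z' zj; apply: (tI t j).
  have dR0 l : \sum_j auxa v l j *: Bt x j = \sum_(i | i != z0) rk (upd (bcol x l) i (auxq v l i)).
    have u0' j i : ucol tau j i = fun=> 0 by apply/funext => a; exact: tau0.
    have := dR l; rewrite [X in _ + X = _]big1 ?addr0 => [->|j _]; last first.
      by rewrite big1 ?scaler0 // => i _; rewrite u0' rk_0.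
    by apply: eq_bigr => i _; rewrite big1 ?addr0 // => i' _; rewrite u0' rk_0.
  have aq0 l : (forall j, auxa v l j = 0) /\ forall i a, auxq v l i a = 0.
    have [lI|lI] := boolP (l \in I); last first.
      have q0 i a : auxq v l i a = 0 by rewrite dq0 //; case: eqP => // _; exact: tau0.
      split=> // j; have bI : below l = I by rewrite /below (negPf lI).
      have [jI|jI] := boolP (j \in I); last by apply: da0; rewrite bI.
      apply: (ind (auxa v l)) => //; rewrite -bI -(sum_below x (da0 l)) dR0 big1 // => i _.
      by rewrite (_ : auxq v l i = fun=> 0) ?rk_0 //; apply/funext => a.
    have [lF|lF] := boolP (l \in Fl); last first.
      split=> [j|i a]; first by have := dC (inl (inl (inl (l, j)))); rewrite /= lI lF.
      by have := dC (inl (inl (inr (l, i, a)))); rewrite /= lI lF.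
    have [Fi _] := Flp l lI lF.
    have a0 : forall j, auxa v l j = 0.
      apply: Fi => [|j jQ]; first by split; [exact: da0|rewrite dR0; apply/ThatP; eexists].
      have [jb|/da0//] := boolP (j \in below l).
      by have := dC (inl (inl (inl (l, j)))); rewrite /= lI lF jb jQ /= addr0.
    have qz a : auxq v l z0 a = 0.
      by have := dC (inl (inl (inr (l, z0, a)))); rewrite /= lI eqxx orbT.
    split=> // i a; have [->|iz] := eqVneq i z0; first exact: qz.
    apply: (That_inj n_gt0 fx i1z (l := l) (q := auxq v l)) => // [i' i'z i'1|].
      have := dC (inl (inr (l, i'))); rewrite /= lI i'z i'1 /= dv_psum /= => <-.
      by apply: eq_bigr => b _; rewrite !vt tau0 mulr0 addr0.
    by rewrite -dR0 big1 // => j _; rewrite a0 scale0r.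
  rewrite memv0; apply/eqP/ffunP => -[z|[[l j]|[[l i] a]]]; rewrite ffunE.
  + by rewrite vt tau0.
  + by have [h _] := aq0 l; exact: h.
  + by have [_ h] := aq0 l; exact: h.
- rewrite dimv0 addn0 add0n dim_col_sum //.
  have kd := kern_dim_rows n_gt0 only1 i1z fx u0 ind.
  apply: leq_ltn_trans kd _.
  have -> : (#|~: I| * n.-1 + \sum_(l in I) \dim (Ecol x (below l) :&: That x l) = \sum_l cost l)%N.
    rewrite [RHS](bigID (mem I)) /= addnC; congr (_ + _)%N.
      by apply: eq_bigr => l lI; rewrite /cost lI.
    rewrite (eq_bigr (fun=> n.-1)) => [|l /negPf lI]; last by rewrite /cost lI.
    by rewrite sum_nat_const; congr (_ * _)%N; apply: eq_card => l; rewrite inE.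
  apply: ltn_sum_strict => [l|]; first by have [_ _ _ []] := pP l.
  have [[l lI]|[l [lI lF lb]]] := str; exists l; have [_ _ _ [_ _ _ h] _] := pP l; apply: h.
    by rewrite /tight (negPf lI).
  by rewrite /tight lI lF /= -ltnNge.
Qed.

End Pattern.

(** For each column [Qs l] is a smallest set of coefficients determining its relations. By
    minimality some relation vanishes on [Qs l] except at one index, and scaling it gives the
    normalization required by the pattern. *)
Lemma null_one : null_set (fun A : tensor R k n => exists x, [/\ kkt_at A x, forall j, ups x j != 0 &
  exists I, [/\ indep x I, forall l, l \notin I -> Bt x l \in Ecol x I &
  (exists l, l \notin I) \/ (exists l, [/\ l \in I, (0 < \dim (Ecol x (below I l) :&: That x l))%N
     & (#|below I l| < n.-1)%N])]]).
Proof.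
pose T : countType := ({set 'I_t} * {set 'I_t} * {ffun 'I_t -> {set 'I_t}} * {ffun 'I_t -> 'I_t})%type.
apply: null_sub (null_cup_count (T := T) n_gt0
   (N := fun p A => exists x, [/\ kkt_at A x, forall j, ups x j != 0 & one_pattern p.1.1.1 p.1.1.2 p.1.2 p.2 x]) _); last first.
  by move=> p; apply: null_one_pattern.
move=> A [x [kx u0 [I [ind BE str]]]].
pose Fl := [set l | (l \in I) && (Ecol x (below I l) :&: That x l != 0)%VS].
pose inj l (Q : {set 'I_t}) := forall al, null_vec I x l al -> (forall j, j \in Q -> al j = 0) -> forall j, al j = 0.
have QE l : exists Q : {set 'I_t}, inj l Q /\ forall Q', inj l Q' -> (#|Q| <= #|Q'|)%N.
  have injT : exists c, `[< exists Q, inj l Q /\ #|Q| = c >].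
    by exists #|[set: 'I_t]|; apply/asboolP; exists setT; split=> // al _ h j; apply: h; rewrite inE.
  case: (ex_minnP injT) => c /asboolP[Q [Qi Qc]] Qm; exists Q; split=> // Q' Qi'.
  by rewrite Qc; apply: Qm; apply/asboolP; exists Q'.
have /choice[Qs QsP] := QE.
have qE l : exists q : 'I_t, l \in Fl -> q \in Qs l /\ exists2 al, null_vec I x l al & forall j, j \in Qs l -> al j = (j == q)%:R.
  have [lF|lF] := boolP (l \in Fl); last by exists l.
  have [Qi Qm] := QsP l.
  have [q qQ] : exists q, q \in Qs l.
    apply: contrapT => nq; move: lF; rewrite inE => /andP[lI /negP]; apply.
    rewrite -subv0; apply/subvP => v; rewrite memv_cap => /andP[/EcolP[be ->] vT].
    pose al j := if j \in below I l then be j else 0.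
    have alE : \sum_j al j *: Bt x j = \sum_(j in below I l) be j *: Bt x j.
      by rewrite [RHS]big_mkcond; apply: eq_bigr => j _; rewrite /al; case: ifP => // _; rewrite scale0r.
    have a0 : forall j, al j = 0.
      apply: Qi => [|j jQ]; last by case: nq; exists j.
      by split=> [j /negPf h|]; [rewrite /al h|rewrite alE].
    by rewrite -alE big1 ?mem0v // => j _; rewrite a0 scale0r.
  exists q => _; split=> //.
  have /existsNP[al /not_implyP[[na nT] /not_implyP[alQ /existsNP[j0 alj]]]] : ~ inj l (Qs l :\ q).
    by move/Qm; rewrite (cardsD1 q) qQ ltnn.
  have aq : al q != 0.
    apply/eqP => aq0; apply: alj; apply: Qi => // j jQ.
    by have [->//|jq] := eqVneq j q; apply: alQ; rewrite !inE jq.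
  exists (fun j => (al q)^-1 * al j).
    split=> [j jb|]; first by rewrite /= (na j) // mulr0.
    under eq_bigr => j _ do rewrite -scalerA.
    by rewrite -scaler_sumr memvZ // nT.
  move=> j jQ; have [->|jq] := eqVneq j q; first by rewrite mulVf.
  by rewrite (alQ j) ?mulr0 // !inE jq.
have /choice[qs qsP] := qE.
exists (I, Fl, [ffun l => Qs l], [ffun l => qs l]), x; split=> //; split=> //=.
- by move=> l lI; rewrite inE lI /= negbK => /eqP.
- move=> l lI lF; rewrite ffunE; have [Qi _] := QsP l; split; first exact: Qi.
  by have [qQ [al nal alE]] := qsP l lF; exists al; split=> //; rewrite ffunE.
- case: str => [?|[l [lI dl bl]]]; first by left.
  by right; exists l; rewrite inE lI -dimv_eq0 -lt0n.
Qed.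
End OneOrthogonalNull.

(** * The last column in the case [t = n] *)

Section BformSlot.
Variables (R : realType) (k n t s : nat).
Local Notation D := {ffun 'I_k -> 'I_n}.
Local Notation X := (vars k n t).
Variables (x : X -> R) (tau : X -> R) (i' : 'I_k) (l : 'I_t).
Hypotheses (i's : (s <= i')%N) (tz : forall z, (forall a, z != inl (i', a, l)) -> tau z = 0).
Local Notation u := (ucol x).
Local Notation th := (ucol tau l i').

Lemma slot_ucol j i : (j != l) || (i != i') -> ucol tau j i = fun=> 0.
Proof. by move=> h; apply/funext => a; apply: tz => b; apply/eqP => -[e1 _ e2]; rewrite e1 e2 !eqxx in h. Qed.

Lemma dv_rkP_slot (j : 'I_t) (c : 'I_k -> 'I_n -> pexpr R X) I :
  (forall i, i != i' -> (fun a => dv (c i a) x tau) = fun=> 0) ->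
  dv (rkP c I) x tau = rk1 (upd (fun i a => ev (c i a) x) i' (fun a => dv (c i' a) x tau)) I.
Proof.
move=> h; rewrite dv_rkP (bigD1 i') //= big1 ?addr0 // => i ii.
by rewrite h // -rkE rk_0 ffunE.
Qed.

Definition slotE i v : {ffun D -> R^o} := rk (upd (upd (u l) i v) i' th).

Lemma ev_upd_unit j i a : (fun l b => ev (upd (@pcol R k n t j) i (pe R k t a) l b) x) = upd (u j) i (unitv R a).
Proof. by apply/funext => z; rewrite /upd; case: eqP. Qed.

Lemma dv_yP_slot h I : dv (yP R s h I) x tau =
  match h with
  | inl (inl j) => (j == l)%:R * rk (upd (u l) i' th) I
  | inl (inr (i, a, j)) => if (i < s)%N then 0 else (j == l)%:R * ((i != i')%:R * slotE i (unitv R a) I)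
  | inr (i, a, b) => if (i < s)%N then
      ups x l * (u l i b * slotE i (unitv R a) I - u l i a * slotE i (unitv R b) I)
      else 0
  end.
Proof.
have P1 j i a I0 : dv (rkP (upd (@pcol R k n t j) i (pe R k t a)) I0) x tau =
   (j == l)%:R * ((i != i')%:R * slotE i (unitv R a) I0).
  rewrite dv_rkP_slot // => [|i2 ii2]; last first.
    rewrite /upd; case: eqP => // _; exact: (slot_ucol (j := j) (i := i2)) (introT orP (or_intror ii2)).
  rewrite ev_upd_unit; have [->|ii'] := eqVneq i i'.
    by rewrite mul0r mulr0 upd_same -rkE rk_0 ffunE.
  rewrite upd_other 1?eq_sym // mul1r; have [->|jl] := eqVneq j l; first by rewrite mul1r /slotE rkE.
  by rewrite mul0r rk1_upd /= tz ?mul0r // => c; apply/eqP => -[_ e]; rewrite e eqxx in jl.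
case: h => [[j|[[i a] j]]|[[i a] b]] /=.
- rewrite dv_rkP_slot // => [|i2 ii2]; last by apply: (slot_ucol (j := j) (i := i2)); rewrite ii2 orbT.
  have [->|jl] := eqVneq j l; first by rewrite mul1r rkE.
  by rewrite mul0r rk1_upd /= tz ?mul0r // => c; apply/eqP => -[_ e]; rewrite e eqxx in jl.
- by case: ifP.
case: ifP => // si; have ii' : i != i' by apply: contraTneq si => ->; rewrite -leqNgt.
rewrite dv_psum /= (bigD1 l) //= big1 ?addr0 => [|j jl]; last first.
  rewrite !P1 (negPf jl) !mul0r !mulr0 /= (tz (z := inr j)) // mul0r add0r.
  have -> : tau (inl (i, b, j)) = 0 by apply: tz => c; apply/eqP => -[_ _ e]; rewrite e eqxx in jl.
  have -> : tau (inl (i, a, j)) = 0 by apply: tz => c; apply/eqP => -[_ _ e]; rewrite e eqxx in jl.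
  by ring.
rewrite !P1 eqxx ii' (tz (z := inr l)) // mul0r add0r.
have -> : tau (inl (i, b, l)) = 0 by apply: tz => c; apply/eqP => -[e _]; rewrite e eqxx in ii'.
have -> : tau (inl (i, a, l)) = 0 by apply: tz => c; apply/eqP => -[e _]; rewrite e eqxx in ii'.
by rewrite /= ?mulr1n /ups /ucol; ring.
Qed.

Lemma dv_kapP_slot h : dv (kapP R s h) x tau =
  match h with
  | inl (inr (i, a, j)) => (j == l)%:R * ((i == i')%:R * (ups x l * th a))
  | _ => 0
  end.
Proof.
case: h => [[j|[[i a] j]]|[[i a] b]] //=; first exact: tz.
case: ifP => [si|_] /=.
  have ii' : i != i' by apply: contraTneq si => ->; rewrite -leqNgt.
  by rewrite (negPf ii') mul0r mulr0.
rewrite (tz (z := inr j)) // mul0r add0r.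
have [->|jl] := eqVneq j l; last first.
  by rewrite mul0r tz ?mulr0 // => c; apply/eqP => -[_ _ e]; rewrite e eqxx in jl.
have [->|ii'] := eqVneq i i'; first by rewrite !mul1r.
by rewrite mul0r mulr0 tz ?mulr0 // => c; apply/eqP => -[e _]; rewrite e eqxx in ii'.
Qed.

(** The skew weights of the orthonormal modes recombine, as in [dPhi_span], into factors of [xi], so
    that only evaluations of the tensor at column [l] with two factors replaced remain. Stationarity
    becomes an explicit affine condition on the tensor. *)
Lemma bform_slot (A : tensor R k n) xi : kkt_at s A x -> tangent s x xi -> dot (u l i') th = 0 ->
  bform s A x tau xi = ups x l * (\sum_(i | i != i') ip A (slotE i (ucol xi l i)) - ups x l * dot th (ucol xi l i')).
Proof.
move=> kx tx uth; have fx := kkt_feas kx.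
pose ipE i a := ip A (slotE i (unitv R a)).
have ipEZ i v : i != i' -> ip A (slotE i v) = \sum_a v a * ipE i a.
  move=> ii'; rewrite /slotE updC // rk_expand ip_sumr; apply: eq_bigr => a _.
  by rewrite ip_Zr /ipE /slotE [in RHS](updC (u l) _ _ ii').
have ipI (c : R) (F : {ffun D -> R^o}) : \sum_I A I * (c * F I) = c * ip A F.
  by rewrite /ip mulr_sumr; apply: eq_bigr => I _; rewrite mulrCA.
have z1 : ip A (rk (upd (u l) i' th)) = 0.
  transitivity (ups x l * dot (u l i') th); last by rewrite uth mulr0.
  rewrite rk_expand ip_sumr dotC /dot mulr_sumr; apply: eq_bigr => a _.
  rewrite ip_Zr mulrCA; congr (_ * _).
  have := kx.2 (inl (inr (i', a, l))); rewrite /= ltnNge i's /= => <-.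
  apply: eq_bigr => I _; congr (_ * _); rewrite ev_rkP rkE; congr (rk1 _ _).
  by rewrite -(ev_upd_unit l i' a).
rewrite /bform sum_kkt_ix.
have -> : \sum_j coefF s x xi (inl (inl j)) * (\sum_I A I * dv (yP R s (inl (inl j)) I) x tau -
      dv (kapP R s (inl (inl j))) x tau) = 0.
  apply: big1 => j _; rewrite dv_kapP_slot subr0.
  under eq_bigr => I _ do rewrite dv_yP_slot.
  by rewrite ipI z1 !mulr0.
rewrite add0r -big_split /= mulrBr mulr_sumr.
pose F i := if i == i' then - (ups x l * (ups x l * dot th (ucol xi l i'))) else ups x l * ip A (slotE i (ucol xi l i)).
rewrite [LHS](eq_bigr F); last first.
  move=> i _; rewrite /F.
  have E2 : \sum_a \sum_j coefF s x xi (inl (inr (i, a, j))) * (\sum_I A I * dv (yP R s (inl (inr (i, a, j))) I) x tau -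
      dv (kapP R s (inl (inr (i, a, j)))) x tau) = if (i < s)%N then 0 else
      \sum_a ups x l * ucol xi l i a * ((i != i')%:R * ipE i a - (i == i')%:R * (ups x l * th a)).
    have G a j : coefF s x xi (inl (inr (i, a, j))) * (\sum_I A I * dv (yP R s (inl (inr (i, a, j))) I) x tau -
      dv (kapP R s (inl (inr (i, a, j)))) x tau) = (if (i < s)%N then 0 else ups x j * ucol xi j i a) *
        ((j == l)%:R * ((i != i')%:R * ipE i a) - (j == l)%:R * ((i == i')%:R * (ups x l * th a))).
      rewrite dv_kapP_slot [coefF _ _ _ _]/=; case: ifP => si; first by rewrite !mul0r.
      congr (_ * (_ - _)); rewrite /ipE /ip !mulr_sumr; apply: eq_bigr => I _.
      by rewrite dv_yP_slot si; ring.
    under [LHS]eq_bigr => a _ do under eq_bigr => j _ do rewrite G.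
    case: ifP => si; first by apply: big1 => a _; apply: big1 => j _; rewrite mul0r.
    apply: eq_bigr => a _; rewrite (bigD1 l) //= [X in _ + X]big1 ?addr0 => [|j /negPf jl].
      by rewrite eqxx !mul1r.
    by rewrite jl !mul0r subrr mulr0.
  have E3 : \sum_a \sum_b coefF s x xi (inr (i, a, b)) * (\sum_I A I * dv (yP R s (inr (i, a, b)) I) x tau -
      dv (kapP R s (inr (i, a, b))) x tau) = if (i < s)%N then
      \sum_a \sum_b 2^-1 * rot x xi i a b * (ups x l * (u l i b * ipE i a - u l i a * ipE i b)) else 0.
    case: ifP => si; last by apply: big1 => a _; apply: big1 => b _; rewrite /= si mul0r.
    apply: eq_bigr => a _; apply: eq_bigr => b _; rewrite dv_kapP_slot subr0 /= si; congr (_ * _).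
    transitivity (ups x l * u l i b * ipE i a - ups x l * u l i a * ipE i b); last by ring.
    rewrite -!ipI -sumrB; apply: eq_bigr => I _.
    by have := dv_yP_slot (inr (i, a, b)) I; rewrite /= si => ->; ring.
  rewrite E2 E3; case: ifP => si.
    have ii' : i != i' by apply: contraTneq si => ->; rewrite -leqNgt.
    rewrite add0r (negPf ii') ipEZ // mulr_sumr.
    pose T a b := ups x l * (u l i b * ipE i a).
    transitivity (2^-1 * (\sum_a \sum_b rot x xi i a b * T a b - \sum_a \sum_b rot x xi i a b * T b a)).
      rewrite -sumrB mulr_sumr; apply: eq_bigr => a _; rewrite -sumrB mulr_sumr.
      by apply: eq_bigr => b _; rewrite /T; ring.
    have -> : \sum_a \sum_b rot x xi i a b * T b a = - \sum_a \sum_b rot x xi i a b * T a b.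
      rewrite exchange_big /= -sumrN; apply: eq_bigr => a _; rewrite -sumrN.
      by apply: eq_bigr => b _; rewrite (rot_skew a b tx si) mulNr.
    transitivity (\sum_a \sum_b rot x xi i a b * T a b); first by field.
    apply: eq_bigr => a _; rewrite -(rot_mul a l fx tx si) mulr_suml mulr_sumr.
    by apply: eq_bigr => b _; rewrite /T; ring.
  rewrite addr0; have [->|ii'] := eqVneq i i'.
    rewrite /dot !mulr_sumr -sumrN; apply: eq_bigr => a _ /=; rewrite ?mulr1n; ring.
  by rewrite ipEZ // mulr_sumr; apply: eq_bigr => a _; rewrite mul1r mul0r subr0 mulrA.
rewrite (bigD1 i') //= {1}/F eqxx addrC; congr (_ - _).
by apply: eq_bigr => i /negPf ii; rewrite /F ii.
Qed.

End BformSlot.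

Section LastColumnNull.
Variables (R : realType) (k n t s : nat).
Hypotheses (n_gt0 : (0 < n)%N) (tn : (t <= n)%N).
Local Notation D := {ffun 'I_k -> 'I_n}.
Local Notation X := (vars k n t).
Local Notation kkt_at := (@kkt_at R k n t s).
Local Notation Tan := (@Tan R k n t s).
Local Notation Kern := (@Kern R k n t s).
Local Notation tangent := (@tangent R k n t s).
Local Notation W := {ffun D -> R^o}.
Variables z0 i' : 'I_k.
Hypothesis only1 : forall i : 'I_k, (i < s)%N = (i == z0).
Hypothesis i'z : i' != z0.
Variable l0 : 'I_t.
Local Notation bcol := (@bcol R k n t z0).
Local Notation Bt := (@Bt R k n t z0).
Local Notation That := (@That R k n t z0).
Local Notation Ecol := (@Ecol R k n t z0).
Local Notation indep := (@indep R k n t z0).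
Local Notation below := (@below t setT).

(* The stationarity of a degenerate direction against moves of column [l0] in mode [i'] is one more
   condition on the tensor; [zform] is its coefficient tensor. *)
Definition zform (x : X -> R) (a : 'I_t -> R) (q : 'I_k -> 'I_n -> R) (th : 'I_n -> R) : W :=
  - ups x l0 *: (\sum_j a j *: rk (upd (upd (ucol x l0) z0 (ucol x j z0)) i' th))
  - \sum_(i | (i != z0) && (i != i')) rk (upd (upd (ucol x l0) i (q i)) i' th).

Lemma zform_lin x a q c th th' :
  zform x a q (fun b => c * th b + th' b) = c *: zform x a q th + zform x a q th'.
Proof.
rewrite /zform; under eq_bigr => j _ do rewrite rk_lin scalerDr !scalerA.
under [X in _ - X]eq_bigr => i _ do rewrite rk_lin.
rewrite !big_split /= -scaler_sumr scalerDr scalerBr opprD addrACA; congr (_ - _ + _).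
rewrite !scaler_sumr; apply: eq_bigr => j _; rewrite !scalerA; congr (_ *: _); ring.
Qed.

Lemma zform_linE x a q c th th' J :
  zform x a q (fun b => c * th b + th' b) J = c * zform x a q th J + zform x a q th' J.
Proof.
rewrite zform_lin; move: (zform x a q th) (zform x a q th') => S T.
by rewrite addfE scalefE.
Qed.

Lemma zform_sum x a q (th : 'I_n -> R) : zform x a q th = \sum_c th c *: zform x a q (unitv R c).
Proof.
have E (r : seq 'I_n) : zform x a q (fun b => \sum_(c <- r) th c * unitv R c b) = \sum_(c <- r) th c *: zform x a q (unitv R c).
  elim: r => [|c r IH].
    rewrite big_nil (_ : (fun b => _) = fun b => 0 * 0 + 0); last first.
      by apply/funext => b; rewrite big_nil mul0r addr0.
    have := zform_lin x a q (-1) (fun=> 0) (fun=> 0).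
    rewrite (_ : (fun b => -1 * 0 + 0) = fun=> 0); last by apply/funext => b; rewrite mulr0 addr0.
    rewrite (_ : (fun b => 0 * 0 + 0) = fun=> 0); last by apply/funext => b; rewrite mulr0 addr0.
    by rewrite scaleN1r addNr.
  rewrite big_cons -IH -zform_lin; congr (zform _ _ _ _); apply/funext => b.
  by rewrite big_cons.
rewrite -E; congr (zform _ _ _ _); apply/funext => b.
rewrite (bigD1 b) //= big1 => [|c cb]; first by rewrite /unitv eqxx mulr1 addr0.
by rewrite /unitv eq_sym (negPf cb) mulr0.
Qed.

(** In the first sum every index other than [l0] is killed by orthogonality in mode [z0], and the
    coefficient at [l0] is zero. The tensors of the new condition are thereby controlled by [zeta],
    which separates them from the image of [dPhi]. *)
Lemma ctr_zform x a q (tau : X -> R) : feas s x -> a l0 = 0 ->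
  ctr z0 (ucol x l0 z0) (zform x a q (ucol tau l0 i')) = - zeta z0 x l0 q i' tau.
Proof.
move=> fx a0; have z0i' : z0 != i' by rewrite eq_sym.
rewrite /zform addrC -scaleN1r ctr_lin ctrZ !ctr_sum [X in _ + _ *: X]big1 ?scaler0 ?addr0 => [|j _]; last first.
  rewrite ctrZ ctr_rk upd_other // upd_same (orth_col fx _ _ (z0s only1)).
  by case: eqP => [<-|_]; rewrite ?a0 ?scale0r ?scaler0.
rewrite scaleN1r /zeta; congr (- _); apply: eq_bigr => i /andP[iz ii'].
rewrite ctr_rk upd_other // upd_other 1?eq_sym // (unit_col fx) scale1r; congr (rk _).
by rewrite updC // (updC _ _ _ iz).
Qed.

Definition LAux : finType := ('I_t + 'I_k * 'I_n)%type.
Local Notation PE := (pexpr R (X + LAux)%type).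
Definition pa j : PE := PX (inr (inl j)).
Definition pq i a : PE := PX (inr (inr (i, a))).
Definition pups j : PE := PX (inl (inr j)).
Definition pvc (j : 'I_t) : 'I_k -> 'I_n -> PE := fun i a => vu R LAux i a j.
Definition zP (th : 'I_n -> PE) (J : D) : PE :=
  PA (PM (PM (PC (-1)) (pups l0)) (psum predT (fun j => PM (pa j) (rkP (upd (upd (pvc l0) z0 (pvc j z0)) i' th) J))))
     (PM (PC (-1)) (psum (fun i => (i != z0) && (i != i')) (fun i => rkP (upd (upd (pvc l0) i (pq i)) i' th) J))).
(** The condition concerns vectors orthogonal to a unit column [u]; it is imposed on the projections
    [e_c - u_c u] of the basis vectors, which keeps the equations polynomial. *)
Definition last_y (c : 'I_n) (J : D) : PE :=
  PA (zP (fun b => PC (unitv R c b)) J) (PM (PM (PC (-1)) (pvc l0 i' c)) (zP (pvc l0 i') J)).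
Definition last_k (c : 'I_n) : PE :=
  PM (PM (PC (-1)) (pups l0)) (PA (pq i' c) (PM (PM (PC (-1)) (pvc l0 i' c)) (psum predT (fun b => PM (pvc l0 i' b) (pq i' b))))).

Definition last_con_ix : finType := (unit + 'I_n + 'I_k + D + unit)%type.
Definition last_con (c : last_con_ix) : PE :=
  match c with
  | inl (inl (inl (inl _))) => pa l0
  | inl (inl (inl (inr b))) => pq z0 b
  | inl (inl (inr i)) => if (i != z0) && (i != i') then psum predT (fun b => PM (pq i b) (pvc l0 i b)) else PC 0
  | inl (inr J) => relP z0 (fun j => PM (pups j) (pa j)) pq l0 J
  | inr _ => PA (psum predT (fun j => PM (pa j) (pa j))) (PC (-1))
  end.

Definition auxv (w : X + LAux -> R) j : R := w (inr (inl j)).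
Definition auxs (w : X + LAux -> R) i b : R := w (inr (inr (i, b))).

Lemma ev_zP (w : X + LAux -> R) th J :
  ev (zP th J) w = zform (xpart w) (auxv w) (auxs w) (fun b => ev (th b) w) J.
Proof.
rewrite /zform addfE oppfE scalefE !sum_ffunE /= !ev_psum /= !mulN1r; congr (- _ * _ - _).
  apply: eq_bigr => j _; rewrite /= ev_rkP scalefE rkE; congr (_ * rk1 _ _).
  apply/funext => i; apply/funext => b; rewrite /upd; case: (i == i') => //.
  by case: (i == z0).
apply: eq_bigr => i _; rewrite /= ev_rkP rkE; congr (rk1 _ _).
apply/funext => i2; apply/funext => b; rewrite /upd; case: (i2 == i') => //.
by case: (i2 == i).
Qed.

Definition last_pattern (A : tensor R k n) (x : X -> R) : Prop :=
  [/\ indep x setT, forall l, l != l0 -> (Ecol x (below l) :&: That x l = 0)%VS,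
     below l0 = [set~ l0] &
     exists (a : 'I_t -> R) (q : 'I_k -> 'I_n -> R),
     [/\ [/\ a l0 = 0, forall b, q z0 b = 0 & forall i, i != z0 -> i != i' -> dot (q i) (ucol x l0 i) = 0],
       \sum_j (ups x j * a j) *: Bt x j = \sum_(i | i != z0) rk (upd (bcol x l0) i (q i)),
       \sum_j a j * a j = 1,
       forall th, dot (ucol x l0 i') th = 0 -> ip A (zform x a q th) = - ups x l0 * dot (q i') th &
       exists2 i0, (i0 != z0) && (i0 != i') & exists b, q i0 b != 0]].

(** Let [c] be the dimension of the intersection for column [l0]. The kernel of [dPhi] has dimension
    at most [c] and [Z] is only known to have dimension at least [c], so the relation alone may tie.
    Stationarity contributes a space [Z'] of the same dimension as [Z], while the freedom left in a
    relation of norm 1 gives [m = c - 1]; then [(c - 1) + c < 2 c] decides. *)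
Lemma null_last_pattern : null_set (fun A : tensor R k n => exists x,
  [/\ kkt_at A x, forall j, ups x j != 0 & last_pattern A x]).
Proof.
apply: null_sub (null_stratum s n_gt0 last_con last_y last_k).
move=> A [x [kx u0 [ind El bl0 [a [q [[a0 qz qn] rel na Aq [i0 /andP[i0z i0i'] [b0 qb0]]]]]]]].
have fx := kkt_feas kx.
pose w (z : X + LAux) : R := match z with
  | inl z => x z | inr (inl j) => a j | inr (inr (i, b)) => q i b end.
have xE : xpart w = x by apply/funext.
have aE : auxv w = a by [].
have qE : auxs w = q by [].
have last_yE c J : ev (last_y c J) w = zform x a q (fun b => - ucol x l0 i' c * ucol x l0 i' b + unitv R c b) J.
  rewrite -[LHS]/(ev (zP _ J) w + _ * ev (zP _ J) w) !ev_zP xE aE qE zform_linE [in RHS]addrC; congr (_ + _ * _) => /=.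
  by rewrite mulN1r.
have bn : (#|below l0| <= n.-1)%N by exact: card_below.
have qn0 : exists b, q i0 b != dot (q i0) (ucol x l0 i0) * ucol x l0 i0 b.
  by exists b0; rewrite qn // mul0r.
have [Z [ZT dZ Zi]] := zeta_complement n_gt0 fx i0z i'z i0i' qn0 (below l0).
set c := \dim (Ecol x (below l0) :&: That x l0) in dZ.
exists w; rewrite !xE; split=> //.
- case=> [[[[[]|b]|i]|J]|[]].
  + exact: a0.
  + exact: qz.
  + rewrite /=; case: ifP => // /andP[iz ii]; rewrite ev_psum /=; exact: qn.
  + rewrite [last_con _]/= ev_relP xE.
    by rewrite [X in X - _](_ : _ = \sum_j (ups x j * a j) *: Bt x j) // rel subrr ffunE.
  + by rewrite /= ev_psum /= na subrr.
- move=> c0; under eq_bigr => J _ do rewrite last_yE.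
  rewrite -/(ip A _) Aq; last first.
    by rewrite dot_linr (unit_col fx) mulr1 [X in _ + X]dotC dot_unitl addNr.
  rewrite /last_k /= mulN1r ev_psum /= mulN1r dot_linr [X in _ * (_ + X)]dotC dot_unitl.
  by rewrite addrC [dot (q i') _]dotC.
have [zf zfE] : {F : 'Hom({ffun X -> R^o}, W) | forall v, F v = zform x a q (ucol v l0 i')}.
  by apply: lin_hom => e v v'; rewrite ffun_lin ucol_lin zform_lin.
have zf_img tau xi : tau \in Z -> zf tau = dPhi x xi -> tangent x xi -> tau = 0.
  move=> tZ; rewrite zfE => E tx; apply: Zi => //; rewrite -[zeta _ _ _ _ _ _]opprK -(@ctr_zform x a q tau fx a0) E memvN.
  rewrite (slot_dPhi only1 fx) -addrA; apply: memv_add.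
    apply/EcolP; exists (fun j => ups x j * dot (ucol x l0 z0) (ucol xi j z0)).
    rewrite bl0 (bigD1 l0) //= dotC (tangent_self _ _ tx) mulr0 scale0r add0r.
    by apply: eq_bigl => j; rewrite !inE.
  apply: memvD; apply: memvZ; first exact: (Bt_in_That i'z).
  by apply/ThatP; eexists.
exists Z, (zf @: Z)%VS, c.-1; split.
- by apply/subvP => v /(subvP ZT) vT; apply/TanP; apply: Theta_tangent vT; exact: (unit_mode only1).
- apply/eqP; rewrite -subv0; apply/subvP => y; rewrite memv_cap => /andP[/memv_imgP[tau tZ ->] /memv_imgP[xi /TanP tx]].
  by rewrite dPhiHE => E; rewrite (zf_img tau xi) // linear0 mem0v.
- move=> _ /memv_imgP[tau tZ ->]; exists (ucol tau l0 i') => J.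
  under eq_bigr => c0 _ do rewrite last_yE zform_linE mulrDr.
  rewrite big_split /= -[RHS]addrC; under [X in X + _]eq_bigr => c0 _ do rewrite -scalefE.
  rewrite -sum_ffunE -zform_sum zfE [X in _ + X](_ : _ = 0) ?addr0 //.
  under eq_bigr => c0 _ do rewrite mulrA mulrN.
  rewrite -mulr_suml sumrN [X in - X](_ : _ = dot (ucol tau l0 i') (ucol x l0 i')) // dotC.
  by rewrite (Theta_dot (subvP ZT _ tZ)) oppr0 mul0r.
- move=> U UP.
  have [G GE] : {F : 'Hom({ffun X + LAux -> R^o}, W) | forall v, F v = \sum_j (ups x j * auxv v j) *: Bt x j}.
    apply: lin_hom => e v v'; rewrite scaler_sumr -big_split; apply: eq_bigr => j _ /=.
    by rewrite scalerA -scalerDl; congr (_ *: _); rewrite /auxv addfE scalefE; ring.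
  have vP v : v \in U -> [/\ forall z, v (inl z) = 0, auxv v l0 = 0,
      G v = \sum_(i | i != z0) rk (upd (bcol x l0) i (auxs v i)) & forall i b, auxs v i b = 0 \/ G v != 0].
    move=> /UP[dC [tau tZ vt]].
    have vtau : xpart v = tau by apply/funext.
    have tT := subvP ZT _ tZ.
    have da0 : auxv v l0 = 0 by have := dC (inl (inl (inl (inl tt)))).
    have up0 j : ups tau j = 0 by apply: (Theta_zero tT).
    have tc i : i != i' -> ucol tau l0 i = fun=> 0.
      by move=> ii; apply/funext => b; apply: (Theta_zero tT) => e; apply: contra ii => /eqP[->].
    have tj j i : j != l0 -> ucol tau j i = fun=> 0.
      by move=> jl; apply/funext => b; apply: (Theta_col tT).
    have dR := dv_relP (l := l0) (fun J => dC (inl (inr J))).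
    rewrite xE vtau in dR.
    have dR1 : \sum_j (ups x j * auxv v j) *: Bt x j =
        \sum_(i | i != z0) rk (upd (bcol x l0) i (auxs v i)) + zeta z0 x l0 q i' tau.
      have -> : \sum_j (ups x j * auxv v j) *: Bt x j = \sum_j dv (PM (pups j) (pa j)) w v *: Bt x j.
        apply: eq_bigr => j _; congr (_ *: _); rewrite /= vt.
        by have := up0 j; rewrite /ups => ->; rewrite mul0r add0r.
      rewrite -[LHS]addr0 -[X in _ + X = _](_ : \sum_j ev (PM (pups j) (pa j)) w *: \sum_(i | i != z0) rk (upd (bcol x j) i (ucol tau j i)) = 0); last first.
        apply: big1 => j _; have [->|jl] := eqVneq j l0; first by rewrite /= a0 mulr0 scale0r.
        by rewrite big1 ?scaler0 // => i _; rewrite tj // rk_0.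
      rewrite dR big_split /=; congr (_ + _); rewrite /zeta big_mkcondr /=; apply: eq_bigr => i iz.
      have [->|ii'] := eqVneq i i'.
        by rewrite big1 // => j /andP[_ ji]; rewrite tc // rk_0.
      rewrite (bigD1 i') /=; last by rewrite i'z eq_sym.
      by rewrite big1 ?addr0 // => j /andP[_ ji]; rewrite tc // rk_0.
    have GEb : \sum_j (ups x j * auxv v j) *: Bt x j = \sum_(j in below l0) (ups x j * auxv v j) *: Bt x j.
      rewrite (bigD1 l0) //= da0 mulr0 scale0r add0r bl0; by apply: eq_bigl => j; rewrite !inE.
    have tau0 : tau = 0.
      apply: Zi => //; have -> : zeta z0 x l0 q i' tau = \sum_(j in below l0) (ups x j * auxv v j) *: Bt x j -
          \sum_(i | i != z0) rk (upd (bcol x l0) i (auxs v i)) by rewrite -GEb dR1 addrAC subrr add0r.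
      apply: memv_add; first by apply/EcolP; exists (fun j => ups x j * auxv v j).
      by rewrite memvN; apply/ThatP; exists (auxs v).
    have ze0 : zeta z0 x l0 q i' tau = 0.
      by apply: big1 => i _; rewrite (_ : ucol tau l0 i' = fun=> 0) ?rk_0 //; apply/funext => b; rewrite tau0 /ucol ffunE.
    rewrite ze0 addr0 -GE in dR1.
    split=> // [z|i b]; first by rewrite vt tau0 ffunE.
    have [G0|] := eqVneq (G v) 0; last by right.
    left; have [->|iz] := eqVneq i z0; first by have := dC (inl (inl (inl (inr b)))).
    apply: (That_inj n_gt0 fx i'z (l := l0) (q := auxs v)) => // [i2 i2z i2'|]; last by rewrite -dR1.
    have := dC (inl (inl (inr i2))); rewrite /= i2z i2' /= dv_psum /= => <-.
    by apply: eq_bigr => e _; rewrite vt tau0 ffunE mulr0 addr0.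
  (* The relation itself is not tangent to the sphere of relations of norm 1, so the admissible
     variations have dimension less than [c]. *)
  pose y0 : W := \sum_j (ups x j * a j) *: Bt x j.
  have GEv v : v \in U -> G v \in (Ecol x (below l0) :&: That x l0)%VS.
    move=> vU; have [_ va0 Gv _] := vP v vU; rewrite memv_cap; apply/andP; split; last by rewrite Gv; apply/ThatP; eexists.
    apply/EcolP; exists (fun j => ups x j * auxv v j); rewrite GE bl0 (bigD1 l0) //= va0 mulr0 scale0r add0r.
    by apply: eq_bigl => j; rewrite !inE.
  have y0E : y0 \in (Ecol x (below l0) :&: That x l0)%VS.
    rewrite memv_cap; apply/andP; split; last by rewrite /y0 rel; apply/ThatP; eexists.
    apply/EcolP; exists (fun j => ups x j * a j); rewrite /y0 bl0 (bigD1 l0) //= a0 mulr0 scale0r add0r.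
    by apply: eq_bigl => j; rewrite !inE.
  have indG (c1 c2 : 'I_t -> R) : \sum_j (ups x j * c1 j) *: Bt x j = \sum_j (ups x j * c2 j) *: Bt x j -> forall j, c1 j = c2 j.
    move=> E j; have := ind (fun j => ups x j * c1 j - ups x j * c2 j).
    rewrite (eq_bigl predT) => [|e]; last by rewrite inE.
    under eq_bigr => e _ do rewrite scalerBl.
    rewrite sumrB E subrr => /(_ erefl j (in_setT _))/eqP; rewrite -mulrBr mulf_eq0 (negPf (u0 j)) /= subr_eq0.
    by move/eqP.
  have y0n v : v \in U -> G v != y0.
    move=> vU; apply/eqP; rewrite GE /y0 => /indG E.
    have [dC _] := UP v vU; have := dC (inr tt); rewrite /= dv_psum /= addr0 => Na.
    have : 2 * \sum_j a j * a j = 0.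
      by rewrite mulr_sumr -[RHS]Na; apply: eq_bigr => j _; rewrite -[v _]/(auxv v j) E; ring.
    by rewrite na mulr1; apply/eqP; rewrite pnatr_eq0.
  have dG : \dim (G @: U) = \dim U.
    apply: limg_dim_eq; apply/eqP; rewrite -subv0; apply/subvP => v; rewrite memv_cap memv_ker => /andP[vU /eqP Gv].
    have [v0 _ _ h] := vP v vU; rewrite memv0; apply/eqP/ffunP => -[z|[j|[i b]]]; rewrite ffunE; first exact: v0.
      have := indG (auxv v) (fun=> 0); rewrite -GE Gv big1 => [|e _]; last by rewrite mulr0 scale0r.
      exact.
    by have [//|] := h i b; rewrite Gv eqxx.
  have dd : (\dim (G @: U) + \dim <[y0]> <= c)%N.
    rewrite -dimv_disjoint_sum.
      apply: dimvS; rewrite subv_add -memvE y0E andbT; apply/subvP => _ /memv_imgP[v vU ->]; exact: GEv.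
    apply/eqP; rewrite -subv0; apply/subvP => y; rewrite memv_cap => /andP[/memv_imgP[v vU ->] /vlineP[e eE]].
    rewrite memv0 eE; have [->|en] := eqVneq e 0; first by rewrite scale0r.
    have /eqP[] := y0n (e^-1 *: v) (memvZ _ vU).
    by rewrite linearZ /= eE scalerA mulVf // scale1r.
  have y0n0 : y0 != 0.
    by have := y0n 0 (mem0v _); rewrite linear0 eq_sym.
  move: dd; rewrite dim_vline y0n0 dG; move: (\dim U) => dU; by rewrite addn1; case: (c).
have c0 : (0 < c)%N.
  rewrite lt0n dimv_eq0; apply/eqP => c00.
  have : \sum_j (ups x j * a j) *: Bt x j \in (Ecol x (below l0) :&: That x l0)%VS.
    rewrite memv_cap; apply/andP; split; last by rewrite rel; apply/ThatP; eexists.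
    apply/EcolP; exists (fun j => ups x j * a j); rewrite bl0 (bigD1 l0) //= a0 mulr0 scale0r add0r.
    by apply: eq_bigl => j; rewrite !inE.
  rewrite c00 memv0 => /eqP E.
  have aa j : a j = 0.
    have := ind (fun j => ups x j * a j); rewrite (eq_bigl predT) => [|e]; last by rewrite inE.
    by move=> /(_ E j (in_setT _))/eqP; rewrite mulf_eq0 (negPf (u0 j)) => /eqP.
  by move: na; rewrite big1 => [/esym/eqP|j _]; rewrite ?oner_eq0 // aa mul0r.
have dzf : \dim (zf @: Z) = \dim Z.
  apply: limg_dim_eq; apply/eqP; rewrite -subv0; apply/subvP => v; rewrite memv_cap memv_ker => /andP[vZ /eqP v0].
  rewrite memv0 (zf_img v (fun=> 0)) ?eqxx //; last exact: tangent0.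
  by rewrite v0 -[(fun=> 0)](@ffun_0 R X) -dPhiHE linear0.
have kd : (\dim (Kern x) <= c)%N.
  apply: leq_trans (kern_dim_rows n_gt0 only1 i'z fx u0 ind) _.
  rewrite setCT cards0 mul0n add0n (bigD1 l0) ?inE //= big1 ?addn0 // => l /andP[_ ll].
  by rewrite El // dimv0.
rewrite dzf; have cZ : (c <= \dim Z)%N by exact: leq_of_add dZ bn.
move: c0 kd cZ; move: (c) (\dim Z) (\dim (Kern x)).
have ar (a1 a2 a3 : nat) : (0 < a1 -> a3 <= a1 -> a1 <= a2 -> a1.-1 + a3 < a2 + a2)%N by lia.
exact: ar.
Qed.
End LastColumnNull.

Lemma orth_basis (R : realType) (n t : nat) (u : 'I_t -> 'I_n -> R) : t = n ->
  (forall j l, dot (u j) (u l) = (j == l)%:R) -> forall a b, \sum_j u j a * u j b = (a == b)%:R.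
Proof.
move=> tn; move: u; rewrite tn => u ou a b.
pose U : 'M[R]_n := \matrix_(i, j) u j i.
have UU : U^T *m U = 1%:M.
  by apply/matrixP => i j; rewrite !mxE -ou; apply: eq_bigr => c _; rewrite !mxE.
have /matrixP/(_ a b) := mulmx1C UU; rewrite !mxE => <-.
by apply: eq_bigr => j _; rewrite !mxE.
Qed.

Section LastColumn.
Variables (R : realType) (k n t s : nat).
Hypotheses (n_gt0 : (0 < n)%N) (tn : (t <= n)%N).
Local Notation D := {ffun 'I_k -> 'I_n}.
Local Notation X := (vars k n t).
Local Notation tangent := (@tangent R k n t s).
Variables z0 i1 i2 : 'I_k.
Hypothesis only1 : forall i : 'I_k, (i < s)%N = (i == z0).
Hypotheses (i1z : i1 != z0) (i2z : i2 != z0) (i12 : i1 != i2).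
Local Notation bcol := (@bcol R k n t z0).
Local Notation Bt := (@Bt R k n t z0).
Local Notation That := (@That R k n t z0).
Local Notation Ecol := (@Ecol R k n t z0).
Local Notation indep := (@indep R k n t z0).
Local Notation below := (@below t setT).
Variables (A : tensor R k n) (x : X -> R).
Hypotheses (kx : kkt_at s A x) (u0 : forall j, ups x j != 0) (ind : indep x setT).
Local Notation krow := (krow z0 x setT).

Lemma krow_zero_all xi : tangent x xi -> dPhi x xi = 0 ->
  (forall l, krow xi l = 0 \/ (Ecol x (below l) :&: That x l = 0)%VS) -> forall z, xi z = 0.
Proof.
move=> tx dx h; have fx := kkt_feas kx.
have xT j a : j \notin [set: 'I_t] -> ucol xi j z0 a = 0 by rewrite inE.
apply: (krow_inj only1 fx u0 ind tx dx) => // l _.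
suff : forall m (l : 'I_t), (t - l <= m)%N -> krow xi l = 0 by move=> /(_ t l); apply; rewrite leq_subr.
move=> {l} m; elim: m => [|m IH] l tl.
  by move: tl (ltn_ord l); lia.
have [//|cap0] := h l.
apply/eqP; rewrite -memv0 -cap0 memv_cap; apply/andP; split; first by apply/EcolP; eexists.
apply: (krow_That only1 i1z fx u0 ind) => [||||l' _ ll']; rewrite ?inE //.
by apply: IH; move: tl ll' (ltn_ord l'); lia.
Qed.

Lemma below_last l : (n.-1 <= #|below l|)%N -> below l = [set~ l] /\ t = n.
Proof.
move=> h; have sub : below l \subset [set~ l].
  by apply/subsetP => j; rewrite /below inE !inE => jl; apply: contraTneq jl => ->; rewrite ltnn.
have := subset_leq_card sub; rewrite cardsC1 card_ord => h2.
have t0 := ltn_ord l.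
have e : #|below l| = t.-1 by move: h h2 t0 tn n_gt0; move: #|below l| => c; lia.
split; first by apply/eqP; rewrite eqEcard sub cardsC1 card_ord e leqnn.
by move: h h2 t0 tn n_gt0; move: #|below l| => c; lia.
Qed.

(** Under the last hypothesis only a last column [l0] can carry a relation, and then [t = n]. The
    direction [xi], scaled to norm 1 in row [l0], supplies the coefficients [a], and its factors in
    the unit modes supply [q]. As [t = n], the columns of mode [z0] form a basis, so the factor of
    [xi] in that mode is given by [a] as well, and [bform_slot] turns into the condition on
    [zform]. *)
Lemma last_pattern_exists xi : tangent x xi -> dPhi x xi = 0 -> (exists z, xi z != 0) ->
  (forall tau, tangent x tau -> bform s A x tau xi = 0) ->
  (forall l, (0 < \dim (Ecol x (below l) :&: That x l))%N -> (n.-1 <= #|below l|)%N) ->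
  exists l0 i', i' != z0 /\ last_pattern z0 i' l0 A x.
Proof.
move=> tx dx [z1 xi1] bx big; have fx := kkt_feas kx.
have [l0 dl0] : exists l0, (0 < \dim (Ecol x (below l0) :&: That x l0))%N.
  apply: contrapT => no; move/eqP: xi1; apply; apply: krow_zero_all => // l; right.
  by apply/eqP; rewrite -dimv_eq0 -leqn0 leqNgt; apply/negP => h; apply: no; exists l.
have [bl0 tE1] := below_last (big _ dl0).
have other l : l != l0 -> (Ecol x (below l) :&: That x l = 0)%VS.
  move=> ll; apply/eqP; rewrite -dimv_eq0 -leqn0 leqNgt; apply/negP => /big/below_last[bl _].
  have h1 : l \in below l0 by rewrite bl0 !inE.
  have h2 : l0 \in below l by rewrite bl !inE eq_sym.
  by move: h1 h2; rewrite /below !inE /= => h1 h2; have := ltn_trans h1 h2; rewrite ltnn.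
pose a0 j := dot (ucol x l0 z0) (ucol xi j z0).
pose r := Num.sqrt (\sum_j a0 j * a0 j).
have sq j : 0 <= a0 j * a0 j by rewrite -expr2 sqr_ge0.
have r0 : \sum_j a0 j * a0 j > 0.
  rewrite lt_def sumr_ge0 ?andbT => [|j _]; last by rewrite -expr2 sqr_ge0.
  apply/negP => /eqP/(psumr_eq0P (fun j _ => sq j)) aa; move/eqP: xi1; apply; apply: krow_zero_all => // l.
  have [->|/other] := eqVneq l l0; last by right.
  left; apply: big1 => j _; rewrite (_ : dot _ _ = 0) ?mulr0 ?scale0r //.
  by have /eqP := aa j isT; rewrite mulf_eq0 orbb => /eqP.
have rp : 0 < r by rewrite sqrtr_gt0.
clear z1 xi1.
(* Linearity is available in the form [c * xi + xi], so this amounts to multiplication by [r^-1]. *)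
pose c := r^-1 - 1.
pose xi' z := c * xi z + xi z.
have tx' : tangent x xi' by exact: tangent_lin.
have dx' : dPhi x xi' = 0 by rewrite dPhi_lin dx scaler0 addr0.
have bx' tau : tangent x tau -> bform s A x tau xi' = 0.
  move=> /bx b0; rewrite -[RHS](mulr0 (c + 1)) -[X in _ = _ * X]b0 mulr_sumr; apply: eq_bigr => h _.
  by rewrite coefF_lin; ring.
pose a j := dot (ucol x l0 z0) (ucol xi' j z0).
have aE j : a j = r^-1 * a0 j by rewrite /a ucol_lin dot_linr -/(a0 j) /c; ring.
clearbody xi'.
have na : \sum_j a j * a j = 1.
  have -> : \sum_j a j * a j = r^-1 ^+ 2 * \sum_j a0 j * a0 j.
    by rewrite mulr_sumr; apply: eq_bigr => j _; rewrite aE; ring.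
  by rewrite -[\sum_j a0 j * a0 j]sqr_sqrtr ?ltW // -/r -exprMn mulVf ?expr1n // gt_eqF.
have al0 : a l0 = 0 by rewrite /a dotC (tangent_self _ _ tx').
have slot := slot_eq only1 fx l0 dx'.
rewrite -[X in X + _ + _]/(\sum_j (ups x j * a j) *: Bt x j) in slot.
have [i0 i0z [b0 xb0]] : exists2 i0, i0 != z0 & exists b, ucol xi' l0 i0 b != 0.
  apply: contrapT => no.
  have xz i : i != z0 -> ucol xi' l0 i = fun=> 0.
    move=> iz; apply/funext => b; apply: contrapT => /eqP h; apply: no; exists i => //; by exists b.
  have E : \sum_j (ups x j * a j + (j == l0)%:R * ups xi' l0) *: Bt x j = 0.
    rewrite -[RHS]slot [X in _ + X](_ : _ = 0) ?addr0; last first.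
      by rewrite big1 ?scaler0 // => i iz; rewrite xz // rk_0.
    under eq_bigr => j _ do rewrite scalerDl.
    rewrite big_split /=; congr (_ + _); rewrite (bigD1 l0) //= big1 ?addr0 => [|j /negPf->].
      by rewrite eqxx mul1r.
    by rewrite mul0r scale0r.
  have a00 j : a j = 0.
    have [->//|jl] := eqVneq j l0.
    have := @ind (fun j => ups x j * a j + (j == l0)%:R * ups xi' l0).
    rewrite (eq_bigl predT) => [|e]; last by rewrite inE.
    move=> /(_ E j (in_setT _)); rewrite (negPf jl) mul0r addr0 => /eqP.
    by rewrite mulf_eq0 (negPf (u0 j)) => /eqP.
  by move: na; rewrite big1 => [/esym/eqP|j _]; rewrite ?oner_eq0 // a00 mul0r.
pose i' := if i0 == i1 then i2 else i1.
have i'z : i' != z0 by rewrite /i'; case: ifP.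
have i0i' : i0 != i' by rewrite /i'; case: (eqVneq i0 i1) => [->|].
(* The multiple of [Bt x l0] in the slot equation is absorbed in mode [i'], where [q] need not be
   orthogonal to the column. *)
pose q i b := if i == z0 then 0 else - ups x l0 * ucol xi' l0 i b - (i == i')%:R * (ups xi' l0 * ucol x l0 i b).
have qi i : i != z0 -> i != i' -> q i = fun b => - ups x l0 * ucol xi' l0 i b.
  by move=> iz ii; apply/funext => b; rewrite /q (negPf iz) (negPf ii) mul0r subr0.
have qi' : q i' = fun b => - ups xi' l0 * ucol x l0 i' b + (- ups x l0 * ucol xi' l0 i' b + 0).
  by apply/funext => b; rewrite /q (negPf i'z) eqxx /=; ring.
exists l0, i'; split=> //; split=> //.
exists a, q; split=> //.
- split=> [//|b|i iz ii]; first by rewrite /q eqxx.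
  rewrite qi // (_ : (fun b => _) = fun b => - ups x l0 * ucol xi' l0 i b + 0); last by apply/funext => b; rewrite addr0.
  by rewrite dot_linl (tangent_self _ _ tx') dot0l mulr0 addr0.
- move/eqP: slot; rewrite -addrA addr_eq0 => /eqP ->.
  rewrite opprD -!scaleNr scaler_sumr (bigD1 i') //= [RHS](bigD1 i') //= addrA; congr (_ + _).
    rewrite qi' rk_lin (_ : (fun b => _ + 0) = fun b => - ups x l0 * ucol xi' l0 i' b); last by apply/funext => b; rewrite addr0.
    rewrite rk_Z; congr (_ *: _ + _); rewrite -[LHS]scale1r (Bt_That _ _ _ i'z); congr (rk (upd _ _ _)).
    by apply/funext => b; rewrite mul1r.
  by apply: eq_bigr => i /andP[iz ii]; rewrite qi // rk_Z.
- move=> th uth.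
  pose tau := @emb R k n t i' l0 ([ffun b => th b] : {ffun 'I_n -> R^o}).
  have tauT : tau \in Theta x i' l0.
    apply: memv_img; apply/perpP; rewrite -[RHS]uth; apply: eq_bigr => b _; by rewrite ffunE.
  have tE : ucol tau l0 i' = th by rewrite /tau ucol_emb; apply/funext => b; rewrite ffunE.
  have := bx' tau (Theta_tangent (unit_mode only1 i'z) tauT).
  rewrite (bform_slot (unit_mode only1 i'z) (Theta_zero tauT) kx tx') ?tE //.
  move/eqP; rewrite mulf_eq0 (negPf (u0 l0)) /= subr_eq0 => /eqP E.
  have xz0 : ucol xi' l0 z0 = fun b => \sum_j - a j * ucol x j z0 b.
    apply/funext => b.
    have ob := orth_basis (u := fun j => ucol x j z0) tE1 (fun j l => orth_col fx j l (z0s only1)) _ b.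
    transitivity (\sum_d ucol xi' l0 z0 d * (d == b)%:R).
      rewrite (bigD1 b) //= big1 ?addr0 => [|d /negPf->]; last by rewrite mulr0.
      by rewrite eqxx mulr1.
    under eq_bigr => d _ do rewrite -ob mulr_sumr.
    rewrite exchange_big /=; apply: eq_bigr => j _.
    rewrite /a -(tangent_skew _ _ (z0s only1) tx') dotC /dot mulr_suml.
    by apply: eq_bigr => d _; rewrite mulrA.
  pose SE := slotE x tau i' l0.
  have S0 : SE z0 (ucol xi' l0 z0) = - \sum_j a j *: rk (upd (upd (ucol x l0) z0 (ucol x j z0)) i' th).
    rewrite xz0 /SE /slotE tE updC 1?eq_sym // rk_sum -sumrN; apply: eq_bigr => j _.
    by rewrite rk_Z scaleNr updC.
  have ipN (S : {ffun D -> R^o}) : ip A (- S) = - ip A S by rewrite -scaleN1r ip_Zr mulN1r.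
  have ipD (S T : {ffun D -> R^o}) : ip A (S + T) = ip A S + ip A T.
    by rewrite /ip -big_split; apply: eq_bigr => J _; rewrite addfE mulrDr.
  rewrite /zform ipD ip_Zr -[\sum_j _]opprK -S0 !ipN ip_sumr.
  transitivity (ups x l0 * \sum_(i | i != i') ip A (SE i (ucol xi' l0 i))).
    rewrite [in RHS](bigD1 z0) 1?eq_sym //= mulrDr; congr (_ + _); first by rewrite mulrNN.
    rewrite -sumrN mulr_sumr; apply: eq_big => [i|i /andP[iz ii]]; first exact: andbC.
    rewrite qi // updC // rk_Z ip_Zr mulNr opprK; congr (_ * ip A _).
    by rewrite /SE /slotE tE updC 1?eq_sym.
  rewrite E qi' dot_linl uth mulr0 add0r dot_linl dot0l addr0 dotC; ring.
- exists i0; first by rewrite i0z.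
  by exists b0; rewrite qi // mulf_neq0 // oppr_eq0.
Qed.

End LastColumn.

(** * Generic nondegeneracy *)

Section MaximalIndependent.
Variables (R : realType) (k n t : nat) (z0 : 'I_k) (x : vars k n t -> R).

Lemma max_indep : exists I, indep z0 x I /\ forall l, l \notin I -> Bt z0 x l \in Ecol z0 x I.
Proof.
have i0 : `[< indep z0 x set0 >] by apply/asboolP => al _ j; rewrite inE.
have [I /asboolP indI Imax] := @arg_maxnP _ set0 (fun I => `[< indep z0 x I >]) (fun I => #|I|) i0.
exists I; split=> // l lI.
have /existsNP[al /not_implyP[al0 /existsNP[j /not_implyP[jI alj]]]] : ~ indep z0 x (l |: I).
  by move=> h; have := Imax (l |: I) (introT (asboolP _) h); rewrite /= cardsU1 lI add1n ltnn.
rewrite big_setU1 //= in al0.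
have al_l : al l != 0.
  apply/eqP => a0; rewrite a0 scale0r add0r in al0.
  by move: jI; rewrite !inE => /orP[/eqP E|jI]; apply: alj; [rewrite E|exact: indI al0 _ jI].
apply/EcolP; exists (fun j => - (al l)^-1 * al j).
under eq_bigr => i _ do rewrite -scalerA.
rewrite -scaler_sumr; move/eqP: al0; rewrite addrC addr_eq0 => /eqP ->.
by rewrite scalerN scaleNr opprK scalerA mulVf // scale1r.
Qed.
End MaximalIndependent.

Section Singular.
Variables (R : realType) (k n t s : nat).
Hypotheses (k_ge3 : (3 <= k)%N) (s_gt0 : (0 < s)%N) (n_gt0 : (0 < n)%N) (tn : (t <= n)%N).
Local Notation X := (vars k n t).

Definition singular_kkt (A : tensor R k n) := exists x : X -> R,
  [/\ kkt_at s A x, forall j, ups x j != 0 &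
   exists2 v : X -> R, exists z, v z != 0 & lin_zero (@conP R k n t s) (@yP R k n t s) (@kapP R k n t s) A x (fun=> 0) v].

Definition degenerate (A : tensor R k n) (x xi : X -> R) :=
  [/\ tangent s x xi, dPhi x xi = 0, exists z, xi z != 0 & forall tau, tangent s x tau -> bform s A x tau xi = 0].

(** Singular points without a degenerate direction are covered by [null_regular], so only tensors
    with a degenerate direction remain to be covered by null sets. *)
Lemma null_singular_of (T : countType) (N : T -> tensor R k n -> Prop) : (forall p, null_set (N p)) ->
  (forall A x xi, kkt_at s A x -> (forall j, ups x j != 0) -> degenerate A x xi -> exists p, N p A) ->
  null_set singular_kkt.
Proof.
move=> nN H; pose N' (o : option T) : tensor R k n -> Prop := match o with Some p => N p | None => fun A => exists x, kkt_at s A x /\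
  (exists2 v : X -> R, exists z, v z != 0 & lin_zero (@conP R k n t s) (@yP R k n t s) (@kapP R k n t s) A x (fun=> 0) v) /\
  (forall xi, tangent s x xi -> dPhi x xi = 0 -> (forall tau, tangent s x tau -> bform s A x tau xi = 0) ->
    forall z, xi z = 0) end.
apply: null_sub (null_cup_count (N := N') n_gt0 _); last by case=> //; exact: null_regular.
move=> A [x [kx u0 sing]].
have [[xi dxi]|nd] := pselect (exists xi, degenerate A x xi).
  by have [p pA] := H A x xi kx u0 dxi; exists (Some p).
exists None, x; split=> //; split=> // xi tx dx bx z.
by apply: contrapT => /eqP xz; apply: nd; exists xi; split=> //; exists z.
Qed.

(** With three orthonormal modes no degenerate direction exists: the third mode kills the cross term
    of [kern_pair]. With two, [k >= 3] leaves the unit mode needed by [null_two]; with one, it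
    leaves the two needed by the count of relations. *)
Theorem null_singular_kkt : null_set singular_kkt.
Proof.
have k0 : (0 < k)%N by apply: leq_trans k_ge3.
have k1 : (1 < k)%N by apply: leq_trans k_ge3.
pose z0 : 'I_k := Ordinal k0; pose z1 : 'I_k := Ordinal k1; pose z2 : 'I_k := Ordinal k_ge3.
have [s1|s2] := leqP s 1.
  have only1 (i : 'I_k) : (i < s)%N = (i == z0).
    have -> : s = 1%N by apply/eqP; rewrite eqn_leq s1.
    by rewrite ltnS leqn0.
  have z1z : z1 != z0 by [].
  have z2z : z2 != z0 by [].
  have z12 : z1 != z2 by [].
  pose N (o : option ('I_t * 'I_k)) : tensor R k n -> Prop := match o with
    | None => fun A => exists x : X -> R, [/\ kkt_at s A x, forall j, ups x j != 0 &
        exists I, [/\ indep z0 x I, forall l, l \notin I -> Bt z0 x l \in Ecol z0 x I &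
        (exists l, l \notin I) \/ (exists l, [/\ l \in I, (0 < \dim (Ecol z0 x (below I l) :&: That z0 x l))%N
         & (#|below I l| < n.-1)%N])]]
    | Some (l0, i') => fun A => i' != z0 /\ exists x, [/\ kkt_at s A x, forall j, ups x j != 0 & last_pattern z0 i' l0 A x] end.
  apply: (null_singular_of (N := N)) => [[[l0 i']|]|A x xi kx u0 [tx dx xi0 bx]].
  - have [i'z|i'z] := eqVneq i' z0; last first.
      by apply: null_sub (null_last_pattern n_gt0 tn only1 i'z l0) => A [].
    apply: null_sub (null_last_pattern n_gt0 tn only1 z1z l0) => A [].
    by rewrite i'z eqxx.
  - exact: (null_one n_gt0 tn only1 z1z z2z z12).
  have [I [indI BI]] := max_indep z0 x.
  have [[l lI]|nI] := pselect (exists l, l \notin I).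
    by exists None, x; split=> //; exists I; split=> //; left; exists l.
  have IT : I = setT by apply/setP => l; rewrite inE; apply: contrapT => /negP h; apply: nI; exists l.
  rewrite IT in indI BI.
  have [[l [dl bl]]|nl] := pselect (exists l, (0 < \dim (Ecol z0 x (below setT l) :&: That z0 x l))%N /\ (#|below setT l| < n.-1)%N).
    by exists None, x; split=> //; exists setT; split=> //; right; exists l; rewrite inE.
  have [|l0 [i' [i'z lp]]] := last_pattern_exists n_gt0 tn only1 z1z z2z z12 kx u0 indI tx dx xi0 bx.
    by move=> l dl; rewrite leqNgt; apply/negP => bl; apply: nl; exists l.
  by exists (Some (l0, i')); split=> //; exists x.
have z0s : (z0 < s)%N by [].
have z1s : (z1 < s)%N by [].
have z01 : z0 != z1 by [].
have z10 : z1 != z0 by [].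
have [s2'|s3] := leqP s 2.
  pose N (_ : unit) (A : tensor R k n) := exists x : X -> R, [/\ kkt_at s A x, forall j, ups x j != 0 &
    exists xi, [/\ tangent s x xi, dPhi x xi = 0 & exists z, xi z != 0]].
  apply: (null_singular_of (N := N)) => [[]|A x xi kx u0 [tx dx xi0 bx]].
    exact: (null_two t n_gt0 z0s z1s z01 (z2 := z2) s2').
  by exists tt, x; split=> //; exists xi.
apply: (null_singular_of (T := void) (N := fun v => match v with end)) => [[]|A x xi kx u0 [tx dx [z xiz] bx]].
have fx := kkt_feas kx; move/eqP: xiz; case.
apply: (kern_zero fx u0 z1s tx dx) => m.
apply: (kern_span2 fx u0 z1s z0s z10 tx dx) => l.
have [<-|lm] := eqVneq m l; first by rewrite dotC (tangent_self _ _ tx).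
have z2s : (z2 < s)%N by [].
have := kern_pair fx z0s z1s z01 lm dx (d := upd (ucol x m) z1 (ucol x l z1)).
rewrite upd_other // upd_same => /(_ erefl erefl).
rewrite (bigD1 z2) //= upd_other // (orth_col fx _ _ z2s) eq_sym (negPf lm) mul0r !mulr0 add0r.
rewrite big1 => [/eqP|i /andP[_ i1]]; last by rewrite upd_other // (unit_col fx).
by rewrite mulr1 mulf_eq0 (negPf (u0 m)) dotC => /eqP.
Qed.

End Singular.

(** * Linear convergence from an error bound *)

Section Bolzano.
Variable R : realType.

(** [y] is the limit superior, the supremum of the levels reached infinitely often. *)
Lemma bolzano_real (x : nat -> R) (B : R) : (forall p, `|x p| <= B) ->
  exists y, forall e, 0 < e -> forall N, exists2 p, (N <= p)%N & `|x p - y| <= e.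
Proof.
move=> xB; pose S : classical_sets.set R := fun c => forall N, exists2 p, (N <= p)%N & c <= x p.
have S0 : S (- B) by move=> N; exists N => //; have := xB N; rewrite ler_norml => /andP[].
have Sub : classical_sets.ubound S B.
  move=> c /(_ 0%N)[p _ h]; apply: le_trans h _; have := xB p; by rewrite ler_norml => /andP[].
have hS : classical_sets.has_sup S by split; [exists (- B)|exists B].
exists (sup S) => e e0 N.
have [c Sc cy] := sup_adherent e0 hS.
have [N0 N0P] : exists N0, forall p, (N0 <= p)%N -> x p < sup S + e.
  apply: contrapT => no; have : S (sup S + e).
    move=> M; apply: contrapT => h; apply: no; exists M => p Mp; rewrite ltNge; apply/negP => h2.
    by apply: h; exists p.
  by move/(ub_le_sup (ex_intro _ B Sub)); rewrite gerDl leNgt e0.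
have [p pN cp] := Sc (maxn N N0).
exists p; first by apply: leq_trans pN; rewrite leq_maxl.
rewrite ler_norml; have := N0P p (leq_trans (leq_maxr _ _) pN); move: cy cp; lra.
Qed.

Lemma archi_inv (e : R) : 0 < e -> exists N : nat, forall q, (N <= q)%N -> q.+1%:R^-1 <= e.
Proof.
move=> e0; have := archi_boundP (ltW (_ : 0 < e^-1)); rewrite invr_gt0 => /(_ e0).
move: (Num.Def.archi_bound _) => N h; exists N => q Nq.
rewrite -[e]invrK lef_pV2 ?posrE ?invr_gt0 ?ltr0Sn //.
by apply: ltW; apply: lt_le_trans h _; rewrite ler_nat ltnW.
Qed.

Lemma bolzano (X : finType) (x : nat -> X -> R) (B : R) : (forall p z, `|x p z| <= B) ->
  exists y, forall e, 0 < e -> forall N, exists2 p, (N <= p)%N & forall z, `|x p z - y z| <= e.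
Proof.
move=> xB.
have [phi [y [phiq yP]]] : exists (phi : nat -> nat) (y : X -> R), (forall q, (q <= phi q)%N) /\
    forall z, z \in enum X -> forall e, 0 < e -> exists N, forall q, (N <= q)%N -> `|x (phi q) z - y z| <= e.
  elim: (enum X) => [|z0 s [phi [y [phiq yP]]]]; first by exists id, (fun=> 0).
  have [w wP] := @bolzano_real (fun q => x (phi q) z0) B (fun q => xB _ _).
  have /choice[psi psiP] : forall q : nat, exists p, (q <= p)%N /\ `|x (phi p) z0 - w| <= q.+1%:R^-1.
    by move=> q; have [|p pq h] := wP q.+1%:R^-1 _ q; [rewrite invr_gt0 ltr0Sn|exists p].
  exists (phi \o psi), (fun z => if z == z0 then w else y z); split=> [q|z zs e e0].
    by apply: leq_trans (phiq _); have [] := psiP q.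
  have [zE|zz] := eqVneq z z0.
    have [N NP] := archi_inv e0; exists N => q Nq /=; rewrite zE; have [_ h] := psiP q.
    exact: le_trans h (NP q Nq).
  have [|N NP] := yP z _ e e0; first by move: zs; rewrite inE (negPf zz).
  by exists N => q Nq /=; apply: NP; apply: leq_trans Nq _; have [] := psiP q.
exists y => e e0 N.
have /choice[M MP] : forall z, exists M, forall q, (M <= q)%N -> `|x (phi q) z - y z| <= e.
  by move=> z; apply: yP => //; rewrite mem_enum.
exists (phi (maxn N (\max_z M z))); first by apply: leq_trans (phiq _); rewrite leq_maxl.
move=> z; apply: MP; apply: leq_trans (leq_maxr _ _); exact: leq_bigmax.
Qed.

End Bolzano.

Lemma mul_frac_le (R : realType) (a b : R) : 0 <= a -> 0 <= b -> b * (a / (b + 1)) <= a.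
Proof.
move=> a0 b0; have p : 0 < b + 1 by lra.
rewrite mulrCA ler_piMr // ler_pdivrMr // mul1r; lra.
Qed.

Section LinearConvergence.
Variables (R : realType) (X Q : finType) (G : Q -> pexpr R X).

(** Injectivity expresses each coordinate of the increment through the differentials, which are
    bounded by [eta] plus a quadratic remainder. For increments below [rho] the remainder accounts
    for at most half of the increment and is absorbed. *)
Lemma error_bound (y : X -> R) : (forall q, ev (G q) y = 0) ->
  (forall v, (forall q, dv (G q) y v = 0) -> forall z, v z = 0) ->
  exists K rho : R, [/\ 0 <= K, 0 < rho & forall y' d eta, 0 <= eta -> d <= rho -> (forall z, `|y' z - y z| <= d) ->
    (forall q, `|ev (G q) y'| <= eta) -> forall z, `|y' z - y z| <= K * eta].
Proof.
move=> Gy inj.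
have /choice[phi phiE] : forall q, exists F : 'Hom({ffun X -> R^o}, R^o), forall v, F v = dv (G q) y v.
  move=> q; have [|F FE] := @lin_hom R _ _ (fun v : {ffun X -> R^o} => dv (G q) y v : R^o); last by exists F.
  by move=> a u v; rewrite ffun_lin dv_lin.
have /choice[c cP] : forall z, exists c : Q -> R, forall v : {ffun X -> R^o}, v z = \sum_q c q * dv (G q) y v.
  move=> z; have [F FE] := proj_hom R z.
  have [v v0|c cP] := @functional_span R _ _ phi F.
    by rewrite FE; apply: inj => q; rewrite -phiE.
  by exists c => v; rewrite -FE cP; apply: eq_bigr => q _; rewrite phiE.
have cP' z v : v z = \sum_q c z q * dv (G q) y v.
  pose w : {ffun X -> R^o} := [ffun z => v z].
  have wE : (w : X -> R) = v by apply/funext => z'; rewrite ffunE.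
  by have := cP z w; rewrite wE.
have [m [m0 mP _]] := max_norm y.
have [B B0 BP] := taylor_fam G (m + 1).
pose L := \sum_z \sum_q `|c z q|.
have L0 : 0 <= L by apply: sumr_ge0 => z _; apply: sumr_ge0.
have Lz z : \sum_q `|c z q| <= L.
  by rewrite /L (bigD1 z) //= lerDl; apply: sumr_ge0 => ? _; apply: sumr_ge0.
pose rho := Num.min 1 ((2 * (L * B + 1))^-1).
have LB0 : 0 <= L * B by exact: mulr_ge0.
have rho0 : 0 < rho by rewrite lt_min ltr01 invr_gt0 /=; lra.
exists (2 * L), rho; split=> //; first by lra.
move=> y' d eta eta0 drho yd Geta.
pose v z := y' z - y z.
have [dm [dm0 dmP dmE]] := max_norm v.
have est (e : R) : 0 <= e -> e <= 1 -> (forall z, `|v z| <= e) -> forall z, `|v z| <= L * (eta + B * e ^+ 2).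
  move=> e0 e1 ve z; rewrite (cP' z v).
  have h q : `|dv (G q) y v| <= eta + B * e ^+ 2.
    have [||_ _] := BP q y y' e e0 _ _ ve.
    - by move=> i; apply: le_trans (mP i) _; lra.
    - move=> i; have -> : y' i = y i + v i by rewrite /v; ring.
      by apply: le_trans (ler_normD _ _) _; apply: lerD => //; apply: le_trans (ve i) e1.
    rewrite Gy subr0 => t; have -> : dv (G q) y v = ev (G q) y' - (ev (G q) y' - dv (G q) y v) by ring.
    by apply: le_trans (ler_normB _ _) _; exact: lerD.
  have p0 : 0 <= eta + B * e ^+ 2 by rewrite addr_ge0 // mulr_ge0 // sqr_ge0.
  apply: le_trans (ler_norm_sum _ _ _) _.
  apply: (@le_trans _ _ (\sum_q `|c z q| * (eta + B * e ^+ 2))).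
    by apply: ler_sum => q _; rewrite normrM ler_wpM2l.
  by rewrite -mulr_suml ler_wpM2r.
have dmd : dm <= Num.max 0 d by case: dmE => [->|[z ->]]; rewrite le_max ?lexx // yd orbT.
have dmr : dm <= rho by apply: le_trans dmd _; rewrite ge_max ltW.
have dm1 : dm <= 1 by apply: le_trans dmr _; rewrite ge_min lexx.
have := est dm dm0 dm1 dmP => h.
have sm : L * B * dm <= 2^-1.
  have : dm <= (2 * (L * B + 1))^-1 by apply: le_trans dmr _; rewrite ge_min lexx orbT.
  have P0 : 0 < 2 * (L * B + 1) by lra.
  rewrite -(ler_pM2l P0) mulfV ?gt_eqF // => t.
  have -> : L * B * dm = 2^-1 * (2 * (L * B * dm)) by field.
  rewrite -[leRHS]mulr1 ler_pM2l ?invr_gt0 ?ltr0Sn //; move: t dm0; nra.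
have dmb : dm <= 2 * L * eta.
  have [->|[z zE]] := dmE; first by rewrite !mulr_ge0.
  have := h z; rewrite -zE => t.
  have : L * (eta + B * dm ^+ 2) <= L * eta + 2^-1 * dm.
    rewrite mulrDr lerD2l; have -> : L * (B * dm ^+ 2) = (L * B * dm) * dm by ring.
    by rewrite ler_wpM2r.
  by move: t; lra.
by move=> z; apply: le_trans (dmP z) dmb.
Qed.



Definition cluster_point (x : nat -> X -> R) (y : X -> R) : Prop :=
  forall e, 0 < e -> forall N, exists2 p, (N <= p)%N & forall z, `|x p z - y z| <= e.

(** Once the objective is close to its value at a cluster point, all later [delta] are small. The
    error bound then gives [|x p.+1 - y| <= D * delta p], which keeps the sequence near [y] without
    summing step lengths. *)
Lemma linear_convergence (E : pexpr R X) (x : nat -> X -> R) (delta : nat -> R) (B c C : R) :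
  (forall p z, `|x p z| <= B) -> (forall p, 0 <= delta p) -> 0 < c -> 0 <= C ->
  (forall p z, `|x p.+1 z - x p z| <= C * delta p) ->
  (forall p q, `|ev (G q) (x p.+1)| <= C * delta p) ->
  (forall p, c * delta p ^+ 2 <= ev E (x p.+1) - ev E (x p)) ->
  (forall y, cluster_point x y -> (forall q, ev (G q) y = 0) ->
    (forall v, (forall q, dv (G q) y v = 0) -> forall z, v z = 0) /\
    exists K, forall p d, (forall z, `|x p z - y z| <= d) -> ev E y - ev E (x p) <= K * d ^+ 2) ->
  exists y, [/\ cluster_point x y, forall q, ev (G q) y = 0 &
   exists C' q, [/\ 0 < C', 0 < q < 1 & exists P0, forall p, (P0 <= p)%N -> forall z, `|x p z - y z| <= C' * q ^+ p]].
Proof.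
move=> xB d0 c0 C0 xC GC EC H.
have [y cy] := bolzano xB.
have yB z : `|y z| <= B + 1.
  have [p _ /(_ z)] := cy 1 ltr01 0%N; have := xB p z; rewrite !ler_norml; move: (x p z) (y z) => a b /andP[h1 h2] /andP[h3 h4]; apply/andP; split; lra.
have xB1 p z : `|x p z| <= B + 1 by apply: le_trans (xB p z) _; rewrite lerDl ler01.
have [B1 B10 BP] := taylor_fam (fun o : option Q => if o is Some q then G q else E) (B + 1).
have lip o p e : 0 <= e -> (forall z, `|x p z - y z| <= e) ->
    `|ev (if o is Some q then G q else E) (x p) - ev (if o is Some q then G q else E) y| <= B1 * e.
  by move=> e0 h; have [//|//|_ h2 _] := BP o y (x p) e e0 _ _ h.
have mono p m : ev E (x p) <= ev E (x (p + m)%N).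
  elim: m => [|m IH]; first by rewrite addn0.
  apply: le_trans IH _; rewrite addnS -subr_ge0; apply: le_trans (EC _).
  by rewrite mulr_ge0 ?sqr_ge0 // ltW.
have mono' p p' : (p <= p')%N -> ev E (x p) <= ev E (x p') by move=> /subnKC <-; exact: mono.
have Ey p : ev E (x p) <= ev E y.
  apply/ler_addgt0Pr => e e0; have [p' pp h] := cy (e / (B1 + 1)) (divr_gt0 e0 (ltr_pwDr ltr01 B10)) p.
  apply: le_trans (mono' _ _ pp) _.
  have := lip None p' _ (ltW (divr_gt0 e0 (ltr_pwDr ltr01 B10))) h.
  have : B1 * (e / (B1 + 1)) <= e by apply: mul_frac_le => //; exact: ltW.
  rewrite ler_norml; lra.
have small eta : 0 < eta -> exists P, forall p, (P <= p)%N -> delta p <= eta.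
  move=> eta0; have ce : 0 < c * eta ^+ 2 by rewrite mulr_gt0 // exprn_gt0.
  have e0 : 0 < c * eta ^+ 2 / (B1 + 1) by rewrite divr_gt0 // ltr_pwDr.
  have [P _ h] := cy _ e0 0%N; exists P => p Pp.
  have := lip None P _ (ltW e0) h => /= t.
  have t2 : B1 * (c * eta ^+ 2 / (B1 + 1)) <= c * eta ^+ 2 by apply: mul_frac_le => //; exact: ltW.
  have : c * delta p ^+ 2 <= c * eta ^+ 2.
    move: (EC p) (Ey p.+1) (mono' _ _ Pp) t t2; rewrite ler_norml; lra.
  by rewrite ler_pM2l // ler_sqr // ?nnegrE // ltW.
have Gy q : ev (G q) y = 0.
  apply/eqP; rewrite -normr_le0; apply/ler_addgt0Pr => e e0; rewrite add0r.
  have P0 : 0 < C + B1 + 1 by lra.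
  have e1 : 0 < e / (C + B1 + 1) by rewrite divr_gt0.
  have [P PP] := small _ e1; have [p Pp h] := cy _ e1 P.+1.
  case: p Pp h => // p; rewrite ltnS => Pp h.
  have := lip (Some q) p.+1 _ (ltW e1) h => /= t1.
  have t2 : C * delta p <= C * (e / (C + B1 + 1)) by rewrite ler_wpM2l // PP.
  have t3 := GC p q.
  have t4 : (C + B1) * (e / (C + B1 + 1)) <= e by apply: mul_frac_le; [exact: ltW|exact: addr_ge0].
  have -> : ev (G q) y = ev (G q) (x p.+1) - (ev (G q) (x p.+1) - ev (G q) y) by ring.
  apply: le_trans (ler_normB _ _) _; move: t1 t2 t3 t4; rewrite mulrDl; lra.
exists y; split=> //.
have [inj [K KP]] := H y cy Gy.
have [K1 [rho [K10 rho0 eb]]] := error_bound Gy inj.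
pose D := K1 * C; have D0 : 0 <= D by exact: mulr_ge0.
(* With [delta p <= eta], a point within [rho / 2] of [y] moves to one within [rho], where the error
   bound holds and returns it to within [rho / 2]. *)
pose eta := rho / (2 * (C + D + 1)).
have P0 : 0 < 2 * (C + D + 1) by lra.
have eta0 : 0 < eta by rewrite divr_gt0.
have etaE : (C + D + 1) * eta = rho / 2 by rewrite /eta; field; lra.
have [P PP] := small _ eta0.
have [p0 Pp0 close0] := cy (rho / 2) (divr_gt0 rho0 (ltr0Sn _ 1)) P.
have next p : (p0 <= p)%N -> (forall z, `|x p z - y z| <= rho / 2) -> forall z, `|x p.+1 z - y z| <= D * delta p.
  move=> pp cl; have dp : delta p <= eta by apply: PP; apply: leq_trans pp.
  have Cd : C * delta p <= rho / 2.
    rewrite -etaE; apply: le_trans (ler_wpM2l C0 dp) _; rewrite ler_wpM2r ?ltW //; lra.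
  move=> z; rewrite /D -mulrA; apply: (eb _ rho) => // [|z'].
    by rewrite mulr_ge0.
  have -> : x p.+1 z' - y z' = (x p.+1 z' - x p z') + (x p z' - y z') by ring.
  apply: le_trans (ler_normD _ _) _; have := xC p z'; have := cl z'; move: Cd; lra.
have close m : forall z, `|x (p0 + m)%N z - y z| <= rho / 2.
  elim: m => [|m IH]; first by rewrite addn0.
  move=> z; rewrite addnS; apply: le_trans (next _ (leq_addr _ _) IH z) _.
  have dp : delta (p0 + m)%N <= eta by apply: PP; apply: leq_trans (leq_addr _ _).
  rewrite -etaE; apply: le_trans (ler_wpM2l D0 dp) _; rewrite ler_wpM2r ?ltW //; lra.
pose e p := ev E y - ev E (x p).
have e_ge0 p : 0 <= e p by rewrite subr_ge0.
pose K3 := `|K| * D ^+ 2 / c.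
have K30 : 0 <= K3 by rewrite !mulr_ge0 ?invr_ge0 ?sqr_ge0 // ltW.
(* The gap obeys [e' <= K3 (e - e')], hence contracts by [K3 / (K3 + 1)]; this slightly larger ratio
   is positive even when [K3 = 0]. *)
pose q1 := (K3 + 1) / (K3 + 2).
have K32 : 0 < K3 + 2 by lra.
have q10 : 0 < q1 by rewrite divr_gt0 //; lra.
have q11 : q1 < 1 by rewrite ltr_pdivrMr // mul1r; lra.
have estep m : e (p0 + m).+1 <= q1 * e (p0 + m)%N.
  have h := KP _ _ (next _ (leq_addr m p0) (close m)).
  have h2 : e (p0 + m).+1 <= K3 * (e (p0 + m)%N - e (p0 + m).+1).
    apply: le_trans h _; apply: (@le_trans _ _ (`|K| * (D * delta (p0 + m)%N) ^+ 2)).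
      by rewrite ler_wpM2r ?sqr_ge0 // ler_norm.
    have -> : `|K| * (D * delta (p0 + m)%N) ^+ 2 = K3 * (c * delta (p0 + m)%N ^+ 2).
      by rewrite /K3; field; rewrite gt_eqF.
    rewrite ler_wpM2l // /e; have := EC (p0 + m)%N; lra.
  have q1E : q1 * (K3 + 2) = K3 + 1 by rewrite /q1 mulfVK // gt_eqF.
  rewrite -(ler_pM2r K32) mulrAC q1E; move: h2 (e_ge0 (p0 + m)%N) (e_ge0 (p0 + m).+1).
  move: (e (p0 + m)%N) (e (p0 + m).+1) => u v; have : 0 <= K3 := K30; move: (K3) => w; nra.
(* The gap bounds the square of the step, so distances decrease with the square root of the
   ratio. *)
pose sq := Num.sqrt q1.
have sq2 : sq ^+ 2 = q1 by rewrite sqr_sqrtr // ltW.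
have sq0 : 0 < sq by rewrite sqrtr_gt0.
have sq1 : sq < 1.
  by rewrite -(@ltr_pXn2r _ 2) ?nnegrE ?ler01 ?(ltW sq0) // sq2 expr1n.
have egeo m : e (p0 + m)%N <= e p0 * (sq ^+ m) ^+ 2.
  elim: m => [|m IH]; first by rewrite addn0 expr0 expr1n mulr1.
  rewrite addnS; apply: le_trans (estep m) _; rewrite [sq ^+ m.+1]exprS exprMn sq2 mulrCA.
  by rewrite ler_wpM2l // ltW.
pose T := Num.sqrt (e p0 / c).
have T0 : 0 <= T by exact: sqrtr_ge0.
have T2 : T ^+ 2 = e p0 / c by rewrite sqr_sqrtr // divr_ge0 // ltW.
have dgeo m : delta (p0 + m)%N <= T * sq ^+ m.
  have Ts : 0 <= T * sq ^+ m by rewrite mulr_ge0 // exprn_ge0 // ltW.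
  have : delta (p0 + m)%N ^+ 2 <= (T * sq ^+ m) ^+ 2.
    rewrite exprMn T2 mulrAC ler_pdivlMr // mulrC; apply: le_trans (egeo m).
    by apply: le_trans (EC _) _; rewrite lerB.
  by rewrite ler_sqr ?nnegrE.
exists ((D * T + 1) / sq ^+ p0.+1), sq; split.
- by rewrite divr_gt0 ?exprn_gt0 // ltr_pwDr // mulr_ge0.
- by rewrite sq0.
- exists p0.+1 => p pp z; have pE : p = (p0 + (p - p0.+1)).+1 by rewrite -addSn subnKC.
  move: (p - p0.+1)%N pE => m ->.
  apply: le_trans (next _ (leq_addr _ _) (close m) z) _.
  rewrite -addSn exprD mulrA mulfVK ?gt_eqF ?exprn_gt0 //.
  apply: le_trans (ler_wpM2l D0 (dgeo m)) _; rewrite mulrA ler_wpM2r ?exprn_ge0 ?(ltW sq0) //.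
  by rewrite lerDl.
Qed.

End LinearConvergence.

(** * Polar factors *)

Section Rayleigh.
Variables (R : realType) (t : nat) (S : 'M[R]_t).
Hypothesis Ssym : S^T = S.

Definition qform (y z : 'I_t -> R) : R := \sum_i \sum_j y i * S i j * z j.

Lemma qformC y z : qform y z = qform z y.
Proof.
rewrite /qform exchange_big; apply: eq_bigr => i _; apply: eq_bigr => j _ /=.
by rewrite -[in LHS]Ssym mxE; ring.
Qed.

Lemma qform_linl a y y' z : qform (fun i => a * y i + y' i) z = a * qform y z + qform y' z.
Proof.
rewrite /qform mulr_sumr -big_split; apply: eq_bigr => i _ /=.
by rewrite mulr_sumr -big_split; apply: eq_bigr => j _ /=; ring.
Qed.

Lemma qform_linr a y y' z : qform z (fun i => a * y i + y' i) = a * qform z y + qform z y'.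
Proof. by rewrite qformC qform_linl !(qformC z). Qed.

Lemma qform_min : (exists i : 'I_t, True) -> exists m y, [/\ dot y y = 1, qform y y = m & forall z, m * dot z z <= qform z z].
Proof.
move=> [i0 _].
pose V : classical_sets.set R := fun c => exists2 y, dot y y = 1 & c = qform y y.
have unitb (y : 'I_t -> R) : dot y y = 1 -> forall i, `|y i| <= 1.
  move=> y1 i; rewrite -(@ler_pXn2r _ 2) ?nnegrE ?ler01 // expr1n -normrX ger0_norm ?sqr_ge0 //.
  rewrite -y1 /dot (bigD1 i) //= expr2 lerDl sumr_ge0 // => j _; by rewrite -expr2 sqr_ge0.
pose qP : pexpr R 'I_t := psum predT (fun i => psum predT (fun j => PM (PM (PX i) (PC (S i j))) (PX j))).
pose nP : pexpr R 'I_t := psum predT (fun i => PM (PX i) (PX i)).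
have qPE y : ev qP y = qform y y.
  by rewrite ev_psum; apply: eq_bigr => i _; rewrite ev_psum.
have nPE y : ev nP y = dot y y by rewrite ev_psum.
have [B B0 BP] := taylor_fam (fun b : bool => if b then qP else nP) 2.
have hV : classical_sets.has_inf V.
  split; first by exists (qform (unitv R i0) (unitv R i0)), (unitv R i0) => //; rewrite dot_unitl /unitv eqxx.
  exists (- B) => _ [y y1 ->]; rewrite -qPE.
  have [|||] := BP true y y 0 (lexx _).
  - by move=> i; apply: le_trans (unitb y y1 i) _; lra.
  - by move=> i; apply: le_trans (unitb y y1 i) _; lra.
  - by move=> i; rewrite subrr normr0.
  by rewrite ler_norml => /andP[].
pose m := inf V.
have mV y : dot y y = 1 -> m <= qform y y.
  by move=> y1; apply: ge_inf; [have [] := hV|exists y].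
have /choice[y yP] : forall p : nat, exists y, dot y y = 1 /\ qform y y <= m + p.+1%:R^-1.
  move=> p; have [|_ [y y1 ->] h] := inf_adherent (_ : 0 < p.+1%:R^-1) hV; first by rewrite invr_gt0 ltr0Sn.
  by exists y; split=> //; exact: ltW.
have [w wP] := @bolzano R _ y 1 (fun p => unitb _ (yP p).1).
have wb i : `|w i| <= 2.
  have [p _ /(_ i)] := wP 1 ltr01 0%N; have := unitb _ (yP p).1 i; rewrite !ler_norml.
  by move: (y p i) (w i) => a b /andP[h1 h2] /andP[h3 h4]; apply/andP; split; lra.
have lip (b : bool) p e : 0 <= e -> (forall z, `|y p z - w z| <= e) ->
    `|ev (if b then qP else nP) (y p) - ev (if b then qP else nP) w| <= B * e.
  move=> e0 h; have [|//] := BP b w (y p) e e0 wb _ h.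
  by move=> i; apply: le_trans (unitb _ (yP p).1 i) _; lra.
have w1 : dot w w = 1.
  apply/eqP; rewrite -subr_eq0 -normr_le0; apply/ler_addgt0Pr => e e0; rewrite add0r.
  have e1 : 0 < e / (B + 1) by rewrite divr_gt0 //; lra.
  have [p _ h] := wP _ e1 0%N; have := lip false p _ (ltW e1) h; rewrite !nPE (yP p).1 distrC => h2.
  by apply: le_trans h2 (mul_frac_le _ _) => //; exact: ltW.
have qw : qform w w <= m.
  apply/ler_addgt0Pr => e e0.
  have e2 : 0 < e / 2 by lra.
  have e1 : 0 < (e / 2) / (B + 1) by rewrite divr_gt0 //; lra.
  have [N NP] := archi_inv e2.
  have [p Np h] := wP _ e1 N; have := lip true p _ (ltW e1) h; rewrite !qPE => h2.
  have h3 := mul_frac_le (ltW e2) B0; have [_ h4] := yP p; have := NP p Np => h5.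
  move: h2; rewrite ler_norml => /andP[h6 h7]; move: h3 h4 h5 h6 h7; move: (B * _) (p.+1%:R^-1) (qform (y p) _) (qform w w) => c1 c2 c3 c4; lra.
exists m, w; split=> // [|z]; first by apply/eqP; rewrite eq_le qw mV.
have [z0|z0] := eqVneq (dot z z) 0.
  have zz := dot_eq0 z0; rewrite z0 mulr0 /qform big1 // => i _.
  by rewrite big1 // => j _; rewrite zz !mul0r.
have zp : 0 < dot z z by rewrite lt_def z0 dot_ge0.
pose r := Num.sqrt (dot z z).
have rp : 0 < r by rewrite sqrtr_gt0.
have r2 : r ^+ 2 = dot z z by rewrite sqr_sqrtr ?ltW.
have sc a u : qform (fun i => a * u i) (fun i => a * u i) = a ^+ 2 * qform u u.
  rewrite /qform mulr_sumr; apply: eq_bigr => i _; rewrite mulr_sumr; apply: eq_bigr => j _; ring.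
have sd a (u : 'I_t -> R) : dot (fun i => a * u i) (fun i => a * u i) = a ^+ 2 * dot u u.
  by rewrite /dot mulr_sumr; apply: eq_bigr => i _; ring.
have := mV (fun i => r^-1 * z i); rewrite sd sc -r2 -exprMn mulVf ?expr1n ?gt_eqF // => /(_ erefl).
by rewrite exprVn mulrC -ler_pdivlMr ?invrK ?invr_gt0 ?exprn_gt0 // mulrC.
Qed.

(** A minimizer of the quadratic form on the unit sphere is an eigenvector, so the minimum is an
    eigenvalue and cannot lie below [eps]. *)
Lemma rayleigh eps : ~ mineig_lt S eps -> forall y, eps * dot y y <= qform y y.
Proof.
move=> nm y; have [[i0 _]|no] := pselect (exists i : 'I_t, True); last first.
  rewrite /dot /qform !big1 ?mulr0 // => i; by case: no; exists i.
have [m [w [w1 wm mz]]] := qform_min (ex_intro _ i0 I).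
apply: le_trans (mz y); rewrite ler_wpM2r ?dot_ge0 // leNgt; apply/negP => me; apply: nm.
exists m; split=> //; apply/eigenvalueP; exists (\row_i w i); last first.
  apply/eqP => /rowP h; have : dot w w = 0.
    by rewrite /dot big1 // => i _; have := h i; rewrite !mxE => ->; rewrite mul0r.
  by rewrite w1; apply/eqP; rewrite oner_eq0.
(* [qform z z - m dot z z] vanishes at its minimum [w], so it is stationary there. *)
have st z : qform w z = m * dot w z.
  pose b := qform w z - m * dot w z; pose f := qform z z - m * dot z z.
  have h s : 0 <= 2 * s * b + s ^+ 2 * f.
    have := mz (fun i => s * z i + w i).
    rewrite qform_linl !qform_linr dot_linl !dot_linr wm w1 (qformC z w) (dotC z w) /b /f.
    by move: (qform w z) (qform z z) (dot w z) (dot z z) => a1 a2 a3 a4; rewrite expr2; nra.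
  have f0 : 0 <= f by have := mz z; rewrite /f; lra.
  apply/eqP; rewrite -subr_eq0 -/b; apply/eqP.
  (* At this parameter the quadratic is negative unless [b = 0]; adding 1 to [f] avoids a division
     by zero. *)
  have := h (- b / (f + 1)); have fp : 0 < f + 1 by lra.
  have -> : 2 * (- b / (f + 1)) * b + (- b / (f + 1)) ^+ 2 * f = - (b ^+ 2 * (f + 2) / (f + 1) ^+ 2).
    by field; rewrite gt_eqF.
  rewrite oppr_ge0 -mulrA pmulr_lle0 => [b2|].
    by apply/eqP; rewrite -sqrf_eq0 eq_le b2 sqr_ge0.
  by rewrite divr_gt0 ?exprn_gt0 //; lra.
apply/rowP => j; rewrite !mxE; have := st (unitv R j).
rewrite [dot w _]dotC dot_unitl => <-; apply: eq_bigr => i _; rewrite !mxE (bigD1 j) //= big1 => [|l lj].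
  by rewrite /unitv eqxx mulr1 addr0.
by rewrite /unitv (negPf lj) mulr0.
Qed.
End Rayleigh.

Section Polar.
Variables (R : realType) (n t : nat).
Implicit Types (X W U : 'M[R]_(n, t)).

Definition mdot W X : R := \sum_a \sum_j W a j * X a j.

Lemma tr_mdot W X : \tr (W^T *m X) = mdot W X.
Proof.
rewrite /mxtrace /mdot exchange_big; apply: eq_bigr => j _ /=; rewrite mxE.
by apply: eq_bigr => a _; rewrite mxE.
Qed.

Lemma stiefelP W : stiefel W <-> forall j l, \sum_a W a j * W a l = (j == l)%:R.
Proof.
split=> [h j l|h]; first by have /matrixP/(_ j l) := h; rewrite !mxE => <-; apply: eq_bigr => a _; rewrite mxE.
by apply/matrixP => j l; rewrite !mxE -h; apply: eq_bigr => a _; rewrite mxE.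
Qed.

(** Rotating the rows [a] and [b] of [W] keeps its columns orthonormal and changes their share of
    the trace from [p] to [c p + s d]. The best rotation reaches the square root of
    [p ^+ 2 + d ^+ 2], so optimality forces [d = 0]. *)
Lemma polar_sym X W : is_polar X W -> forall a b, \sum_j X a j * W b j = \sum_j X b j * W a j.
Proof.
move=> [/stiefelP sW opt] a b; have [->//|ab] := eqVneq a b.
have ba : b != a by rewrite eq_sym.
pose Y c d := \sum_j X c j * W d j.
pose p := Y a a + Y b b; pose d := Y a b - Y b a.
have key c s : c ^+ 2 + s ^+ 2 = 1 -> c * p + s * d <= p.
  move=> cs.
  pose Q : 'M[R]_(n, t) := \matrix_(i, j) if i == a then c * W a j + s * W b j
    else if i == b then - s * W a j + c * W b j else W i j.
  have sQ : stiefel Q.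
    apply/stiefelP => j l; rewrite -sW (bigD1 a) //= (bigD1 b) //= [RHS](bigD1 a) //= [in RHS](bigD1 b) //=.
    rewrite !mxE !eqxx (negPf ba) !addrA; congr (_ + _).
      transitivity ((c ^+ 2 + s ^+ 2) * (W a j * W a l + W b j * W b l)); first by ring.
      by rewrite cs mul1r.
    by apply: eq_bigr => i /andP[ia ib]; rewrite !mxE (negPf ia) (negPf ib).
  have := opt Q sQ; rewrite !tr_mdot /mdot (bigD1 a) //= (bigD1 b) //= [leRHS](bigD1 a) //= [in leRHS](bigD1 b) //=.
  have -> : \sum_(i | (i != a) && (i != b)) \sum_j Q i j * X i j = \sum_(i | (i != a) && (i != b)) \sum_j W i j * X i j.
    by apply: eq_bigr => i /andP[ia ib]; apply: eq_bigr => j _; rewrite !mxE (negPf ia) (negPf ib).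
  rewrite !addrA lerD2r.
  have -> : \sum_j Q a j * X a j = c * Y a a + s * Y a b.
    by rewrite /Y !mulr_sumr -big_split; apply: eq_bigr => j _ /=; rewrite mxE eqxx; ring.
  have -> : \sum_j Q b j * X b j = - s * Y b a + c * Y b b.
    by rewrite /Y !mulr_sumr -big_split; apply: eq_bigr => j _ /=; rewrite mxE (negPf ba) eqxx; ring.
  have -> : \sum_j W a j * X a j = Y a a by apply: eq_bigr => j _; rewrite mulrC.
  have -> : \sum_j W b j * X b j = Y b b by apply: eq_bigr => j _; rewrite mulrC.
  by rewrite /p /d; lra.
apply/eqP; rewrite -subr_eq0 -/(Y a b) -/(Y b a) -/d.
have [//|d0] := eqVneq d 0.
have pd : 0 < p ^+ 2 + d ^+ 2 by rewrite ltr_wpDl ?sqr_ge0 // lt_def sqr_ge0 sqrf_eq0 d0.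
pose r := Num.sqrt (p ^+ 2 + d ^+ 2).
have r0 : 0 < r by rewrite sqrtr_gt0.
have r2 : r ^+ 2 = p ^+ 2 + d ^+ 2 by rewrite sqr_sqrtr // ltW.
have := key (p / r) (d / r).
have -> : (p / r) ^+ 2 + (d / r) ^+ 2 = 1 by rewrite !expr_div_n -mulrDl -r2 divff // sqrf_eq0 gt_eqF.
move=> /(_ erefl).
have -> : p / r * p + d / r * d = r.
  transitivity (r ^+ 2 / r); first by rewrite r2; field; rewrite gt_eqF.
  by rewrite expr2 mulfK // gt_eqF.
move=> rp; have : r ^+ 2 <= p ^+ 2 by rewrite ler_sqr ?nnegrE // ?(ltW r0) // (le_trans (ltW r0)).
by rewrite r2 gerDl leNgt lt_def sqr_ge0 sqrf_eq0 d0.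
Qed.

Lemma sym_decomp X W : stiefel W -> (forall a b, \sum_j X a j * W b j = \sum_j X b j * W a j) ->
  X = W *m (W^T *m X) /\ (W^T *m X)^T = W^T *m X.
Proof.
rewrite /stiefel => sW h.
have sym : X *m W^T = W *m X^T.
  apply/matrixP => a b; rewrite !mxE (eq_bigr (fun j => X a j * W b j)) => [|j _]; last by rewrite mxE.
  rewrite h; apply: eq_bigr => j _; by rewrite mxE mulrC.
have XE : X = W *m (X^T *m W).
  by rewrite mulmxA -sym -mulmxA sW mulmx1.
have SE : W^T *m X = X^T *m W by rewrite {1}XE mulmxA sW mul1mx.
by rewrite SE -XE trmx_mul trmxK SE.
Qed.

Lemma polar_decomp X W : is_polar X W -> X = W *m (W^T *m X) /\ (W^T *m X)^T = W^T *m X.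
Proof. by move=> pX; apply: sym_decomp; [case: pX|exact: polar_sym]. Qed.

Lemma mdot_sub W U : stiefel W -> stiefel U -> \sum_a \sum_j (W a j - U a j) ^+ 2 = 2 * (t%:R - mdot W U).
Proof.
have nrm (V : 'M[R]_(n, t)) : stiefel V -> \sum_a \sum_j V a j ^+ 2 = t%:R.
  move=> /stiefelP h; rewrite exchange_big /= -[t in RHS]card_ord -sumr_const; apply: eq_bigr => j _.
  have := h j j; rewrite eqxx => h1; transitivity (\sum_a V a j * V a j) => //; apply: eq_bigr => a _; rewrite expr2 //.
move=> sW sU; transitivity (\sum_a \sum_j W a j ^+ 2 + \sum_a \sum_j U a j ^+ 2 - 2 * mdot W U).
  rewrite /mdot mulr_sumr -big_split -sumrB; apply: eq_bigr => a _ /=.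
  by rewrite mulr_sumr -big_split -sumrB; apply: eq_bigr => j _ /=; ring.
by rewrite !nrm //; ring.
Qed.

(** With [X = W S], twice the loss of trace is the sum over the rows of the quadratic form of [S] at
    [W - U], because both matrices have orthonormal columns; the eigenvalues of [S] are at least
    [eps]. *)
Lemma polar_gap X W U eps : is_polar X W -> ~ mineig_lt (W^T *m X) eps -> stiefel U ->
  eps * \sum_a \sum_j (W a j - U a j) ^+ 2 <= 2 * (mdot W X - mdot U X).
Proof.
move=> pX nm sU; have [XE Ssym] := polar_decomp pX.
set S := W^T *m X in nm XE Ssym.
have ray := rayleigh Ssym nm.
have sW : stiefel W by case: pX.
have E : \sum_a qform S (fun j => W a j - U a j) (fun j => W a j - U a j) = 2 * (mdot W X - mdot U X).
  have XE' a l : X a l = \sum_j W a j * S j l by rewrite {1}XE mxE.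
  have q1 (V : 'M[R]_(n, t)) : \sum_a qform S (V a) (W a) = mdot V X.
    rewrite /mdot; apply: eq_bigr => a _; rewrite /qform; apply: eq_bigr => i _; rewrite XE' mulr_sumr; apply: eq_bigr => j _.
    by rewrite -{1}Ssym mxE; ring.
  have q2 : \sum_a qform S (U a) (U a) = \sum_a qform S (W a) (W a).
    have tr (V : 'M[R]_(n, t)) : stiefel V -> \sum_a qform S (V a) (V a) = \sum_j S j j.
      move=> /stiefelP h; rewrite /qform exchange_big; apply: eq_bigr => i _ /=.
      rewrite exchange_big /= (bigD1 i) //= [X in _ + X]big1 ?addr0 => [|j ji].
        transitivity (S i i * \sum_a V a i * V a i); last by rewrite h eqxx mulr1.
        rewrite mulr_sumr; apply: eq_bigr => a _; ring.
      transitivity (S i j * \sum_a V a i * V a j); last by rewrite h eq_sym (negPf ji) mulr0.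
      by rewrite mulr_sumr; apply: eq_bigr => a _; ring.
    by rewrite !tr.
  transitivity (\sum_a qform S (W a) (W a) + \sum_a qform S (U a) (U a) - 2 * \sum_a qform S (U a) (W a)).
    rewrite mulr_sumr -big_split -sumrB; apply: eq_bigr => a _ /=.
    have dE : (fun j => W a j - U a j) = fun j => -1 * U a j + W a j by apply/funext => j; ring.
    by rewrite dE (qform_linl S) !(qform_linr Ssym) (qformC Ssym (W a)); ring.
  by rewrite q2 !q1; ring.
rewrite -E mulr_sumr; apply: ler_sum => a _; apply: le_trans (ray _).
by rewrite le_eqVlt; apply/orP; left; apply/eqP; congr (_ * _); apply: eq_bigr => j _; rewrite expr2.
Qed.

(** Here [U] itself is a competitor, and the regularizing term separates it from [W] by [eps] times
    half their square distance. *)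
Lemma polar_reg_gap X W U eps : is_polar (X + eps *: U) W -> stiefel U ->
  eps * \sum_a \sum_j (W a j - U a j) ^+ 2 <= 2 * (mdot W X - mdot U X).
Proof.
move=> [sW /(_ U)] h sU; have := h sU; rewrite !tr_mdot mdot_sub //.
have E (V : 'M[R]_(n, t)) : mdot V (X + eps *: U) = mdot V X + eps * mdot V U.
  rewrite /mdot mulr_sumr -big_split; apply: eq_bigr => a _ /=.
  by rewrite mulr_sumr -big_split; apply: eq_bigr => j _ /=; rewrite !mxE; ring.
have UU : mdot U U = t%:R.
  have := mdot_sub sU sU; rewrite big1 => [|a _]; last by rewrite big1 // => j _; rewrite subrr expr0n.
  lra.
by rewrite !E UU; move: (mdot W X) (mdot U X) (mdot W U) => a b c; lra.
Qed.

End Polar.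

(** * One sweep of the algorithm *)

Section Entries.
Variables (R : realType) (k n : nat).
Local Notation D := {ffun 'I_k -> 'I_n}.
Variable A : tensor R k n.

Lemma dot_unit_le (u v : 'I_n -> R) : dot u u = 1 -> dot u v ^+ 2 <= dot v v.
Proof.
move=> u1; have := dot_ge0 (fun a => - dot u v * u a + v a).
rewrite dot_linl !dot_linr u1 (dotC v u); nra.
Qed.

Lemma unit_entry (u : 'I_n -> R) a : dot u u = 1 -> `|u a| <= 1.
Proof.
move=> u1; rewrite -(@ler_pXn2r _ 2) ?nnegrE ?ler01 // expr1n -normrX ger0_norm ?sqr_ge0 //.
by rewrite -u1 /dot (bigD1 a) //= expr2 lerDl sumr_ge0 // => b _; rewrite -expr2 sqr_ge0.
Qed.

Definition tnorm : R := \sum_I `|A I|.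

Lemma tnorm_ge0 : 0 <= tnorm. Proof. exact: sumr_ge0. Qed.

Lemma prod_le1 (T : finType) (r : seq T) (c : T -> R) : (forall l, `|c l| <= 1) -> `|\prod_(l <- r) c l| <= 1.
Proof.
move=> c1; elim: r => [|l r IH]; first by rewrite big_nil normr1.
by rewrite big_cons normrM mulr_ile1.
Qed.

Lemma prod_lip (T : finType) (r : seq T) (c d : T -> R) e : (forall l, `|c l| <= 1) -> (forall l, `|d l| <= 1) ->
  (forall l, `|c l - d l| <= e) -> `|\prod_(l <- r) c l - \prod_(l <- r) d l| <= (size r)%:R * e.
Proof.
move=> c1 d1 cd; elim: r => [|l r IH]; first by rewrite !big_nil subrr normr0 mul0r.
rewrite !big_cons /= -natr1 mulrDl mul1r.
have -> : c l * \prod_(j <- r) c j - d l * \prod_(j <- r) d j =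
    c l * (\prod_(j <- r) c j - \prod_(j <- r) d j) + (c l - d l) * \prod_(j <- r) d j by ring.
apply: le_trans (ler_normD _ _) _; rewrite !normrM; apply: lerD.
  by rewrite -[leRHS]mul1r ler_pM.
by rewrite -[leRHS]mulr1 ler_pM // prod_le1.
Qed.

Lemma ip_bound (c : cfg R k n) : (forall i a, `|c i a| <= 1) -> `|ip A (rk c)| <= tnorm.
Proof.
move=> c1; apply: le_trans (ler_norm_sum _ _ _) _; apply: ler_sum => I _.
by rewrite normrM rkE ler_piMr // prod_le1.
Qed.

Lemma ip_lip (c d : cfg R k n) e : (forall i a, `|c i a| <= 1) -> (forall i a, `|d i a| <= 1) ->
  (forall i a, `|c i a - d i a| <= e) -> `|ip A (rk c) - ip A (rk d)| <= tnorm * k%:R * e.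
Proof.
move=> c1 d1 cd; rewrite /ip -sumrB; apply: le_trans (ler_norm_sum _ _ _) _.
rewrite -mulrA /tnorm mulr_suml; apply: ler_sum => I _; rewrite -mulrBr normrM ler_wpM2l // !rkE.
apply: le_trans (prod_lip _ (fun l => c1 l (I l)) (fun l => d1 l (I l)) (fun l => cd l (I l))) _.
by rewrite /index_enum -enumT size_enum_ord.
Qed.

Lemma unitv_le1 a b : `|unitv R (n := n) a b| <= 1.
Proof. by rewrite /unitv; case: eqP; rewrite ?normr1 ?normr0 ?ler01. Qed.

Lemma ip_upd (c : cfg R k n) i v : ip A (rk (upd c i v)) = dot v (fun a => ip A (rk (upd c i (unitv R a)))).
Proof. by rewrite rk_expand ip_sumr; apply: eq_bigr => a _; rewrite ip_Zr. Qed.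

Section Columns.
Variable t : nat.
Implicit Types U V M : 'I_k -> 'M[R]_(n, t).

Definition ucf U j : cfg R k n := fun i a => U i a j.
Definition ti U j i a : R := ip A (rk (upd (ucf U j) i (unitv R a))).

Lemma lamE U j : lam A U j = ip A (rk (ucf U j)).
Proof.
apply: eq_bigr => I _; rewrite rkE; congr (_ * _).
by apply: eq_bigr => l _; rewrite mxE.
Qed.

Lemma tauiE U j i a : taui A (cols U j) i a 0 = ti U j i a.
Proof.
rewrite mxE big_mkcond; apply: eq_bigr => I _; rewrite rkE rk1_upd /unitv.
case: eqP => _; last by rewrite mul0r mulr0.
by rewrite mul1r; congr (_ * _); apply: eq_bigr => l _; rewrite mxE.
Qed.

Lemma VmatE U i a j : Vmat A U i a j = ti U j i a.
Proof. by rewrite -tauiE mxE. Qed.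

Lemma VLamE U i a j : (Vmat A U i *m Lam A U) a j = ti U j i a * lam A U j.
Proof. by rewrite mul_mx_diag mxE VmatE !mxE. Qed.

Lemma lam_ti U j i : lam A U j = dot (fun a => U i a j) (ti U j i).
Proof. by rewrite lamE -(upd_id (ucf U j) i) ip_upd. Qed.

Definition mixn (m : nat) V U : 'I_k -> 'M[R]_(n, t) := fun l => if (l < m)%N then V l else U l.

Lemma mixnS_ti V U j (i : 'I_k) : ti (mixn i.+1 V U) j i = ti (mixn i V U) j i.
Proof.
apply/funext => a; rewrite /ti; congr (ip A (rk _)); apply/funext => l; rewrite /upd.
case: eqVneq => // li; apply/funext => b; rewrite /ucf /mixn ltnS leq_eqVlt.
by rewrite [nat_of_ord l == _](negPf li).
Qed.

Lemma lam_mixnS V U j (i : 'I_k) : lam A (mixn i.+1 V U) j = dot (fun a => V i a j) (ti (mixn i V U) j i).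
Proof. by rewrite (lam_ti _ j i) mixnS_ti /mixn ltnSn. Qed.

Lemma lam_mixn V U j (i : 'I_k) : lam A (mixn i V U) j = dot (fun a => U i a j) (ti (mixn i V U) j i).
Proof. by rewrite (lam_ti _ j i) /mixn ltnn. Qed.

Lemma feasible_unit s U : feasible s U -> forall i j, dot (fun a => U i a j) (fun a => U i a j) = 1.
Proof.
move=> fU i j; have := fU i; case: ifP => _ h; last first.
  by rewrite -(h j); apply: eq_bigr => a _; rewrite expr2.
by have /stiefelP/(_ j j) := h; rewrite eqxx.
Qed.

Variables (s : nat) (kappa : R).
Hypotheses (s_gt0 : (0 < s)%N) (sk : (s <= k)%N) (kappa0 : 0 < kappa).

Definition half_step U V : Prop :=
  [/\ forall i : 'I_k, (i < s)%N -> stiefel (V i),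
      forall i : 'I_k, i = s.-1 :> nat -> forall j, kappa <= `|dot (fun a => V i a j) (ti (mixn i V U) j i)| &
      forall i : 'I_k, (s <= i)%N -> forall j a,
        V i a j = Num.sg (lam A (mixn i V U) j) / Num.sqrt (dot (ti (mixn i V U) j i) (ti (mixn i V U) j i)) * ti (mixn i V U) j i a].

Section Half.
Variables U V : 'I_k -> 'M[R]_(n, t).
Hypotheses (hUV : half_step U V) (Uu : forall i : 'I_k, (s <= i)%N -> forall j, dot (fun a => U i a j) (fun a => U i a j) = 1).

Lemma als_step (i : 'I_k) j : (s <= i)%N -> kappa <= `|lam A (mixn i V U) j| ->
  [/\ dot (fun a => V i a j) (fun a => V i a j) = 1, `|lam A (mixn i V U) j| <= `|lam A (mixn i.+1 V U) j|,
    exists rho, forall a, ti (mixn i V U) j i a = rho * V i a j &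
    kappa ^+ 2 / 2 * \sum_a (V i a j - U i a j) ^+ 2 <= lam A (mixn i.+1 V U) j ^+ 2 - lam A (mixn i V U) j ^+ 2].
Proof.
move=> si lk; have [_ _ /(_ i si j) VE] := hUV.
have u1 := Uu si j.
set l := lam A (mixn i V U) j in lk VE *; set v := ti (mixn i V U) j i in VE *.
have lE : l = dot (fun a => U i a j) v by exact: lam_mixn.
have l2 : l ^+ 2 <= dot v v by rewrite lE; exact: dot_unit_le.
pose w := Num.sqrt (dot v v).
have w2 : w ^+ 2 = dot v v by rewrite sqr_sqrtr // dot_ge0.
have w0 : 0 <= w by exact: sqrtr_ge0.
have lw : `|l| <= w.
  by rewrite -(@ler_pXn2r _ 2) ?nnegrE // w2 -normrX ger0_norm ?sqr_ge0.
have wk : kappa <= w by apply: le_trans lw.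
have wp : 0 < w by apply: lt_le_trans wk.
have l0 : l != 0 by rewrite -normr_gt0; apply: lt_le_trans lk.
have sg2 : Num.sg l ^+ 2 = 1 by rewrite sqr_sg l0.
have Vf : (fun a => V i a j) = fun a => Num.sg l / w * v a + 0 by apply/funext => a; rewrite VE addr0.
have dV z : dot (fun a => V i a j) z = Num.sg l / w * dot v z by rewrite Vf dot_linl dot0l addr0.
have VV : dot (fun a => V i a j) (fun a => V i a j) = 1.
  rewrite dV [dot v _]dotC dV -w2 mulrA.
  transitivity (Num.sg l ^+ 2 * (w / w) ^+ 2); first by field; rewrite gt_eqF.
  by rewrite sg2 divff ?gt_eqF // expr1n mulr1.
have l'E : lam A (mixn i.+1 V U) j = Num.sg l * w.
  by rewrite lam_mixnS -/v dV -w2; field; rewrite gt_eqF.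
split=> //.
- by rewrite l'E normrM normr_sg l0 mul1r ger0_norm.
- exists (Num.sg l * w) => a; rewrite VE.
  transitivity (Num.sg l ^+ 2 * v a * (w / w)); first by rewrite sg2 divff ?gt_eqF // mul1r mulr1.
  by rewrite -/w; field; rewrite gt_eqF.
have -> : \sum_a (V i a j - U i a j) ^+ 2 = 2 - 2 * (`|l| / w).
  transitivity (dot (fun a => V i a j) (fun a => V i a j) + dot (fun a => U i a j) (fun a => U i a j)
     - 2 * dot (fun a => V i a j) (fun a => U i a j)).
    by rewrite /dot mulr_sumr -big_split -sumrB; apply: eq_bigr => a _ /=; ring.
  by rewrite VV u1 dV [dot v _]dotC -lE -{2}[l]/l normrEsg; field; rewrite gt_eqF.
rewrite l'E exprMn sg2 mul1r.
have -> : kappa ^+ 2 / 2 * (2 - 2 * (`|l| / w)) = kappa ^+ 2 / w * (w - `|l|) by field; rewrite gt_eqF.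
have -> : w ^+ 2 - l ^+ 2 = (w + `|l|) * (w - `|l|) by rewrite -[l ^+ 2]ger0_norm ?sqr_ge0 // normrX; ring.
rewrite ler_wpM2r ?subr_ge0 //; apply: (@le_trans _ _ w); last by rewrite lerDl.
by rewrite ler_pdivrMr // expr2 ler_pM // ltW.
Qed.

(** The truncation test gives the bound right after the last orthonormal mode, and the updates of
    unit modes do not decrease the modulus. *)
Lemma half_lower m : (s <= m <= k)%N -> forall j, kappa <= `|lam A (mixn m V U) j|.
Proof.
move=> /andP[sm]; rewrite -(subnKC sm); move: (m - s)%N => d {m sm}; elim: d => [|d IH] dk j.
  have i0k : (s.-1 < k)%N by rewrite prednK // -ltnS prednK.
  have [_ /(_ (Ordinal i0k) erefl j) h _] := hUV; move: h; rewrite -lam_mixnS /=.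
  by rewrite addn0 prednK.
rewrite addnS in dk *; pose i := Ordinal dk.
have lk : kappa <= `|lam A (mixn i V U) j| by apply: IH; exact: ltnW.
by have [_ h _ _] := als_step (i := i) (leq_addr _ _) lk; exact: le_trans lk h.
Qed.

Lemma half_feasible : feasible s V.
Proof.
move=> i; case: ifP => [si|/negbT]; first by have [h _ _] := hUV; exact: h.
rewrite -leqNgt => si j; have [|h _ _ _] := als_step (j := j) si.
  by apply: half_lower; rewrite si ltnW.
by rewrite -[RHS]h; apply: eq_bigr => a _; rewrite expr2.
Qed.

Lemma mixn_all : mixn k V U = V.
Proof. by apply/funext => i; rewrite /mixn ltn_ord. Qed.

Lemma half_lam j : kappa <= `|lam A V j|.
Proof. by rewrite -mixn_all; apply: half_lower; rewrite sk leqnn. Qed.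

End Half.

Variable eps : R.
Hypothesis eps0 : 0 < eps.

Definition polar_step U V : Prop := forall i : 'I_k, (i < s)%N ->
  let X := Vmat A (mixn i V U) i *m Lam A (mixn i V U) in
  (is_polar X (V i) /\ ~ mineig_lt ((V i)^T *m X) eps) \/ is_polar (X + eps *: U i) (V i).

Section Full.
Variables U V : 'I_k -> 'M[R]_(n, t).
Hypotheses (hUV : half_step U V) (pUV : polar_step U V) (fU : feasible s U).

Let Uu i j : dot (fun a => U i a j) (fun a => U i a j) = 1 := feasible_unit fU i j.
Let fV : feasible s V := half_feasible hUV (fun i _ => Uu i).
Let Vu i j : dot (fun a => V i a j) (fun a => V i a j) = 1 := feasible_unit fV i j.

Definition rate : R := Num.min eps (kappa ^+ 2 / 2).

Lemma rate_gt0 : 0 < rate.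
Proof. by rewrite lt_min eps0 divr_gt0 ?exprn_gt0 ?ltr0Sn. Qed.

(** In an orthonormal mode the polar gap bounds the distance by the sum of [2 l (l' - l)] over the
    columns, with old and new values [l], [l'], and each term is at most [l' ^+ 2 - l ^+ 2]. *)
Lemma mode_ascent (i : 'I_k) : rate * \sum_a \sum_j (V i a j - U i a j) ^+ 2 <=
  fobj A (mixn i.+1 V U) - fobj A (mixn i V U).
Proof.
have S0 : 0 <= \sum_a \sum_j (V i a j - U i a j) ^+ 2.
  by apply: sumr_ge0 => a _; apply: sumr_ge0 => j _; exact: sqr_ge0.
have [si|si] := ltnP i s; last first.
  apply: (@le_trans _ _ (kappa ^+ 2 / 2 * \sum_a \sum_j (V i a j - U i a j) ^+ 2)).
    by rewrite ler_wpM2r // ge_min lexx orbT.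
  rewrite exchange_big /= mulr_sumr /fobj -sumrB; apply: ler_sum => j _.
  have [|_ _ _ h] := als_step hUV (fun i _ => Uu i) (j := j) si; last exact: h.
  by apply: (half_lower hUV (fun i _ => Uu i)); rewrite si ltnW.
apply: (@le_trans _ _ (eps * \sum_a \sum_j (V i a j - U i a j) ^+ 2)).
  by rewrite ler_wpM2r // ge_min lexx.
have sU : stiefel (U i) by have := fU i; rewrite si.
set X := Vmat A (mixn i V U) i *m Lam A (mixn i V U).
have gap : eps * \sum_a \sum_j (V i a j - U i a j) ^+ 2 <= 2 * (mdot (V i) X - mdot (U i) X).
  by case: (pUV si) => [[h1 h2]|h]; [exact: polar_gap|exact: polar_reg_gap].
apply: le_trans gap _.
have E (W : 'M[R]_(n, t)) : mdot W X = \sum_j lam A (mixn i V U) j * dot (fun a => W a j) (ti (mixn i V U) j i).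
  rewrite /mdot exchange_big; apply: eq_bigr => j _; rewrite /dot mulr_sumr; apply: eq_bigr => a _.
  by rewrite VLamE; ring.
rewrite !E /fobj -!sumrB mulr_sumr; apply: ler_sum => j _; rewrite -lam_mixnS -lam_mixn.
move: (lam A (mixn i.+1 V U) j) (lam A (mixn i V U) j) => a b; rewrite -subr_ge0 (_ : _ - _ = (a - b) ^+ 2) ?sqr_ge0 //; ring.
Qed.

Lemma step_ascent : rate * frob_dist V U ^+ 2 <= fobj A V - fobj A U.
Proof.
have S0 : 0 <= \sum_(l < k) \sum_(a < n) \sum_(j < t) (V l a j - U l a j) ^+ 2.
  by apply: sumr_ge0 => i _; apply: sumr_ge0 => a _; apply: sumr_ge0 => j _; exact: sqr_ge0.
rewrite sqr_sqrtr //.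
have h m (mk : (m <= k)%N) : rate * (\sum_(l < k | (l < m)%N) \sum_a \sum_j (V l a j - U l a j) ^+ 2) <=
    fobj A (mixn m V U) - fobj A U.
  elim: m mk => [|m IH] mk.
    by rewrite big1 // mulr0 (_ : mixn 0 V U = U) ?subrr.
  pose i := Ordinal mk; rewrite (bigD1 i) //= mulrDr.
  rewrite (eq_bigl (fun l : 'I_k => (l < m)%N)) => [|l].
    by have := IH (ltnW mk); have := mode_ascent i; rewrite /=; lra.
  rewrite ltnS leq_eqVlt -val_eqE /=.
  by have [->|] := eqVneq (nat_of_ord l) m; rewrite ?ltnn ?andbT.
have := h k (leqnn k); rewrite mixn_all (eq_bigl predT) // => l.
by rewrite ltn_ord.
Qed.

Let delta := frob_dist V U.

Lemma delta_ge0 : 0 <= delta. Proof. exact: sqrtr_ge0. Qed.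

Lemma delta_entry i a j : `|V i a j - U i a j| <= delta.
Proof.
rewrite -(@ler_pXn2r _ 2) ?nnegrE ?delta_ge0 // -normrX ger0_norm ?sqr_ge0 // sqr_sqrtr.
  rewrite (bigD1 i) //= (bigD1 a) //= (bigD1 j) //= -!addrA lerDl !addr_ge0 ?sumr_ge0 // => *; rewrite ?sqr_ge0 //.
    by apply: sumr_ge0 => *; rewrite sqr_ge0.
  by apply: sumr_ge0 => *; apply: sumr_ge0 => *; rewrite sqr_ge0.
by apply: sumr_ge0 => *; apply: sumr_ge0 => *; apply: sumr_ge0 => *; rewrite sqr_ge0.
Qed.

Lemma entryU i a j : `|U i a j| <= 1. Proof. exact: unit_entry (Uu i j). Qed.
Lemma entryV i a j : `|V i a j| <= 1. Proof. exact: unit_entry (Vu i j). Qed.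
Lemma entry_mix m i a j : `|mixn m V U i a j| <= 1.
Proof. by rewrite /mixn; case: ifP => _; [exact: entryV|exact: entryU]. Qed.
Lemma delta_mix m i a j : `|V i a j - mixn m V U i a j| <= delta.
Proof. by rewrite /mixn; case: ifP => _; rewrite ?subrr ?normr0 ?delta_ge0 ?delta_entry. Qed.

Local Notation L := (tnorm * k%:R).

Lemma lip_lam m j : `|lam A V j - lam A (mixn m V U) j| <= L * delta.
Proof.
rewrite !lamE; apply: ip_lip => i a; [exact: entryV|exact: entry_mix|exact: delta_mix].
Qed.

Lemma lip_ti m j i a : `|ti V j i a - ti (mixn m V U) j i a| <= L * delta.
Proof.
apply: ip_lip => i' a'; rewrite /upd; case: eqP => _; rewrite ?unitv_le1 ?entryV ?entry_mix ?subrr ?normr0 ?delta_ge0 //.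
exact: delta_mix.
Qed.

Lemma bound_lam j : `|lam A V j| <= tnorm.
Proof. by rewrite lamE; apply: ip_bound => i a; exact: entryV. Qed.

Lemma bound_ti m j i a : `|ti (mixn m V U) j i a| <= tnorm.
Proof.
by apply: ip_bound => i' a'; rewrite /upd; case: eqP => _; [exact: unitv_le1|exact: entry_mix].
Qed.

(** Right after its update the factor is exactly parallel to the contraction. Later updates perturb
    the contraction by at most [L * delta], and pairing with the unit column compares the multiplier
    with the value. *)
Lemma residual_unit (i : 'I_k) j a : (s <= i)%N ->
  `|ti V j i a - lam A V j * V i a j| <= L * (1 + n%:R) * delta.
Proof.
move=> si; have [|_ _ [rho rhoE] _] := als_step hUV (fun i _ => Uu i) (j := j) si.
  by apply: (half_lower hUV (fun i _ => Uu i)); rewrite si ltnW.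
pose r b := ti V j i b - ti (mixn i V U) j i b.
have rE b : ti V j i b = rho * V i b j + r b by rewrite /r rhoE; ring.
have rl b : `|r b| <= L * delta by exact: lip_ti.
have lE : lam A V j = rho + dot (fun b => V i b j) r.
  rewrite (lam_ti V j i) (_ : ti V j i = fun b => rho * V i b j + r b); last by apply/funext.
  by rewrite dot_linr Vu mulr1.
have -> : ti V j i a - lam A V j * V i a j = r a - dot (fun b => V i b j) r * V i a j by rewrite lE rE; ring.
apply: le_trans (ler_normB _ _) _; rewrite mulrDr mulr1 mulrDl; apply: lerD => //.
rewrite normrM -[leRHS]mulr1; apply: ler_pM => //; last exact: entryV.
apply: le_trans (ler_norm_sum _ _ _) _.
apply: (@le_trans _ _ (\sum_(b < n) L * delta)).
  by apply: ler_sum => b _; rewrite normrM -[leRHS]mul1r ler_pM // entryV.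
by rewrite sumr_const card_ord -[leLHS]mulr_natr [leLHS]mulrAC.
Qed.

(** At the update the symmetry holds exactly, or up to [eps] times the increment if the regularized
    polar factor is chosen; the remaining error comes from the later updates. *)
Lemma residual_stiefel (i : 'I_k) a b : (i < s)%N ->
  `|\sum_j lam A V j * (V i b j * ti V j i a - V i a j * ti V j i b)| <= (t%:R * (4 * tnorm * L + 2 * eps)) * delta.
Proof.
move=> si.
pose X := Vmat A (mixn i V U) i *m Lam A (mixn i V U).
have XE c j : X c j = ti (mixn i V U) j i c * lam A (mixn i V U) j by exact: VLamE.
pose err c j := lam A V j * ti V j i c - X c j.
have errb c j : `|err c j| <= 2 * tnorm * L * delta.
  have -> : err c j = lam A V j * (ti V j i c - ti (mixn i V U) j i c) +
      (lam A V j - lam A (mixn i V U) j) * ti (mixn i V U) j i c by rewrite /err XE; ring.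
  apply: le_trans (ler_normD _ _) _; rewrite !normrM.
  have -> : 2 * tnorm * L * delta = tnorm * (L * delta) + (L * delta) * tnorm by ring.
  by apply: lerD; apply: ler_pM => //; rewrite ?bound_lam ?lip_ti ?lip_lam ?bound_ti.
have [g [gE gb]] : exists g : 'I_t -> R, \sum_j X a j * V i b j - \sum_j X b j * V i a j = \sum_j g j /\
   forall j, `|g j| <= 2 * eps * delta.
  case: (pUV si) => [[h _]|h].
    exists (fun=> 0); rewrite (polar_sym h) subrr big1 //; split=> // j; rewrite normr0.
    by rewrite !mulr_ge0 ?delta_ge0 // ltW.
  exists (fun j => eps * ((V i a j - U i a j) * V i b j - (V i b j - U i b j) * V i a j)); split.
    have := polar_sym h a b; under eq_bigr => j _ do rewrite mxE [(eps *: U i) a j]mxE mulrDl.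
    under [RHS]eq_bigr => j _ do rewrite mxE [(eps *: U i) b j]mxE mulrDl.
    rewrite !big_split /= -/X => E.
    have -> : \sum_j X a j * V i b j - \sum_j X b j * V i a j =
       \sum_j eps * U i b j * V i a j - \sum_j eps * U i a j * V i b j by lra.
    by rewrite -sumrB; apply: eq_bigr => j _; ring.
  move=> j; rewrite normrM (gtr0_norm eps0).
  have -> : 2 * eps * delta = eps * (delta * 1 + delta * 1) by ring.
  rewrite ler_wpM2l ?(ltW eps0) //; apply: le_trans (ler_normB _ _) _.
  by rewrite !normrM; apply: lerD; apply: ler_pM => //; rewrite ?delta_entry ?entryV.
have -> : \sum_j lam A V j * (V i b j * ti V j i a - V i a j * ti V j i b) =
    \sum_j (g j + (err a j * V i b j - err b j * V i a j)).
  rewrite big_split /= -gE -!sumrB -big_split /=; apply: eq_bigr => j _; rewrite /err; ring.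
apply: le_trans (ler_norm_sum _ _ _) _.
apply: (@le_trans _ _ (\sum_(j < t) (4 * tnorm * L + 2 * eps) * delta)); last first.
  by rewrite sumr_const card_ord -[leLHS]mulr_natl mulrA.
apply: ler_sum => j _; apply: le_trans (ler_normD _ _) _.
have -> : (4 * tnorm * L + 2 * eps) * delta = 2 * eps * delta + (2 * tnorm * L * delta * 1 + 2 * tnorm * L * delta * 1) by ring.
apply: lerD => //; apply: le_trans (ler_normB _ _) _; rewrite !normrM.
by apply: lerD; apply: ler_pM => //; rewrite ?errb ?entryV.
Qed.

End Full.
End Columns.
End Entries.

(** * From the algorithm to a sequence with a fixed number of columns *)

Lemma increasing_ge (t : nat) (g : 'I_t -> 'I_t) : (forall a b : 'I_t, (a < b)%N -> (g a < g b)%N) ->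
  forall a : 'I_t, (a <= g a)%N.
Proof.
move=> gi [m]; elim: m => [|m IH] mt //.
have mt' : (m < t)%N by exact: ltnW.
by apply: leq_ltn_trans (IH mt') _; exact: gi.
Qed.

(** Reversing the order turns [a <= g a] into the opposite inequality. Hence a truncation that keeps
    the number of columns is the identity. *)
Lemma increasing_id (t : nat) (g : 'I_t -> 'I_t) : (forall a b : 'I_t, (a < b)%N -> (g a < g b)%N) -> g =1 id.
Proof.
move=> gi a; apply: val_inj; apply/eqP; rewrite eqn_leq (increasing_ge gi) andbT.
have gi' (b c : 'I_t) : (b < c)%N -> (rev_ord (g (rev_ord b)) < rev_ord (g (rev_ord c)))%N.
  move=> bc; have /gi : (rev_ord c < rev_ord b)%N by move: bc (ltn_ord c) => /=; lia.
  have := ltn_ord (g (rev_ord b)); rewrite /=; move: (nat_of_ord (g _)) (nat_of_ord (g _)) => u v; lia.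
have := increasing_ge gi' (rev_ord a); rewrite rev_ordK /=.
have := ltn_ord a; have := ltn_ord (g a); move: (nat_of_ord a) (nat_of_ord (g a)) => u v; lia.
Qed.

Lemma increasing_inj (t t' : nat) (g : 'I_t -> 'I_t') : (forall a b : 'I_t, (a < b)%N -> (g a < g b)%N) -> injective g.
Proof.
move=> gi a b gab; apply: val_inj; have [ab|ba|//] := ltngtP a b.
  by have := gi _ _ ab; rewrite gab ltnn.
by have := gi _ _ ba; rewrite gab ltnn.
Qed.

Lemma eventually_constant (u : nat -> nat) : (forall p, (u p.+1 <= u p)%N) -> exists P0, forall p, u (P0 + p)%N = u P0.
Proof.
move=> dec; have ex : exists m, `[< exists p, u p = m >] by exists (u 0%N); apply/asboolP; exists 0%N.
case: (ex_minnP ex) => m /asboolP[P0 Pm] mmin; exists P0 => p; apply/eqP; rewrite eqn_leq; apply/andP; split.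
  by elim: p => [|p IH]; rewrite ?addn0 // addnS; exact: leq_trans (dec _) IH.
by rewrite Pm; apply: mmin; apply/asboolP; exists (P0 + p)%N.
Qed.

Section Steps.
Variables (R : realType) (k n s : nat) (A : tensor R k n) (eps kappa : R).
Hypotheses (s_gt0 : (0 < s)%N) (sk : (s <= k)%N) (kappa0 : 0 < kappa).

Lemma step_half t t' (U : 'I_k -> 'M[R]_(n, t)) (V : 'I_k -> 'M[R]_(n, t')) : step_raw A s eps kappa U V ->
  exists g : 'I_t' -> 'I_t, (forall a b : 'I_t', (a < b)%N -> (g a < g b)%N) /\
    half_step A s kappa (fun i => colsub g (U i)) V.
Proof.
move=> [W [g [st1 [gi [tr [VW als]]]]]]; exists g; split=> //.
have ginj := increasing_inj gi.
split.
- move=> i si; have /stiefelP h : stiefel (W i) by case: (st1 i si) => [[[]]|[P [_ [_ []]]]].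
  rewrite VW //; apply/stiefelP => j l; rewrite -(inj_eq ginj) -h.
  by apply: eq_bigr => a _; rewrite !mxE.
- move=> i0 i0E j; have [/(_ (ex_intro _ j erefl) i0 i0E)/negP + _] := tr (g j).
  rewrite -leNgt; congr (_ <= `|_|); rewrite mxE; apply: eq_bigr => a _.
  have si0 : (i0 < s)%N by rewrite i0E prednK.
  rewrite mxE VmatE VW // mxE; congr (_ * ip A (rk _)); apply/funext => l; rewrite /upd; case: eqP => // _.
  apply/funext => b; rewrite /ucf /mix /mixn; case: ifP => li; last by rewrite mxE.
  by rewrite VW ?mxE //; apply: ltn_trans li si0.
move=> i si j a; have [v0 /colP/(_ a)] := als i si j; rewrite [LHS]mxE [RHS]mxE => ->.
have tE b : taui A (cols (mix i V (fun l => colsub g (U l))) j) i b 0 = ti A (mixn i V (fun l => colsub g (U l))) j i b.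
  exact: tauiE.
rewrite tE; congr (_ / Num.sqrt _ * _); apply: eq_bigr => b _; by rewrite tE expr2.
Qed.

Lemma step_feasible t t' (U : 'I_k -> 'M[R]_(n, t)) (V : 'I_k -> 'M[R]_(n, t')) : step_raw A s eps kappa U V ->
  feasible s U -> feasible s V.
Proof.
move=> /step_half[g [_ h]] fU; apply: (half_feasible s_gt0 sk kappa0 h) => i _ j.
rewrite -[RHS](feasible_unit fU i (g j)); apply: eq_bigr => a _; by rewrite !mxE.
Qed.

Lemma step_full t (U V : 'I_k -> 'M[R]_(n, t)) : step_raw A s eps kappa U V ->
  half_step A s kappa U V /\ polar_step A s eps U V.
Proof.
move=> st; have [g [gi h]] := step_half st.
have gid := increasing_id gi.
have cg (M : 'M[R]_(n, t)) : colsub g M = M by apply/matrixP => a j; rewrite mxE gid.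
split; first by have -> : U = (fun i => colsub g (U i)) by apply/funext => i; rewrite cg.
move: st => [W [g' [st1 [gi' [_ [VW _]]]]]] i si.
have gid' := increasing_id gi'.
have VE (l : 'I_k) : (l < s)%N -> V l = W l by move=> ls; rewrite VW //; apply/matrixP => a j; rewrite mxE gid'.
have mE : mix i W U = mixn i V U.
  by apply/funext => l; rewrite /mix /mixn; case: ifP => // li; rewrite VE //; apply: ltn_trans li si.
have := st1 i si; rewrite mE -VE // => -[[h1 h2]|[P [_ [_ h1]]]]; [by left|by right].
Qed.

(** The number of columns never increases, so it is eventually constant; from then on the iterates
    have a single type and no column is deleted. *)
Lemma eventual_sequence r (U0 : 'I_k -> 'M[R]_(n, r)) (Useq : nat -> state R k n) :
  feasible s U0 -> Useq 0%N = existT _ r U0 ->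
  (forall p, step A s eps kappa (Useq p) (Useq p.+1)) ->
  exists t P0 (U : nat -> 'I_k -> 'M[R]_(n, t)), [/\ (t <= r)%N,
    forall p, Useq (P0 + p)%N = existT _ t (U p), forall p, feasible s (U p) &
    forall p, half_step A s kappa (U p) (U p.+1) /\ polar_step A s eps (U p) (U p.+1)].
Proof.
move=> fU0 U0E st.
pose fs (x : state R k n) := let: existT t U := x in feasible s U.
have fsP p : fs (Useq p).
  elim: p => [|p]; first by rewrite U0E.
  have := st p; case: (Useq p) => t U; case: (Useq p.+1) => t' V /= h.
  exact: step_feasible h.
have dec p : (projT1 (Useq p.+1) <= projT1 (Useq p))%N.
  have := st p; case: (Useq p) => t U; case: (Useq p.+1) => t' V /= /step_half[g [/increasing_inj/leq_card + _]].
  by rewrite !card_ord.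
have [P0 P0E] := eventually_constant dec.
have tr p : (projT1 (Useq p) <= r)%N.
  by elim: p => [|p IH]; [rewrite U0E|exact: leq_trans (dec p) IH].
have /choice[U UE] : forall p, exists U : 'I_k -> 'M[R]_(n, projT1 (Useq P0)), Useq (P0 + p)%N = existT _ (projT1 (Useq P0)) U.
  by move=> p; rewrite -(P0E p); case: (Useq (P0 + p)%N) => t U; exists U.
exists (projT1 (Useq P0)), P0, U; split=> // p; first by have := fsP (P0 + p)%N; rewrite UE.
by apply: step_full; have := st (P0 + p)%N; rewrite -addnS !UE.
Qed.

End Steps.

(** * Critical points of the objective *)

Section Limit.
Variables (R : realType) (k n t s : nat) (A : tensor R k n).
Local Notation D := {ffun 'I_k -> 'I_n}.
Local Notation X := (vars k n t).
Local Notation conP := (@conP R k n t s).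
Local Notation yP := (@yP R k n t s).
Local Notation kapP := (@kapP R k n t s).
Implicit Types U V : 'I_k -> 'M[R]_(n, t).

Definition xof U (z : X) : R := match z with inl (i, a, j) => U i a j | inr j => lam A U j end.
Definition uof (x : X -> R) (i : 'I_k) : 'M[R]_(n, t) := \matrix_(a, j) x (inl (i, a, j)).

Definition resP (q : con_ix k t + kkt_ix k n t) : pexpr R X :=
  match q with
  | inl c => conP c
  | inr h => PA (psum predT (fun I => PM (PC (A I)) (yP h I))) (PM (PC (-1)) (kapP h))
  end.
(** The objective in the variables [lambda_j]. [fobjP] below is a polynomial in the factors with the
    same value at iterates, and its derivatives see the modes. *)
Definition objP : pexpr R X := psum predT (fun j => PM (pv R k n j) (pv R k n j)).
Definition lamP (j : 'I_t) : pexpr R X := psum predT (fun I : D => PM (PC (A I)) (rkP (@pcol R k n t j) I)).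
Definition fobjP : pexpr R X := psum predT (fun j => PM (lamP j) (lamP j)).

Lemma ev_resP_kkt h x : ev (resP (inr h)) x = \sum_I A I * ev (yP h I) x - ev (kapP h) x.
Proof. by rewrite /= ev_psum /= mulN1r. Qed.

Lemma res_zero_kkt x : (forall q, ev (resP q) x = 0) -> kkt_at s A x.
Proof.
move=> h; split=> [c|g]; first exact: (h (inl c)).
by have := h (inr g); rewrite ev_resP_kkt => /eqP; rewrite subr_eq0 => /eqP.
Qed.

Lemma res_lin_zero x v : (forall q, dv (resP q) x v = 0) -> lin_zero conP yP kapP A x (fun=> 0) v.
Proof.
move=> h; split=> [c|g]; first exact: (h (inl c)).
rewrite [X in X + _]big1 ?add0r => [|I _]; last by rewrite mul0r.
have := h (inr g); rewrite /= dv_psum /= mul0r add0r mulN1r => /eqP; rewrite subr_eq0 => /eqP <-.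
by apply: eq_bigr => I _; rewrite mul0r add0r.
Qed.

Lemma ucol_uof x j : ucf (uof x) j = ucol x j.
Proof. by apply/funext => i; apply/funext => a; rewrite /ucf mxE. Qed.

Lemma ucol_xof U j : ucol (xof U) j = ucf U j.
Proof. by []. Qed.

Lemma feas_feasible U : feas s (xof U) <-> feasible s U.
Proof.
split=> [h i|fU i j j'].
  case: ifP => si.
    by apply/stiefelP => j l; apply: (h i j l); rewrite /active si.
  move=> j; have E : dot (ucol (xof U) j i) (ucol (xof U) j i) = 1.
    by rewrite (h i j j) ?eqxx // /active eqxx orbT.
  by rewrite -[RHS]E; apply: eq_bigr => a _; rewrite expr2.
rewrite /active; case/orP => [si|/eqP <-].
  by have := fU i; rewrite si => /stiefelP; apply.
by rewrite eqxx; exact: feasible_unit fU i j.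
Qed.

Lemma kkt_lam x : kkt_at s A x -> forall j, lam A (uof x) j = ups x j.
Proof.
move=> kx j; rewrite lamE ucol_uof /ups; have := kx.2 (inl (inl j)) => /= <-.
by apply: eq_bigr => I _; rewrite rkE ev_rkP.
Qed.

Lemma kkt_xof x : kkt_at s A x -> xof (uof x) = x.
Proof. by move=> kx; apply/funext => -[[[i a] j]|j] /=; [rewrite mxE|exact: kkt_lam]. Qed.

Lemma ip_yP_unit U (i : 'I_k) a j : (s <= i)%N ->
  \sum_I A I * ev (yP (inl (inr (i, a, j))) I) (xof U) = ti A U j i a.
Proof.
move=> si; apply: eq_bigr => I _; rewrite ev_yP ltnNge si /= rkE; congr (_ * rk1 _ _).
Qed.

Lemma ip_yP_stiefel U (i : 'I_k) a b : (i < s)%N ->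
  \sum_I A I * ev (yP (inr (i, a, b)) I) (xof U) =
  \sum_j lam A U j * (U i b j * ti A U j i a - U i a j * ti A U j i b).
Proof.
move=> si; under eq_bigr => I _ do rewrite ev_yP si mulr_sumr.
rewrite exchange_big /=; apply: eq_bigr => j _.
rewrite /ti /ip !mulr_sumr -sumrB mulr_sumr; apply: eq_bigr => I _; rewrite !rkE ucol_xof.
by rewrite /ups /ucol /ucf /=; ring.
Qed.

Section Kkt.
Variable U : 'I_k -> 'M[R]_(n, t).
Hypothesis kU : kkt_at s A (xof U).

Lemma kkt_feasible : feasible s U.
Proof. by apply/feas_feasible; exact: kkt_feas kU. Qed.

Lemma kkt_unit (i : 'I_k) j a : (s <= i)%N -> ti A U j i a = lam A U j * U i a j.
Proof. by move=> si; rewrite -(ip_yP_unit U a j si) kU.2 /= ltnNge si. Qed.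

Lemma kkt_stiefel (i : 'I_k) : (i < s)%N ->
  let M := Vmat A U i *m Lam A U in M = U i *m ((U i)^T *m M) /\ ((U i)^T *m M)^T = (U i)^T *m M.
Proof.
move=> si /=; apply: sym_decomp; first by have := kkt_feasible i; rewrite si.
move=> a b; apply/eqP; rewrite -subr_eq0; apply/eqP.
have := kU.2 (inr (i, a, b)); rewrite (ip_yP_stiefel U a b si) [RHS]/= => E.
rewrite -[RHS]E -sumrB; apply: eq_bigr => j _; rewrite !VLamE; ring.
Qed.

Lemma kkt_is_KKT : is_KKT s A U.
Proof.
split; first exact: kkt_feasible.
exists (fun i => (U i)^T *m (Vmat A U i *m Lam A U)), (\row_j lam A U j ^+ 2) => i.
case: ifP => si; first by have [h1 h2] := kkt_stiefel si; split=> //.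
have si' : (s <= i)%N by rewrite leqNgt si.
apply/matrixP => a j; rewrite VLamE mul_mx_diag [RHS]mxE [X in _ = _ * X]mxE (kkt_unit _ _ si'); ring.
Qed.

Lemma dot_small (v w : 'I_n -> R) d : (forall a, `|v a| <= d) -> (forall a, `|w a| <= d) -> `|dot v w| <= n%:R * d ^+ 2.
Proof.
move=> vd wd; apply: le_trans (ler_norm_sum _ _ _) _.
apply: (@le_trans _ _ (\sum_(a < n) d ^+ 2)); last by rewrite sumr_const card_ord -[leLHS]mulr_natl.
by apply: ler_sum => a _; rewrite normrM expr2 ler_pM.
Qed.

(** For feasible [V] the symmetric part of [U^T (V - U)] in an orthonormal mode is
    [- (V - U)^T (V - U) / 2]. At a critical point [V^(i) Lambda] is [U] times a symmetric matrix,
    so its pairing with [V - U] only sees this quadratic part. In a unit mode the same holds column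
    by column. *)
Lemma kkt_second_order (i : 'I_k) : exists2 K, 0 <= K & forall V d, feasible s V ->
  (forall a j, `|V i a j - U i a j| <= d) ->
  `|\sum_j lam A U j * dot (fun a => V i a j - U i a j) (ti A U j i)| <= K * d ^+ 2.
Proof.
have fU := kkt_feasible.
have [si|si] := ltnP i s; last first.
  exists (\sum_j lam A U j ^+ 2 * n%:R).
    by apply: sumr_ge0 => j _; rewrite mulr_ge0 ?sqr_ge0.
  move=> V d fV Vd; rewrite mulr_suml; apply: le_trans (ler_norm_sum _ _ _) _; apply: ler_sum => j _.
  pose v a := V i a j - U i a j.
  have vu : dot v (fun a => U i a j) = - (2^-1 * dot v v).
    have E := feasible_unit fV i j.
    have VE : (fun a => V i a j) = fun a => 1 * v a + U i a j by apply/funext => a; rewrite /v; ring.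
    rewrite VE dot_linl !dot_linr (feasible_unit fU i j) (dotC (fun a => U i a j) v) in E; lra.
  rewrite (_ : ti A U j i = fun a => lam A U j * U i a j + 0); last first.
    by apply/funext => a; rewrite addr0; exact: kkt_unit.
  rewrite dot_linr dot0r addr0 vu.
  have -> : lam A U j * (lam A U j * - (2^-1 * dot v v)) = - (2^-1 * (lam A U j ^+ 2 * dot v v)) by ring.
  rewrite normrN normrM normrM [`|2^-1|]ger0_norm ?invr_ge0 ?ler0n // [`|_ ^+ 2|]ger0_norm ?sqr_ge0 //.
  have h := dot_small (fun a => Vd a j) (fun a => Vd a j).
  have h2 : lam A U j ^+ 2 * `|dot v v| <= lam A U j ^+ 2 * (n%:R * d ^+ 2) by rewrite ler_wpM2l ?sqr_ge0.
  have h3 : 0 <= lam A U j ^+ 2 * `|dot v v| by rewrite mulr_ge0 ?sqr_ge0.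
  by rewrite -mulrA; lra.
set M := Vmat A U i *m Lam A U; pose P := (U i)^T *m M.
have [ME Psym] := kkt_stiefel si; rewrite -/M -/P in ME Psym.
exists (\sum_l \sum_j `|P l j| * n%:R).
  by apply: sumr_ge0 => l _; apply: sumr_ge0 => j _; rewrite mulr_ge0.
move=> V d fV Vd; pose v j a := V i a j - U i a j.
have uv l j : dot (fun a => U i a l) (v j) + dot (fun a => U i a j) (v l) = - dot (v l) (v j).
  have := fV i; have := fU i; rewrite si => /stiefelP/(_ l j) E1 /stiefelP/(_ l j).
  rewrite -E1 -[in LHS]/(dot (fun a => V i a l) (fun a => V i a j)).
  have VE e : (fun a => V i a e) = fun a => 1 * v e a + U i a e by apply/funext => a; rewrite /v; ring.
  rewrite !VE dot_linl !dot_linr -[X in _ = X -> _]/(dot (fun a => U i a l) (fun a => U i a j)).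
  by rewrite (dotC (v l) (fun a => U i a j)); lra.
have E : \sum_j lam A U j * dot (v j) (ti A U j i) = \sum_l \sum_j P l j * dot (fun a => U i a l) (v j).
  rewrite [RHS]exchange_big; apply: eq_bigr => j _ /=.
  rewrite /dot mulr_sumr; under [RHS]eq_bigr => l _ do rewrite mulr_sumr.
  rewrite exchange_big; apply: eq_bigr => a _ /=.
  transitivity (v j a * M a j); first by rewrite /M VLamE; ring.
  by rewrite ME mxE mulr_sumr; apply: eq_bigr => l _; ring.
have Ps l j : P j l = P l j by rewrite -[in LHS]Psym mxE.
have E2 : \sum_j lam A U j * dot (v j) (ti A U j i) = - (2^-1 * \sum_l \sum_j P l j * dot (v l) (v j)).
  transitivity (2^-1 * (\sum_l \sum_j P l j * dot (fun a => U i a l) (v j) + \sum_l \sum_j P l j * dot (fun a => U i a j) (v l))).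
    rewrite E [X in _ + X]exchange_big /=.
    under [X in _ + X]eq_bigr => l _ do under eq_bigr => j _ do rewrite Ps.
    by field.
  rewrite -big_split -mulrN; congr (_ * _); rewrite -sumrN; apply: eq_bigr => l _ /=.
  rewrite -big_split -sumrN; apply: eq_bigr => j _ /=.
  by rewrite -mulrDr uv mulrN.
rewrite E2 normrN normrM [`|2^-1|]ger0_norm ?invr_ge0 ?ler0n //.
have h : `|\sum_l \sum_j P l j * dot (v l) (v j)| <= (\sum_l \sum_j `|P l j| * n%:R) * d ^+ 2.
  rewrite mulr_suml; apply: le_trans (ler_norm_sum _ _ _) _; apply: ler_sum => l _.
  rewrite mulr_suml; apply: le_trans (ler_norm_sum _ _ _) _; apply: ler_sum => j _.
  by rewrite normrM -mulrA ler_wpM2l // dot_small // => a; exact: Vd.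
have h0 : 0 <= `|\sum_l \sum_j P l j * dot (v l) (v j)| by [].
lra.
Qed.

Lemma ev_fobjP V : ev fobjP (xof V) = fobj A V.
Proof.
rewrite ev_psum; apply: eq_bigr => j _; rewrite /= expr2 lamE.
suff -> : ev (lamP j) (xof V) = ip A (rk (ucf V j)) by [].
by rewrite ev_psum; apply: eq_bigr => I _; rewrite /= ev_rkP rkE.
Qed.

Lemma dv_fobjP v : dv fobjP (xof U) v =
  2 * \sum_i \sum_j lam A U j * dot (ucol v j i) (ti A U j i).
Proof.
have lE j : ev (lamP j) (xof U) = lam A U j.
  by rewrite lamE ev_psum; apply: eq_bigr => I _; rewrite /= ev_rkP rkE.
have dE j : dv (lamP j) (xof U) v = \sum_i dot (ucol v j i) (ti A U j i).
  transitivity (\sum_i ip A (rk (upd (ucf U j) i (ucol v j i)))).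
    rewrite dv_psum -ip_sumr; apply: eq_bigr => I _; rewrite /= mul0r add0r dv_rkP sum_ffunE.
    by congr (_ * _); apply: eq_bigr => i _; rewrite rkE.
  by apply: eq_bigr => i _; rewrite ip_upd.
rewrite dv_psum exchange_big mulr_sumr; apply: eq_bigr => j _ /=.
by rewrite lE dE -mulr_sumr; ring.
Qed.

Lemma kkt_quadratic (B : R) : exists K, forall V d, feasible s V -> (forall z, `|xof V z| <= B) -> (forall z, `|xof U z| <= B) ->
  (forall z, `|xof V z - xof U z| <= d) -> fobj A U - fobj A V <= K * d ^+ 2.
Proof.
have /choice[Ki KiP] : forall i, exists K, 0 <= K /\ forall V d, feasible s V ->
  (forall a j, `|V i a j - U i a j| <= d) ->
  `|\sum_j lam A U j * dot (fun a => V i a j - U i a j) (ti A U j i)| <= K * d ^+ 2.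
  by move=> i; have [K K0 h] := kkt_second_order i; exists K.
have [C C0 CP] := taylor fobjP B.
exists (2 * (\sum_i Ki i) + C) => V d fV VB UB Vd.
have [[z _]|no] := pselect (exists z : X, True); last first.
  rewrite -!ev_fobjP (@ev_ext _ _ fobjP (xof U) (xof V)) ?subrr => [|z]; last by case: no; exists z.
  by rewrite mulr_ge0 ?sqr_ge0 // addr_ge0 // mulr_ge0 // sumr_ge0 // => i _; have [] := KiP i.
have d0 : 0 <= d by exact: le_trans (Vd z).
have [_ _ _ _] := CP (xof U) (xof V) d d0 UB VB Vd.
rewrite !ev_fobjP dv_fobjP.
have h : `|\sum_i \sum_j lam A U j * dot (ucol (fun z => xof V z - xof U z) j i) (ti A U j i)| <= (\sum_i Ki i) * d ^+ 2.
  rewrite mulr_suml; apply: le_trans (ler_norm_sum _ _ _) _; apply: ler_sum => i _.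
  by have [_] := KiP i; apply => // a j; exact: (Vd (inl (i, a, j))).
move: h; rewrite !ler_norml => /andP[h1 h2] /andP[h3 h4].
rewrite mulrDl; move: h1 h2 h3 h4; lra.
Qed.

End Kkt.
End Limit.

(** * Convergence *)

Lemma frob_dist_le (R : realType) (k n t : nat) (U W : 'I_k -> 'M[R]_(n, t)) e : 0 <= e ->
  (forall i a j, `|U i a j - W i a j| <= e) -> frob_dist U W <= (k * n * t).+1%:R * e.
Proof.
move=> e0 h; rewrite -(@ler_pXn2r _ 2) ?nnegrE ?sqrtr_ge0 ?mulr_ge0 // sqr_sqrtr; last first.
  by apply: sumr_ge0 => *; apply: sumr_ge0 => *; apply: sumr_ge0 => *; rewrite sqr_ge0.
apply: (@le_trans _ _ ((k * n * t)%:R * e ^+ 2)).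
  rewrite !natrM -!mulrA; apply: (@le_trans _ _ (\sum_(l < k) n%:R * (t%:R * e ^+ 2))); last first.
    by rewrite sumr_const card_ord -[leLHS]mulr_natl.
  apply: ler_sum => l _; apply: (@le_trans _ _ (\sum_(a < n) (t%:R * e ^+ 2))); last first.
    by rewrite sumr_const card_ord -[leLHS]mulr_natl.
  apply: ler_sum => a _; apply: (@le_trans _ _ (\sum_(j < t) e ^+ 2)); last first.
    by rewrite sumr_const card_ord -[leLHS]mulr_natl.
  by apply: ler_sum => j _; rewrite -[leLHS]ger0_norm ?sqr_ge0 // normrX ler_sqr ?nnegrE.
rewrite exprMn ler_wpM2r ?sqr_ge0 // -natrX ler_nat; move: (k * n * t)%N => N.
by rewrite -mulnn; nia.
Qed.

Lemma summand_le4 (R : realType) (a b c d : R) : 0 <= a -> 0 <= b -> 0 <= c -> 0 <= d ->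
  [/\ a <= a + b + c + d, b <= a + b + c + d, c <= a + b + c + d & d <= a + b + c + d].
Proof. by move=> *; split; lra. Qed.

Section Convergence.
Variables (R : realType) (k n t s : nat) (A : tensor R k n) (eps kappa : R).
Hypotheses (s_gt0 : (0 < s)%N) (sk : (s <= k)%N) (kappa0 : 0 < kappa) (eps0 : 0 < eps).
Hypothesis regA : ~ singular_kkt t s A.
Variable U : nat -> 'I_k -> 'M[R]_(n, t).
Hypotheses (fU : forall p, feasible s (U p))
  (stU : forall p, half_step A s kappa (U p) (U p.+1) /\ polar_step A s eps (U p) (U p.+1)).

Let delta p := frob_dist (U p.+1) (U p).
Let L := tnorm A * k%:R.
(** Sum of the constants of the step and residual estimates, so that a single one serves in
    [linear_convergence]. *)
Let C := 1 + L + L * (1 + n%:R) + t%:R * (4 * tnorm A * L + 2 * eps).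

Let L0 : 0 <= L. Proof. by rewrite mulr_ge0 ?tnorm_ge0. Qed.
Let Ln0 : 0 <= L * (1 + n%:R). Proof. by rewrite mulr_ge0 ?addr_ge0 ?ler01. Qed.
Let Lt0 : 0 <= t%:R * (4 * tnorm A * L + 2 * eps).
Proof. by rewrite mulr_ge0 // addr_ge0 // !mulr_ge0 ?tnorm_ge0 // ltW. Qed.

Let CP : [/\ 1 <= C, L <= C, L * (1 + n%:R) <= C & t%:R * (4 * tnorm A * L + 2 * eps) <= C].
Proof. exact: summand_le4. Qed.

Lemma iterate_bound p z : `|xof A (U p) z| <= 1 + tnorm A.
Proof.
have u1 i j := feasible_unit (fU p) i j.
case: z => [[[i a] j]|j] /=.
  by apply: le_trans (unit_entry a (u1 i j)) _; rewrite lerDl tnorm_ge0.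
apply: (@le_trans _ _ (tnorm A)); last by rewrite lerDr ler01.
by rewrite lamE; apply: ip_bound => i a; exact: unit_entry (u1 i j).
Qed.

Lemma iterate_step p z : `|xof A (U p.+1) z - xof A (U p) z| <= C * delta p.
Proof.
have d0 : 0 <= delta p := delta_ge0 _ _.
have [C1 CL _ _] := CP.
case: z => [[[i a] j]|j] /=.
  by apply: le_trans (delta_entry _ _ _ _ _) _; rewrite -[leLHS]mul1r ler_wpM2r.
apply: le_trans (_ : L * delta p <= _); last by rewrite ler_wpM2r.
by have := lip_lam s_gt0 sk kappa0 (stU p).1 (fU p) 0%N j; rewrite (_ : mixn 0 _ (U p) = U p).
Qed.

Lemma iterate_residual p q : `|ev (resP s A q) (xof A (U p.+1))| <= C * delta p.
Proof.
have d0 : 0 <= delta p := delta_ge0 _ _.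
have [hh pp] := stU p.
have [C1 _ CLn CLt] := CP.
have z0 : 0 <= C * delta p by rewrite mulr_ge0 // (le_trans ler01).
case: q => [c|h]; first by rewrite /= (proj2 (feasP s _)) ?normr0 //; apply/feas_feasible; exact: fU.
rewrite ev_resP_kkt; case: h => [[j|[[i a] j]]|[[i a] b]].
- rewrite [X in X - _](_ : _ = lam A (U p.+1) j) ?subrr ?normr0 // lamE.
  by apply: eq_bigr => I _; rewrite ev_yP rkE.
- have [si|si] := ltnP i s.
    by rewrite /= si big1 ?subrr ?normr0 // => I _; rewrite mulr0.
  rewrite ip_yP_unit //= ltnNge si /=.
  apply: le_trans (residual_unit s_gt0 sk kappa0 hh (fU p) j a si) _.
  by rewrite ler_wpM2r.
have [si|si] := ltnP i s; last first.
  by rewrite /= ltnNge si /= big1 ?subrr ?normr0 // => I _; rewrite mulr0.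
rewrite ip_yP_stiefel // [ev (kapP _ _ _) _]/= subr0.
apply: le_trans (residual_stiefel s_gt0 sk kappa0 eps0 hh pp (fU p) a b si) _.
by rewrite ler_wpM2r.
Qed.

Lemma ev_objP p : ev (objP R k n t) (xof A (U p)) = fobj A (U p).
Proof. by rewrite ev_psum; apply: eq_bigr => j _; rewrite expr2. Qed.

Theorem iterates_converge : exists Ustar : 'I_k -> 'M[R]_(n, t), is_KKT s A Ustar /\
  exists C' q : R, [/\ 0 < C', 0 < q < 1 & exists P0, forall p, (P0 <= p)%N -> frob_dist (U p) Ustar <= C' * q ^+ p].
Proof.
have C0 : 0 <= C by have [C1 _ _ _] := CP; exact: le_trans C1.
have asc p : rate kappa eps * delta p ^+ 2 <= ev (objP R k n t) (xof A (U p.+1)) - ev (objP R k n t) (xof A (U p)).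
  by rewrite !ev_objP; have [hh pp] := stU p; have := step_ascent s_gt0 sk kappa0 hh pp (fU p).
have [|y [cy y0 [C' [q [C'0 q01 [P0 conv]]]]]] := linear_convergence iterate_bound (fun p => delta_ge0 _ _)
    (rate_gt0 kappa0 eps0) C0 iterate_step iterate_residual asc.
  move=> y cy y0; have ky := res_zero_kkt y0; have yE := kkt_xof ky.
  have kU : kkt_at s A (xof A (uof y)) by rewrite yE.
  have ups0 j : ups y j != 0.
    rewrite -normr_gt0; apply: (@lt_le_trans _ _ (kappa / 2)); first by rewrite divr_gt0.
    (* The values are known to be at least [kappa] in modulus only after a step, hence an index at
       least 1; closeness [kappa / 2] keeps the limit away from zero. *)
    have [[//|p] _ /(_ (inr j)) /= h] := cy (kappa / 2) (divr_gt0 kappa0 (ltr0Sn _ 1)) 1%N.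
    have := half_lam s_gt0 sk kappa0 (stU p).1 (fun i _ => feasible_unit (fU p) i) j.
    have -> : lam A (U p.+1) j = (lam A (U p.+1) j - y (inr j)) + ups y j by rewrite /ups; ring.
    move=> h2; have := le_trans h2 (ler_normD _ _); lra.
  split.
    move=> v v0 z; apply: contrapT => /eqP vz; apply: regA; exists y; split=> //.
    by exists v; [exists z|exact: res_lin_zero].
  have [K KP] := kkt_quadratic kU (1 + tnorm A + 1); exists K => p d yd.
  have -> : ev (objP R k n t) y = fobj A (uof y).
    by rewrite -[in LHS]yE ev_psum; apply: eq_bigr => j _; rewrite expr2.
  rewrite ev_objP; apply: KP => //.
  - by move=> z; apply: le_trans (iterate_bound p z) _; rewrite lerDl ler01.
  - rewrite yE => z; have [p' _ /(_ z) h] := cy 1 ltr01 0%N.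
    have -> : y z = xof A (U p') z - (xof A (U p') z - y z) by ring.
    by apply: le_trans (ler_normB _ _) _; rewrite lerD // iterate_bound.
  - by rewrite yE.
have ky := res_zero_kkt y0; have yE := kkt_xof ky.
exists (uof y); split; first by apply: kkt_is_KKT; rewrite yE.
exists ((k * n * t).+1%:R * C'), q; split=> //; first by rewrite mulr_gt0 // ltr0Sn.
exists P0 => p pp; have /andP[q0 _] := q01.
rewrite -mulrA; apply: frob_dist_le => [|i a j]; first by rewrite mulr_ge0 ?exprn_ge0 // ltW.
by have := conv p pp (inl (i, a, j)); rewrite /= mxE.
Qed.

End Convergence.

Theorem theorem5p16 (R : realType) (k s n r : nat) :
  (3 <= k)%N -> (1 <= s <= k)%N -> (2 <= n)%N -> (1 <= r <= n)%N ->
  exists N : tensor R k n -> Prop, null_set N /\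
  forall A : tensor R k n, ~ N A ->
  forall eps : R, 0 < eps ->
  forall (U0 : 'I_k -> 'M[R]_(n, r)) (kappa : R),
    feasible s U0 -> 0 < fobj A U0 ->
    0 < kappa -> kappa < Num.sqrt (fobj A U0 / r%:R) ->
  forall Useq : nat -> state R k n,
    Useq 0%N = existT _ r U0 ->
    (forall p : nat, step A s eps kappa (Useq p) (Useq p.+1)) ->
  exists (t : nat) (Ustar : 'I_k -> 'M[R]_(n, t)),
    is_KKT s A Ustar /\
    exists (C q : R), 0 < C /\ 0 < q < 1 /\
    exists P0 : nat, forall p : nat, (P0 <= p)%N ->
      exists U : 'I_k -> 'M[R]_(n, t),
        Useq p = existT _ t U /\ frob_dist U Ustar <= C * q ^+ p.
Proof.
move=> k3 /andP[s1 sk] n2 /andP[r1 rn]; have n0 : (0 < n)%N by exact: ltnW.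
(* The eventual number of columns depends on the run, so all [t <= r] are excluded at once. *)
exists (fun A => exists t : 'I_r.+1, singular_kkt t s A); split.
  apply: (null_cup_count (N := fun (t : 'I_r.+1) (A : tensor R k n) => singular_kkt t s A) n0) => t; apply: null_singular_kkt => //.
  by apply: leq_trans rn; rewrite -ltnS.
move=> A regA eps eps0 U0 kappa fU0 _ kappa0 _ Useq U0E st.
have [t [P0 [U [tr UE fU stU]]]] := eventual_sequence s1 sk kappa0 fU0 U0E st.
have regt : ~ singular_kkt t s A.
  by have tr' : (t < r.+1)%N := tr; move=> h; apply: regA; exists (Ordinal tr').
have [Ustar [kkt [C [q [C0 q01 [P1 conv]]]]]] := iterates_converge s1 sk kappa0 eps0 regt fU stU.
have /andP[q0 _] := q01.
(* Division by [q ^+ P0] undoes the shift of the index by [P0]. *)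
exists t, Ustar; split=> //; exists (C / q ^+ P0), q; split; first by rewrite divr_gt0 ?exprn_gt0.
split=> //; exists (P0 + P1)%N => p pp; exists (U (p - P0)%N).
have P0p : (P0 <= p)%N by apply: leq_trans (leq_addr _ _) pp.
split; first by rewrite -UE subnKC.
apply: le_trans (conv _ _) _; first by rewrite leq_subRL.
by rewrite -{2}(subnKC P0p) exprD mulrA mulfVK // gt_eqF ?exprn_gt0.
Qed.
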